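(* Let $c\in\left(1,1+\frac{1}{149}\right]$ and let $\lambda_0,\lambda_1,\lambda_2\in\mathbb{R}$ be such that $\frac{\lambda_1}{\lambda_2}$ is negative and irrational. Define $$\rho(c):=\frac{1+9(c^{-1}-1)}{12}-\frac{c}{13-0.144}.$$ Then there are infinitely many pairs $(\tilde p,P_{13})$, where $\tilde p$ is a prime of the form $\lfloor n^c\rfloor$ for some positive integer $n$ and $P_{13}$ is a positive integer with at most $13$ prime factors, satisfying $$|\lambda_0+\lambda_1\tilde p+\lambda_2 P_{13}|<\tilde p^{-\rho(c)}.$$
   Context: $\lfloor x\rfloor$ denotes the largest integer not exceeding $x$. $P_r$ denotes a positive integer having at most $r$ prime factors. *)

(* Defs.v *)
From Stdlib Require Import Reals QArith Qreals.
From mathcomp Require Import all_boot.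

Definition bigOmega (n : nat) : nat :=
  \sum_(p <- primes n) logn p n.

Definition is_P (r n : nat) : Prop := (0 < n)%N /\ (bigOmega n <= r)%N.

Local Open Scope R_scope.
Definition rho (c : R) : R :=
  (1 + 9 * (/ c - 1)) / 12 - c / (13 - 144 / 1000).

Local Close Scope R_scope.
Definition piatetski_prime (c : R) (p : nat) : Prop :=
  prime p /\ exists n : nat, (0 < n)%N /\
    Z.of_nat p = Int_part (Rpower (INR n) c).

Local Open Scope R_scope.
Definition good_pair (c l0 l1 l2 : R) (p P : nat) : Prop :=
  piatetski_prime c p /\ is_P 13 P /\
 
  (Rabs (l0 + l1 * INR p + l2 * INR P) < Rpower (INR p) (- rho c)).

(* Main.v *)
(** Put [g = 1/c], [u = 1 - g], [a = - l1/l2] and [b = - l0/l2]. A prime [n] has the form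
    [floor (j^c)] as soon as an integer lies strictly between [n^g] and [(n+1)^g], and the
    inequality asks that [a n + b] be close to an integer [m]. Over [x < n <= 8 x] both
    conditions are detected by triangle functions of the distance to the nearest integer, of
    widths [1/t] and [1/sg] with [t] of order [x^u] and [t sg] about [x^(27/4000)], and [m] is
    detected by a weighted Selberg sieve whose moduli [d] do not exceed [x^(11/100)]: the
    condition [d | m] is again a triangle function, of [(a n + b)/d]. After Fourier expansion
    the zero frequency contributes at least [x/(t sg)] up to lower order terms, and the other
    frequencies give sums over primes, which Vaughan's identity reduces to linear sums and to
    bilinear sums. Frequencies without [n^g] are controlled by a good rational approximation
    of [a], whose denominator [q] fixes [x] through [x^(19/50) <= q]; those with [n^g] are
    controlled by the second derivative test. Prime powers and integers [m] divisible by a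
    large square are negligible, and a surviving [m] has at most 13 prime factors. *)
Require Import Defs.
From Stdlib Require Import -(notations) QArith Qreals.
From Stdlib Require Import Reals.
From mathcomp Require Import all_boot all_order all_algebra cyclic.
From mathcomp Require Import boolp classical_sets functions reals.
From mathcomp Require Import topology normedtype derive realfun sequences exp trigo.
From mathcomp Require Import lra ring zify.
Set Implicit Arguments.
Unset Strict Implicit.
Unset Printing Implicit Defensive.
Import Order.TTheory GRing.Theory Num.Theory.
Import numFieldNormedType.Exports.
Local Open Scope ring_scope.

(** * Exponential sums *)

(** The exponents answer to two budgets. With [x = E ^ 4000], the precision asked for costs x^rho(c)
    and the thin set of primes costs x^(1 - 1/c); on the range of c the sum of max(rho(c), 0) and 1
    - 1/c is at most 269/40000, just below 27/4000. On the sieve side the integers are at most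
    [E ^ 4001] and the logarithmic weights are cut at [E ^ 400]; positivity holds because 3.99
    exceeds the integral of 1/u - 1/400 from 10 to 400, about 2.71, by enough to pay for the primes
    below [E ^ 10]. The obstacle is the mass of the sieve weight: expanded into cosines it may reach
    about [E ^ 440], and the frequencies with [n ^ g] meet its square in the bilinear sums. Off the
    diagonal, a product of cosines is a sum of cosines and the second derivative test does not feel
    a linear term in the phase, so the whole weight costs a factor bounded by its mass, against a
    larger saving. On the diagonal there is no saving, but there the weight is bounded pointwise by
    divisor counts. *)

Ltac drop_reals := repeat match goal with H : context [Real.sort] |- _ => clear H end.
Ltac nlia := drop_reals; lia.
Ltac nnia := drop_reals; nia.

Section ExponentialSums.
Variable R : realType.
Implicit Types (x y t k : R).

Lemma sum_norm_le1 (F : nat -> R) a b : (forall m, `|F m| <= 1) ->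
  `|\sum_(a <= m < b) F m| <= (b - a)%:R.
Proof.
move=> H; apply: le_trans (ler_norm_sum _ _ _) _.
apply: (@le_trans _ _ (\sum_(a <= m < b) (1 : R))); first exact: ler_sum.
by rewrite big_const_nat iter_addr_0.
Qed.

(** Summation by parts: the monotone [c] has total variation at most 2C, and the two boundary terms
    add at most 2CB. *)
Lemma abel_bound (c S : nat -> R) (n : nat) (B C : R) :
  0 <= C ->
  (forall m, (m < n)%N -> `|c m| <= C) ->
  (forall m, (m.+1 < n)%N -> c m <= c m.+1) ->
  (forall m, (m <= n)%N -> `|S m| <= B) ->
  `|\sum_(0 <= m < n) c m * (S m.+1 - S m)| <= 4 * C * B.
Proof.
case: n => [|n] C0 Hc Hm HS.
  rewrite big_nil normr0; have := HS 0%N isT.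
  by move=> /(le_trans (normr_ge0 _)) B0; rewrite !mulr_ge0.
have key j : (j <= n)%N ->
   `|\sum_(0 <= m < j.+1) c m * (S m.+1 - S m) - c j * S j.+1 + c 0%N * S 0%N|
     <= B * (c j - c 0%N).
  elim: j => [|j IH] Hj.
    rewrite big_nat1 (_ : _ + _ = 0) ?normr0 ?subrr ?mulr0 //; ring.
  have {}IH := IH (ltnW Hj).
  rewrite big_nat_recr //=.
  set s := \sum_(_ <= _ < _) _ in IH *.
  rewrite (_ : _ + _ = (s - c j * S j.+1 + c 0%N * S 0%N)
                        - (c j.+1 - c j) * S j.+1); last ring.
  apply: le_trans (ler_normB _ _) _.
  rewrite normrM (_ : B * _ = B * (c j - c 0%N) + (c j.+1 - c j) * B); last ring.
  apply: lerD => //.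
  have h : 0 <= c j.+1 - c j by rewrite subr_ge0 Hm.
  by rewrite ger0_norm // ler_wpM2l // HS //; apply: leqW.
have := key n (leqnn n).
set s := \sum_(_ <= _ < _) _ => Hs.
have h0 := Hc 0%N isT; have hn := Hc n (ltnSn n).
have s0 := HS 0%N isT; have sn := HS n.+1 (leqnn _).
have B0 : 0 <= B by apply: le_trans s0.
have p1 : `|c n * S n.+1| <= C * B by rewrite normrM ler_pM.
have p2 : `|c 0%N * S 0%N| <= C * B by rewrite normrM ler_pM.
have p3 : B * (c n - c 0%N) <= B * (C + C).
  apply: ler_wpM2l => //; move: h0 hn; rewrite !ler_norml => /andP[? ?] /andP[? ?]; lra.
move: Hs p1 p2; rewrite !ler_norml => /andP[? ?] /andP[? ?] /andP[? ?].
apply/andP; split; lra.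
Qed.

Lemma sum_by_parts_le (g f : nat -> R) (n : nat) (B C : R) :
  0 <= C -> (forall m, (m < n)%N -> `|g m| <= C) ->
  (forall m, (m.+1 < n)%N -> g m <= g m.+1) ->
  (forall m, (m <= n)%N -> `|\sum_(0 <= i < m) f i| <= B) ->
  `|\sum_(0 <= m < n) g m * f m| <= 4 * C * B.
Proof.
move=> C0 Hg Hm HB.
rewrite (eq_bigr (fun m => g m * (\sum_(0 <= i < m.+1) f i - \sum_(0 <= i < m) f i))).
  exact: abel_bound.
by move=> m _; rewrite [in RHS]big_nat_recr //= addrAC subrr add0r.
Qed.

Lemma cos_mul_le_sin x : 0 <= x <= pi / 2 -> x * cos x <= sin x.
Proof.
move=> /andP[x0 xpi].
have [c cI] :
    exists2 c : R, c \in `[0, x] & sin x - sin 0 = cos c * (x - 0).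
  apply: MVT_segment => //.
  by apply: continuous_subspaceT; exact: continuous_sin.
move: cI; rewrite in_itv /= sin0 !subr0 => /andP[c0 cx] ->; rewrite mulrC ler_wpM2r //.
rewrite leNgt ltr_cos; first by rewrite -leNgt.
- by rewrite in_itv /= x0 /=; have := @pi_gt0 R; lra.
- by rewrite in_itv /= c0 /=; have := @pi_gt0 R; lra.
Qed.

Lemma sin_lipschitz x y : `|sin x - sin y| <= `|x - y|.
Proof.
wlog xy : x y / y <= x.
  by move=> H; case: (leP y x) => [/H //|/ltW /H]; rewrite distrC (distrC y).
have [c _ ->] :
    exists2 c : R, c \in `[y, x] & sin x - sin y = cos c * (x - y).
  apply: MVT_segment => //.
  by apply: continuous_subspaceT; exact: continuous_sin.
by rewrite normrM -[leRHS]mul1r ler_wpM2r // cos_max.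
Qed.

Lemma cos_lipschitz x y : `|cos x - cos y| <= `|x - y|.
Proof.
have := sin_lipschitz (x + pi / 2) (y + pi / 2).
by rewrite !sinDpihalf (_ : x + _ - _ = x - y) //; ring.
Qed.

Definition cot x := cos x / sin x.

Lemma cot_le x y : 0 < x -> x <= y -> y < pi -> cot y <= cot x.
Proof.
move=> x0 xy yp; rewrite /cot.
have sx : 0 < sin x by apply: sin_gt0_pi; apply/andP; split; lra.
have sy : 0 < sin y by apply: sin_gt0_pi; apply/andP; split; lra.
have sxy : 0 <= sin (y - x) by apply: sin_ge0_pi; apply/andP; split; lra.
rewrite ler_pdivrMr // mulrAC ler_pdivlMr //.
by move: sxy; rewrite sinB; lra.
Qed.

Lemma cot_norm_le k x : 0 < k <= 1 / 2 -> pi * k <= x <= pi - pi * k ->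
  `|cot x| <= (pi * k)^-1.
Proof.
move=> /andP[k0 k2] /andP[x1 x2]; have pi0 := @pi_gt0 R.
have pk : 0 < pi * k by apply: mulr_gt0.
have pk2 : pi * k <= pi / 2 by nra.
have sk : 0 < sin (pi * k) by apply: sin_gt0_pi; apply/andP; split; lra.
have ck : cot (pi * k) <= (pi * k)^-1.
  rewrite /cot ler_pdivrMr // ler_pdivlMl //.
  by apply: cos_mul_le_sin; rewrite (ltW pk).
have cN : cot (pi - pi * k) = - cot (pi * k).
  rewrite /cot -opprB cosN sinN cosB sinB cospi sinpi.
  by rewrite !mulr0 subr0 addr0 !mulrN1 opprK mulNr.
rewrite ler_norml; apply/andP; split.
- apply: (@le_trans _ _ (cot (pi - pi * k))); first by rewrite cN lerN2.
  by apply: cot_le => //; lra.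
- by apply: le_trans ck; apply: cot_le => //; lra.
Qed.

(** Kusmin-Landau. With h = pi (f(m+1) - f(m)), each cosine is half a telescoping difference of
    cosines plus half of -cot h times a difference of the [S m]. Since cot h is monotone in m,
    partial summation applies; h keeps the distance pi k from 0 and pi, which bounds cot h by 1/(pi
    k). *)
Lemma kusmin_landau0 (f : nat -> R) n k : 0 < k <= 1 / 2 ->
  (forall m, (m < n)%N -> k <= f m.+1 - f m <= 1 - k) ->
  (forall m, (m.+1 < n)%N -> f m.+1 - f m <= f m.+2 - f m.+1) ->
  `|\sum_(0 <= m < n) cos (2 * pi * f m)| <= 2 / k.
Proof.
move=> k02 Hg Hm; have /andP[k0 k2] := k02; have pi0 := @pi_gt0 R.
have pk : 0 < pi * k by apply: mulr_gt0.
pose C := (pi * k)^-1.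
pose c m := - cot (pi * (f m.+1 - f m)).
pose S m := - sin (2 * pi * f m).
have bnd m : (m < n)%N -> pi * k <= pi * (f m.+1 - f m) <= pi - pi * k.
  move=> /Hg /andP[h1 h2]; apply/andP; split; nra.
have key m : (m < n)%N -> cos (2 * pi * f m) =
    2^-1 * (cos (2 * pi * f m) - cos (2 * pi * f m.+1)) + 2^-1 * (c m * (S m.+1 - S m)).
  move=> mn; rewrite /c /S /cot.
  set h := pi * _.
  have sh : sin h != 0.
    have /andP[h1 h2] := bnd _ mn.
    by rewrite gt_eqF // sin_gt0_pi //; apply/andP; split; rewrite /h in h1 h2 *; lra.
  have e1 : 2 * pi * f m = (pi * (f m.+1 + f m)) - h by rewrite /h; ring.
  have e2 : 2 * pi * f m.+1 = (pi * (f m.+1 + f m)) + h by rewrite /h; ring.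
  rewrite e1 e2 cosB cosD sinD sinB; field; exact: sh.
rewrite (eq_big_nat _ _ (F2 := fun m => 2^-1 * (cos (2 * pi * f m) - cos (2 * pi * f m.+1)) + 2^-1 * (c m * (S m.+1 - S m)))); last first.
  by move=> m /andP[_ mn]; exact: key.
rewrite big_split /= -!mulr_sumr.
have t1 : `|\sum_(0 <= m < n) (cos (2 * pi * f m) - cos (2 * pi * f m.+1))| <= 2.
  rewrite (eq_bigr (fun m => - (cos (2 * pi * f m.+1) - cos (2 * pi * f m)))); last first.
    by move=> m _; rewrite opprB.
  rewrite sumrN telescope_sumr // normrN.
  by apply: le_trans (ler_normB _ _) _; have := cos_max (2 * pi * f n); have := cos_max (2 * pi * f 0%N); lra.
have t2 : `|\sum_(0 <= m < n) c m * (S m.+1 - S m)| <= 4 * C * 1.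
  apply: abel_bound.
  - by rewrite invr_ge0 ltW.
  - by move=> m mn; rewrite normrN cot_norm_le // bnd.
  - move=> m mn; rewrite /c lerN2; have /andP[u1 u2] := bnd _ mn.
    have /andP[v1 v2] := bnd m (ltnW mn).
    apply: cot_le; try lra.
    by rewrite ler_pM2l // Hm.
  - by move=> m _; rewrite normrN sin_max.
have hC : C <= k^-1 / 2.
  rewrite /C invfM mulrC ler_wpM2l ?invr_ge0 ?(ltW k0) //.
  by rewrite lef_pV2 ?posrE //; exact: pi_ge2.
have hk : 2 <= k^-1.
  rewrite -[2]invrK lef_pV2 ?posrE //; lra.
apply: le_trans (ler_normD _ _) _.
rewrite !normrM !(@ger0_norm _ 2^-1) ?invr_ge0 //.
move: t1 t2; set A := `|_|; set B := `|_|; lra.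
Qed.

Lemma cos2piz x (z : int) : cos (x + 2 * pi * z%:~R) = cos x.
Proof.
have h (n : nat) y : cos (y + 2 * pi * n%:R) = cos y.
  rewrite (_ : 2 * pi * n%:R = (pi *+ 2) *+ n); first exact: (periodicn (@cosD2pi R)).
  rewrite -[RHS]mulr_natr; congr (_ * _); rewrite -mulr_natr; ring.
case: z => n; first exact: h.
rewrite NegzE mulrNz mulrN -[LHS](h n.+1); congr (cos _).
by rewrite -addrA addNr addr0.
Qed.

Lemma sin2piz x (z : int) : sin (x + 2 * pi * z%:~R) = sin x.
Proof.
by rewrite -[in LHS](subrK (pi / 2) x) addrAC sinDpihalf cos2piz cosBpihalf.
Qed.

(** Subtracting [z * m] from the phase changes no cosine and moves the differences into
    [k, 1 - k]. *)
Lemma kusmin_landau (f : nat -> R) a b k (z : int) : 0 < k <= 1 / 2 ->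
  (forall m, (a <= m < b)%N -> z%:~R + k <= f m.+1 - f m <= z%:~R + 1 - k) ->
  (forall m, (a <= m)%N -> (m.+1 < b)%N -> f m.+1 - f m <= f m.+2 - f m.+1) ->
  `|\sum_(a <= m < b) cos (2 * pi * f m)| <= 2 / k.
Proof.
move=> k0 Hg Hm; rewrite -[X in \sum_(X <= _ < _) _]add0n big_addn.
rewrite (eq_bigr (fun m => cos (2 * pi * (f (m + a)%N - z%:~R * m%:R)))); last first.
  move=> m _; rewrite -[RHS](cos2piz _ (z * m)); congr (cos _).
  rewrite intrM /=; ring.
apply: kusmin_landau0 => // m mn.
- have /Hg : (a <= m + a < b)%N by lia.
  by rewrite addSn -natr1 => /andP[? ?]; apply/andP; split; lra.
- have : f (m + a).+1 - f (m + a)%N <= f (m + a).+2 - f (m + a).+1 by apply: Hm; lia.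
  rewrite !addSn -!natr1; lra.
Qed.

Lemma monotone_split (g : nat -> R) a b y : (a <= b)%N ->
  (forall m, (a <= m)%N -> (m.+1 < b)%N -> g m <= g m.+1) ->
  exists c, [/\ (a <= c <= b)%N, forall m, (a <= m < c)%N -> g m < y
    & forall m, (c <= m < b)%N -> y <= g m].
Proof.
elim: b => [|b IH] ab Hm.
  by exists a; split; [lia| lia | lia].
have [->|ab'] : a = b.+1 \/ (a <= b)%N by lia.
  by exists b.+1; split; [lia| lia | lia].
have [|c [cab c1 c2]] := IH ab'; first by move=> m am mb; apply: Hm; lia.
case: (ltnP c b) => cb.
  exists c; split; [lia| by [] |] => m /andP[cm].
  rewrite ltnS leq_eqVlt => /orP[/eqP->|mb]; last by apply: c2; lia.
  have e : b = b.-1.+1 by lia.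
  apply: (le_trans (c2 b.-1 _)); first by lia.
  rewrite [in leRHS]e; apply: Hm; lia.
have {cb cab} ec : c = b by lia.
case: (ltP (g b) y) => gy.
- exists b.+1; split; [lia| |lia] => m /andP[am].
  by rewrite ltnS leq_eqVlt => /orP[/eqP->//|mb]; apply: c1; lia.
- exists b; split; [lia| by move=> m ?; apply: c1; lia |] => m ?.
  by have -> : m = b by lia.
Qed.

(** * The second derivative test *)

Section SecondDerivative.
Variables (f : nat -> R) (kp : R).
Let g m := f m.+1 - f m.
Hypothesis kp0 : 0 < kp <= 1 / 2.

Lemma diff_growth a b : (forall m, (a <= m)%N -> (m.+1 < b)%N -> kp ^+ 2 <= g m.+1 - g m) ->
  forall m, (a <= m < b)%N -> g a + kp ^+ 2 * (m - a)%:R <= g m.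
Proof.
move=> H; elim=> [|m IH] /andP[am mb].
  have -> : a = 0%N by lia.
  by rewrite subnn mulr0 addr0.
have [<-|am'] : a = m.+1 \/ (a <= m)%N by lia.
  by rewrite subnn mulr0 addr0.
rewrite subSn // -natr1.
have := IH _; have := H m am' mb; move=> h1 h2.
have : g a + kp ^+ 2 * (m - a)%:R <= g m by apply: h2; lia.
lra.
Qed.

(** A difference that stays in an interval of length [kp] and grows by [kp ^ 2] at each step leaves
    room for at most 1/kp + 1 terms, so the trivial bound is enough. *)
Lemma short_piece a b (y : R) :
  (forall m, (a <= m)%N -> (m.+1 < b)%N -> kp ^+ 2 <= g m.+1 - g m) ->
  (forall m, (a <= m < b)%N -> y <= g m <= y + kp) ->
  `|\sum_(a <= m < b) cos (2 * pi * f m)| <= kp^-1 + 1.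
Proof.
have /andP[k0 k2] := kp0.
move=> Hm Hg; apply: le_trans (sum_norm_le1 _ _ _) _.
  by move=> m; exact: cos_max.
case: (leqP b a) => ab.
  have -> : (b - a = 0)%N by lia.
  by rewrite addr_ge0 // invr_ge0 ltW.
have h : (a <= b.-1 < b)%N by lia.
have := diff_growth Hm h; have := Hg _ h; have := Hg a; rewrite leqnn ab => /(_ isT).
move=> /andP[h1 h2] /andP[h3 h4] h5.
have -> : (b - a)%:R = (b.-1 - a)%:R + 1 :> R by rewrite natr1; congr (_%:R); lia.
rewrite lerD2r -(@ler_pM2l _ (kp ^+ 2)) ?exprn_gt0 //.
by rewrite expr2 -[leRHS]mulrA mulfV ?gt_eqF // mulr1; rewrite expr2 in h5; lra.
Qed.

(** The difference is within [kp] of an integer on two short pieces; Kusmin-Landau with [k = kp]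
    handles the middle. Taking [kp] to be the square root of the growth makes all three costs of
    order 1/kp. *)
Lemma unit_piece a b (z : int) : (a <= b)%N ->
  (forall m, (a <= m)%N -> (m.+1 < b)%N -> kp ^+ 2 <= g m.+1 - g m) ->
  (forall m, (a <= m < b)%N -> z%:~R <= g m <= z%:~R + 1) ->
  `|\sum_(a <= m < b) cos (2 * pi * f m)| <= 6 / kp.
Proof.
have /andP[k0 k2] := kp0.
move=> ab Hm Hg.
have sq0 : 0 <= kp ^+ 2 by rewrite exprn_ge0 // ltW.
have mono m : (a <= m)%N -> (m.+1 < b)%N -> g m <= g m.+1.
  by move=> h1 h2; have := Hm m h1 h2; lra.
have [c [cab c1 c2]] := monotone_split (z%:~R + kp) ab mono.
have [d [dcb d1 d2]] : exists d, [/\ (c <= d <= b)%N,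
    forall m, (c <= m < d)%N -> g m < z%:~R + 1 - kp
    & forall m, (d <= m < b)%N -> z%:~R + 1 - kp <= g m].
  by apply: monotone_split; [lia|move=> m ? ?; apply: mono; lia].
have [ac [cb [cd db]]] : (a <= c /\ c <= b /\ c <= d /\ d <= b)%N by lia.
rewrite (big_cat_nat ac cb) (big_cat_nat cd db) /=.
have s1 : `|\sum_(a <= m < c) cos (2 * pi * f m)| <= kp^-1 + 1.
  apply: (short_piece (y := z%:~R)) => m; first by move=> ? ?; apply: Hm; lia.
  move=> mm; have /Hg /andP[-> _] : (a <= m < b)%N by lia.
  exact/ltW/c1.
have s2 : `|\sum_(c <= m < d) cos (2 * pi * f m)| <= 2 / kp.
  apply: (kusmin_landau (z := z)) => // m.
  - by move=> mm; apply/andP; split; [apply: c2; lia|apply/ltW/d1].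
  - by move=> ? ?; apply: mono; lia.
have s3 : `|\sum_(d <= m < b) cos (2 * pi * f m)| <= kp^-1 + 1.
  apply: (short_piece (y := z%:~R + 1 - kp)) => m; first by move=> ? ?; apply: Hm; lia.
  move=> mm; rewrite d2 //=; have /Hg /andP[_ ?] : (a <= m < b)%N by lia.
  lra.
have hk : 2 <= kp^-1 by rewrite -[2]invrK lef_pV2 ?posrE //; lra.
move: s1 s2 s3; rewrite !ler_norml => /andP[? ?] /andP[? ?] /andP[? ?].
by apply/andP; split; lra.
Qed.

Lemma integer_pieces (j : nat) : forall a b (z : int), (a <= b)%N ->
  (forall m, (a <= m)%N -> (m.+1 < b)%N -> kp ^+ 2 <= g m.+1 - g m) ->
  (forall m, (a <= m < b)%N -> z%:~R <= g m < z%:~R + j%:R) ->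
  `|\sum_(a <= m < b) cos (2 * pi * f m)| <= 6 / kp * j%:R.
Proof.
have /andP[k0 k2] := kp0.
elim: j => [|j IH] a b z ab Hm Hg.
  case: (ltnP a b) => ab'.
    by have := Hg a; rewrite leqnn ab' addr0 => /(_ isT) /andP[h1 h2]; lra.
  by rewrite big_geq // normr0 mulr0.
have sq0 : 0 <= kp ^+ 2 by rewrite exprn_ge0 // ltW.
have mono m : (a <= m)%N -> (m.+1 < b)%N -> g m <= g m.+1.
  by move=> h1 h2; have := Hm m h1 h2; lra.
have [c [cab c1 c2]] := monotone_split (z%:~R + 1) ab mono.
have [ac cb] : (a <= c)%N /\ (c <= b)%N by lia.
rewrite (big_cat_nat ac cb) /=.
have s1 : `|\sum_(a <= m < c) cos (2 * pi * f m)| <= 6 / kp.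
  apply: (unit_piece (z := z)); first lia.
    by move=> m ? ?; apply: Hm; lia.
  move=> m mm; have /Hg /andP[-> _] : (a <= m < b)%N by lia.
  exact/ltW/c1.
have s2 : `|\sum_(c <= m < b) cos (2 * pi * f m)| <= 6 / kp * j%:R.
  apply: (IH _ _ (z + 1)); first lia.
    by move=> m ? ?; apply: Hm; lia.
  move=> m mm; have := c2 m mm.
  have /Hg /andP[_] : (a <= m < b)%N by lia.
  by rewrite intrD /= -natr1 => ? ?; apply/andP; split; lra.
apply: le_trans (ler_normD _ _) _; have -> : 6 / kp * j.+1%:R = 6 / kp + 6 / kp * j%:R.
  rewrite (_ : j.+1%:R = j%:R + 1 :> R) ?natr1 //; ring.
exact: lerD.
Qed.

(** The differences range over an interval of length G, which is covered by at most G + 2 unit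
    intervals between integers. *)
Lemma second_derivative_test a b (G : R) : 0 <= G ->
  (forall m, (a <= m)%N -> (m.+1 < b)%N -> kp ^+ 2 <= g m.+1 - g m) ->
  (forall m, (a <= m < b)%N -> g m - g a <= G) ->
  `|\sum_(a <= m < b) cos (2 * pi * f m)| <= 6 / kp * (G + 2).
Proof.
have /andP[k0 k2] := kp0.
move=> G0 Hm Hg.
have kk : 0 <= 6 / kp by rewrite mulr_ge0 // invr_ge0 ltW.
case: (leqP b a) => ab.
  by rewrite big_geq // normr0; apply: mulr_ge0 => //; lra.
have sq0 : 0 <= kp ^+ 2 by rewrite exprn_ge0 // ltW.
pose z := Num.floor (g a); pose j := (Num.trunc G).+2.
have /andP[z1 z2] := floor_itv (g a); rewrite -/z in z1 z2.
have /andP[j1 j2] : (Num.trunc G)%:R <= G < (Num.trunc G).+1%:R by exact: truncn_itv.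
apply: (le_trans (y := 6 / kp * j%:R)); last first.
  by apply: ler_wpM2l => //; rewrite /j -!natr1; lra.
apply: (integer_pieces (z := z)); [lia| by [] |] => m mm.
have h1 := Hg m mm; have := diff_growth Hm mm => h2.
have h3 : 0 <= kp ^+ 2 * (m - a)%:R by apply: mulr_ge0.
rewrite intrD /= in z2; rewrite -!natr1 in j2; rewrite /j -!natr1.
by apply/andP; split; lra.
Qed.

End SecondDerivative.
End ExponentialSums.

(** * Distance to the nearest integer *)

Section NearestInteger.
Variable R : realType.
Implicit Types (x y t k : R).

Definition nint t : int := Num.floor (t + 1 / 2).
Definition nd t : R := `|t - (nint t)%:~R|.

Lemma nd_ge0 t : 0 <= nd t. Proof. exact: normr_ge0. Qed.

Lemma nint_itv t : (nint t)%:~R - 1 / 2 <= t < (nint t)%:~R + 1 / 2.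
Proof.
have := floor_itv (t + 1 / 2); rewrite -/(nint t) intrD /= => /andP[? ?].
by apply/andP; split; lra.
Qed.

Lemma nd_le_half t : nd t <= 1 / 2.
Proof.
by have /andP[? ?] := nint_itv t; rewrite /nd ler_norml; apply/andP; split; lra.
Qed.

Lemma nd_min t (z : int) : nd t <= `|t - z%:~R|.
Proof.
have [<-//|zn] := eqVneq (nint t) z.
apply: le_trans (nd_le_half t) _.
have /andP[h1 h2] := nint_itv t.
have [zl|zl] : (z + 1 <= nint t)%R \/ (nint t + 1 <= z)%R by lia.
- have : (z + 1)%:~R <= (nint t)%:~R :> R by rewrite ler_int.
  rewrite intrD /= => h3; rewrite ger0_norm; lra.
- have : (nint t + 1)%:~R <= z%:~R :> R by rewrite ler_int.
  rewrite intrD /= => h3; rewrite ler0_norm; lra.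
Qed.

Lemma nd_lip t u : nd t <= nd u + `|t - u|.
Proof.
apply: le_trans (nd_min t (nint u)) _.
by rewrite [leRHS]addrC (_ : t - (nint u)%:~R = (t - u) + (u - (nint u)%:~R)) ?ler_normD //; ring.
Qed.

Lemma nd_small t (z : int) : `|t - z%:~R| <= 1 / 2 -> nd t = `|t - z%:~R|.
Proof.
move=> h; apply/eqP; rewrite eq_le nd_min /=.
have [->//|zn] := eqVneq z (nint t).
have h1 := nd_le_half t; rewrite leNgt; apply/negP => h2.
have : `|(z - nint t)%:~R : R| < 1.
  rewrite intrB (_ : _ - _ = (t - (nint t)%:~R) - (t - z%:~R)); last by ring.
  apply: le_lt_trans (ler_normB _ _) _; rewrite -/(nd t); lra.
rewrite -intr_norm (_ : 1 = 1%:~R) // ltr_int; lia.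
Qed.

Lemma nd_addz t (z : int) : nd (t + z%:~R) = nd t.
Proof.
apply/eqP; rewrite eq_le; apply/andP; split.
- apply: le_trans (nd_min _ (nint t + z)) _.
  by rewrite intrD (_ : _ - _ = t - (nint t)%:~R) //; ring.
- apply: le_trans (nd_min _ (nint (t + z%:~R) - z)) _.
  by rewrite intrB (_ : _ - (_ - _) = t + z%:~R - (nint (t + z%:~R))%:~R) //; ring.
Qed.

Lemma ndN t : nd (- t) = nd t.
Proof.
have h u : nd (- u) <= nd u.
  apply: le_trans (nd_min _ (- nint u)) _.
  by rewrite intrN -opprB opprK normrN addrC.
by apply/eqP; rewrite eq_le h; have := h (- t); rewrite opprK.
Qed.

Lemma linear_sum_bound (al ph k : R) a b : 0 < k -> k <= nd al ->
  `|\sum_(a <= m < b) cos (2 * pi * (al * m%:R + ph))| <= 2 / k.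
Proof.
move=> k0 kn; have kh := le_trans kn (nd_le_half al).
pose z := Num.floor al; have /andP[z1 z2] := floor_itv al.
rewrite -/z in z1 z2; rewrite intrD /= in z2.
have h1 := le_trans kn (nd_min al z).
have := le_trans kn (nd_min al (z + 1)); rewrite intrD /= => h2.
rewrite ger0_norm in h1; last lra.
rewrite ler0_norm in h2; last lra.
apply: (kusmin_landau (f := fun m => al * m%:R + ph) (z := z)).
- by rewrite k0.
- move=> m _ /=; rewrite -[m.+1%:R]natr1.
  by apply/andP; split; lra.
- move=> m _ _ /=; rewrite -[m.+2%:R]natr1 -[m.+1%:R]natr1; lra.
Qed.

Definition harm (K : nat) : R := \sum_(1 <= i < K.+1) i%:R^-1.

Lemma harm_ge0 K : 0 <= harm K.
Proof. by apply: sumr_ge0 => i _; rewrite invr_ge0. Qed.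

Lemma sum_injective_le (n K : nat) (P : pred nat) (b : nat -> nat) (phi : nat -> R) :
  (forall i, 0 <= phi i) ->
  (forall j, (j < n)%N -> P j -> (b j <= K)%N) ->
  (forall i j, (i < n)%N -> (j < n)%N -> P i -> P j -> b i = b j -> i = j) ->
  \sum_(0 <= j < n | P j) phi (b j) <= \sum_(0 <= i < K.+1) phi i.
Proof.
move=> phi0 bK binj.
rewrite !big_mkord.
rewrite (partition_big (fun j : 'I_n => inord (b j) : 'I_K.+1) predT) //=.
apply: ler_sum => i _.
case: (pickP (fun j : 'I_n => P j && (inord (b j) == i))) => [j0 /andP[Pj0 /eqP bj0]|no].
  rewrite (bigD1 j0) /=; last by rewrite Pj0 bj0 eqxx.
  rewrite big_pred0 ?addr0; first by rewrite -bj0 inordK ?ltnS ?bK.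
  move=> j; apply/negP => /andP[/andP[Pj /eqP bj]] /eqP; apply.
  apply/val_inj/binj => //=.
  have := congr1 (fun i : 'I_K.+1 => nat_of_ord i) (etrans bj (esym bj0)).
  by rewrite !inordK ?ltnS ?bK.
by rewrite big_pred0.
Qed.

(** The points are sorted by the band [ik, (i+1)k) that contains their distance to the nearest
    integer. Two points in one band and on the same side of their nearest integers would be closer
    than k modulo 1, so a band holds at most one point on each side. Band 0 costs X, band i costs
    C/(ki), and the two sides give the factor 2. *)
Lemma spacing_bound (n K : nat) (y g : nat -> R) (X C k : R) :
  0 < k -> 0 <= C -> k^-1 <= K%:R ->
  (forall j, (j < n)%N -> g j <= X) -> 0 <= X ->
  (forall j, (j < n)%N -> g j * nd (y j) <= C) ->
  (forall i j, (i < n)%N -> (j < n)%N -> i <> j -> k <= nd (y i - y j)) ->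
  \sum_(0 <= j < n) g j <= 2 * (X + C / k * harm K).
Proof.
move=> k0 C0 hK gX X0 gC sp.
pose b j := Num.trunc (nd (y j) / k).
pose P j := y j < (nint (y j))%:~R.
pose phi i := if i == 0%N then X else C / k * i%:R^-1.
have Ck : 0 <= C / k by rewrite divr_ge0 // ltW.
have phi0 i : 0 <= phi i.
  by rewrite /phi; case: eqP => // _; apply: mulr_ge0; rewrite ?invr_ge0.
have bt j : (b j)%:R <= nd (y j) / k < (b j).+1%:R.
  by apply: truncn_itv; rewrite divr_ge0 ?nd_ge0 // ltW.
have gphi j : (j < n)%N -> g j <= phi (b j).
  move=> jn; rewrite /phi; case: eqP => [_|/eqP b0]; first exact: gX.
  have /andP[h1 _] := bt j.
  have b0' : 0 < (b j)%:R :> R by rewrite ltr0n lt0n.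
  have nd0 : 0 < nd (y j).
    by have := lt_le_trans b0' h1; rewrite pmulr_lgt0 // invr_gt0.
  have : g j <= C / nd (y j) by rewrite ler_pdivlMr // gC.
  move=> h; apply: le_trans h _; rewrite -mulrA ler_wpM2l // -invfM.
  rewrite lef_pV2 ?posrE ?mulr_gt0 //.
  by rewrite mulrC -ler_pdivlMr.
have bK j : (b j <= K)%N.
  have /andP[h1 _] := bt j; rewrite -(ler_nat R); apply: le_trans h1 _.
  apply: le_trans hK; rewrite ler_pdivrMr // mulVf ?gt_eqF //.
  have := nd_le_half (y j); lra.
have binj (Q : bool) i j : (i < n)%N -> (j < n)%N -> P i == Q -> P j == Q ->
    b i = b j -> i = j.
  move=> iN jN /eqP Pi /eqP Pj bij; case: (eqVneq i j) => // /eqP ij.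
  have h := sp _ _ iN jN ij.
  have /andP[a1 a2] := bt i; have /andP[a3 a4] := bt j.
  rewrite bij -natr1 in a1 a2; rewrite -natr1 in a4.
  have d : `|nd (y i) - nd (y j)| < k.
    have e : `|nd (y i) / k - nd (y j) / k| < 1.
      by rewrite ltr_norml; apply/andP; split; lra.
    rewrite -mulrBl normrM (ger0_norm (_ : 0 <= k^-1)) ?invr_ge0 ?(ltW k0) // in e.
    by rewrite ltr_pdivrMr // mul1r in e.
  have h2 := nd_min (y i - y j) (nint (y i) - nint (y j)).
  have : `|y i - y j - (nint (y i) - nint (y j))%:~R| = `|nd (y i) - nd (y j)|.
    rewrite intrB /nd; case: Q Pi Pj; rewrite /P.
    - move=> p1 p2; rewrite (@ler0_norm _ (y i - (nint (y i))%:~R)) ?subr_le0 ?(ltW p1) //.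
      rewrite (@ler0_norm _ (y j - (nint (y j))%:~R)) ?subr_le0 ?(ltW p2) // -normrN.
      by congr (`|_|); ring.
    - move=> /negbT; rewrite -leNgt => p1 /negbT; rewrite -leNgt => p2.
      rewrite (@ger0_norm _ (y i - (nint (y i))%:~R)) ?subr_ge0 //.
      rewrite (@ger0_norm _ (y j - (nint (y j))%:~R)) ?subr_ge0 //.
      by congr (`|_|); ring.
  by move=> e; exfalso; rewrite e in h2; lra.
have part (S : pred nat) (Q : bool) : (forall j, S j -> P j == Q) ->
    \sum_(0 <= j < n | S j) g j <= X + C / k * harm K.
  move=> SQ.
  apply: (@le_trans _ _ (\sum_(0 <= j < n | S j) phi (b j))).
    by rewrite !big_mkord; apply: ler_sum => j _; apply: gphi.
  have inj i j : (i < n)%N -> (j < n)%N -> S i -> S j -> b i = b j -> i = j.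
    by move=> iN jN /SQ Si /SQ Sj; exact: (binj Q).
  apply: le_trans (sum_injective_le (K := K) phi0 _ inj) _.
    by move=> j _ _; exact: bK.
  rewrite big_ltn // {1}/phi eqxx lerD2l mulr_sumr.
  rewrite !big_nat; apply: ler_sum => i /andP[i1 _].
  by rewrite /phi; case: eqP i1 => // ->.
rewrite (bigID P) /= (_ : 2 * _ = (X + C / k * harm K) + (X + C / k * harm K)); last ring.
apply: lerD.
- by apply: (part P true) => j ->.
- by apply: (part (fun j => ~~ P j) false) => j /negbTE->.
Qed.

(** The width 1/r is the inverse of a natural number so that the corners lie on every grid of step
    1/(rJ). *)
Definition tri (r : nat) t : R := Num.max 0 (1 - r%:R * nd t).

Lemma tri_ge0 r t : 0 <= tri r t.
Proof. by rewrite /tri le_max lexx. Qed.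

Lemma tri_le1 r t : tri r t <= 1.
Proof. by rewrite /tri ge_max ler01 /= gerBl mulr_ge0 ?nd_ge0. Qed.

Lemma tri_lip r t u : `|tri r t - tri r u| <= r%:R * `|t - u|.
Proof.
have h (t0 u0 : R) : tri r t0 <= tri r u0 + r%:R * `|t0 - u0|.
  rewrite {1}/tri ge_max; apply/andP; split.
    by rewrite addr_ge0 ?tri_ge0 ?mulr_ge0.
  apply: (@le_trans _ _ (1 - r%:R * nd u0 + r%:R * `|t0 - u0|)).
    have : r%:R * nd u0 <= r%:R * (nd t0 + `|t0 - u0|).
      by rewrite ler_wpM2l // distrC nd_lip.
    rewrite mulrDr; lra.
  by rewrite lerD2r /tri le_max lexx orbT.
have h1 := h t u; have h2 := h u t; rewrite (distrC u t) in h2.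
by rewrite ler_norml; apply/andP; split; lra.
Qed.

End NearestInteger.

(** * Fourier expansion of the triangle function *)

Section TriangleFourier.
Variable R : realType.

Lemma sin_mul_cos (a b : R) : 2 * sin b * cos a = sin (a + b) - sin (a - b).
Proof. rewrite sinD sinB; ring. Qed.

Lemma cos_mul_cos (a b : R) : cos a * cos b = 2^-1 * (cos (a - b) + cos (a + b)).
Proof. by rewrite cosB cosD; field. Qed.

Lemma sum_cos_full (N : nat) (z : int) : (0 < N)%N ->
  \sum_(0 <= h < N) cos (2 * pi * (h%:R * (z%:~R / N%:R))) =
  if (N%:Z %| z)%Z then N%:R else 0 :> R.
Proof.
move=> N0; have N0' : 0 < N%:R :> R by rewrite ltr0n.
have Nn : N%:R != 0 :> R by rewrite gt_eqF.
case: ifP => [/dvdzP[w ->]|/negbT ndv].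
  rewrite (eq_bigr (fun=> 1)); first by rewrite big_const_nat iter_addr_0 subn0.
  move=> h _; rewrite -[RHS](@cos0 R) -(cos2piz 0 (h%:Z * w)) add0r.
  by congr (cos _); rewrite !intrM /=; field; exact: Nn.
set m := (z %% N%:Z)%Z.
have m0 : 0 < m by rewrite lt_neqAle modz_ge0 ?andbT; [rewrite eq_sym; apply: contra ndv => /eqP/dvdz_mod0P|lia].
have mN : m < N%:Z by rewrite ltz_pmod //; lia.
pose al : R := 2 * pi * (m%:~R / N%:R).
have -> : \sum_(0 <= h < N) cos (2 * pi * (h%:R * (z%:~R / N%:R)))
  = \sum_(0 <= h < N) cos (h%:R * al).
  apply: eq_bigr => h _.
  rewrite -[RHS](cos2piz _ (h%:Z * (z %/ N%:Z)%Z)); congr (cos _).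
  rewrite [in LHS](divz_eq z N%:Z) -/m intrD !intrM /= /al; field; exact: Nn.
have sa : sin (al / 2) != 0.
  rewrite gt_eqF //; apply: sin_gt0_pi.
  have -> : al / 2 = pi * (m%:~R / N%:R) by rewrite /al; field.
  have m0' : 0 < m%:~R :> R by rewrite ltr0z.
  have q0 : 0 < m%:~R / N%:R :> R by rewrite divr_gt0.
  have q1 : m%:~R / N%:R < 1 :> R by rewrite ltr_pdivrMr // mul1r -[N%:R]/(N%:Z%:~R) ltr_int.
  have pi0 := @pi_gt0 R.
  by apply/andP; split; nra.
have sa2 : 2 * sin (al / 2) != 0 by rewrite mulf_neq0 // pnatr_eq0.
apply: (mulfI sa2).
rewrite mulr0 mulr_sumr.
rewrite (eq_bigr (fun h => sin (h.+1%:R * al - al / 2) - sin (h%:R * al - al / 2))).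
  rewrite telescope_sumr // mul0r add0r.
  have -> : N%:R * al - al / 2 = - (al / 2) + 2 * pi * m%:~R.
    by rewrite /al; field.
  by rewrite sin2piz subrr.
move=> h _; rewrite sin_mul_cos; congr (sin _ - sin _).
by rewrite -[h.+1%:R]natr1; field.
Qed.

Lemma sum_nat_eq (J k : nat) : \sum_(0 <= i < J) (i == k)%:R = (k < J)%:R :> R.
Proof.
elim: J => [|J IH]; first by rewrite big_nil.
rewrite big_nat_recr //= IH -natrD; congr (_%:R).
by case: (ltngtP k J) => h //=; lia.
Qed.

Lemma sum_nat_lt (J K : nat) : (K <= J)%N -> \sum_(0 <= i < J) (i < K)%:R = K%:R :> R.
Proof.
elim: J => [|J IH] KJ.
  have -> : K = 0%N by lia.
  by rewrite big_nil.
rewrite big_nat_recr //=.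
have [->|{}KJ] : K = J.+1 \/ (K <= J)%N by lia.
  rewrite ltnSn -natr1; congr (_ + _).
  rewrite (eq_big_nat _ _ (F2 := fun=> 1)) ?big_const_nat ?iter_addr_0 ?subn0 //.
  by move=> i /andP[_ ij]; rewrite (leqW ij).
by rewrite IH // (_ : (J < K)%N = false) ?addr0 //; lia.
Qed.

(** This is the Fejer triangle, the self-correlation of an interval of length J; the truncated
    subtraction makes it vanish for |n| >= J. *)
Lemma count_differences (J : nat) (n : int) :
  \sum_(0 <= i < J) \sum_(0 <= j < J) (i%:Z - j%:Z == n)%:R = (J - `|n|%N)%:R :> R.
Proof.
have pos (m : nat) :
    \sum_(0 <= i < J) \sum_(0 <= j < J) (i%:Z - j%:Z == m%:Z)%:R = (J - m)%:R :> R.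
  rewrite exchange_big /= (eq_bigr (fun j => (j < J - m)%:R)).
    by rewrite sum_nat_lt // leq_subr.
  move=> j _; rewrite (eq_bigr (fun i => (i == j + m)%N%:R)).
    by rewrite sum_nat_eq; congr (_%:R); lia.
  by move=> i _; congr ((_ : bool)%:R); lia.
case: n => n; first exact: pos.
rewrite exchange_big /= -pos; apply: eq_bigr => i _; apply: eq_bigr => j _.
by congr ((_ : bool)%:R); lia.
Qed.

Section Coefficients.
Variables (r J : nat).
Hypotheses (r2 : (2 <= r)%N) (J0 : (0 < J)%N).
Let N := (r * J)%N.

(* Discrete Fourier coefficients of [tri r] sampled on the grid [Z/(rJ)]: finite sums, and
   manifestly nonnegative. *)
Definition fejer_coef (h : nat) : R := (J%:R * N%:R)^-1 *
  \sum_(0 <= i < J) \sum_(0 <= j < J) cos (2 * pi * (h%:R * (i%:R - j%:R) / N%:R)).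

Lemma fejer_size_gt0 : (0 < N)%N.
Proof. by rewrite /N muln_gt0 J0 andbT; lia. Qed.

(** The squared modulus of a geometric sum, as real part squared plus imaginary part squared. The
    phase -1/4 turns the cosine into a sine, so that the bound for cosine sums covers both parts. *)
Lemma fejer_coef_square h : fejer_coef h = (J%:R * N%:R)^-1 *
  ((\sum_(0 <= i < J) cos (2 * pi * (h%:R / N%:R * i%:R + 0))) ^+ 2
   + (\sum_(0 <= i < J) cos (2 * pi * (h%:R / N%:R * i%:R - 4^-1))) ^+ 2).
Proof.
rewrite /fejer_coef; congr (_ * _); rewrite !expr2 !big_distrlr /= -big_split /=.
apply: eq_bigr => i _; rewrite -big_split /=; apply: eq_bigr => j _.
have e (k : nat) : cos (2 * pi * (h%:R / N%:R * k%:R - 4^-1))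
    = sin (2 * pi * (h%:R / N%:R * k%:R + 0)) :> R.
  by rewrite -cosBpihalf; congr (cos _); field; rewrite pnatr_eq0 -lt0n fejer_size_gt0.
rewrite !e -cosB; congr (cos _); field.
by rewrite pnatr_eq0 -lt0n fejer_size_gt0.
Qed.

Lemma fejer_coef_ge0 h : 0 <= fejer_coef h.
Proof.
by rewrite fejer_coef_square mulr_ge0 ?invr_ge0 ?mulr_ge0 // addr_ge0 // sqr_ge0.
Qed.

Lemma fejer_coef0 : fejer_coef 0 = r%:R^-1.
Proof.
have Jn : J%:R != 0 :> R by rewrite pnatr_eq0 -lt0n.
have rn : r%:R != 0 :> R by rewrite pnatr_eq0 -lt0n; lia.
rewrite fejer_coef_square.
rewrite (eq_bigr (fun=> 1)); last by move=> i _; rewrite !mul0r addr0 mulr0 cos0.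
rewrite [X in _ + X ^+ 2](eq_bigr (fun=> 0)); last first.
  move=> i _; rewrite !mul0r add0r (_ : 2 * pi * - 4^-1 = - (pi / 2)); last by field.
  by rewrite cosN cos_pihalf.
rewrite !big_const_nat !iter_addr_0 subn0 mul0rn expr0n addr0 /N natrM.
by field; rewrite rn Jn.
Qed.

(** On the grid, h and N - h give the same cosine. The smaller one is kept because off the grid only
    the low frequencies vary slowly enough for the error estimate. *)
Definition fejer_freq (h : nat) : nat := minn h (N - h).

Lemma fejer_freq_gt0 h : (1 <= h < N)%N -> (0 < fejer_freq h)%N.
Proof. by rewrite /fejer_freq; lia. Qed.

(** With m the folded frequency, h/N is at distance at least m/N from the integers, so each of the
    two sums is at most 2N/m. *)
Lemma fejer_coef_le h : (1 <= h < N)%N ->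
  fejer_coef h <= 8 * r%:R / (fejer_freq h)%:R ^+ 2.
Proof.
move=> hN; have N0 := fejer_size_gt0; have N0' : 0 < N%:R :> R by rewrite ltr0n.
have m0 := fejer_freq_gt0 hN; set m := fejer_freq h in m0 *.
have m0' : 0 < m%:R :> R by rewrite ltr0n.
have mN : (m <= h)%N /\ (m <= N - h)%N by rewrite /m /fejer_freq; lia.
have k0 : 0 < m%:R / N%:R :> R by rewrite divr_gt0.
have kn : m%:R / N%:R <= nd (h%:R / N%:R : R).
  rewrite /nd; set z := nint _; rewrite -(ler_pM2r N0') divfK ?gt_eqF //.
  rewrite -[X in _ * X](@ger0_norm _ N%:R) // -normrM mulrBl divfK ?gt_eqF //.
  have -> : h%:R - z%:~R * N%:R = (h%:Z - z * N%:Z)%:~R :> R by rewrite intrB intrM.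
  rewrite -intr_norm -[m%:R]/(m%:Z%:~R) ler_int.
  have [z0|z1] : z <= 0 \/ 1 <= z by lia.
  - have : z * N%:Z <= 0 by rewrite mulr_le0_ge0.
    lia.
  - have : 1 * N%:Z <= z * N%:Z by rewrite ler_wpM2r.
    lia.
have b1 := linear_sum_bound 0 0%N J k0 kn.
have b2 := linear_sum_bound (- 4^-1) 0%N J k0 kn.
have sq (x : R) : `|x| <= 2 / (m%:R / N%:R) -> x ^+ 2 <= (2 / (m%:R / N%:R)) ^+ 2.
  move=> h1; rewrite -real_normK ?num_real // ler_pXn2r //.
  by rewrite nnegrE (le_trans _ h1).
rewrite fejer_coef_square.
have J0' : 0 < J%:R :> R by rewrite ltr0n.
have r0' : 0 < r%:R :> R by rewrite ltr0n; lia.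
apply: (@le_trans _ _ ((J%:R * N%:R)^-1 * ((2 / (m%:R / N%:R)) ^+ 2 + (2 / (m%:R / N%:R)) ^+ 2))).
  apply: ler_wpM2l; first by rewrite invr_ge0 mulr_ge0 // ltW.
  by apply: lerD; apply: sq.
rewrite /N natrM le_eqVlt; apply/orP; left; apply/eqP; field.
by rewrite !gt_eqF.
Qed.

(** Both sides depend on n modulo N only, so |n| <= N/2 may be assumed. Orthogonality then counts
    the pairs i, j < J with i - j = n or i - j = -n; since J <= N/2 there is no wrap-around, and J -
    |n| divided by J is 1 - r|n/N|, cut off at 0. *)
Lemma fejer_grid (n : int) :
  tri r (n%:~R / N%:R) = \sum_(0 <= h < N) fejer_coef h * cos (2 * pi * (h%:R * (n%:~R / N%:R))) :> R.
Proof.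
have N0 := fejer_size_gt0; have N0' : 0 < N%:R :> R by rewrite ltr0n.
have J0' : 0 < J%:R :> R by rewrite ltr0n.
have r0' : 0 < r%:R :> R by rewrite ltr0n; lia.
wlog nsmall : n / (2 * `|n| <= N)%N.
  move=> H; pose z := nint (n%:~R / N%:R : R); pose n0 := n - z * N%:Z.
  have e : n%:~R / N%:R = n0%:~R / N%:R + z%:~R :> R.
    by rewrite /n0 intrB intrM /=; field; rewrite gt_eqF.
  have -> : tri r (n%:~R / N%:R : R) = tri r (n0%:~R / N%:R).
    by rewrite e /tri nd_addz.
  rewrite H; last first.
    have := nd_le_half (n%:~R / N%:R : R); rewrite /nd -/z.
    have -> : n%:~R / N%:R - z%:~R = n0%:~R / N%:R :> R by rewrite e addrK.
    rewrite normrM [`|_^-1|]ger0_norm ?invr_ge0 // ler_pdivrMr // -intr_norm => h.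
    have : (2 * `|n0|)%:~R <= N%:Z%:~R :> R by rewrite intrM /=; lra.
    by rewrite ler_int; lia.
  apply: eq_bigr => h _; congr (_ * _).
  rewrite -[LHS](cos2piz _ (h%:Z * z)) e; congr (cos _); rewrite intrM /=; ring.
have JN : 2 * J%:Z <= N%:Z by rewrite /N; nia.
have cnt (s : int) : \sum_(0 <= i < J) \sum_(0 <= j < J)
    \sum_(0 <= h < N) cos (2 * pi * (h%:R * (((i%:Z - j%:Z) + s)%:~R / N%:R)))
    = N%:R * \sum_(0 <= i < J) \sum_(0 <= j < J) ((N%:Z %| (i%:Z - j%:Z) + s)%Z)%:R :> R.
  rewrite mulr_sumr; apply: eq_bigr => i _; rewrite mulr_sumr; apply: eq_bigr => j _.
  by rewrite sum_cos_full //; case: ifP => _; rewrite ?mulr1 ?mulr0.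
pose T := \sum_(0 <= i < J) \sum_(0 <= j < J) (i%:Z - j%:Z == n)%:R : R.
have tm : \sum_(0 <= i < J) \sum_(0 <= j < J) ((N%:Z %| (i%:Z - j%:Z) - n)%Z)%:R = T :> R.
  rewrite /T !big_nat; apply: eq_bigr => i /andP[_ iJ].
  rewrite !big_nat; apply: eq_bigr => j /andP[_ jJ].
  congr ((_ : bool)%:R); apply/idP/eqP => [/dvdzP[q hq]|->]; last by rewrite subrr dvdz0.
  have [q0|[q0|q0]] : q = 0 \/ 1 <= q \/ q <= -1 by lia.
  - by rewrite q0 mul0r in hq; lia.
  - have : 1 * N%:Z <= q * N%:Z by rewrite ler_wpM2r.
    lia.
  - have : q * N%:Z <= -1 * N%:Z by rewrite ler_wpM2r.
    lia.
have tp : \sum_(0 <= i < J) \sum_(0 <= j < J) ((N%:Z %| (i%:Z - j%:Z) + n)%Z)%:R = T :> R.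
  rewrite exchange_big /= -tm; apply: eq_bigr => i _; apply: eq_bigr => j _.
  congr ((_ : bool)%:R); rewrite !dvdzE; congr (_ %| _)%N; lia.
have -> : \sum_(0 <= h < N) fejer_coef h * cos (2 * pi * (h%:R * (n%:~R / N%:R)))
   = J%:R^-1 * T :> R.
  transitivity ((J%:R * N%:R)^-1 * (2^-1 * (N%:R * T + N%:R * T)) : R); last first.
    by field; rewrite !gt_eqF.
  rewrite -{1}tm -tp -!cnt -big_split /= !mulr_sumr.
  have E h : fejer_coef h * cos (2 * pi * (h%:R * (n%:~R / N%:R)))
      = \sum_(0 <= i < J) \sum_(0 <= j < J) (J%:R * N%:R)^-1 * (2^-1 *
         (cos (2 * pi * (h%:R * ((i%:Z - j%:Z - n)%:~R / N%:R)))
          + cos (2 * pi * (h%:R * ((i%:Z - j%:Z + n)%:~R / N%:R))))).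
    rewrite /fejer_coef -[LHS]mulrA mulr_suml mulr_sumr; apply: eq_bigr => i _.
    rewrite mulr_suml mulr_sumr; apply: eq_bigr => j _; congr (_ * _).
    by rewrite cos_mul_cos; congr (_ * (cos _ + cos _)); rewrite intrD intrB ?intrN /=; ring.
  rewrite (eq_bigr _ (fun h _ => E h)) exchange_big /=; apply: eq_bigr => i _.
  rewrite exchange_big /= -big_split /= !mulr_sumr; apply: eq_bigr => j _.
  by rewrite -big_split /= !mulr_sumr.
rewrite /T count_differences /tri (nd_small (z := 0)); last first.
  rewrite subr0 normrM [`|_^-1|]ger0_norm ?invr_ge0 // ler_pdivrMr // -intr_norm.
  have : (2 * `|n|%N)%N%:R <= N%:R :> R by rewrite ler_nat.
  rewrite natrM -abszE /=; lra.
rewrite subr0 normrM [`|_^-1|]ger0_norm ?invr_ge0 // -intr_norm.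
have -> : r%:R * (`|n|%:~R / N%:R) = `|n|%N%:R / J%:R :> R.
  by rewrite -abszE /N natrM /=; field; rewrite !gt_eqF.
case: (leqP J `|n|) => h.
  have -> : (J - `|n| = 0)%N by lia.
  rewrite mulr0; apply/max_idPl; rewrite subr_le0 ler_pdivlMr // mul1r ler_nat; exact: h.
rewrite natrB ?(ltnW h) //; rewrite (_ : J%:R^-1 * _ = 1 - `|n|%N%:R / J%:R); last by field; rewrite gt_eqF.
by apply/max_idPr; rewrite subr_ge0 ler_pdivrMr // mul1r ler_nat ltnW.
Qed.

Lemma fejer_coef_sum : \sum_(1 <= h < N) fejer_coef h <= 1.
Proof.
have N0 := fejer_size_gt0.
have := fejer_grid 0; rewrite mul0r big_ltn //.
have -> : tri r (0 : R) = 1.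
  rewrite /tri (nd_small (z := 0)) ?subr0 ?normr0 ?mulr0 ?subr0; last lra.
  exact/max_idPr.
rewrite (eq_bigr (fun h => fejer_coef h)); last by move=> h _; rewrite !mulr0 cos0 mulr1.
rewrite !mulr0 cos0 mulr1 => e; have := fejer_coef_ge0 0; lra.
Qed.

(** A frequency m arises at most from h = m and from h = N - m, whence 16 in place of 8. *)
Lemma fejer_coef_weight (w : nat -> R) : (forall m, 0 <= w m) ->
  \sum_(1 <= h < N) fejer_coef h * w (fejer_freq h)
  <= \sum_(1 <= m < N) 16 * r%:R / m%:R ^+ 2 * w m.
Proof.
move=> w0; pose p m : R := 8 * r%:R / m%:R ^+ 2 * w m.
have p0 m : 0 <= p m by rewrite !mulr_ge0 ?invr_ge0 ?exprn_ge0.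
apply: (@le_trans _ _ (\sum_(1 <= h < N) (p h + p (N - h)%N))).
  rewrite !big_nat; apply: ler_sum => h hN.
  apply: (@le_trans _ _ (p (fejer_freq h))).
    by rewrite ler_wpM2r // fejer_coef_le.
  rewrite /fejer_freq /minn; case: ifP => _; [rewrite lerDl|rewrite lerDr]; exact: p0.
rewrite big_split /=.
have -> : \sum_(1 <= h < N) p (N - h)%N = \sum_(1 <= h < N) p h.
  rewrite [RHS]big_nat_rev /=; apply: eq_bigr => h _; congr (p _); lia.
rewrite -big_split /= le_eqVlt; apply/orP; left; apply/eqP.
apply: eq_bigr => m _; rewrite /p; ring.
Qed.

Lemma pi_lt4 : pi < 4 :> R.
Proof. have := @pihalf_lt2 R; lra. Qed.

(** [t] is moved to the grid point [u] just below it. The polynomial changes by a multiple of the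
    sum of c(h) m / N, which is estimated through m <= (L + m^2/L)/2 with L = 3rj: the c(h) sum to
    at most 1 and each c(h) m^2 is at most 8r. With [J = j ^ 2] both halves are of order 1/j. *)
Lemma fejer_approx (j : nat) (t : R) : (0 < j)%N -> J = (j ^ 2)%N ->
  `|tri r t - (r%:R^-1 + \sum_(1 <= h < N)
       fejer_coef h * cos (2 * pi * ((fejer_freq h)%:R * t)))| <= 24 / j%:R.
Proof.
move=> j0 Jj; have N0 := fejer_size_gt0; have N0' : 0 < N%:R :> R by rewrite ltr0n.
have J0' : 0 < J%:R :> R by rewrite ltr0n.
have j0' : 0 < j%:R :> R by rewrite ltr0n.
have j1' : 1 <= j%:R :> R by rewrite ler1n.
have r0' : 0 < r%:R :> R by rewrite ltr0n; lia.
pose n := Num.floor (t * N%:R); pose u : R := n%:~R / N%:R.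
have tu : `|t - u| <= N%:R^-1.
  have /andP[h1 h2] := floor_itv (t * N%:R); rewrite -/n intrD /= in h1 h2.
  rewrite -(ler_pM2r N0') mulVf ?gt_eqF // -[X in _ * X](@ger0_norm _ N%:R) //.
  rewrite -normrM mulrBl divfK ?gt_eqF // ger0_norm; lra.
have e1 : `|tri r t - tri r u| <= J%:R^-1.
  apply: le_trans (tri_lip _ _ _) _.
  apply: (@le_trans _ _ (r%:R * N%:R^-1)); first by rewrite ler_wpM2l // ltW.
  by rewrite /N natrM le_eqVlt; apply/orP; left; apply/eqP; field; rewrite !gt_eqF.
have eu : tri r u = r%:R^-1 + \sum_(1 <= h < N)
       fejer_coef h * cos (2 * pi * ((fejer_freq h)%:R * u)).
  rewrite fejer_grid big_ltn // mul0r mulr0 cos0 mulr1 fejer_coef0; congr (_ + _).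
  rewrite !big_nat; apply: eq_bigr => h /andP[h1 hN]; congr (_ * _).
  rewrite /fejer_freq /minn; case: ifP => // _.
  rewrite natrB ?(ltnW hN) // mulrBl mulrBr.
  have -> : N%:R * u = n%:~R by rewrite /u mulrC divfK // gt_eqF.
  by rewrite -[LHS]cosN -(cos2piz (- _) n) addrC.
pose f h := fejer_coef h * (cos (2 * pi * ((fejer_freq h)%:R * t))
                     - cos (2 * pi * ((fejer_freq h)%:R * u))).
have e2 : `|\sum_(1 <= h < N) f h| <= 23 / j%:R.
  apply: le_trans (ler_norm_sum _ _ _) _.
  have step h : `|f h| <= fejer_coef h * (8 / N%:R) * (fejer_freq h)%:R.
    rewrite /f normrM (ger0_norm (fejer_coef_ge0 h)) -[leRHS]mulrA.
    apply: ler_wpM2l; first exact: fejer_coef_ge0.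
    apply: le_trans (cos_lipschitz _ _) _.
    have p0 := @pi_gt0 R; have m0 : 0 <= (fejer_freq h)%:R :> R by [].
    have pm : 0 <= 2 * pi * (fejer_freq h)%:R :> R by rewrite !mulr_ge0 // ltW.
    rewrite (_ : _ - _ = (2 * pi * (fejer_freq h)%:R) * (t - u)); last by ring.
    rewrite normrM (ger0_norm pm) (_ : 8 / N%:R * _ = (8 * (fejer_freq h)%:R) * N%:R^-1); last by ring.
    apply: ler_pM => //; apply: ler_wpM2r => //; have := pi_lt4; lra.
  apply: (@le_trans _ _ (\sum_(1 <= h < N) (8 / N%:R / 2) * (fejer_coef h * (3 * r%:R * j%:R)
       + fejer_coef h * ((fejer_freq h)%:R ^+ 2 / (3 * r%:R * j%:R))))).
    apply: ler_sum => h _; apply: le_trans (step h) _.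
    set m := (fejer_freq h)%:R; set c := fejer_coef h; set L := 3 * r%:R * j%:R.
    have L0 : 0 < L by rewrite !mulr_gt0.
    have c0 : 0 <= c by exact: fejer_coef_ge0.
    have am : m <= (L + m ^+ 2 / L) / 2.
      rewrite ler_pdivlMr // -(ler_pM2r L0) mulrDl divfK ?gt_eqF //.
      have := sqr_ge0 (L - m); rewrite !expr2; lra.
    have n8 : 0 <= c * (8 / N%:R) by rewrite mulr_ge0 // divr_ge0 // ltW.
    apply: le_trans (ler_wpM2l n8 am) _.
    by rewrite le_eqVlt; apply/orP; left; apply/eqP; ring.
  rewrite -mulr_sumr big_split /= -mulr_suml.
  have s1 := fejer_coef_sum.
  have s2 : \sum_(1 <= h < N) fejer_coef h * ((fejer_freq h)%:R ^+ 2 / (3 * r%:R * j%:R))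
     <= 8 * r%:R * N%:R / (3 * r%:R * j%:R).
    apply: (@le_trans _ _ (\sum_(1 <= h < N) 8 * r%:R / (3 * r%:R * j%:R))).
      rewrite !big_nat; apply: ler_sum => h hN.
      rewrite mulrA ler_wpM2r ?invr_ge0 ?mulr_ge0 //.
      have := fejer_coef_le hN; have := fejer_freq_gt0 hN => m0.
      by rewrite ler_pdivlMr // exprn_gt0 // ltr0n.
    have C0 : 0 <= 8 * r%:R / (3 * r%:R * j%:R) :> R by rewrite divr_ge0 // !mulr_ge0.
    set C := 8 * r%:R / (3 * r%:R * j%:R) in C0 *.
    have -> : 8 * r%:R * N%:R / (3 * r%:R * j%:R) = C * N%:R by rewrite /C mulrAC.
    by rewrite big_const_nat iter_addr_0 -[C *+ _]mulr_natr ler_wpM2l // ler_nat leq_subr.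
  apply: (@le_trans _ _ (8 / N%:R / 2 * (1 * (3 * r%:R * j%:R) + 8 * r%:R * N%:R / (3 * r%:R * j%:R)))).
    apply: ler_wpM2l; first by rewrite !mulr_ge0 ?invr_ge0 ?(ltW N0').
    by apply: lerD => //; rewrite ler_wpM2r // !mulr_ge0.
  rewrite /N Jj natrM natrX.
  rewrite (_ : _ * _ = (12 + 32 / 3) / j%:R); last by field; rewrite !gt_eqF.
  rewrite ler_wpM2r ?invr_ge0 ?(ltW j0') //; lra.
have -> : tri r t - (r%:R^-1 + \sum_(1 <= h < N) fejer_coef h * cos (2 * pi * ((fejer_freq h)%:R * t)))
   = (tri r t - tri r u) - \sum_(1 <= h < N) f h.
  have -> : \sum_(1 <= h < N) f h = \sum_(1 <= h < N) fejer_coef h * cos (2 * pi * ((fejer_freq h)%:R * t))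
     - \sum_(1 <= h < N) fejer_coef h * cos (2 * pi * ((fejer_freq h)%:R * u)).
    by rewrite -sumrB; apply: eq_bigr => h _; rewrite /f mulrBr.
  by rewrite eu; ring.
apply: le_trans (ler_normB _ _) _.
have e3 : J%:R^-1 <= j%:R^-1 :> R.
  by rewrite Jj natrX lef_pV2 ?posrE ?exprn_gt0 // expr2 -[leLHS]mul1r ler_wpM2r // ltW.
rewrite (_ : 24 / j%:R = j%:R^-1 + 23 / j%:R); last by ring.
by apply: lerD => //; apply: le_trans e3.
Qed.

End Coefficients.

(** The interface to the rest. As the frequencies [mu h] repeat, sums along them are controlled by
    testing against an arbitrary nonnegative [w], which reduces them to a series with coefficients
    16r/m^2. *)
Lemma tri_fourier (r : nat) (eps : R) : (2 <= r)%N -> 0 < eps ->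
  exists (N : nat) (c : nat -> R) (mu : nat -> nat),
  [/\ N%:R <= r%:R * (24 / eps + 1) ^+ 2,
      (forall h, 0 <= c h) /\ \sum_(1 <= h < N) c h <= 1,
      forall w : nat -> R, (forall m, 0 <= w m) ->
        \sum_(1 <= h < N) c h * w (mu h) <= \sum_(1 <= m < N) 16 * r%:R / m%:R ^+ 2 * w m,
      forall h, (1 <= h < N)%N -> (0 < mu h)%N
    & forall t, `|tri r t - (r%:R^-1 + \sum_(1 <= h < N) c h * cos (2 * pi * ((mu h)%:R * t)))| <= eps].
Proof.
move=> r2 e0; pose j := (Num.trunc (24 / eps)).+1.
have /andP[j1 j2] : (Num.trunc (24 / eps))%:R <= 24 / eps < (Num.trunc (24 / eps)).+1%:R.
  by apply: truncn_itv; rewrite divr_ge0 // ltW.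
have j0 : (0 < j)%N by [].
have J0 : (0 < j ^ 2)%N by rewrite expn_gt0.
exists (r * j ^ 2)%N, (fejer_coef r (j ^ 2)), (fejer_freq r (j ^ 2)); split.
- have jle : j%:R <= 24 / eps + 1 :> R by rewrite /j -natr1 lerD2r.
  by rewrite natrM natrX ler_wpM2l // ler_pXn2r ?nnegrE // (le_trans _ jle).
- by split; [exact: fejer_coef_ge0|exact: fejer_coef_sum].
- exact: fejer_coef_weight.
- by move=> h; exact: fejer_freq_gt0.
- move=> t; apply: le_trans (fejer_approx r2 J0 t j0 erefl) _.
  rewrite ler_pdivrMr ?ltr0n // mulrC -ler_pdivrMr //; exact: ltW.
Qed.

End TriangleFourier.

(** * Arithmetic functions *)

Section DivisorSums.
Variable V : nmodType.

Lemma sum_multiples (B d : nat) (P : pred nat) (F : nat -> V) : (0 < d)%N ->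
  \sum_(1 <= n < B.+1 | P n && (d %| n)%N) F n =
  \sum_(1 <= l < B.+1 | (d * l <= B)%N && P (d * l)%N) F (d * l)%N.
Proof.
move=> d0.
transitivity (\sum_(1 <= n < B.+1) \sum_(1 <= l < B.+1 | (n == d * l)%N) (if P n then F n else 0)).
  rewrite big_mkcond !big_nat; apply: eq_bigr => n /andP[n1 nB].
  have [/dvdnP[q nq]|ndv] := boolP (d %| n)%N.
    rewrite (eq_bigl (fun l => l == q)); last first.
      by move=> l; rewrite nq mulnC eqn_pmul2l // eq_sym.
    have q0 : (0 < q)%N by move: n1; rewrite nq muln_gt0 => /andP[].
    have qn : (q <= n)%N by rewrite nq leq_pmulr.
    have r : (1 <= q < B.+1)%N by lia.
    by rewrite big_nat1_eq andbT r.
  rewrite big_pred0 ?andbF // => l; apply: contraNF ndv => /eqP->.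
  exact: dvdn_mulr.
rewrite (exchange_big_dep xpredT) //= [RHS]big_mkcond /=; apply: eq_big_nat => l /andP[l1 lB].
rewrite big_nat1_eq.
have -> : (1 <= d * l < B.+1)%N = (d * l <= B)%N by nia.
by case: (d * l <= B)%N => //=; case: (P _).
Qed.

(** A pair (n, d) with d | n becomes the pair (d, n/d). All variables keep the common upper limit B,
    with the true conditions as predicates, so that sums can be exchanged freely. *)
Lemma sum_divisor_switch (B : nat) (P : pred nat) (g : nat -> nat -> V) :
  \sum_(1 <= n < B.+1 | P n) \sum_(1 <= d < B.+1 | (d %| n)%N) g d (n %/ d)%N =
  \sum_(1 <= m < B.+1) \sum_(1 <= l < B.+1 | (m * l <= B)%N && P (m * l)%N) g m l.
Proof.
rewrite (exchange_big_dep xpredT) //=; apply: eq_big_nat => d /andP[d1 dB].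
rewrite sum_multiples //; apply: eq_bigr => l _; congr (g _ _).
by rewrite mulKn.
Qed.

Lemma sum_divisors_widen (n B : nat) (F : nat -> V) : (0 < n)%N -> (n <= B)%N ->
  \sum_(1 <= d < B.+1 | (d %| n)%N) F d = \sum_(1 <= d < n.+1 | (d %| n)%N) F d.
Proof.
move=> n0 nB; rewrite (big_cat_nat _ (n := n.+1)) //= [X in _ + X]big_nat_cond.
rewrite [X in _ + X]big_pred0 ?addr0 // => d; apply/negP => /andP[/andP[h1 h2] h3].
by have := dvdn_leq n0 h3; lia.
Qed.

End DivisorSums.

(** * The Moebius function *)

Section Moebius.

Definition squarefree n := (0 < n)%N && all (fun p => logn p n == 1%N) (primes n).

Definition mu (n : nat) : int := if squarefree n then (-1) ^+ size (primes n) else 0.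

Lemma mu_norm n : `|mu n| <= 1.
Proof. by rewrite /mu; case: ifP => // _; rewrite normrX normrN1 expr1n. Qed.

Lemma squarefreeP n : (0 < n)%N ->
  reflect (forall p, prime p -> ~~ (p ^ 2 %| n)%N) (squarefree n).
Proof.
move=> n0; apply: (iffP andP) => [[_ /allP H] p pp|H].
  apply/negP => h; have pn : p \in primes n.
    by rewrite mem_primes pp n0 (dvdn_trans _ h) // -{1}(expn1 p) dvdn_exp2l.
  have /eqP := H p pn; move: h; rewrite pfactor_dvdn // => h1 h2.
  by rewrite h2 in h1.
split=> //; apply/allP => p; rewrite mem_primes => /and3P[pp _ pn].
have := H p pp; rewrite pfactor_dvdn // -ltnNge.
have : (0 < logn p n)%N by rewrite logn_gt0 mem_primes pp n0.
by move=> ? ?; apply/eqP; lia.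
Qed.

Lemma mu_square p n : prime p -> (p ^ 2 %| n)%N -> mu n = 0.
Proof.
move=> pp h; rewrite /mu; case: ifP => // sn; have n0 : (0 < n)%N by case/andP: sn.
by have /(squarefreeP n0)/(_ p pp) := sn; rewrite h.
Qed.

Lemma primes_prime_mul p n : prime p -> (0 < n)%N -> ~~ (p %| n)%N ->
  perm_eq (primes (p * n)) (p :: primes n).
Proof.
move=> pp n0 pn; have p0 := prime_gt0 pp; apply: uniq_perm; first exact: primes_uniq.
  by rewrite /= primes_uniq mem_primes pp n0 pn.
by move=> q; rewrite primesM // inE primes_prime // inE.
Qed.

Lemma squarefree_prime_mul p n : prime p -> (0 < n)%N -> ~~ (p %| n)%N ->
  squarefree (p * n) = squarefree n.
Proof.
move=> pp n0 pn; have p0 := prime_gt0 pp.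
rewrite /squarefree muln_gt0 p0 n0 /=.
rewrite (perm_all _ (primes_prime_mul pp n0 pn)) /= lognM // logn_prime // eqxx.
have -> : logn p n = 0%N by apply/eqP; rewrite -leqn0 leqNgt logn_gt0 mem_primes pp n0.
apply: eq_in_all => q; rewrite mem_primes => /and3P[qp _ qn].
rewrite lognM // logn_prime //; case: (eqVneq q p) => [qp'|_]; last by rewrite add0n.
by move: qn pn; rewrite qp' => ->.
Qed.

Lemma mu_prime_mul p n : prime p -> (0 < n)%N -> ~~ (p %| n)%N -> mu (p * n) = - mu n.
Proof.
move=> pp n0 pn; rewrite /mu squarefree_prime_mul //; case: ifP => _; last by rewrite oppr0.
by rewrite (perm_size (primes_prime_mul pp n0 pn)) /= exprS mulN1r.
Qed.


(** Let p be the least prime factor of n. Among the divisors pl, those with p | l contribute 0 and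
    the others cancel the divisors prime to p. *)
Lemma sum_mu n : (0 < n)%N ->
  \sum_(1 <= d < n.+1 | (d %| n)%N) mu d = (n == 1%N)%:R.
Proof.
move=> n0; case: (eqVneq n 1%N) => [->|n1].
  by rewrite big_mkcond big_nat1.
pose p := pdiv n; have pp : prime p by rewrite pdiv_prime; lia.
have pn : (p %| n)%N by exact: pdiv_dvd.
rewrite (bigID (fun d => p %| d)%N) /= sum_multiples ?prime_gt0 //.
rewrite (bigID (fun l => p %| l)%N) /= big1 ?add0r; last first.
  move=> l /andP[_ pl]; apply: (mu_square pp).
  by rewrite expnS expn1 dvdn_pmul2l ?prime_gt0.
have E (l : nat) : (1 <= l < n.+1)%N ->
  ((p * l <= n)%N && (p * l %| n)%N) && ~~ (p %| l)%N = (l %| n)%N && ~~ (p %| l)%N.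
  move=> l1; case pl : (p %| l)%N; rewrite ?andbF ?andbT //.
  have -> : (p * l %| n)%N = (l %| n)%N.
    rewrite Gauss_dvd ?pn //; by rewrite prime_coprime // pl.
  case ln : (l %| n)%N; rewrite ?andbF ?andbT //.
  apply: dvdn_leq => //; rewrite Gauss_dvd ?pn ?ln //; by rewrite prime_coprime // pl.
rewrite (big_nat_cond) (eq_bigl (fun l => (1 <= l < n.+1) && ((l %| n) && ~~ (p %| l)))%N).
  rewrite -big_nat_cond (eq_bigr (fun l => - mu l)); last first.
    by move=> l /andP[ln pl]; rewrite mu_prime_mul // (dvdn_gt0 n0 ln).
  by rewrite sumrN addNr.
move=> l; case l1 : (1 <= l < n.+1)%N => //=; exact: E.
Qed.

End Moebius.

(** * The divisor bound *)

Section DivisorCount.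

Definition tau n := size (divisors n).

Lemma divisors_filter n : (0 < n)%N ->
  perm_eq (divisors n) [seq d <- index_iota 1 n.+1 | d %| n]%N.
Proof.
move=> n0; apply: uniq_perm; rewrite ?divisors_uniq ?filter_uniq ?iota_uniq //.
move=> d; rewrite -dvdn_divisors // mem_filter mem_index_iota.
case dn : (d %| n)%N => //=; rewrite (dvdn_gt0 n0 dn) /= ltnS.
by rewrite (dvdn_leq n0 dn).
Qed.

Lemma tau_sum (R : nzSemiRingType) (n B : nat) : (0 < n)%N -> (n <= B)%N ->
  \sum_(1 <= d < B.+1 | (d %| n)%N) 1 = (tau n)%:R :> R.
Proof.
move=> n0 nB; rewrite sum_divisors_widen // /tau (perm_size (divisors_filter n0)).
by rewrite -big_filter big_const_seq count_predT iter_addr_0.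
Qed.

Lemma tau_prime_power p e m : prime p -> (0 < m)%N -> ~~ (p %| m)%N ->
  (tau (p ^ e * m) <= e.+1 * tau m)%N.
Proof.
move=> pp m0 pm; have p0 := prime_gt0 pp.
have n0 : (0 < p ^ e * m)%N by rewrite muln_gt0 expn_gt0 p0.
rewrite /tau -[X in (_ <= X * _)%N](size_iota 0) -(size_allpairs (fun i d => p ^ i * d)%N).
apply: uniq_leq_size; first exact: divisors_uniq.
move=> d; rewrite -dvdn_divisors // => dn.
have d0 := dvdn_gt0 n0 dn.
have [i pd' dE] := pfactor_coprime pp d0.
apply/allpairsP; exists (logn p d, i).
split; rewrite ?mem_iota ?add0n /=; last by rewrite {1}dE mulnC.
- have := dvdn_leq_log p n0 dn; rewrite lognM ?expn_gt0 ?p0 // pfactorK //.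
  have -> : logn p m = 0%N by apply/eqP; rewrite -leqn0 leqNgt logn_gt0 mem_primes pp m0.
  by rewrite addn0.
- rewrite -dvdn_divisors //.
  have : (i %| p ^ e * m)%N by apply: dvdn_trans dn; rewrite dE dvdn_mulr.
  by rewrite Gauss_dvdr // coprime_sym coprimeXl // prime_coprime.
Qed.

(** Induction on k by halving e: in (e+1)^(k+1) <= 2^(k+1) (e/2+1)^(k+1), one factor e/2+1 is paid
    by 2^(e/2) and the others by the induction hypothesis. *)
Lemma pow_le_exp2 k : exists A, (0 < A)%N /\ forall e, (e.+1 ^ k <= A * 2 ^ e)%N.
Proof.
elim: k => [|k [A [A0 IH]]]; first by exists 1%N; split=> // e; rewrite mul1n expn_gt0.
exists (2 ^ k.+1 * A)%N; split=> [|e]; first by rewrite muln_gt0 expn_gt0.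
have e2 : (e.+1 <= 2 * (e./2).+1)%N by lia.
apply: (@leq_trans (2 ^ k.+1 * (A * 2 ^ (e./2 + e./2)))%N); last first.
  by rewrite mulnA leq_mul2l leq_pexp2l ?orbT //; lia.
apply: (@leq_trans ((2 * (e./2).+1) ^ k.+1)%N); first by rewrite leq_exp2r.
rewrite expnMn leq_mul2l expnD; apply/orP; right.
rewrite expnS mulnC mulnA; apply: leq_mul => //.
exact: ltn_expl.
Qed.

(** One prime at a time: if p >= 2^k then (e+1)^k <= 2^(ke) <= p^e without loss; only the primes
    below 2^k, at most 2^k in number, cost the constant [A]. *)
Lemma divisor_bound k : exists C, (0 < C)%N /\ forall n, (0 < n)%N -> (tau n ^ k <= C * n)%N.
Proof.
have [A [A0 HA]] := pow_le_exp2 k.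
pose small n := size [seq p <- primes n | (p < 2 ^ k)%N].
have main N : forall n, (n <= N)%N -> (0 < n)%N -> (tau n ^ k <= A ^ small n * n)%N.
  elim: N => [|N IH] n nN n0; first lia.
  case: (eqVneq n 1%N) => [->|n1]; first by rewrite /tau /small /= exp1n.
  pose p := pdiv n; have pp : prime p by rewrite pdiv_prime; lia.
  have pn : (p %| n)%N by exact: pdiv_dvd.
  have [m pm nE] := pfactor_coprime pp n0.
  set e := logn p n in nE.
  have e0 : (0 < e)%N by rewrite logn_gt0 mem_primes pp n0.
  have m0 : (0 < m)%N by move: n0; rewrite nE muln_gt0 => /andP[].
  have pe : (1 < p ^ e)%N by rewrite -(expn0 p) ltn_exp2l // prime_gt1.
  have mN : (m <= N)%N.
    have : (m < n)%N by rewrite nE -[X in (X < _)%N]muln1 ltn_mul2l m0.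
    lia.
  have pm' : ~~ (p %| m)%N by rewrite -prime_coprime.
  have {}IH := IH m mN m0.
  have t1 : (tau n ^ k <= e.+1 ^ k * tau m ^ k)%N.
    rewrite -expnMn nE mulnC; case: (k) => // k'; rewrite leq_exp2r //.
    exact: tau_prime_power.
  have prm : perm_eq (primes n) (p :: primes m).
    apply: uniq_perm; rewrite /= ?primes_uniq ?mem_primes ?pp ?m0 ?pm' //.
    have h : (0 < p ^ e)%N by rewrite expn_gt0 prime_gt0.
    move=> q; rewrite {1}nE (primesM _ m0 h) (primesX _ e0) (primes_prime pp) mem_seq1 in_cons.
    by rewrite orbC.
  have sE : small n = ((p < 2 ^ k) + small m)%N.
    by rewrite /small (perm_size (perm_filter _ prm)) /=; case: ifP.
  apply: leq_trans t1 _; rewrite sE expnD [X in (_ <= _ * X)%N]nE.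
  apply: (@leq_trans ((A ^ (p < 2 ^ k) * p ^ e) * (A ^ small m * m))%N).
    apply: leq_mul => //; case: ltnP => p2 /=.
      rewrite expn1; apply: leq_trans (HA e) _.
      by rewrite leq_mul2l leq_exp2r // prime_gt1 // orbT.
    rewrite expn0 mul1n; apply: (@leq_trans ((2 ^ k) ^ e)%N); last by rewrite leq_exp2r.
    rewrite -expnM mulnC expnM; case: (k) => // k'; rewrite leq_exp2r //.
    exact: ltn_expl.
  by rewrite leq_eqVlt; apply/orP; left; apply/eqP; ring.
exists (A ^ (2 ^ k))%N; split=> [|n n0]; first by rewrite expn_gt0 A0.
apply: leq_trans (main n n (leqnn n) n0) _.
rewrite leq_mul2r; apply/orP; right; rewrite leq_pexp2l //.
rewrite /small -[X in (_ <= X)%N](size_iota 0); apply: uniq_leq_size.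
  by rewrite filter_uniq // primes_uniq.
by move=> q; rewrite mem_filter mem_iota add0n => /andP[].
Qed.

End DivisorCount.

(** * The von Mangoldt function *)

Section VonMangoldt.
Variable R : realType.

Definition Lam (n : nat) : R :=
  if (1 < n)%N && (n == pdiv n ^ logn (pdiv n) n)%N then ln (pdiv n)%:R else 0.

Lemma Lam_ge0 n : 0 <= Lam n.
Proof. by rewrite /Lam; case: ifP => // _; rewrite ln_ge0 // ler1n pdiv_gt0. Qed.

Lemma Lam_le_ln n : (0 < n)%N -> Lam n <= ln n%:R.
Proof.
move=> n0; rewrite /Lam; case: ifP => [/andP[n1 _]|_]; last by rewrite ln_ge0 // ler1n.
by rewrite ler_ln ?posrE ?ltr0n ?pdiv_gt0 // ler_nat dvdn_leq // pdiv_dvd.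
Qed.

Lemma Lam_prime p : prime p -> Lam p = ln p%:R.
Proof.
by move=> pp; rewrite /Lam prime_gt1 // pdiv_id // logn_prime // eqxx expn1 eqxx.
Qed.

Lemma Lam_neq0 n : Lam n != 0 -> exists p e, [/\ prime p, (0 < e)%N & n = (p ^ e)%N].
Proof.
rewrite /Lam; case: ifP => [/andP[n1 /eqP nE] _|]; last by rewrite eqxx.
exists (pdiv n), (logn (pdiv n) n); split => //; first exact: pdiv_prime.
by rewrite logn_gt0 mem_primes pdiv_prime // pdiv_dvd; lia.
Qed.

Lemma Lam_prime_power p e : prime p -> (0 < e)%N -> Lam (p ^ e) = ln p%:R.
Proof.
case: e => [//|e] pp e0; rewrite /Lam pdiv_pfactor //.
rewrite pfactorK // eqxx andbT ifT //.
by rewrite -(expn0 p) ltn_exp2l // prime_gt1.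
Qed.

(** Write n = pm with p the least prime factor. The only prime power that divides n but not m is
    p^(v+1), with v the exponent of p in m, and it adds ln p. *)
Lemma sum_Lam n : (0 < n)%N -> \sum_(1 <= d < n.+1 | (d %| n)%N) Lam d = ln n%:R.
Proof.
elim/ltn_ind: n => n IH n0; case: (eqVneq n 1%N) => [->|n1].
  by rewrite big_mkcond big_nat1 /= ln1.
pose p := pdiv n; have pp : prime p by rewrite pdiv_prime; lia.
have pn : (p %| n)%N by exact: pdiv_dvd.
have p0 := prime_gt0 pp; have p1 := prime_gt1 pp.
have [m nE] : exists m, n = (p * m)%N by case/dvdnP: pn => m ->; exists m; rewrite mulnC.
have m0 : (0 < m)%N by move: n0; rewrite nE muln_gt0 => /andP[].
have mn : (m < n)%N by rewrite nE -[X in (X < _)%N]mul1n ltn_mul2r m0.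
rewrite (bigID (fun d => d %| m)%N) /=.
have -> : \sum_(1 <= d < n.+1 | (d %| n)%N && (d %| m)%N) Lam d = ln m%:R.
  rewrite -IH // -(sum_divisors_widen _ m0 (ltnW mn)); apply: eq_bigl => d.
  case dm : (d %| m)%N; rewrite ?andbF ?andbT //.
  by rewrite nE dvdn_mull.
pose d0 := (p ^ (logn p m).+1)%N.
have d0n : (d0 %| n)%N by rewrite /d0 nE expnS dvdn_pmul2l // pfactor_dvdnn.
have d0m : ~~ (d0 %| m)%N by rewrite pfactor_dvdn // ltnn.
have E d : (1 <= d < n.+1)%N ->
    (if (d %| n)%N && ~~ (d %| m)%N then Lam d else 0) = (if d == d0 then ln p%:R else 0).
  move=> _; case: (eqVneq d d0) => [->|dd0].
    by rewrite d0n d0m /d0 Lam_prime_power.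
  case: ifP => // /andP[dn dm]; apply/eqP; apply: contraNT dm => /Lam_neq0[q [e [qp e0 dE]]].
  case: (eqVneq q p) => [qp'|qp'].
    rewrite dE qp' pfactor_dvdn //.
    move: dn; rewrite dE qp' pfactor_dvdn // nE lognM // logn_prime // eqxx.
    move: dd0; rewrite dE qp' /d0 eqn_exp2l // => ? ?; lia.
  move: dn; rewrite dE nE Gauss_dvdr // coprimeXl // prime_coprime //.
  by rewrite dvdn_prime2 // eq_sym.
rewrite big_mkcond (eq_big_nat _ _ E) -big_mkcond big_nat1_eq ifT; last first.
  by rewrite expn_gt0 p0 /= ltnS dvdn_leq.
by rewrite nE natrM lnM ?posrE ?ltr0n // addrC.
Qed.

End VonMangoldt.

(** * Chebyshev and Mertens bounds, Vaughan's identity *)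

Section ChebyshevMertens.
Variable R : realType.
Notation Lam := (@Lam R).
Notation lnn n := (ln n%:R : R).

Lemma sum_floor (B m : nat) : (0 < m)%N ->
  \sum_(1 <= l < B.+1 | (m * l <= B)%N) 1 = (B %/ m)%:R :> R.
Proof.
move=> m0; rewrite big_mkcond (big_cat_nat (n := (B %/ m).+1)) //=; last first.
  by rewrite ltnS leq_div.
rewrite (eq_big_nat _ _ (F2 := fun=> 1)); last first.
  by move=> l /andP[_ lB]; rewrite ifT // mulnC -leq_divRL.
rewrite [X in _ + X]big_nat_cond [X in _ + X]big1; last first.
  move=> l /andP[/andP[h1 _] _]; rewrite ifF //; apply/negbTE.
  by rewrite mulnC -leq_divRL // -ltnNge.
by rewrite addr0 big_const_nat iter_addr_0 subn1.
Qed.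

Lemma ln_fact_Lam (N : nat) :
  \sum_(1 <= n < N.+1) lnn n = \sum_(1 <= d < N.+1) Lam d * (N %/ d)%:R.
Proof.
have -> : \sum_(1 <= n < N.+1) lnn n = \sum_(1 <= n < N.+1 | predT n)
     \sum_(1 <= d < N.+1 | (d %| n)%N) Lam d.
  rewrite !big_nat; apply: eq_bigr => n /andP[n1 nN].
  by rewrite sum_divisors_widen // ?sum_Lam.
rewrite (sum_divisor_switch N predT (fun d _ => Lam d)) !big_nat.
apply: eq_bigr => d /andP[d1 dN]; rewrite -sum_floor // mulr_sumr.
by apply: eq_big => l; rewrite ?andbT ?mulr1.
Qed.

Lemma ln_fact N : \sum_(1 <= n < N.+1) lnn n = ln (N`!)%:R.
Proof.
elim: N => [|N IH]; first by rewrite big_geq // fact0 ln1.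
by rewrite big_nat_recr //= IH factS natrM lnM ?posrE ?ltr0n ?fact_gt0 // addrC.
Qed.

Definition psi (N : nat) : R := \sum_(1 <= n < N.+1) Lam n.

Lemma psi_ge0 N : 0 <= psi N.
Proof. by apply: sumr_ge0 => n _; exact: Lam_ge0. Qed.

Lemma psi_le m n : (m <= n)%N -> psi m <= psi n.
Proof.
move=> mn; rewrite [leRHS]/psi (big_cat_nat (n := m.+1)) //= lerDl.
by apply: sumr_ge0 => k _; exact: Lam_ge0.
Qed.

Lemma sum_floor_widen (n N : nat) : (n <= N)%N ->
  \sum_(1 <= d < N.+1) Lam d * (n %/ d)%:R = ln (n`!)%:R.
Proof.
move=> nN; rewrite -ln_fact ln_fact_Lam (big_cat_nat (n := n.+1)) //=.
rewrite [X in _ + X]big_nat [X in _ + X]big1 ?addr0 // => d /andP[h _].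
by rewrite divn_small ?mulr0.
Qed.

(** Legendre's formula for the central binomial coefficient. By [floor_double] every coefficient of
    [Lam d] is 0 or 1, and it is 1 for n < d <= 2n: hence the two bounds on [psi] that follow. *)
Lemma ln_central_bin (n : nat) :
  ln ((n.*2)`!)%:R - 2 * ln (n`!)%:R
  = \sum_(1 <= d < n.*2.+1) Lam d * ((n.*2 %/ d)%:R - 2 * (n %/ d)%:R) :> R.
Proof.
have nN : (n <= n.*2)%N by rewrite -addnn leq_addr.
rewrite -(sum_floor_widen nN) -(sum_floor_widen (leqnn n.*2)) mulr_sumr -sumrB.
by apply: eq_bigr => d _; ring.
Qed.

Lemma floor_double n d : (0 < d)%N ->
  (2 * (n %/ d) <= n.*2 %/ d)%N /\ (n.*2 %/ d <= 2 * (n %/ d) + 1)%N.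
Proof.
move=> d0; have h1 := divn_eq n d; have h2 := ltn_pmod n d0.
have h3 := divn_eq n.*2 d; have h4 := ltn_pmod n.*2 d0.
by split; nia.
Qed.

Lemma psi_lower n : ln ((n.*2)`!)%:R - 2 * ln (n`!)%:R <= psi n.*2.
Proof.
rewrite ln_central_bin; rewrite /psi !big_nat; apply: ler_sum => d /andP[d1 _].
rewrite -[leRHS]mulr1; apply: ler_wpM2l; first exact: Lam_ge0.
have [_ h] := floor_double n d1.
have : (n.*2 %/ d)%:R <= (2 * (n %/ d) + 1)%N%:R :> R by rewrite ler_nat.
rewrite natrD natrM; lra.
Qed.

Lemma psi_upper n : psi n.*2 - psi n <= ln ((n.*2)`!)%:R - 2 * ln (n`!)%:R.
Proof.
have nN : (n.+1 <= n.*2.+1)%N by lia.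
rewrite ln_central_bin /psi (big_cat_nat (n := n.+1) (p := n.*2.+1)) //=.
rewrite addrAC subrr add0r [leRHS](big_cat_nat (n := n.+1)) //= -[leLHS]add0r.
apply: lerD.
  rewrite big_nat; apply: sumr_ge0 => d /andP[d1 _]; rewrite mulr_ge0 ?Lam_ge0 //.
  have [h _] := floor_double n d1.
  have : (2 * (n %/ d))%N%:R <= (n.*2 %/ d)%:R :> R by rewrite ler_nat.
  rewrite natrM; lra.
rewrite !big_nat; apply: ler_sum => d /andP[d1 d2].
rewrite -[leLHS]mulr1; apply: ler_wpM2l; first exact: Lam_ge0.
rewrite (divn_small d1) mulr0 subr0 ler1n divn_gt0; lia.
Qed.

Lemma central_bin_bounds n :
  n%:R * (2 * ln 2) - ln (n.*2.+1)%:R <= ln ((n.*2)`!)%:R - 2 * ln (n`!)%:R :> R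
  /\ ln ((n.*2)`!)%:R - 2 * ln (n`!)%:R <= n%:R * (2 * ln 2) :> R.
Proof.
elim: n => [|n [IH1 IH2]]; first by rewrite fact0 ln1 mul0r; lra.
have l2 : ln 4 = 2 * ln 2 :> R.
  by rewrite (_ : 4 = 2 ^+ 2 :> R) ?lnXn ?mulr_natl //; ring.
have e1 : ln ((n.+1).*2`!)%:R = ln (n.*2.+2)%:R + ln (n.*2.+1)%:R + ln (n.*2`!)%:R :> R.
  rewrite doubleS !factS !natrM !lnM ?posrE ?mulr_gt0 ?ltr0n ?fact_gt0 //; ring.
have e2 : ln (n.+1`!)%:R = ln n.+1%:R + ln (n`!)%:R :> R.
  by rewrite factS natrM lnM ?posrE ?ltr0n ?fact_gt0.
have e3 : ln (n.*2.+2)%:R = ln 2 + ln n.+1%:R :> R.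
  have -> : n.*2.+2 = (2 * n.+1)%N by lia.
  by rewrite natrM lnM ?posrE ?ltr0n.
have h1 : ln (n.*2.+1)%:R <= ln 2 + ln n.+1%:R :> R.
  by rewrite -e3 ler_ln ?posrE ?ltr0n // ler_nat.
have h2 : ln 2 + ln n.+1%:R <= ln (n.+1).*2.+1%:R :> R.
  by rewrite -e3 ler_ln ?posrE ?ltr0n // ler_nat; lia.
rewrite e1 e2 -[n.+1%:R in X in X * _ - _]natr1 -[n.+1%:R in X in _ <= X * _]natr1.
by rewrite e3; split; nra.
Qed.

(** Halving, with m' the upper half of m: psi(m) <= 4m' ln 2 + 2m' ln 2 <= 3(m+1) ln 2, which is at
    most 4m ln 2 once m >= 3. The constant 4 in place of 2 pays for the rounding. *)
Lemma psi_linear m : psi m <= 4 * ln 2 * m%:R.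
Proof.
have l2 : 0 < ln 2 :> R by rewrite ln_gt0 // ltr1n.
elim/ltn_ind: m => m IH.
have [m2|m3] := leqP m 2.
  have -> : psi m = if m == 2%N then ln 2 else 0.
    case: m m2 {IH} => [|[|[|//]]] _ /=; rewrite /psi.
    - by rewrite big_geq.
    - by rewrite big_nat1 /Lam.
    - by rewrite big_ltn // big_ltn // big_geq // (@Lam_prime R 2) // addr0 /Lam /= add0r.
  case: eqP => [->|_]; first by nra.
  by rewrite !mulr_ge0 // ltW.
pose m' := (uphalf m); have mm : (m <= m'.*2)%N /\ (m'.*2 <= m.+1)%N by rewrite /m'; lia.
have m'm : (m' < m)%N by lia.
have h1 := IH _ m'm; have h2 := psi_upper m'; have [_ h3] := central_bin_bounds m'.
have h4 := psi_le (proj1 mm).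
have h5 : 2 * m'%:R <= m%:R + 1 :> R.
  by rewrite natr1 -natrM ler_nat; lia.
have h6 : 3 <= m%:R :> R by rewrite ler_nat.
have : m'%:R * ln 2 <= (m%:R + 1) / 2 * ln 2 :> R by rewrite ler_wpM2r ?(ltW l2) //; lra.
have : 3 * ln 2 <= m%:R * ln 2 :> R by rewrite ler_wpM2r ?(ltW l2).
lra.
Qed.

Lemma ln2_bounds : 1 / 2 <= (ln 2 : R) <= 1.
Proof.
apply/andP; split.
- have : - ln 2 <= - (1 / 2) :> R.
    have := @le_ln1Dx R (- (1 / 2)); rewrite (_ : 1 + _ = 2^-1); last by field.
    by rewrite lnV ?posrE //; apply; lra.
  lra.
- by have := @le_ln1Dx R 1 _; rewrite (_ : 1 + 1 = 2) //; apply; lra.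
Qed.

(** The range reaches 8x because the lower bound 8x ln 2 - ln(8x+1) for psi(8x) has to beat the
    upper bound 4x ln 2 for psi(x); by ln 2 >= 1/2 there remains at least 2x - x. *)
Lemma chebyshev_lower x : (0 < x)%N -> (ln (8 * x + 1)%N%:R : R) <= x%:R -> x%:R <= psi (8 * x) - psi x.
Proof.
move=> x0 hx.
have h1 := psi_lower (4 * x); have [h2 _] := central_bin_bounds (4 * x).
have h3 := psi_linear x; have /andP[l1 l2] := ln2_bounds.
have e : ((4 * x).*2 = 8 * x)%N by lia.
rewrite e in h1 h2; rewrite addn1 in hx.
have x0' : 0 < x%:R :> R by rewrite ltr0n.
rewrite natrM in h2; nra.
Qed.

Lemma ln_fact_lower N : (0 < N)%N -> N%:R * lnn N - N%:R <= ln (N`!)%:R.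
Proof.
case: N => // N _; elim: N => [|N IH]; first by rewrite (_ : 1`! = 1)%N // ln1; lra.
rewrite factS natrM lnM ?posrE ?ltr0n ?fact_gt0 //.
have h : N.+1%:R * (ln N.+2%:R - ln N.+1%:R) <= 1 :> R.
  rewrite -ln_div ?posrE ?ltr0n //.
  have -> : N.+2%:R / N.+1%:R = 1 + N.+1%:R^-1 :> R.
    by rewrite -[N.+2%:R]natr1 mulrDl mulfV ?pnatr_eq0 // mul1r.
  have h : ln (1 + N.+1%:R^-1) <= N.+1%:R^-1 :> R.
    apply: le_ln1Dx; apply: (@lt_trans _ _ 0); first lra.
    by rewrite invr_gt0 ltr0n.
  by have := ler_wpM2l (ler0n R N.+1) h; rewrite mulfV ?pnatr_eq0.
rewrite -[N.+2%:R in X in X * _ - _]natr1 -[N.+2%:R in X in _ - X <= _]natr1; nra.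
Qed.

Lemma sum_Lam_div_upper N : (0 < N)%N -> \sum_(1 <= d < N.+1) Lam d / d%:R <= lnn N + 4.
Proof.
move=> N0; have N0' : 0 < N%:R :> R by rewrite ltr0n.
rewrite -(ler_pM2l N0').
have h1 : N%:R * \sum_(1 <= d < N.+1) Lam d / d%:R <= ln (N`!)%:R + psi N.
  rewrite -(sum_floor_widen (leqnn N)) /psi -big_split /= mulr_sumr !big_nat.
  apply: ler_sum => d /andP[d1 dN]; rewrite mulrCA -[X in _ + X]mulr1 -mulrDr.
  apply: ler_wpM2l; first exact: Lam_ge0.
  have d0 : 0 < d%:R :> R by rewrite ltr0n.
  rewrite ler_pdivrMr // natr1 -natrM ler_nat.
  by have := divn_eq N d; have := ltn_pmod N d1; nia.
have h2 : ln (N`!)%:R <= N%:R * lnn N.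
  rewrite -ln_fact; apply: (@le_trans _ _ (\sum_(1 <= n < N.+1) lnn N)).
    rewrite !big_nat; apply: ler_sum => n /andP[n1 nN].
    by rewrite ler_ln ?posrE ?ltr0n // ler_nat.
  by rewrite big_const_nat iter_addr_0 subn1 mulr_natl.
have h3 := psi_linear N; have /andP[_ l2] := ln2_bounds.
rewrite mulrDr; nra.
Qed.

Lemma sum_Lam_div_lower N : (0 < N)%N -> lnn N - 1 <= \sum_(1 <= d < N.+1) Lam d / d%:R.
Proof.
move=> N0; have N0' : 0 < N%:R :> R by rewrite ltr0n.
rewrite -(ler_pM2l N0') mulrBr mulr1; apply: le_trans (ln_fact_lower N0) _.
rewrite -(sum_floor_widen (leqnn N)) mulr_sumr !big_nat.
apply: ler_sum => d /andP[d1 dN]; rewrite mulrCA.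
apply: ler_wpM2l; first exact: Lam_ge0.
have d0 : 0 < d%:R :> R by rewrite ltr0n.
by rewrite ler_pdivlMr // -natrM ler_nat leq_trunc_div.
Qed.

Lemma mertens_interval a b : (0 < a)%N -> (a <= b)%N ->
  \sum_(a.+1 <= d < b.+1) Lam d / d%:R <= lnn b - lnn a + 5.
Proof.
move=> a0 ab; have h1 := sum_Lam_div_upper (leq_trans a0 ab).
have h2 := sum_Lam_div_lower a0.
by rewrite (big_cat_nat (n := a.+1)) //= in h1; lra.
Qed.

Lemma harm_le K : (0 < K)%N -> harm R K <= 1 + lnn K.
Proof.
case: K => // K _; elim: K => [|K IH].
  by rewrite /harm big_nat1 invr1 ln1 addr0.
rewrite /harm big_nat_recr //=.
have h : K.+2%:R^-1 <= ln K.+2%:R - ln K.+1%:R :> R.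
  rewrite -lerN2 opprB -ln_div ?posrE ?ltr0n //.
  have -> : K.+1%:R / K.+2%:R = 1 + - K.+2%:R^-1 :> R.
    have kn : K.+2%:R != 0 :> R by rewrite pnatr_eq0.
    by apply: (mulIf kn); rewrite mulrBl mul1r divfK // mulVf // -[K.+2%:R]natr1 addrK.
  apply: le_ln1Dx; rewrite ltrN2 invf_lt1 ?ltr1n ?ltr0n //.
apply: le_trans (lerD IH h) _; lra.
Qed.

End ChebyshevMertens.

(** * Vaughan's identity *)

Section Vaughan.
Variables (R : realType) (B x U V : nat) (f : nat -> R).
Notation Lam := (@Lam R).
Hypotheses (Vx : (V <= x)%N) (xB : (x <= B)%N) (U0 : (0 < U)%N) (V0 : (0 < V)%N)
  (UVB : (U * V <= B)%N).

Definition mu_tail (m : nat) : R :=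
  \sum_(1 <= b < B.+1 | (b %| m)%N && (U < b)%N) (mu b)%:~R.

(** As n > V, the sum of Lam(c) mu(b) over bc | n with c > V is Lam(n). The terms with b > U form
    the bilinear part; for b <= U the sum over c > V is ln(n/b) minus the sum over c <= V. *)
Lemma vaughan_pointwise n : (x < n)%N -> (n <= B)%N ->
  Lam n = \sum_(1 <= b < B.+1 | (b %| n)%N) (if (b <= U)%N then (mu b)%:~R * ln (n %/ b)%:R else 0)
   - \sum_(1 <= b < B.+1 | (b %| n)%N) (if (b <= U)%N then (mu b)%:~R *
        \sum_(1 <= c < B.+1 | (c %| n %/ b)%N && (c <= V)%N) Lam c else 0)
   + \sum_(1 <= c < B.+1 | (c %| n)%N) (if (V < c)%N then Lam c * mu_tail (n %/ c) else 0).
Proof.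
move=> xn nB; have n0 : (0 < n)%N by lia.
have quo b : (b %| n)%N -> (0 < n %/ b)%N /\ (n %/ b <= B)%N.
  move=> bn; rewrite divn_gt0 ?(dvdn_gt0 n0 bn) // (dvdn_leq n0 bn); split=> //.
  exact: leq_trans (leq_div n b) nB.
pose S := \sum_(1 <= c < B.+1 | (c %| n)%N && (V < c)%N) Lam c *
   \sum_(1 <= b < B.+1 | (b %| n %/ c)%N) (mu b)%:~R.
have SE : S = Lam n.
  rewrite /S (eq_bigr (fun c => if c == n then Lam n else 0)); last first.
    move=> c /andP[cn _]; have [q0 qB] := quo c cn.
    rewrite sum_divisors_widen // -(rmorph_sum intr) sum_mu //.
    case: (eqVneq c n) => [->|cn']; first by rewrite divnn n0 eqxx mulr1.
    rewrite (_ : (n %/ c == 1)%N = false) ?mulr0 //.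
    apply/negP => /eqP h; have := divnK cn; rewrite h mul1n => e; by rewrite e eqxx in cn'.
  rewrite -big_mkcondr /= (eq_bigl (fun c => c == n)) ?big_nat1_eq.
    by rewrite n0 ltnS nB.
  move=> c; case: (eqVneq c n) => [->|_]; last by rewrite andbF.
  rewrite dvdnn /= andbT; exact: leq_ltn_trans Vx xn.
have -> : Lam n = \sum_(1 <= c < B.+1 | (c %| n)%N && (V < c)%N) Lam c *
   \sum_(1 <= b < B.+1 | (b %| n %/ c)%N && (b <= U)%N) (mu b)%:~R +
   \sum_(1 <= c < B.+1 | (c %| n)%N) (if (V < c)%N then Lam c * mu_tail (n %/ c) else 0).
  rewrite -SE /S -big_mkcondr -big_split /=; apply: eq_bigr => c _.
  rewrite (bigID (fun b => b <= U)%N) /= mulrDr; congr (_ + _ * _).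
  by rewrite /mu_tail; apply: eq_bigl => b; rewrite ltnNge.
congr (_ + _).
have swap (Q : pred nat) : \sum_(1 <= c < B.+1 | (c %| n)%N && Q c) Lam c *
   \sum_(1 <= b < B.+1 | (b %| n %/ c)%N && (b <= U)%N) (mu b)%:~R
  = \sum_(1 <= b < B.+1 | (b %| n)%N) (if (b <= U)%N then (mu b)%:~R *
        \sum_(1 <= c < B.+1 | (c %| n %/ b)%N && Q c) Lam c else 0).
  rewrite -big_mkcondr /=.
  under eq_bigr do rewrite mulr_sumr.
  rewrite (exchange_big_dep (fun b => (b %| n)%N && (b <= U)%N)) /=; last first.
    move=> c b /andP[cn _] /andP[bq ->]; rewrite andbT.
    by apply: dvdn_trans bq _; rewrite dvdn_div.
  rewrite big_nat_cond [RHS]big_nat_cond; apply: eq_bigr => b /andP[/andP[b1 _] /andP[bn bU]].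
  rewrite mulr_sumr big_nat_cond [RHS]big_nat_cond; apply: eq_big => [c|c _]; last by rewrite mulrC.
  case c1 : (1 <= c < B.+1)%N => //=; rewrite bU andbT.
  have c0 : (0 < c)%N by lia.
  case Qc : (Q c); rewrite ?andbF // !andbT.
  have [cn|cn] := boolP (c %| n)%N; last first.
    rewrite andFb; apply/esym/negP => h; move/negP: cn; apply.
    by apply: dvdn_trans h _; rewrite dvdn_div.
  by rewrite /= !dvdn_divRL // mulnC.
rewrite (swap (fun c => V < c)%N) -sumrB; apply: eq_bigr => b bn; case: ifP => _; last by rewrite subr0.
rewrite -mulrBr; congr (_ * _); have [q0 qB] := quo b bn.
rewrite -(sum_Lam R q0) -(sum_divisors_widen _ q0 qB) [X in _ = X - _](bigID (fun c => c <= V)%N) /=.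
rewrite addrAC subrr add0r; apply: eq_bigl => c; by rewrite ltnNge.
Qed.

(** The logarithm in the first sum is removed by partial summation, which is why [G d] must also
    bound the sums truncated at any y <= B. In the second sum the products d = bc carry a total
    weight of at most ln d. Together this is 4 + 1 times [Lg]. *)
Lemma vaughan_bound (G : nat -> R) (Lg T : R) : ln B%:R <= Lg ->
  (forall d, 0 <= G d) ->
  (forall d y, (1 <= d <= U * V)%N -> (y <= B)%N ->
    `|\sum_(1 <= e < B.+1 | (x < d * e)%N && (d * e <= y)%N) f (d * e)%N| <= G d) ->
  `|\sum_(1 <= l < B.+1 | (V < l)%N) \sum_(1 <= m < B.+1 | (x < l * m)%N && (l * m <= B)%N)
      Lam l * mu_tail m * f (l * m)%N| <= T ->
  `|\sum_(1 <= n < B.+1 | (x < n)%N) Lam n * f n| <= 5 * Lg * (\sum_(1 <= d < (U * V).+1) G d) + T.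
Proof.
move=> HL G0 HI HT.
have Lg0 : 0 <= Lg by apply: le_trans HL; rewrite ln_ge0 // ler1n; lia.
pose A := \sum_(1 <= b < B.+1 | (b <= U)%N) (mu b)%:~R *
   \sum_(1 <= l < B.+1 | (b * l <= B)%N && (x < b * l)%N) ln l%:R * f (b * l)%N.
pose C := \sum_(1 <= b < B.+1 | (b <= U)%N) \sum_(1 <= c < B.+1 | (c <= V)%N) (mu b)%:~R * Lam c *
   \sum_(1 <= e < B.+1 | (x < b * c * e)%N && (b * c * e <= B)%N) f (b * c * e)%N.
pose T0 := \sum_(1 <= l < B.+1 | (V < l)%N) \sum_(1 <= m < B.+1 | (x < l * m)%N && (l * m <= B)%N)
      Lam l * mu_tail m * f (l * m)%N.
have E : \sum_(1 <= n < B.+1 | (x < n)%N) Lam n * f n = A - C + T0.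
  transitivity (\sum_(1 <= n < B.+1 | (x < n)%N)
     ((\sum_(1 <= b < B.+1 | (b %| n)%N) (if (b <= U)%N then (mu b)%:~R * (ln (n %/ b)%:R * f (b * (n %/ b))%N) else 0)
   - \sum_(1 <= b < B.+1 | (b %| n)%N) (if (b <= U)%N then (mu b)%:~R *
        (\sum_(1 <= c < B.+1 | (c %| n %/ b)%N) (if (c <= V)%N then Lam c * f (b * c * ((n %/ b) %/ c))%N else 0)) else 0))
   + \sum_(1 <= c < B.+1 | (c %| n)%N) (if (V < c)%N then Lam c * mu_tail (n %/ c) * f (c * (n %/ c))%N else 0))).
    rewrite big_nat_cond [RHS]big_nat_cond; apply: eq_bigr => n /andP[/andP[n1 nB] xn].
    rewrite vaughan_pointwise // mulrDl mulrBl !mulr_suml; congr (_ - _ + _).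
    - apply: eq_bigr => b bn; case: ifP => _; last by rewrite mul0r.
      by rewrite -mulrA mulnC divnK.
    - apply: eq_bigr => b bn; case: ifP => _; last by rewrite mul0r.
      rewrite -mulrA mulr_suml big_mkcondr /=; congr (_ * _); apply: eq_bigr => c cn.
      case: ifP => _ //; congr (_ * f _).
      by rewrite -mulnA [(c * _)%N]mulnC divnK // mulnC divnK.
    - apply: eq_bigr => c cn; case: ifP => _; last by rewrite mul0r.
      by rewrite [(c * _)%N]mulnC divnK.
  rewrite big_split /= sumrB; congr (_ - _ + _).
  - rewrite (sum_divisor_switch B (fun n => x < n)%N
       (fun b l => if (b <= U)%N then (mu b)%:~R * (ln l%:R * f (b * l)%N) else 0)).
    rewrite /A [RHS]big_mkcond; apply: eq_bigr => b _; case: ifP => _; last by rewrite big1.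
    by rewrite mulr_sumr.
  - rewrite (sum_divisor_switch B (fun n => x < n)%N
       (fun b l => if (b <= U)%N then (mu b)%:~R * (\sum_(1 <= c < B.+1 | (c %| l)%N)
         (if (c <= V)%N then Lam c * f (b * c * (l %/ c))%N else 0)) else 0)).
    rewrite /C [RHS]big_mkcond; apply: eq_big_nat => b /andP[b1 _]; case: ifP => _; last by rewrite big1.
    rewrite -mulr_sumr (sum_divisor_switch B (fun l => (b * l <= B)%N && (x < b * l)%N)
       (fun c e => if (c <= V)%N then Lam c * f (b * c * e)%N else 0)).
    rewrite mulr_sumr [RHS]big_mkcond; apply: eq_big_nat => c /andP[c1 _].
    case: ifP => _; last by rewrite big1 ?mulr0.
    rewrite -mulrA; congr (_ * _); rewrite mulr_sumr; apply: eq_bigl => e.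
    rewrite mulnA; case h : (b * c * e <= B)%N; rewrite ?andbF ?andbT //=.
    by rewrite (_ : (c * e <= B)%N); [|nia].
  - rewrite (sum_divisor_switch B (fun n => x < n)%N
       (fun c m => if (V < c)%N then Lam c * mu_tail m * f (c * m)%N else 0)).
    rewrite /T0 [RHS]big_mkcond; apply: eq_bigr => c _; case: ifP => _; last by rewrite big1.
    by apply: eq_bigl => m; rewrite andbC.
have muR b : `|(mu b)%:~R : R| <= 1 by rewrite -intr_norm lerz1 mu_norm.
have hA : `|A| <= 4 * Lg * \sum_(1 <= b < (U * V).+1) G b.
  have UB : (U <= U * V)%N by nia.
  apply: le_trans (ler_norm_sum _ _ _) _.
  apply: (@le_trans _ _ (\sum_(1 <= b < B.+1 | (b <= U)%N) 4 * Lg * G b)); last first.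
    rewrite mulr_sumr big_mkcond /= (big_cat_nat (n := (U * V).+1)) //=.
    rewrite [X in _ + X]big_nat [X in _ + X]big1 ?addr0; last first.
      by move=> b /andP[h _]; rewrite ifF //; apply/negbTE; rewrite -ltnNge; lia.
    by apply: ler_sum => b _; case: ifP => // _; rewrite !mulr_ge0.
  rewrite big_nat_cond [leRHS]big_nat_cond; apply: ler_sum => b /andP[/andP[b1 bB] bU].
  rewrite normrM -[leRHS]mul1r; apply: ler_pM => //.
  rewrite big_add1 /= big_mkcond /=.
  rewrite (eq_bigr (fun l => ln l.+1%:R * (if (b * l.+1 <= B)%N && (x < b * l.+1)%N then f (b * l.+1)%N else 0))); last first.
    by move=> l _; case: ifP => _; rewrite ?mulr0.
  apply: sum_by_parts_le => //.
  - move=> m mB; rewrite ger0_norm ?ln_ge0 ?ler1n //; apply: le_trans HL.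
    by rewrite ler_ln ?posrE ?ltr0n ?ler_nat //; lia.
  - by move=> m mB; rewrite ler_ln ?posrE ?ltr0n ?ler_nat.
  - move=> m mB.
    have bd : (1 <= b <= U * V)%N by rewrite b1 (leq_trans bU).
    have := HI b (minn B (b * m)) bd (geq_minl _ _).
    rewrite big_add1 /= big_mkcond /= (big_cat_nat (n := m)) //=.
    rewrite [X in _ + X]big_nat [X in _ + X]big1 ?addr0; last first.
      move=> l /andP[h _]; rewrite ifF //; apply/negbTE/nandP; right.
      by rewrite leq_min negb_and leq_pmul2l // -leqNgt h orbT.
    rewrite (eq_big_nat _ _ (F2 := fun i => if (b * i.+1 <= B)%N && (x < b * i.+1)%N then f (b * i.+1)%N else 0)) //.
    move=> l /andP[_ lm]; rewrite leq_min leq_pmul2l // lm andbT andbC //.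
have hC : `|C| <= Lg * \sum_(1 <= b < (U * V).+1) G b.
  apply: le_trans (ler_norm_sum _ _ _) _.
  apply: (@le_trans _ _ (\sum_(1 <= b < B.+1 | (b <= U)%N) \sum_(1 <= c < B.+1 | (c <= V)%N) Lam c * G (b * c)%N)).
    rewrite big_nat_cond [leRHS]big_nat_cond; apply: ler_sum => b /andP[/andP[b1 bB] bU].
    apply: le_trans (ler_norm_sum _ _ _) _.
    rewrite big_nat_cond [leRHS]big_nat_cond; apply: ler_sum => c /andP[/andP[c1 cB] cV].
    rewrite !normrM (ger0_norm (Lam_ge0 _ _)) -[leRHS]mul1r -mulrA.
    apply: ler_pM => //; first by rewrite mulr_ge0 ?Lam_ge0.
    rewrite ler_wpM2l ?Lam_ge0 //; apply: HI => //.
    by rewrite muln_gt0 b1 c1 leq_mul.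
  rewrite exchange_big /=.
  apply: (@le_trans _ _ (\sum_(1 <= c < B.+1) \sum_(1 <= b < B.+1 | (c * b <= B)%N && (c * b <= U * V)%N)
     Lam c * G (c * b)%N)).
    rewrite big_mkcond /=; apply: ler_sum => c _; case: leqP => cV; last first.
      by apply: sumr_ge0 => b _; rewrite mulr_ge0 ?Lam_ge0.
    rewrite big_mkcond [leRHS]big_mkcond; apply: ler_sum => b _; case: leqP => bU.
      have h : (c * b <= U * V)%N by rewrite mulnC leq_mul.
      by rewrite h (leq_trans h UVB) mulnC.
    by case: ifP => // _; rewrite mulr_ge0 ?Lam_ge0.
  rewrite -(sum_divisor_switch B (fun n => n <= U * V)%N (fun c b => Lam c * G (c * b)%N)).
  rewrite mulr_sumr big_mkcond /= (big_cat_nat (n := (U * V).+1)) //=.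
  rewrite [X in _ + X]big_nat [X in _ + X]big1 ?addr0; last first.
    by move=> n /andP[h _]; rewrite ifF //; apply/negbTE; rewrite -ltnNge.
  rewrite big_nat [leRHS]big_nat; apply: ler_sum => n /andP[n1 nW].
  rewrite ltnS in nW; rewrite nW (eq_bigr (fun c => Lam c * G n)); last first.
    by move=> c cn; rewrite mulnC divnK.
  have nB : (n <= B)%N by apply: leq_trans UVB.
  rewrite -mulr_suml sum_divisors_widen // sum_Lam // ler_wpM2r //.
  by apply: le_trans HL; rewrite ler_ln ?posrE ?ltr0n ?ler_nat //; lia.
rewrite E; apply: le_trans (ler_normD _ _) _; apply: lerD => //.
apply: le_trans (ler_normB _ _) _.
set S := \sum_(_ <= _ < _) _ in hA hC *; lra.
Qed.
End Vaughan.

(** * Bilinear sums *)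

Section PowerSums.
Variable R : realType.
Implicit Types (a b c g x y : R).

Lemma powR_mvt g a b : 0 < a -> a < b ->
  exists2 c, a < c < b & b `^ g - a `^ g = g * c `^ (g - 1) * (b - a).
Proof.
move=> a0 ab.
have [y||c cI E] := @MVT R (fun t : R => t `^ g) (fun t : R => g * t `^ (g - 1)) a b ab.
- rewrite in_itv /= => /andP[ay yb].
  by apply: is_derive1_powR; apply: lt_trans ay.
- apply: derivable_within_continuous => y; rewrite in_itv /= => /andP[ay yb].
  by apply: derivable_powR; rewrite in_itv /= andbT (lt_le_trans a0).
- by rewrite in_itv in cI; exists c.
Qed.

Lemma ler_powR_neg x y g : 0 < x -> x <= y -> g <= 0 -> y `^ g <= x `^ g.
Proof.
move=> x0 xy g0; have y0 := lt_le_trans x0 xy.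
have e (z : R) : z `^ g = (z `^ (- g))^-1 by rewrite powRN invrK.
rewrite !e lef_pV2 ?posrE ?powR_gt0 //.
by rewrite ge0_ler_powR ?oppr_ge0 ?nnegrE // ltW.
Qed.

Definition pdiff g (y : R) : R := (y + 1) `^ g - y `^ g.

Lemma pdiff_ge0 g y : 0 < g -> 0 < y -> 0 <= pdiff g y.
Proof.
move=> g0 y0; rewrite subr_ge0 ge0_ler_powR ?nnegrE ?(ltW g0) ?(ltW y0) //.
  by apply: addr_ge0 => //; exact: ltW.
by rewrite lerDl.
Qed.

Lemma pdiff_le g y : 0 < g < 1 -> 0 < y -> pdiff g y <= g * y `^ (g - 1).
Proof.
move=> /andP[g0 g1] y0; rewrite /pdiff.
have [|c /andP[c1 c2] ->] := powR_mvt g y0 (b := y + 1); first lra.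
rewrite addrAC subrr add0r mulr1 ler_wpM2l ?(ltW g0) // ler_powR_neg ?(ltW c1) //; lra.
Qed.

Lemma pdiff_ge g y : 0 < g < 1 -> 0 < y -> g * (y + 1) `^ (g - 1) <= pdiff g y.
Proof.
move=> /andP[g0 g1] y0; rewrite /pdiff.
have [|c /andP[c1 c2] ->] := powR_mvt g y0 (b := y + 1); first lra.
rewrite addrAC subrr add0r mulr1 ler_wpM2l ?(ltW g0) // ler_powR_neg ?(ltW c2) //; lra.
Qed.

(** The mean value theorem twice: for [pdiff], whose derivative [dh] is again a difference of
    powers, and then for that difference. *)
Lemma pdiff_diff g y : 0 < g < 1 -> 0 < y ->
  g * (1 - g) * (y + 2) `^ (g - 2) <= pdiff g y - pdiff g (y + 1).
Proof.
move=> /andP[g0 g1] y0.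
pose dh z := g * (z + 1) `^ (g - 1) - g * z `^ (g - 1).
have dhP (z : R) : 0 < z -> is_derive z (1 : R) (pdiff g) (dh z).
  move=> z0; rewrite /pdiff /dh; apply: is_deriveB; last exact: is_derive1_powR.
  have z1 : 0 < z + 1 by apply: addr_gt0.
  have h1 := is_derive1_powR g z1.
  have h2 : is_derive z 1 (fun t : R => t + 1) 1.
    by apply: is_derive_eq; rewrite addr0.
  have := is_derive1_comp (f := (@powR R)^~ g) (g := fun t : R => t + 1) h1 h2.
  by rewrite mulr1.
have yy1 : y < y + 1 by rewrite ltrDl.
have [z||c cI E] := @MVT R (pdiff g) dh y (y + 1) yy1.
- by rewrite in_itv /= => /andP[yz _]; apply: dhP; apply: lt_trans yz.
- apply: derivable_within_continuous => z; rewrite in_itv /= => /andP[yz _].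
  by have [] := dhP z (lt_le_trans y0 yz).
move: cI; rewrite in_itv /= => /andP[c1 c2].
have c0 : 0 < c by apply: lt_trans c1.
have [|d /andP[d1 d2] Ed] := powR_mvt (g - 1) c0 (b := c + 1); first lra.
have E2 : pdiff g y - pdiff g (y + 1) = g * (1 - g) * d `^ (g - 2).
  rewrite -opprB E /dh -mulrBr Ed (_ : g - 1 - 1 = g - 2); last ring.
  ring.
rewrite E2 ler_wpM2l ?mulr_ge0 ?subr_ge0 ?(ltW g0) ?(ltW g1) //.
rewrite ler_powR_neg ?(lt_trans c0) //; lra.
Qed.

(** The minus sign makes the phase convex. From M to 32M its differences vary by at most [Z] and its
    second differences are at least [mu0 * Z / M], where 1024 = 32^2 bounds the loss in the power g
    - 2. The last hypothesis is the inequality 6/kp (Z + 2) <= M eta after squaring. *)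
Lemma power_sum_neg (g C M eta om ph : R) (a b : nat) :
  0 < g < 1 -> 1 <= M -> 0 < C -> M <= a%:R -> b%:R + 1 <= 32 * M -> 0 <= eta ->
  let Z := C * M `^ (g - 1) in let mu0 := g * (1 - g) / 1024 in
  4 * mu0 * Z <= M -> 36 * (Z + 4 + 4 / Z) <= eta ^+ 2 * mu0 * M ->
  `|\sum_(a <= m < b) cos (2 * pi * (om * m%:R + ph + - (C * m%:R `^ g)))| <= M * eta.
Proof.
move=> g01 M1 C0 Ma bM eta0 Z mu0 hZ heta.
have /andP[g0 g1] := g01.
have M0 : 0 < M by lra.
have Z0 : 0 < Z by rewrite mulr_gt0 // powR_gt0.
have mu00 : 0 < mu0 by rewrite /mu0 !mulr_gt0 ?subr_gt0 // invr_gt0.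
pose kp := Num.sqrt (mu0 * Z / M).
have q0 : 0 < mu0 * Z / M by rewrite divr_gt0 // mulr_gt0.
have kp0 : 0 < kp by rewrite sqrtr_gt0.
have kp2 : kp ^+ 2 = mu0 * Z / M by rewrite sqr_sqrtr // ltW.
have kph : kp <= 1 / 2.
  have q4 : mu0 * Z / M <= 1 / 4 by rewrite ler_pdivrMr //; lra.
  by rewrite -kp2 expr2 in q4; rewrite leNgt; apply/negP => h; nra.
pose f m : R := om * m%:R + ph + - (C * m%:R `^ g).
have fd m : f m.+1 - f m = om - C * pdiff g m%:R.
  by rewrite /f /pdiff -[m.+1%:R]natr1; ring.
have H := @second_derivative_test R f kp _ a b Z (ltW Z0).
apply: le_trans (H _ _ _) _.
- by rewrite kp0.
- move=> m am mb; rewrite !fd -[m.+1%:R]natr1 kp2.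
  have m0 : 0 < m%:R :> R by apply: lt_le_trans M0 (le_trans Ma _); rewrite ler_nat.
  rewrite (_ : _ - _ = C * (pdiff g m%:R - pdiff g (m%:R + 1))); last ring.
  have h := pdiff_diff g01 m0.
  apply: le_trans (ler_wpM2l (ltW C0) h).
  have h2 : (32 * M) `^ (g - 2) <= (m%:R + 2) `^ (g - 2).
    apply: ler_powR_neg; [lra| |lra].
    have : m%:R + 1 <= b%:R :> R by rewrite natr1 ler_nat ltnW.
    lra.
  have h3 : 1024^-1 * (M `^ (g - 1) / M) <= (32 * M) `^ (g - 2).
    rewrite powRM ?(ltW M0) //; apply: ler_pM.
    - by rewrite invr_ge0.
    - by rewrite divr_ge0 ?powR_ge0 ?ltW.
    - apply: (@le_trans _ _ (32 `^ (- 2%:R))); last by apply: ler_powR; [lra|lra].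
      by rewrite powR_invn // lef_pV2 ?posrE ?exprn_gt0 //; rewrite !exprS expr0; lra.
    - rewrite (_ : g - 2 = g - 1 - 1); last ring.
      rewrite (@powRB R M (g - 1) 1); last by rewrite (gt_eqF M0) implybT.
      by rewrite powRr1 // ltW.
  rewrite /mu0 /Z (_ : _ / M = C * (g * (1 - g) * (1024^-1 * (M `^ (g - 1) / M)))); last by field; rewrite gt_eqF.
  rewrite ler_wpM2l ?(ltW C0) // ler_wpM2l ?mulr_ge0 ?subr_ge0 ?(ltW g0) ?(ltW g1) //.
  exact: le_trans h3 h2.
- move=> m /andP[am mb]; rewrite !fd.
  have a0 : 0 < a%:R :> R by apply: lt_le_trans Ma.
  have m0 : 0 < m%:R :> R by apply: lt_le_trans a0 _; rewrite ler_nat.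
  have h1 := pdiff_ge0 g0 m0; have h2 := pdiff_le g01 a0.
  have h3 : a%:R `^ (g - 1) <= M `^ (g - 1) by apply: ler_powR_neg => //; lra.
  have h4 : pdiff g a%:R <= M `^ (g - 1).
    apply: le_trans h2 (le_trans _ h3); rewrite -[leRHS]mul1r.
    by apply: ler_wpM2r; [exact: powR_ge0|exact: ltW].
  have := ler_wpM2l (ltW C0) h4; have := mulr_ge0 (ltW C0) h1; rewrite -/Z; lra.
rewrite mulrAC ler_pdivrMr //.
rewrite -ler_sqr ?nnegrE ?mulr_ge0 ?addr_ge0 ?(ltW kp0) ?(ltW M0) ?(ltW Z0) //.
rewrite exprMn [leRHS]exprMn kp2 exprMn.
have := ler_wpM2l (mulr_ge0 (ltW Z0) (ltW M0)) heta => h.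
rewrite -(ler_pM2r M0).
rewrite (_ : (M ^+ 2 * eta ^+ 2) * (mu0 * Z / M) * M = M * (Z * M * (eta ^+ 2 * mu0))); last by field; rewrite gt_eqF.
move: h; rewrite (_ : Z * M * (36 * _) = (6 ^+ 2 * (Z + 2) ^+ 2) * M); last by field; rewrite gt_eqF.
by rewrite (_ : Z * M * (eta ^+ 2 * mu0 * M) = M * (Z * M * (eta ^+ 2 * mu0))) //; ring.
Qed.

Lemma power_sum (g C M eta om ph : R) (a b : nat) :
  0 < g < 1 -> 1 <= M -> C != 0 -> M <= a%:R -> b%:R + 1 <= 32 * M -> 0 <= eta ->
  let Z := `|C| * M `^ (g - 1) in let mu0 := g * (1 - g) / 1024 in
  4 * mu0 * Z <= M -> 36 * (Z + 4 + 4 / Z) <= eta ^+ 2 * mu0 * M ->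
  `|\sum_(a <= m < b) cos (2 * pi * (om * m%:R + ph + C * m%:R `^ g))| <= M * eta.
Proof.
move=> g01 M1 C0 Ma bM eta0; have [Cneg|Cpos|C00] := ltgtP C 0.
- rewrite ltr0_norm // => Z mu0 hZ he.
  have C0' : 0 < - C by lra.
  have := @power_sum_neg g (- C) M eta om ph a b g01 M1 C0' Ma bM eta0 hZ he.
  by under eq_bigr do rewrite mulNr opprK.
- rewrite gtr0_norm // => Z mu0 hZ he.
  have := @power_sum_neg g C M eta (- om) (- ph) a b g01 M1 Cpos Ma bM eta0 hZ he.
  rewrite (eq_bigr (fun m => cos (2 * pi * (om * m%:R + ph + C * m%:R `^ g)))) => [//|m _].
  by rewrite -cosN; congr (cos _); ring.
- by rewrite C00 eqxx in C0.
Qed.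

End PowerSums.

(** * Multiplication by a trigonometric polynomial *)

Section TrigPolynomials.
Variable R : realType.

Definition tpoly (s : seq (R * R * R)) (n : nat) : R :=
  \sum_(t <- s) t.1.1 * cos (2 * pi * (t.1.2 * n%:R + t.2)).

Definition tmass (s : seq (R * R * R)) : R := \sum_(t <- s) `|t.1.1|.

Lemma tmass_ge0 s : 0 <= tmass s.
Proof. by apply: sumr_ge0 => t _. Qed.

(** A product of two cosines is half a sum of two cosines whose linear parts are shifted. As the
    hypothesis is uniform in the linear part, an entry of the polynomial costs no more than its
    coefficient. *)
Lemma tpoly_sum (v Th : nat -> R) (a b l : nat) (Bnd : R) s :
  (forall om ph : R, `|\sum_(a <= m < b) v m * cos (2 * pi * (om * m%:R + ph + Th m))| <= Bnd) ->
  forall om ph : R, `|\sum_(a <= m < b) (v m * tpoly s (l * m)) * cos (2 * pi * (om * m%:R + ph + Th m))|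
    <= tmass s * Bnd.
Proof.
move=> H om ph.
have -> : \sum_(a <= m < b) (v m * tpoly s (l * m)) * cos (2 * pi * (om * m%:R + ph + Th m))
  = \sum_(t <- s) t.1.1 * (2^-1 * (
      \sum_(a <= m < b) v m * cos (2 * pi * ((om - t.1.2 * l%:R) * m%:R + (ph - t.2) + Th m))
    + \sum_(a <= m < b) v m * cos (2 * pi * ((om + t.1.2 * l%:R) * m%:R + (ph + t.2) + Th m)))).
  under eq_bigr do rewrite /tpoly mulr_sumr mulr_suml.
  rewrite exchange_big /=; apply: eq_bigr => t _.
  rewrite -big_split /= !mulr_sumr; apply: eq_bigr => m _.
  rewrite -mulrDr (_ : v m * _ * _ = t.1.1 * (v m * (cos (2 * pi * (om * m%:R + ph + Th m)) * cos (2 * pi * (t.1.2 * (l * m)%:R + t.2))))); last ring.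
  rewrite cos_mul_cos natrM.
  rewrite (_ : 2 * pi * (om * m%:R + ph + Th m) - _ = 2 * pi * ((om - t.1.2 * l%:R) * m%:R + (ph - t.2) + Th m)); last ring.
  rewrite (_ : 2 * pi * (om * m%:R + ph + Th m) + _ = 2 * pi * ((om + t.1.2 * l%:R) * m%:R + (ph + t.2) + Th m)); last ring.
  ring.
apply: le_trans (ler_norm_sum _ _ _) _.
rewrite /tmass mulr_suml; apply: ler_sum => t _.
rewrite normrM ler_wpM2l // normrM ger0_norm ?invr_ge0 //.
apply: (@le_trans _ _ (2^-1 * (Bnd + Bnd))); last lra.
rewrite ler_wpM2l ?invr_ge0 //; apply: le_trans (ler_normD _ _) _.
by apply: lerD.
Qed.

Lemma tpoly_corr (Th : nat -> R) (a b l l' : nat) (Bnd : R) s s' :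
  (forall om ph : R, `|\sum_(a <= m < b) cos (2 * pi * (om * m%:R + ph + Th m))| <= Bnd) ->
  `|\sum_(a <= m < b) tpoly s (l * m) * tpoly s' (l' * m) * cos (2 * pi * Th m)|
    <= tmass s' * (tmass s * Bnd).
Proof.
move=> H.
have H3 : forall om ph : R, `|\sum_(a <= m < b) 1 * cos (2 * pi * (om * m%:R + ph + Th m))| <= Bnd.
  move=> om ph; rewrite (eq_bigr (fun m => cos (2 * pi * (om * m%:R + ph + Th m)))); first exact: H.
  by move=> m _; rewrite mul1r.
have H1 := @tpoly_sum (fun=> 1) Th a b l Bnd s H3.
have H2 := @tpoly_sum (fun m => 1 * tpoly s (l * m)) Th a b l' _ s' H1.
have := H2 0 0.
rewrite (eq_bigr (fun m => tpoly s (l * m) * tpoly s' (l' * m) * cos (2 * pi * Th m))) => [//|m _].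
by rewrite mul0r !add0r mul1r.
Qed.

End TrigPolynomials.

(** * Bilinear sums in short blocks *)

Section TypeTwo.
Variable R : realType.

Lemma sum_interval (F : nat -> R) (P : pred nat) (B a b : nat) :
  (1 <= a)%N -> (b <= B.+1)%N -> (forall m, (1 <= m)%N -> P m = (a <= m < b)%N) ->
  \sum_(1 <= m < B.+1 | P m) F m = \sum_(a <= m < b) F m.
Proof.
move=> a1 bB HP.
rewrite big_nat_cond (eq_bigl (fun m => (1 <= m < B.+1)%N && (a <= m < b)%N)); last first.
  by move=> m; case h : (1 <= m < B.+1)%N => //=; rewrite HP //; lia.
rewrite -big_nat_cond.
case: (leqP a b) => ab; last first.
  rewrite [RHS]big_geq ?(ltnW ab) // big1 // => m; lia.
rewrite (big_cat_nat (n := a)) //=; last lia.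
rewrite big_nat_cond big1 ?add0r; last by move=> m; lia.
rewrite (big_cat_nat (n := b)) //= [X in _ + X]big_nat_cond [X in _ + X]big1 ?addr0; last by move=> m; lia.
rewrite big_nat_cond [RHS]big_nat_cond; apply: eq_bigl => m.
by case h : (a <= m < b)%N.
Qed.

(** Cauchy's inequality with a free weight [t] in place of square roots. *)
Lemma sum_mul_le (u v : nat -> R) a b (t : R) : 0 < t ->
  `|\sum_(a <= m < b) u m * v m| <=
   2^-1 * (t * \sum_(a <= m < b) u m ^+ 2 + t^-1 * \sum_(a <= m < b) v m ^+ 2).
Proof.
move=> t0; apply: le_trans (ler_norm_sum _ _ _) _.
rewrite !mulr_sumr -big_split /= mulr_sumr; apply: ler_sum => m _.
rewrite normrM -(real_normK (num_real (u m))) -(real_normK (num_real (v m))).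
set p : R := `|u m|; set q : R := `|v m|.
rewrite -subr_ge0 (_ : _ - _ = (2 * t)^-1 * (t * p - q) ^+ 2); last by field; rewrite gt_eqF.
by rewrite mulr_ge0 ?sqr_ge0 // invr_ge0 mulr_ge0 // ltW.
Qed.

Variables (B x Q : nat) (f1 f2 al be : nat -> R) (CA CB kap : R).
Hypotheses (x0 : (0 < x)%N) (Bx : B = (8 * x)%N) (Q0 : (0 < Q)%N).
Hypotheses (CA0 : 0 < CA) (CB0 : 0 < CB) (kap0 : 0 < kap).
Hypotheses (hal : forall l, `|al l| <= CA)
  (hbe : forall m, (1 <= m <= B)%N -> `|be m| <= CB).

Definition in_range (l m : nat) := (x < l * m)%N && (l * m <= B)%N.

(* Only products with [l, l'] in a common short block are correlated, which avoids a dyadic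
   decomposition of the range of [l]. *)
Definition corr_bound (l0 : nat) :=
  \sum_(l0 <= l < l0 + Q) \sum_(l0 <= l' < l0 + Q)
   `|\sum_(1 <= m < B.+1 | in_range l m && in_range l' m)
      (f1 (l * m)%N * f1 (l' * m)%N + f2 (l * m)%N * f2 (l' * m)%N)|
   <= kap ^+ 2 * Q%:R ^+ 2 * (x%:R / l0%:R).

(** The coefficients [be m] are split off and the square of the sum over l is opened. Adding the
    square formed with [f2] can only increase it; when [f1] and [f2] are cosine and sine of one
    phase, f1 f1' + f2 f2' is the cosine of a phase difference. *)
Lemma block_bound (l0 : nat) : (0 < l0)%N -> corr_bound l0 ->
  `|\sum_(l0 <= l < l0 + Q) \sum_(1 <= m < B.+1 | in_range l m) al l * be m * f1 (l * m)%N|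
  <= 5 * CA * CB * kap * Q%:R * (x%:R / l0%:R).
Proof.
move=> l00 HC; pose Mm := (B %/ l0)%N.
have l0R : 0 < l0%:R :> R by rewrite ltr0n.
have MB : (Mm <= B)%N by exact: leq_div.
have MR : Mm%:R <= 8 * (x%:R / l0%:R) :> R.
  by rewrite mulrA ler_pdivlMr // -!natrM ler_nat -Bx leq_trunc_div.
have cut (l : nat) (F : nat -> R) (P : pred nat) : (l0 <= l)%N -> (forall m, P m -> in_range l m) ->
    \sum_(1 <= m < B.+1 | P m) F m = \sum_(1 <= m < Mm.+1) (if P m then F m else 0).
  move=> ll HP; rewrite (big_cat_nat (n := Mm.+1)) //= [X in _ + X]big_nat_cond.
  rewrite [X in _ + X]big1 ?addr0; first by rewrite big_mkcond.
  move=> m /andP[/andP[h _] /HP /andP[_ h2]]; exfalso.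
  have : (l0 * m <= B)%N by apply: leq_trans h2; rewrite leq_mul2r ll orbT.
  by rewrite mulnC -leq_divRL // -/Mm leqNgt h.
pose v (f : nat -> R) m := \sum_(l0 <= l < l0 + Q) (if in_range l m then al l * f (l * m)%N else 0).
have -> : \sum_(l0 <= l < l0 + Q) \sum_(1 <= m < B.+1 | in_range l m) al l * be m * f1 (l * m)%N
   = \sum_(1 <= m < Mm.+1) be m * v f1 m.
  transitivity (\sum_(l0 <= l < l0 + Q) \sum_(1 <= m < Mm.+1)
      (if in_range l m then al l * be m * f1 (l * m)%N else 0)).
    by apply: eq_big_nat => l /andP[ll _]; rewrite (cut l).
  rewrite exchange_big /=; apply: eq_bigr => m _; rewrite /v mulr_sumr.
  by apply: eq_bigr => l _; case: ifP => _; rewrite ?mulr0 //; ring.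
have QR : 0 < Q%:R :> R by rewrite ltr0n.
(* This weight brings both terms of [sum_mul_le] to the order of CA CB kap Q x/l0. *)
pose t := CA * kap * Q%:R / CB.
have t0 : 0 < t by rewrite /t divr_gt0 // !mulr_gt0.
apply: le_trans (sum_mul_le _ _ _ _ t0) _.
have s1 : \sum_(1 <= m < Mm.+1) be m ^+ 2 <= CB ^+ 2 * (8 * (x%:R / l0%:R)).
  apply: (@le_trans _ _ (\sum_(1 <= m < Mm.+1) CB ^+ 2)).
    rewrite !big_nat; apply: ler_sum => m /andP[m1 mM].
    rewrite -real_normK ?num_real // ler_pXn2r ?nnegrE ?(ltW CB0) //.
    by apply: hbe; rewrite m1 (leq_trans _ MB).
  by rewrite big_const_nat iter_addr_0 subn1 -[_ *+ Mm]mulr_natr ler_wpM2l // exprn_ge0 // ltW.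
have s2 : \sum_(1 <= m < Mm.+1) v f1 m ^+ 2 <= CA ^+ 2 * (kap ^+ 2 * Q%:R ^+ 2 * (x%:R / l0%:R)).
  apply: (@le_trans _ _ (\sum_(1 <= m < Mm.+1) (v f1 m ^+ 2 + v f2 m ^+ 2))).
    by apply: ler_sum => m _; rewrite lerDl sqr_ge0.
  have E m : v f1 m ^+ 2 + v f2 m ^+ 2 = \sum_(l0 <= l < l0 + Q) \sum_(l0 <= l' < l0 + Q)
     (if in_range l m && in_range l' m then al l * al l' *
       (f1 (l * m)%N * f1 (l' * m)%N + f2 (l * m)%N * f2 (l' * m)%N) else 0).
    rewrite /v !expr2 !big_distrlr /= -big_split /=; apply: eq_bigr => l _.
    rewrite -big_split /=; apply: eq_bigr => l' _.
    by case: (in_range l m); case: (in_range l' m); rewrite /= ?mulr0 ?mul0r ?addr0 //; ring.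
  under eq_bigr do rewrite E.
  apply: le_trans (ler_wpM2l (exprn_ge0 2 (ltW CA0)) HC).
  rewrite exchange_big /= mulr_sumr big_nat [leRHS]big_nat; apply: ler_sum => l /andP[ll _].
  rewrite exchange_big /= mulr_sumr; apply: ler_sum => l' _.
  rewrite (cut l) //; last by move=> m /andP[].
  apply: (@le_trans _ _ (al l * al l' * \sum_(1 <= m < Mm.+1)
     (if in_range l m && in_range l' m then
       (f1 (l * m)%N * f1 (l' * m)%N + f2 (l * m)%N * f2 (l' * m)%N) else 0))).
    rewrite mulr_sumr; apply: ler_sum => m _; case: ifP => _ //; by rewrite mulr0.
  apply: le_trans (ler_norm _) _; rewrite normrM ler_wpM2r // normrM expr2.
  exact: ler_pM.
have xl : 0 <= x%:R / l0%:R :> R by rewrite divr_ge0.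
apply: (@le_trans _ _ (2^-1 * (t * (CB ^+ 2 * (8 * (x%:R / l0%:R)))
   + t^-1 * (CA ^+ 2 * (kap ^+ 2 * Q%:R ^+ 2 * (x%:R / l0%:R)))))).
  rewrite ler_wpM2l ?invr_ge0 // lerD // ler_wpM2l ?invr_ge0 ?(ltW t0) //.
rewrite (_ : 2^-1 * _ = (CA * CB * kap * Q%:R * (x%:R / l0%:R)) * (9 / 2)); last first.
  by rewrite /t; field; rewrite !gt_eqF.
have : 0 <= CA * CB * kap * Q%:R * (x%:R / l0%:R).
  by rewrite mulr_ge0 // !mulr_ge0 // ltW.
by move=> h; lra.
Qed.

(** In a block that starts at l0 > L0 >= Q every l is below 2 l0, so Q/l0 is at most twice the sum
    of 1/l over the block, and consecutive blocks add up to a harmonic sum. The last block may run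
    past L1, where [al] vanishes; hence L1 + Q. *)
Lemma type_two_bound (L0 L1 : nat) : (Q <= L0)%N ->
  (forall l, (L1 < l)%N -> al l = 0) ->
  (forall l0, (L0 < l0 <= L1)%N -> corr_bound l0) ->
  `|\sum_(L0.+1 <= l < L1.+1) \sum_(1 <= m < B.+1 | in_range l m) al l * be m * f1 (l * m)%N|
  <= 10 * CA * CB * kap * x%:R * harm R (L1 + Q).
Proof.
move=> QL hal0 HC.
pose F l := \sum_(1 <= m < B.+1 | in_range l m) al l * be m * f1 (l * m)%N.
have F0 l : (L1 < l)%N -> F l = 0.
  by move=> h; rewrite /F big1 // => m _; rewrite hal0 // !mul0r.
pose c := 10 * CA * CB * kap * x%:R : R.
have c0 : 0 <= c by rewrite /c !mulr_ge0 // ltW.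
have blk l0 : (L0 < l0 <= L1)%N -> `|\sum_(l0 <= l < l0 + Q) F l| <= c * \sum_(l0 <= l < l0 + Q) l%:R^-1.
  move=> /andP[h1 h2]; have l00 : (0 < l0)%N by lia.
  apply: le_trans (block_bound l00 (HC _ _)) _; first by rewrite h1.
  have l0R : 0 < l0%:R :> R by rewrite ltr0n.
  apply: (@le_trans _ _ (c * (Q%:R * (2 * l0%:R)^-1))).
    by rewrite le_eqVlt; apply/orP; left; apply/eqP; rewrite /c; field; rewrite gt_eqF.
  rewrite ler_wpM2l // mulr_natl -[X in _ *+ X](addKn l0) -iter_addr_0 -big_const_nat.
  rewrite !big_nat; apply: ler_sum => l /andP[a1 a2].
  rewrite lef_pV2 ?posrE ?mulr_gt0 // ?ltr0n; last lia.
  by rewrite -natrM ler_nat; lia.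
have main n : forall l0, (L1 - l0 <= n)%N -> (L0 < l0)%N -> (l0 <= L1)%N ->
    `|\sum_(l0 <= l < L1.+1) F l| <= c * \sum_(l0 <= l < (L1 + Q).+1) l%:R^-1.
  elim/ltn_ind: n => n IH l0 hn h1 h2.
  have [le|gt] := leqP (l0 + Q) L1.
    rewrite (big_cat_nat (n := l0 + Q)) /=; [|lia|lia].
    rewrite [X in c * X](big_cat_nat (n := l0 + Q)) /=; [|lia|lia].
    apply: le_trans (ler_normD _ _) _; rewrite mulrDr; apply: lerD.
      by apply: blk; lia.
    by apply: (IH (L1 - (l0 + Q))%N); lia.
  have -> : \sum_(l0 <= l < L1.+1) F l = \sum_(l0 <= l < l0 + Q) F l.
    rewrite [RHS](big_cat_nat (n := L1.+1)) /=; [|lia|lia].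
    rewrite [X in _ + X]big_nat [X in _ + X]big1 ?addr0 // => l h; apply: F0; lia.
  apply: le_trans (blk _ _) _; first lia.
  rewrite ler_wpM2l // [leRHS](big_cat_nat (n := l0 + Q)) /=; [|lia|lia].
  by rewrite lerDl; apply: sumr_ge0 => l _; rewrite invr_ge0.
have [h|h] := leqP L1 L0.
  by rewrite big_geq // normr0; apply: mulr_ge0 => //; exact: harm_ge0.
apply: le_trans (main _ L0.+1 (leqnn _) (ltnSn _) h) _.
rewrite ler_wpM2l // /harm [leRHS](big_cat_nat (n := L0.+1)) /=; [|lia|lia].
by rewrite lerDr; apply: sumr_ge0 => l _; rewrite invr_ge0.
Qed.

End TypeTwo.

(** * Exponential sums over primes *)

Section PrimeSums.
Variable R : realType.
Notation Lam := (@Lam R).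

Lemma mu_tail_small (B U m : nat) : (0 < m)%N -> (m <= U)%N -> mu_tail R B U m = 0.
Proof.
move=> m0 mU; rewrite /mu_tail big1 // => b /andP[bm Ub].
by have := dvdn_leq m0 bm; nlia.
Qed.

Lemma mu_tail_le (B U m : nat) : (0 < m)%N -> (m <= B)%N ->
  `|mu_tail R B U m| <= (tau m)%:R.
Proof.
move=> m0 mB; apply: le_trans (ler_norm_sum _ _ _) _.
rewrite -(tau_sum R m0 mB) big_mkcondr /=; apply: ler_sum => b _.
by case: ifP => // _; rewrite -intr_norm lerz1 mu_norm.
Qed.

(** In the bilinear part both variables exceed U, since [mu_tail] vanishes up to U. As lm <= B <=
    Y^2, one of them is at most Y and becomes the block variable: l if l <= Y, otherwise m. So
    correlations are required only for U < l0 <= Y. *)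
Lemma prime_sum_bound (x B U Q Y : nat) (f1 f2 G : nat -> R) (Lg CT kap : R) :
  (0 < x)%N -> B = (8 * x)%N -> (0 < Q)%N -> (Q <= U)%N -> (U <= x)%N ->
  (U * U <= B)%N -> (B <= Y * Y)%N -> (Y <= B)%N ->
  0 < Lg -> ln B%:R <= Lg -> harm R (Y + Q) <= Lg ->
  0 < CT -> (forall m, (1 <= m <= B)%N -> (tau m)%:R <= CT) -> 0 < kap ->
  (forall d, 0 <= G d) ->
  (forall d y, (1 <= d <= U * U)%N -> (y <= B)%N ->
    `|\sum_(1 <= e < B.+1 | (x < d * e)%N && (d * e <= y)%N) f1 (d * e)%N| <= G d) ->
  (forall l0, (U < l0 <= Y)%N -> corr_bound B x Q f1 f2 kap l0) ->
  `|\sum_(1 <= n < B.+1 | (x < n)%N) Lam n * f1 n| <=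
   5 * Lg * (\sum_(1 <= d < (U * U).+1) G d) + 20 * Lg ^+ 2 * CT * kap * x%:R.
Proof.
move=> x0 Bx Q0 QU Ux UB BY YB Lg0 HL Hh CT0 HT kap0 G0 HI HC.
have U0 : (0 < U)%N by nlia.
have xB : (x <= B)%N by nlia.
apply: (vaughan_bound (U := U) (V := U)) => //.
set T0 := \sum_(_ <= _ < _ | _) _.
have LamB l : (1 <= l <= B)%N -> `|Lam l| <= Lg.
  move=> /andP[l1 lB]; rewrite ger0_norm ?Lam_ge0 //.
  apply: le_trans (Lam_le_ln _ l1) (le_trans _ HL).
  by rewrite ler_ln ?posrE ?ltr0n ?ler_nat //; nlia.
have muB m : (1 <= m <= B)%N -> `|mu_tail R B U m| <= CT.
  by move=> mm; apply: le_trans (HT _ mm); case/andP: mm => *; exact: mu_tail_le.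
pose al1 l := if (U < l <= Y)%N then Lam l else 0.
pose al2 m := if (U < m <= Y)%N then mu_tail R B U m else 0.
pose be2 l := if (U < l)%N && (Y < l)%N then Lam l else 0.
have b1 : `|\sum_(U.+1 <= l < Y.+1) \sum_(1 <= m < B.+1 | in_range B x l m) al1 l * mu_tail R B U m * f1 (l * m)%N|
    <= 10 * Lg * CT * kap * x%:R * harm R (Y + Q).
  apply: (type_two_bound (f2 := f2)) => //.
  - by move=> l; rewrite /al1; case: ifP => h; [apply: LamB; nlia|rewrite normr0 ltW].
  - by move=> l h; rewrite /al1 ifF //; nlia.
have b2 : `|\sum_(U.+1 <= m < Y.+1) \sum_(1 <= l < B.+1 | in_range B x m l) al2 m * be2 l * f1 (m * l)%N|
    <= 10 * CT * Lg * kap * x%:R * harm R (Y + Q).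
  apply: (type_two_bound (f2 := f2)) => //.
  - by move=> l; rewrite /al2; case: ifP => h; [apply: muB; nlia|rewrite normr0 ltW].
  - by move=> l h; rewrite /be2; case: ifP => _; [exact: LamB|rewrite normr0 ltW].
  - by move=> l h; rewrite /al2 ifF //; nlia.
have E : T0 = \sum_(U.+1 <= l < Y.+1) \sum_(1 <= m < B.+1 | in_range B x l m) al1 l * mu_tail R B U m * f1 (l * m)%N
   + \sum_(U.+1 <= m < Y.+1) \sum_(1 <= l < B.+1 | in_range B x m l) al2 m * be2 l * f1 (m * l)%N.
  rewrite /T0 (bigID (fun l => l <= Y)%N) /=; congr (_ + _).
    rewrite (@sum_interval R _ _ B U.+1 Y.+1) //.
    by apply: eq_big_nat => l /andP[h1 h2]; rewrite /al1 h1 -ltnS h2.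
  rewrite (exchange_big_dep xpredT) //=.
  rewrite -(@sum_interval R _ (fun m => (U < m)%N && (m <= Y)%N) B U.+1 Y.+1) // [RHS]big_mkcond /=.
  apply: eq_big_nat => m /andP[m1 mB].
  case: ifP => [/andP[Um mY]|h].
    rewrite /al2 Um mY /= [RHS]big_mkcond [LHS]big_mkcond; apply: eq_bigr => l _.
    rewrite /in_range /be2 -ltnNge (mulnC m l).
    by case: (U < l)%N; case: (Y < l)%N; case: (x < l * m)%N; case: (l * m <= B)%N; rewrite /= ?mulr0 ?mul0r //; ring.
  rewrite big_nat_cond big1 // => l /andP[_ /andP[/andP[Ul lY] /andP[h1 h2]]].
  rewrite -ltnNge in lY.
  have [mU|Um] := leqP m U; first by rewrite mu_tail_small // mulr0 mul0r.
  exfalso; move: h; rewrite Um /=; have [//|Ym _] := leqP m Y.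
  have : (Y.+1 * Y.+1 <= l * m)%N by apply: leq_mul.
  by nnia.
rewrite E; apply: le_trans (ler_normD _ _) _.
have c0 : 0 <= 10 * Lg * CT * kap * x%:R by rewrite !mulr_ge0 // ltW.
have := ler_wpM2l c0 Hh.
rewrite (_ : 10 * CT * Lg * kap * x%:R = 10 * Lg * CT * kap * x%:R) in b2; last ring.
move: b1 b2; set h := harm _ _; set u := `|_|; set v := `|_|; rewrite expr2; lra.
Qed.

(** The minimum of X and 2 / nd y, arranged so that nd y = 0 gives X and not the default value 2/0 =
    0. *)
Definition nd_cap (X : R) (y : R) : R := if X * nd y <= 2 then X else 2 / nd y.

Lemma nd_cap_bounds (X y : R) : 0 <= X -> [/\ 0 <= nd_cap X y, nd_cap X y <= X & nd_cap X y * nd y <= 2].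
Proof.
move=> X0; rewrite /nd_cap; case: (leP (X * nd y) 2) => h.
  by split.
have n0 : 0 < nd y.
  rewrite lt_neqAle nd_ge0 andbT; apply/eqP => e; rewrite -e mulr0 in h; lra.
split; first by rewrite divr_ge0 // ltW.
- by rewrite ler_pdivrMr // ltW.
- by rewrite divfK ?gt_eqF.
Qed.

Lemma linear_interval_sum (al ph X : R) (a b : nat) : 0 <= X -> (b - a)%:R <= X ->
  `|\sum_(a <= m < b) cos (2 * pi * (al * m%:R + ph))| <= nd_cap X al.
Proof.
move=> X0 hX; rewrite /nd_cap; case: (leP (X * nd al) 2) => h.
  by apply: le_trans hX; apply: sum_norm_le1 => m; exact: cos_max.
have n0 : 0 < nd al.
  rewrite lt_neqAle nd_ge0 andbT; apply/eqP => e; rewrite -e mulr0 in h; lra.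
exact: linear_sum_bound.
Qed.

(** * Sums over primes with a linear phase *)

Section Linear.
Variables (x B U Q Y K : nat) (al ph ks Lg CT kap : R).
Hypotheses (x0 : (0 < x)%N) (Bx : B = (8 * x)%N) (Q0 : (0 < Q)%N).
Hypotheses (ks0 : 0 < ks) (ksK : ks^-1 <= K%:R).
Hypothesis sp : forall j, (1 <= j < Q)%N -> ks <= nd (al * j%:R).

Lemma spaced i j (c : R) : (i < Q)%N -> (j < Q)%N -> i <> j ->
  ks <= nd ((al * i%:R + c) - (al * j%:R + c)).
Proof.
move=> iQ jQ ij; rewrite (_ : _ - _ = al * (i%:R - j%:R)); last ring.
case: (ltngtP i j) => h; last by case: ij.
- have -> : i%:R - j%:R = - (j - i)%:R :> R by rewrite natrB ?(ltnW h) // opprB.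
  by rewrite mulrN ndN; apply: sp; nlia.
- by rewrite -natrB ?(ltnW h) //; apply: sp; nlia.
Qed.

Lemma cap_block (X : R) (l0 : nat) : 0 <= X ->
  \sum_(0 <= j < Q) nd_cap X (al * (l0 + j)%N%:R) <= 2 * (X + 2 / ks * harm R K).
Proof.
move=> X0; apply: (spacing_bound (y := fun j => al * (l0 + j)%N%:R)) => //.
- by move=> j _; have [] := nd_cap_bounds (al * (l0 + j)%N%:R) X0.
- by move=> j _; have [] := nd_cap_bounds (al * (l0 + j)%N%:R) X0.
- move=> i j iQ jQ ij; have := spaced (al * l0%:R) iQ jQ ij.
  by rewrite !natrD !mulrDr ![al * l0%:R + _]addrC.
Qed.

(** Blocks of Q consecutive d. For d < Q the spacing itself bounds each cap by 2/ks. Block t has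
    caps of at most 8x/(tQ), paid twice by [spacing_bound], and these add up to a harmonic sum in
    t. *)
Lemma linear_type_one (J : nat) : (0 < J)%N ->
  \sum_(1 <= d < (J * Q).+1) nd_cap (8 * x%:R / d%:R) (al * d%:R)
  <= 16 * x%:R / Q%:R * harm R J + J.+1%:R * (4 / ks * (harm R K + 1)).
Proof.
move=> J0; have QR : 0 < Q%:R :> R by rewrite ltr0n.
have H0 := harm_ge0 R K.
have c0 : 0 <= 4 / ks * (harm R K + 1) by rewrite mulr_ge0 ?divr_ge0 ?addr_ge0 // ltW.
pose F d := nd_cap (8 * x%:R / d%:R) (al * d%:R).
have F0 d : 0 <= F d by have [] := @nd_cap_bounds (8 * x%:R / d%:R) (al * d%:R) _; rewrite ?divr_ge0 ?mulr_ge0.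
have first : \sum_(1 <= d < Q) F d <= 4 / ks * (harm R K + 1).
  apply: (@le_trans _ _ (\sum_(0 <= j < Q) (if (1 <= j)%N then F j else 0))).
    rewrite [leRHS]big_ltn //= add0r !big_nat; apply: ler_sum => d /andP[d1 _]; by rewrite d1.
  have -> : 4 / ks * (harm R K + 1) = 2 * (2 / ks + 2 / ks * harm R K) by ring.
  have k2 : 0 <= 2 / ks by rewrite divr_ge0 // ltW.
  apply: (spacing_bound (y := fun j => al * j%:R + 0)) => //.
  - move=> j jQ; case: ifP => // j1.
    have Xj : 0 <= 8 * x%:R / j%:R :> R by rewrite divr_ge0 ?mulr_ge0.
    have [_ _ h] := nd_cap_bounds (al * j%:R) Xj.
    have sj := sp (introT andP (conj j1 jQ)).
    rewrite ler_pdivlMr //; apply: le_trans h.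
    by apply: ler_wpM2l.
  - move=> j jQ; case: ifP => // j1; last by rewrite mul0r.
    have Xj : 0 <= 8 * x%:R / j%:R :> R by rewrite divr_ge0 ?mulr_ge0.
    by rewrite addr0; have [_ _ h] := nd_cap_bounds (al * j%:R) Xj.
  - by move=> i j; exact: spaced.
have block t : (1 <= t)%N -> \sum_(t * Q <= d < t.+1 * Q) F d <=
    16 * x%:R / Q%:R * t%:R^-1 + 4 / ks * (harm R K + 1).
  move=> t1; have tR : 0 < t%:R :> R by rewrite ltr0n.
  have tQ : 0 < (t * Q)%N%:R :> R by rewrite ltr0n muln_gt0 t1.
  rewrite -{1}(add0n (t * Q)%N) big_addn.
  have -> : (t.+1 * Q - t * Q = Q)%N by rewrite mulSn addnK.
  apply: (@le_trans _ _ (\sum_(0 <= j < Q) nd_cap (8 * x%:R / (t * Q)%N%:R) (al * (t * Q + j)%N%:R))).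
    apply: ler_sum => j _; rewrite /F addnC.
    have mono X X' y : 0 <= X -> X <= X' -> nd_cap X y <= nd_cap X' y.
      move=> X0 XX; have [_ h1 h2] := nd_cap_bounds y X0.
      rewrite [X in _ <= X]/nd_cap; case: (leP (X' * nd y) 2) => h; first exact: le_trans h1 XX.
      rewrite ler_pdivlMr // lt_neqAle nd_ge0 andbT; apply/eqP => e.
      by rewrite -e mulr0 in h; lra.
    apply: mono; first by rewrite divr_ge0 ?mulr_ge0.
    have tj : (t * Q)%N%:R <= (t * Q + j)%N%:R :> R by rewrite ler_nat leq_addr.
    by rewrite ler_wpM2l ?mulr_ge0 // lef_pV2 ?posrE // (lt_le_trans tQ tj).
  apply: le_trans (cap_block _ _) _; first by rewrite divr_ge0 ?mulr_ge0.
  rewrite natrM (_ : 2 * (_ + _) = 16 * x%:R / Q%:R * t%:R^-1 + 4 / ks * harm R K); last by field; rewrite !gt_eqF.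
  by rewrite lerD2l mulrDr mulr1 lerDl; apply: divr_ge0 => //; exact: ltW.
have main : \sum_(1 <= d < J.+1 * Q) F d <= 16 * x%:R / Q%:R * harm R J + J.+1%:R * (4 / ks * (harm R K + 1)).
  elim: J J0 => // J IH _; case: (posnP J) => [->|J0].
    rewrite (big_cat_nat (n := Q)) /=; [|nlia|nlia].
    have -> : harm R 1 = 1 by rewrite /harm big_nat1 invr1.
    have := block 1%N isT; rewrite mul1n invr1 => hb.
    apply: le_trans (lerD first hb) _.
    lra.
  rewrite (big_cat_nat (n := (J.+1 * Q)%N)) /=; [|nnia|nnia].
  apply: le_trans (lerD (IH J0) (block J.+1 isT)) _.
  have -> : harm R J.+1 = harm R J + J.+1%:R^-1 by rewrite /harm big_nat_recr.
  have -> : J.+2%:R = J.+1%:R + 1 :> R by rewrite natr1.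
  move: (4 / ks * (harm R K + 1)) (16 * x%:R / Q%:R) (J.+1%:R^-1 : R) (J.+1%:R : R) (harm R J).
  by move=> c e i j h; rewrite le_eqVlt; apply/orP; left; apply/eqP; ring.
apply: le_trans main; rewrite [leRHS](big_cat_nat (n := (J * Q).+1)) //=.
  by rewrite lerDl; apply: sumr_ge0.
by rewrite mulSn -addn1 addnC leq_add2r.
Qed.

Hypotheses (QU : (Q <= U)%N) (Ux : (U <= x)%N).
Hypotheses (UB : (U * U <= B)%N) (BY : (B <= Y * Y)%N) (YB : (Y <= B)%N).
Hypotheses (Lg0 : 0 < Lg) (HL : ln B%:R <= Lg) (Hh : harm R (Y + Q) <= Lg) (HK : harm R K <= Lg).
Hypotheses (CT0 : 0 < CT) (HT : forall m, (1 <= m <= B)%N -> (tau m)%:R <= CT) (kap0 : 0 < kap).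
Hypothesis (Hkap : 16 + 4 * Lg * Y%:R / (ks * x%:R) <= kap ^+ 2 * Q%:R).

(** For fixed l the numbers al (l - l') with l' in one block are again spaced by [ks], so a single
    spacing hypothesis serves the linear and the bilinear sums. [Hkap] is the correlation condition
    at its worst point l0 = Y. *)
Lemma linear_prime_sum (J : nat) : (0 < J)%N -> (U * U <= J * Q)%N -> harm R J <= Lg ->
  `|\sum_(1 <= n < B.+1 | (x < n)%N) Lam n * cos (2 * pi * (al * n%:R + ph))| <=
   5 * Lg * (16 * x%:R / Q%:R * Lg + J.+1%:R * (4 / ks * (Lg + 1)))
    + 20 * Lg ^+ 2 * CT * kap * x%:R.
Proof.
move=> J0 UJ HJ.
have QR : 0 < Q%:R :> R by rewrite ltr0n.
have xR : 0 < x%:R :> R by rewrite ltr0n.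
pose f1 n := cos (2 * pi * (al * n%:R + ph)) : R.
pose f2 n := sin (2 * pi * (al * n%:R + ph)) : R.
pose G d := nd_cap (8 * x%:R / d%:R) (al * d%:R).
have G0 d : 0 <= G d by have [] := @nd_cap_bounds (8 * x%:R / d%:R) (al * d%:R) _; rewrite ?divr_ge0 ?mulr_ge0.
have HI d y : (1 <= d <= U * U)%N -> (y <= B)%N ->
    `|\sum_(1 <= e < B.+1 | (x < d * e)%N && (d * e <= y)%N) f1 (d * e)%N| <= G d.
  move=> /andP[d1 _] yB.
  rewrite (@sum_interval R _ _ B (x %/ d).+1 (y %/ d).+1) //; last 2 first.
  - by rewrite ltnS (leq_trans (leq_div _ _)).
  - by move=> e e1; rewrite ltnS leq_divRL // ltn_divLR // !(mulnC d).
  rewrite (eq_bigr (fun m => cos (2 * pi * ((al * d%:R) * m%:R + ph)))); last first.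
    by move=> m _; rewrite /f1 natrM; congr (cos _); ring.
  apply: linear_interval_sum; first by rewrite divr_ge0 ?mulr_ge0.
  rewrite ler_pdivlMr ?ltr0n // -!natrM ler_nat -Bx.
  apply: leq_trans yB; apply: leq_trans (leq_trunc_div y d); rewrite leq_mul2r; apply/orP; right; rewrite subSS; exact: leq_subr.
have HC l0 : (U < l0 <= Y)%N -> corr_bound B x Q f1 f2 kap l0.
  move=> /andP[Ul lY]; have l00 : (0 < l0)%N := leq_ltn_trans (leq0n U) Ul.
  have l0R : 0 < l0%:R :> R by rewrite ltr0n.
  have X0 : 0 <= 8 * (x%:R / l0%:R) :> R by rewrite mulr_ge0 // divr_ge0.
  rewrite /corr_bound.
  apply: (@le_trans _ _ (\sum_(l0 <= l < l0 + Q) 2 * (8 * (x%:R / l0%:R) + 2 / ks * harm R K))).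
    rewrite !big_nat; apply: ler_sum => l /andP[h1 h2].
    apply: (@le_trans _ _ (\sum_(0 <= j < Q) nd_cap (8 * (x%:R / l0%:R)) (al * l%:R - al * (l0 + j)%N%:R))).
      rewrite -{1}(add0n l0) big_addn addKn; apply: ler_sum => j _.
      rewrite (addnC j l0); set l' := (l0 + j)%N.
      have l'0 : (0 < l')%N := leq_trans l00 (leq_addr _ _).
      have l'1 : (0 < l)%N := leq_trans l00 h1.
      rewrite (@sum_interval R _ _ B (maxn (x %/ l) (x %/ l')).+1 (minn (B %/ l) (B %/ l')).+1) //; last 2 first.
      - by rewrite ltnS (leq_trans (geq_minl _ _)) // leq_div.
      - move=> m m1; rewrite /in_range gtn_max ltnS leq_min !leq_divRL ?ltn_divLR //.
        by rewrite !(mulnC m) andbACA.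
      rewrite (eq_bigr (fun m => cos (2 * pi * ((al * l%:R - al * l'%:R) * m%:R + 0)))); last first.
        by move=> m _; rewrite /f1 /f2 -cosB !natrM; congr (cos _); ring.
      apply: linear_interval_sum => //.
      rewrite mulrA ler_pdivlMr // -!natrM ler_nat -Bx.
      apply: leq_trans (leq_trunc_div B l); apply: leq_mul => //.
      by rewrite subSS (leq_trans (leq_subr _ _)) // geq_minl.
    apply: (spacing_bound (y := fun j => al * l%:R - al * (l0 + j)%N%:R)) => //.
    - by move=> j _; have [] := nd_cap_bounds (al * l%:R - al * (l0 + j)%N%:R) X0.
    - by move=> j _; have [] := nd_cap_bounds (al * l%:R - al * (l0 + j)%N%:R) X0.
    - move=> i j iQ jQ ij; have := spaced 0 iQ jQ ij; rewrite -ndN.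
      by congr (_ <= nd _); rewrite !natrD; ring.
  rewrite big_const_nat iter_addr_0 addKn -[_ *+ Q]mulr_natr.
  have h1 : 2 * (8 * (x%:R / l0%:R) + 2 / ks * harm R K) <= kap ^+ 2 * Q%:R * (x%:R / l0%:R).
    rewrite -(ler_pM2r (_ : 0 < l0%:R / x%:R)); last by rewrite divr_gt0.
    rewrite -[leRHS]mulrA (_ : x%:R / l0%:R * (l0%:R / x%:R) = 1) ?mulr1; last by field; rewrite !gt_eqF.
    apply: le_trans Hkap.
    rewrite (_ : 2 * _ * _ = 16 + 4 * harm R K * l0%:R / (ks * x%:R)); last by field; rewrite !gt_eqF.
    rewrite lerD2l ler_wpM2r ?invr_ge0 ?mulr_ge0 ?(ltW ks0) //.
    apply: ler_pM; rewrite ?mulr_ge0 ?harm_ge0 //; first by rewrite ler_wpM2l.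
    by rewrite ler_nat.
  by have := ler_wpM2r (ltW QR) h1; rewrite expr2; lra.
have := @prime_sum_bound x B U Q Y f1 f2 G Lg CT kap x0 Bx Q0 QU Ux UB BY YB Lg0 HL Hh CT0 HT kap0 G0 HI HC.
move=> h; apply: le_trans h _; rewrite lerD2r ler_wpM2l ?mulr_ge0 ?(ltW Lg0) //.
apply: (@le_trans _ _ (\sum_(1 <= d < (J * Q).+1) G d)).
  rewrite [leRHS](big_cat_nat (n := (U * U).+1)) //= lerDl; exact: sumr_ge0.
apply: le_trans (linear_type_one J0) _; apply: lerD.
  by rewrite ler_wpM2l // divr_ge0 // mulr_ge0.
rewrite ler_wpM2l // ler_wpM2l ?divr_ge0 ?(ltW ks0) // lerD2r //.
Qed.

End Linear.

(** * Sums over primes with phase n^g and a trigonometric factor *)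

Section Power.
Variables (x B U Q Y : nat) (g C0 ph Lg CT kap eta eta1 W : R) (s : seq (R * R * R)).
Let T : R := C0 * x%:R `^ (g - 1).
Let mu0 : R := g * (1 - g) / 1024.
Hypotheses (x0 : (0 < x)%N) (Bx : B = (8 * x)%N) (Q0 : (0 < Q)%N).
Hypotheses (QU : (Q <= U)%N) (Ux : (U * U <= x)%N) (Yx : (2 * Y <= x)%N).
Hypotheses (BY : (B <= Y * Y)%N) (YB : (Y <= B)%N).
Hypotheses (g12 : 1 / 2 <= g) (g1 : g < 1) (C00 : 0 < C0).
Hypotheses (eta0 : 0 <= eta) (eta10 : 0 <= eta1).
Hypothesis W0 : forall n, (x < n <= B)%N -> `|tpoly s n| <= W.
Hypothesis smallT : 8 * mu0 * Q%:R * T <= x%:R / (2 * Y%:R).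
Hypothesis smallT1 : 4 * mu0 * T * (U * U)%:R ^+ 2 <= x%:R.
Hypothesis Heta : 36 * (2 * Q%:R * T + 4 + 8 / T) <= eta ^+ 2 * mu0 * (x%:R / (2 * Y%:R)).
Hypothesis Heta1 : 36 * (T + 4 + 4 / T) <= eta1 ^+ 2 * mu0 * x%:R.
Hypotheses (Lg0 : 0 < Lg) (HL : ln B%:R <= Lg) (Hh : harm R (Y + Q) <= Lg).
Hypotheses (CT0 : 0 < CT) (HT : forall m, (1 <= m <= B)%N -> (tau m)%:R <= CT) (kap0 : 0 < kap).
Hypothesis Hkap : 8 * W ^+ 2 + tmass s ^+ 2 * eta * Q%:R / 2 <= kap ^+ 2 * Q%:R.

Let f1 n : R := tpoly s n * cos (2 * pi * (C0 * n%:R `^ g + ph)).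
Let f2 n : R := tpoly s n * sin (2 * pi * (C0 * n%:R `^ g + ph)).

Let g01 : 0 < g < 1.
Proof. by rewrite g1 andbT; move: g12; lra. Qed.
Let g0 : 0 < g.
Proof. by case/andP: g01. Qed.
Let xR : 0 < x%:R :> R.
Proof. by rewrite ltr0n. Qed.
Let T0 : 0 < T.
Proof. by rewrite mulr_gt0 // powR_gt0. Qed.
Let mu00 : 0 < mu0.
Proof. by rewrite /mu0 divr_gt0 // mulr_gt0 // subr_gt0. Qed.

(** For n = dm the phase is C m^g with C = C0 d^g, and on the scale M = x/d one has C M^(g-1) = Td.
    [smallT1] and [Heta1] are what [power_sum] asks for, uniformly in d <= U^2. *)
Lemma power_type_one d y : (1 <= d <= U * U)%N -> (y <= B)%N ->
  `|\sum_(1 <= e < B.+1 | (x < d * e)%N && (d * e <= y)%N) f1 (d * e)%N| <= tmass s * (x%:R * eta1).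
Proof.
move=> /andP[d1 dU] yB.
have dR : 0 < d%:R :> R by rewrite ltr0n.
have d1R : 1 <= d%:R :> R by rewrite ler1n.
rewrite (@sum_interval R _ _ B (x %/ d).+1 (y %/ d).+1) //; last 2 first.
- by rewrite ltnS (leq_trans (leq_div _ _)).
- by move=> e e1; rewrite ltnS leq_divRL // ltn_divLR // !(mulnC d).
pose C := C0 * d%:R `^ g.
have C1 : 0 < C by rewrite mulr_gt0 // powR_gt0.
rewrite (eq_bigr (fun m => (1 * tpoly s (d * m)) * cos (2 * pi * (0 * m%:R + ph + C * m%:R `^ g)))); last first.
  by move=> m _; rewrite /f1 natrM powRM // /C mul1r; congr (_ * cos _); ring.
pose M : R := x%:R / d%:R.
have M0 : 0 < M by rewrite divr_gt0.
have M1 : 1 <= M.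
  by rewrite ler_pdivlMr // mul1r ler_nat (leq_trans dU).
have HP om ph' : `|\sum_((x %/ d).+1 <= m < (y %/ d).+1) 1 * cos (2 * pi * (om * m%:R + ph' + C * m%:R `^ g))| <= x%:R * eta1.
  have -> : x%:R * eta1 = M * (d%:R * eta1) by rewrite /M; field; rewrite gt_eqF.
  under eq_bigr do rewrite mul1r.
  have CM : `|C| * M `^ (g - 1) = T * d%:R.
    rewrite gtr0_norm // /C /M /T powRM ?invr_ge0 //.
    have -> : (d%:R^-1 : R) = d%:R `^ (-1) by rewrite powR_inv1.
    rewrite -powRrM.
    rewrite (_ : C0 * d%:R `^ g * _ = C0 * x%:R `^ (g - 1) * (d%:R `^ g * d%:R `^ (-1 * (g - 1)))); last ring.
    rewrite -powRD; last by rewrite (gt_eqF dR) implybT.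
    by rewrite (_ : g + -1 * (g - 1) = 1) ?powRr1 ?ltW //; ring.
  have dd : d%:R <= (U * U)%N%:R :> R by rewrite ler_nat.
  apply: power_sum => //; rewrite ?CM.
  - by rewrite gt_eqF.
  - by rewrite /M ler_pdivrMr // -natrM ler_nat ltnW // -ltn_divLR.
  - have h : (y %/ d)%N%:R <= 8 * M.
      rewrite /M mulrA ler_pdivlMr // -!natrM ler_nat -Bx (leq_trans _ yB) // leq_trunc_div //.
    by rewrite -natr1; lra.
  - by rewrite mulr_ge0 // ltW.
  - rewrite /M ler_pdivlMr //; apply: le_trans smallT1.
    rewrite (_ : 4 * mu0 * (T * d%:R) * d%:R = 4 * mu0 * T * d%:R ^+ 2); last ring.
    have c0 : 0 <= 4 * mu0 * T by rewrite mulr_ge0 ?(ltW T0) // (mulr_ge0 _ (ltW mu00)).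
    by rewrite ler_wpM2l // ler_pXn2r ?nnegrE ?(ltW dR).
  - apply: (@le_trans _ _ (36 * (T + 4 + 4 / T) * d%:R)).
      have hi : (T * d%:R)^-1 <= T^-1 * d%:R.
        rewrite invfM ler_wpM2l ?invr_ge0 ?(ltW T0) //.
        have dI : d%:R^-1 <= 1 :> R by rewrite invf_le1.
        exact: le_trans dI d1R.
      move: hi; move: (T * d%:R)^-1 (T^-1) => i j hi; lra.
    apply: le_trans (ler_wpM2r (ltW dR) Heta1) _.
    rewrite -/mu0 le_eqVlt /M; apply/orP; left; apply/eqP; field; by rewrite gt_eqF.
exact: (@tpoly_sum R (fun=> 1) (fun m => C * m%:R `^ g) _ _ d _ s HP 0 ph).
Qed.

(** For l <> l' the phase difference is C0 (l^g - l'^g) m^g. On the scale M = x/(2 l0) the mean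
    value theorem puts its size |C| M^(g-1) between gT and 2QT, whatever l0 is. For l = l' the
    polynomial is bounded pointwise by W; its mass would be far too large there. *)
Lemma power_corr l0 : (U < l0 <= Y)%N -> corr_bound B x Q f1 f2 kap l0.
Proof.
move=> /andP[Ul lY]; have l00 : (0 < l0)%N := leq_ltn_trans (leq0n U) Ul.
have Ql : (Q <= l0)%N by rewrite (leq_trans QU) // ltnW.
have l0R : 0 < l0%:R :> R by rewrite ltr0n.
have QR : 0 < Q%:R :> R by rewrite ltr0n.
have lYR : l0%:R <= Y%:R :> R by rewrite ler_nat.
pose M : R := x%:R / (2 * l0%:R).
have M0 : 0 < M by rewrite divr_gt0 // mulr_gt0.
have YR : 0 < Y%:R :> R by exact: lt_le_trans lYR.
have MY : x%:R / (2 * Y%:R) <= M.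
  by rewrite /M ler_wpM2l // lef_pV2 ?posrE ?mulr_gt0 // ler_wpM2l.
have M1 : 1 <= M.
  apply: le_trans MY; rewrite ler_pdivlMr ?mulr_gt0 // mul1r.
  by rewrite -natrM ler_nat.
have A0 := tmass_ge0 s.
have Wn : 0 <= W by apply: le_trans (W0 (n := B) _) => //; rewrite leqnn andbT Bx ltn_Pmull.
rewrite /corr_bound.
pose cut l l' := (maxn (x %/ l) (x %/ l')).+1.
pose cut' l l' := (minn (B %/ l) (B %/ l')).+1.
have bnd l l' : (l0 <= l < l0 + Q)%N -> (l0 <= l' < l0 + Q)%N ->
   `|\sum_(1 <= m < B.+1 | in_range B x l m && in_range B x l' m)
      (f1 (l * m)%N * f1 (l' * m)%N + f2 (l * m)%N * f2 (l' * m)%N)|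
   <= (if l == l' then 16 * W ^+ 2 * M else 0) + tmass s ^+ 2 * eta * M.
  move=> /andP[a1 a2] /andP[a1' a2'].
  have lp : (0 < l)%N := leq_trans l00 a1.
  have lp' : (0 < l')%N := leq_trans l00 a1'.
  have lR : 0 < l%:R :> R by rewrite ltr0n.
  have lR' : 0 < l'%:R :> R by rewrite ltr0n.
  have rest0 : 0 <= tmass s ^+ 2 * eta * M.
    apply: mulr_ge0; last exact: ltW.
    by apply: mulr_ge0 => //; exact: sqr_ge0.
  have HB : (cut' l l' - cut l l')%N%:R <= 16 * M.
    have -> : 16 * M = 8 * x%:R / l0%:R by rewrite /M; field; rewrite gt_eqF.
    rewrite ler_pdivlMr // -!natrM ler_nat -Bx.
    apply: leq_trans (leq_trunc_div B l); apply: leq_mul => //.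
    by rewrite subSS (leq_trans (leq_subr _ _)) // geq_minl.
  have rng m : (1 <= m)%N -> in_range B x l m && in_range B x l' m = (cut l l' <= m < cut' l l')%N.
    move=> m1; rewrite /in_range gtn_max ltnS leq_min !leq_divRL ?ltn_divLR //.
    by rewrite !(mulnC m) andbACA.
  rewrite (@sum_interval R _ _ B (cut l l') (cut' l l')) //; last first.
    by rewrite ltnS (leq_trans (geq_minl _ _)) // leq_div.
  pose C := C0 * (l%:R `^ g - l'%:R `^ g).
  rewrite (eq_bigr (fun m => tpoly s (l * m) * tpoly s (l' * m) * cos (2 * pi * (C * m%:R `^ g)))); last first.
    move=> m _; rewrite /f1 /f2.
    rewrite (_ : 2 * pi * (C * m%:R `^ g) = 2 * pi * (C0 * (l * m)%N%:R `^ g + ph) - 2 * pi * (C0 * (l' * m)%N%:R `^ g + ph)); last first.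
      by rewrite !natrM !powRM // /C; ring.
    rewrite cosB; ring.
  have [e|ne] := eqVneq l l'.
    apply: (@le_trans _ _ (16 * W ^+ 2 * M)); last by rewrite lerDl.
    rewrite mulrAC; apply: le_trans (ler_wpM2r (sqr_ge0 W) HB).
    have -> : (cut' l l' - cut l l')%:R * W ^+ 2 = \sum_(cut l l' <= i < cut' l l') W ^+ 2.
      by rewrite big_const_nat iter_addr_0 mulr_natl.
    apply: le_trans (ler_norm_sum _ _ _) _; rewrite !big_nat; apply: ler_sum => m hm.
    have m1 : (1 <= m)%N by case/andP: hm => h _; exact: leq_trans h.
    move: hm; rewrite -rng // -e andbb => /andP[h1 h2].
    rewrite !normrM -[W ^+ 2]mulr1.
    apply: ler_pM; rewrite ?mulr_ge0 //; last by rewrite ler_norml cos_geN1 cos_le1.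
    by apply: ler_pM; rewrite ?W0 // h1 h2.
  rewrite add0r expr2 -!mulrA.
  rewrite (eq_bigr (fun m => tpoly s (l * m) * tpoly s (l' * m) * cos (2 * pi * (C * m%:R `^ g)))); last by move=> m _; rewrite -!mulrA.
  apply: (@tpoly_corr R (fun m => C * m%:R `^ g)) => om ph'.
  rewrite [leRHS]mulrC.
  have dbl i : (i < l0 + Q)%N -> (i <= 2 * l0)%N.
    by move=> h; rewrite mul2n -addnn (leq_trans (ltnW h)) // leq_add2l.
  have l2 : l%:R <= 2 * l0%:R :> R by rewrite -natrM ler_nat dbl.
  have l2' : l'%:R <= 2 * l0%:R :> R by rewrite -natrM ler_nat dbl.
  have pw (i j : nat) : (l0 <= i)%N -> (i < j)%N -> (j < l0 + Q)%N ->
      g * (2 * l0%:R) `^ (g - 1) <= j%:R `^ g - i%:R `^ g <= g * l0%:R `^ (g - 1) * Q%:R.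
    move=> i1 i2 i3.
    have iR : 0 < i%:R :> R by rewrite ltr0n; exact: leq_trans i1.
    have ij : i%:R < j%:R :> R by rewrite ltr_nat.
    have [z /andP[z1 z2] ->] := powR_mvt g iR ij.
    have li : l0%:R <= i%:R :> R by rewrite ler_nat.
    have jl : j%:R <= 2 * l0%:R :> R by rewrite -natrM ler_nat dbl.
    have d1 : 1 <= j%:R - i%:R :> R by rewrite -natrB ?(ltnW i2) // ler1n subn_gt0.
    have d2 : j%:R - i%:R <= Q%:R :> R by rewrite -natrB ?(ltnW i2) // ler_nat leq_subLR (leq_trans (ltnW i3)) // leq_add2r.
    have z0 : 0 < z by lra.
    have g10 : g - 1 <= 0 by rewrite subr_le0 ltW.
    apply/andP; split.
      rewrite -[leLHS]mulr1; apply: ler_pM => //; rewrite ?mulr_ge0 ?powR_ge0 ?(ltW g0) //.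
      rewrite ler_wpM2l ?(ltW g0) //; apply: ler_powR_neg => //; lra.
    apply: ler_pM => //; rewrite ?mulr_ge0 ?powR_ge0 ?(ltW g0) //; first lra.
    rewrite ler_wpM2l ?(ltW g0) //; apply: ler_powR_neg => //; lra.
  have pw2 : g * (2 * l0%:R) `^ (g - 1) <= `|l%:R `^ g - l'%:R `^ g| <= g * l0%:R `^ (g - 1) * Q%:R.
    case: (ltngtP l l') => h; last by rewrite h eqxx in ne.
      have /andP[q1 q2] := pw _ _ a1 h a2'.
      have p0 : 0 < g * (2 * l0%:R) `^ (g - 1) by rewrite mulr_gt0 // powR_gt0 // mulr_gt0.
      by rewrite distrC gtr0_norm ?q1 // (lt_le_trans p0).
    have /andP[q1 q2] := pw _ _ a1' h a2.
    have p0 : 0 < g * (2 * l0%:R) `^ (g - 1) by rewrite mulr_gt0 // powR_gt0 // mulr_gt0.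
    by rewrite gtr0_norm ?q1 // (lt_le_trans p0).
  have nC : `|C| = C0 * `|l%:R `^ g - l'%:R `^ g| by rewrite /C normrM gtr0_norm.
  have Mp : M `^ (g - 1) * (2 * l0%:R) `^ (g - 1) = x%:R `^ (g - 1).
    have <- : M * (2 * l0%:R) = x%:R by rewrite /M divfK // gt_eqF // mulr_gt0.
    have l2p : 0 <= 2 * l0%:R :> R by rewrite mulr_ge0.
    by rewrite (powRM _ (ltW M0) l2p).
  have two : l0%:R `^ (g - 1) <= 2 * (2 * l0%:R) `^ (g - 1).
    rewrite powRM ?(ltW l0R) // mulrA ler_peMl ?powR_ge0 //.
    have e2 : 2 * 2 `^ (-1) = 1 :> R by rewrite powR_inv1 // divff // pnatr_eq0.
    have g1' : -1 <= g - 1 by move: g12; lra.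
    by rewrite -[leLHS]e2 ler_wpM2l //; apply: ler_powR => //; rewrite ler1n.
  have Mp0 : 0 < M `^ (g - 1) by rewrite powR_gt0.
  have Z1 : g * T <= `|C| * M `^ (g - 1).
    rewrite nC /T -Mp.
    rewrite (_ : g * _ = C0 * M `^ (g - 1) * (g * (2 * l0%:R) `^ (g - 1))); last ring.
    rewrite [leRHS]mulrAC ler_wpM2l ?mulr_ge0 ?(ltW C00) ?(ltW Mp0) //.
    by case/andP: pw2.
  have Z2 : `|C| * M `^ (g - 1) <= 2 * Q%:R * T.
    rewrite nC /T -Mp.
    rewrite (_ : 2 * Q%:R * _ = C0 * M `^ (g - 1) * ((2 * (2 * l0%:R) `^ (g - 1)) * Q%:R)); last ring.
    rewrite [leLHS]mulrAC ler_wpM2l ?mulr_ge0 ?(ltW C00) ?(ltW Mp0) //.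
    case/andP: pw2 => _ h; apply: le_trans h _; rewrite ler_wpM2r ?(ltW QR) //.
    apply: le_trans two; rewrite ler_piMl ?powR_ge0 ?(ltW g1) //.
  have Z0 : 0 < `|C| * M `^ (g - 1) by apply: lt_le_trans Z1; rewrite mulr_gt0.
  apply: power_sum => //.
  - by apply/eqP => h; rewrite h normr0 mul0r ltxx in Z0.
  - rewrite /M ler_pdivrMr ?mulr_gt0 //.
    apply: (@le_trans _ _ ((cut l l')%:R * l%:R)); last by rewrite ler_wpM2l.
    rewrite -natrM ler_nat ltnW // -ltn_divLR //.
    by rewrite /cut ltnS leq_maxl.
  - have h : (minn (B %/ l) (B %/ l'))%N%:R <= 16 * M.
      have -> : 16 * M = 8 * x%:R / l0%:R by rewrite /M; field; rewrite gt_eqF.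
      rewrite ler_pdivlMr // -!natrM ler_nat -Bx.
      apply: leq_trans (leq_trunc_div B l); apply: leq_mul => //.
      by rewrite geq_minl.
    by rewrite /cut' -natr1; move: h M1; set m := (minn _ _)%:R; lra.
  - apply: le_trans MY; apply: le_trans smallT; rewrite -/mu0.
    rewrite (_ : 8 * mu0 * _ * _ = 4 * mu0 * (2 * Q%:R * T)); last ring.
    by rewrite ler_wpM2l // mulr_ge0 // ltW.
  - rewrite -/mu0.
    have h1 : 4 / (`|C| * M `^ (g - 1)) <= 8 / T.
      rewrite ler_pdivrMr // mulrAC ler_pdivlMr //.
      have := Z1; have : 1 / 2 * T <= g * T by rewrite ler_wpM2r // ltW.
      by lra.
    have h2 : eta ^+ 2 * mu0 * (x%:R / (2 * Y%:R)) <= eta ^+ 2 * mu0 * M.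
      by rewrite ler_wpM2l // mulr_ge0 ?sqr_ge0 // ltW.
    by move: Heta; lra.
apply: (@le_trans _ _ (\sum_(l0 <= l < l0 + Q) (16 * W ^+ 2 * M + Q%:R * (tmass s ^+ 2 * eta * M)))).
  rewrite !big_nat; apply: ler_sum => l hl.
  apply: (@le_trans _ _ (\sum_(l0 <= l' < l0 + Q) ((if l == l' then 16 * W ^+ 2 * M else 0) + tmass s ^+ 2 * eta * M))).
    by rewrite !big_nat; apply: ler_sum => l' hl'; exact: bnd.
  rewrite big_split /=; apply: lerD; last first.
    by rewrite big_const_nat iter_addr_0 addKn mulr_natl.
  rewrite -big_mkcond /= (big_nat_widenl _ 0) //= (big_nat_widen _ _ (maxn l.+1 (l0 + Q))) ?leq_maxr //=.
  rewrite (eq_bigl (fun i => i == l)); last first.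
    by move=> i; rewrite eq_sym; case: eqVneq => [->|]; rewrite ?hl //= -?hl; case/andP: hl => -> ->.
  by rewrite big_nat1_eq /= leq_max ltnSn.
rewrite big_const_nat iter_addr_0 addKn -[_ *+ Q]mulr_natr.
have h := ler_wpM2r (mulr_ge0 (ltW QR) (divr_ge0 (ltW xR) (ltW l0R))) Hkap.
rewrite (_ : _ * Q%:R = (8 * W ^+ 2 + tmass s ^+ 2 * eta * Q%:R / 2) * (Q%:R * (x%:R / l0%:R))); last first.
  by rewrite /M; field; rewrite gt_eqF.
by apply: le_trans h _; rewrite le_eqVlt; apply/orP; left; apply/eqP; ring.
Qed.

Lemma power_prime_sum :
  `|\sum_(1 <= n < B.+1 | (x < n)%N) Lam n * (tpoly s n * cos (2 * pi * (C0 * n%:R `^ g + ph)))| <=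
   5 * Lg * ((U * U)%N%:R * (tmass s * (x%:R * eta1))) + 20 * Lg ^+ 2 * CT * kap * x%:R.
Proof.
have Ux' : (U <= x)%N.
  apply: leq_trans Ux; have : (0 < U)%N := leq_trans Q0 QU.
  by case: (U) => // n _; rewrite leq_pmulr.
have UB : (U * U <= B)%N by rewrite (leq_trans Ux) // Bx leq_pmull.
have h := @prime_sum_bound x B U Q Y f1 f2 (fun=> tmass s * (x%:R * eta1)) Lg CT kap x0 Bx Q0 QU
  Ux' UB BY YB Lg0 HL Hh CT0 HT kap0 _ power_type_one power_corr.
apply: le_trans (h _) _.
  by move=> _; rewrite mulr_ge0 ?tmass_ge0 // mulr_ge0.
rewrite lerD2r; apply: ler_wpM2l; first by rewrite mulr_ge0 // ltW.
by rewrite big_const_nat iter_addr_0 subn1 /= [leRHS]mulr_natl.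
Qed.

End Power.
End PrimeSums.

(** * Selberg's sieve *)

Section ArithmeticWeights.
Variable R : realType.
Local Notation lnn := (fun n : nat => ln (n%:R : R)).

Lemma sum_divisors_prime_mul (V : nmodType) (p m B : nat) (F : nat -> V) :
  prime p -> (0 < m)%N -> ~~ (p %| m)%N -> (p * m <= B)%N ->
  \sum_(1 <= d < B.+1 | (d %| p * m)%N) F d =
  \sum_(1 <= d < B.+1 | (d %| m)%N) F d + \sum_(1 <= d < B.+1 | (d %| m)%N) F (p * d)%N.
Proof.
move=> pp m0 pm pmB; have p0 := prime_gt0 pp.
have cop d : (d %| m)%N -> coprime p d.
  by move=> dm; rewrite prime_coprime //; apply: contra pm => h; exact: dvdn_trans h dm.
rewrite (bigID (fun d => p %| d)%N) /= sum_multiples // addrC; congr (_ + _).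
  apply: eq_bigl => d; case pd : (p %| d)%N; rewrite ?andbF ?andbT.
    by apply/esym/negbTE; apply: contra pm => h; exact: dvdn_trans h.
  by rewrite Gauss_dvdr // coprime_sym prime_coprime // pd.
apply: eq_bigl => d; rewrite dvdn_pmul2l // andb_idl // => dm.
by apply: leq_trans pmB; rewrite leq_mul2l dvdn_leq ?orbT.
Qed.

Lemma squarefree_split p m : prime p -> (0 < m)%N -> squarefree (p * m) -> ~~ (p %| m)%N /\ squarefree m.
Proof.
move=> pp m0; have p0 := prime_gt0 pp.
have pm0 : (0 < p * m)%N by rewrite muln_gt0 p0.
move=> /(squarefreeP pm0) H; split.
  by apply: contra (H p pp) => h; rewrite expnS expn1 dvdn_pmul2l.
by apply/(squarefreeP m0) => q qq; apply: contra (H q qq) => h; exact: dvdn_mull.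
Qed.

Lemma squarefree_dvd d m : (0 < m)%N -> (d %| m)%N -> squarefree m -> squarefree d.
Proof.
move=> m0 dm /(squarefreeP m0) H; apply/(squarefreeP (dvdn_gt0 m0 dm)) => q qq.
by apply: contra (H q qq) => h; exact: dvdn_trans h dm.
Qed.

Lemma prime_factor n : (1 < n)%N -> exists p m, [/\ prime p, (0 < m)%N, (m < n)%N & n = (p * m)%N].
Proof.
move=> n1; have pp := pdiv_prime n1; exists (pdiv n), (n %/ pdiv n)%N.
have pn := pdiv_dvd n; have n0 : (0 < n)%N := ltnW n1.
split => //.
- by rewrite divn_gt0 ?pdiv_gt0 // dvdn_leq.
- by rewrite ltn_Pdiv // prime_gt1.
- by rewrite mulnC divnK.
Qed.

Definition wt r : R := if squarefree r then (totient r)%:R^-1 else 0.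

Lemma wt_ge0 r : 0 <= wt r. Proof. by rewrite /wt; case: ifP => // _; rewrite invr_ge0. Qed.

Lemma wt_le1 r : wt r <= 1.
Proof.
rewrite /wt; case: ifP => // /andP[r0 _].
by rewrite invf_le1 ?ler1n ?ltr0n totient_gt0.
Qed.

Lemma wt_prime_mul p m : prime p -> (0 < m)%N -> ~~ (p %| m)%N -> wt (p * m) = wt m / p.-1%:R.
Proof.
move=> pp m0 pm; rewrite /wt squarefree_prime_mul //; case: ifP => _; last by rewrite mul0r.
by rewrite totient_coprime ?prime_coprime // totient_prime // natrM invfM mulrC.
Qed.

Lemma prime_pred_gt0 p : prime p -> 0 < p.-1%:R :> R.
Proof. by move=> pp; rewrite ltr0n -subn1 subn_gt0 prime_gt1. Qed.

Lemma prime_predE p : prime p -> p.-1%:R = p%:R - 1 :> R.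
Proof. by move=> pp; rewrite -subn1 natrB // prime_gt0. Qed.

(** For squarefree r this comes from r/phi(r) being the sum of 1/phi(d) over d | r, built one prime
    at a time; for other r the left side is 0. *)
Lemma wt_le_sum r B : (0 < r)%N -> (r <= B)%N ->
  r%:R * wt r <= \sum_(1 <= d < B.+1 | (d %| r)%N) wt d.
Proof.
elim/ltn_ind: r => r IH r0 rB; case: (ltnP 1 r) => r1; last first.
  have B0 := leq_trans r0 rB; have -> : r = 1%N by lia.
  rewrite [leRHS]big_mkcond [leRHS]big_ltn ?ltnS //= [leLHS]mul1r lerDl; apply: sumr_ge0 => d _.
  by case: ifP => // _; exact: wt_ge0.
have [p [m [pp m0 mr rE]]] := prime_factor r1.
case sq : (squarefree r); last first.
  by rewrite {1}/wt sq mulr0; apply: sumr_ge0 => d _; exact: wt_ge0.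
rewrite rE in sq; have [pm sm] := squarefree_split pp m0 sq.
rewrite rE in rB *; rewrite sum_divisors_prime_mul // wt_prime_mul //.
have p1 := prime_pred_gt0 pp.
rewrite [X in _ + X](eq_bigr (fun d => wt d / p.-1%:R)); last first.
  move=> d dm; rewrite wt_prime_mul ?(dvdn_gt0 m0 dm) //.
  by apply: contra pm => h; exact: dvdn_trans h dm.
rewrite -mulr_suml.
have := IH m mr m0 (leq_trans (ltnW mr) _); rewrite rE => /(_ rB).
set s := \sum_(_ <= _ < _ | _) _ => h.
have -> : (p * m)%N%:R * (wt m / p.-1%:R) = (m%:R * wt m) * (1 + p.-1%:R^-1).
  rewrite natrM prime_predE // in p1 *; field; by rewrite gt_eqF.
rewrite -[X in _ <= X + _]mulr1 -mulrDr; apply: ler_wpM2r => //.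
by rewrite addr_ge0 // invr_ge0 ltW.
Qed.

Lemma wt_le_tau r : (0 < r)%N -> r%:R * wt r <= (tau r)%:R.
Proof.
move=> r0; apply: le_trans (wt_le_sum r0 (leqnn r)) _.
by rewrite -(tau_sum R r0 (leqnn r)); apply: ler_sum => d _; exact: wt_le1.
Qed.

Definition primorial k := \prod_(1 <= p < k.+1 | prime p) p.

Lemma primorial_gt0 k : (0 < primorial k)%N.
Proof. by rewrite /primorial; apply: prodn_cond_gt0 => p; exact: prime_gt0. Qed.

Lemma primorial_notdvd k p : prime p -> (k < p)%N -> ~~ (p %| primorial k)%N.
Proof.
move=> pp kp; rewrite /primorial big_nat_cond; apply: (big_ind (fun n => ~~ (p %| n)%N)).
- by rewrite dvdn1 neq_ltn prime_gt1 ?orbT.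
- by move=> a b pa pb; rewrite Euclid_dvdM // negb_or pa.
- move=> q /andP[/andP[q1 qk] qq]; rewrite dvdn_prime2 // neq_ltn.
  by rewrite (leq_trans (_ : (q < k.+1)%N) kp) ?orbT.
Qed.

Lemma primorialS k : primorial k.+1 = if prime k.+1 then (k.+1 * primorial k)%N else primorial k.
Proof. by rewrite /primorial big_mkcond big_nat_recr //= -big_mkcond; case: ifP => _; [exact: mulnC|exact: muln1]. Qed.

Lemma primorial_dvd k n : squarefree n -> (forall p, prime p -> (p %| n)%N -> (p <= k)%N) -> (n %| primorial k)%N.
Proof.
elim/ltn_ind: n => n IH sn H; have n0 : (0 < n)%N by case/andP: sn.
case: (ltnP 1 n) => n1; last by have -> : n = 1%N by lia; exact: dvd1n.
have [p [m [pp m0 mr nE]]] := prime_factor n1.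
rewrite nE in sn; have [pm sm] := squarefree_split pp m0 sn.
rewrite nE Gauss_dvd ?prime_coprime //; apply/andP; split; last first.
  by apply: IH => // q qq qm; apply: H => //; rewrite nE dvdn_mull.
have pk : (p <= k)%N by apply: H => //; rewrite nE dvdn_mulr.
rewrite /primorial; have : p \in index_iota 1 k.+1 by rewrite mem_index_iota prime_gt0 // ltnS.
by move=> h; rewrite (big_rem p) //= pp dvdn_mulr.
Qed.

Definition euler_const : R := 441 / 200.

(** A bound for the product of 1 + 1/(p(p-1)) over the primes p <= k. Up to k = 6 it is the exact
    product. Beyond, (1 + 1/(k(k+1)))(1 - 1/k) <= 1 - 1/(k+1) treats every integer as if it were
    prime, and 6/5 = 1/(1 - 1/6) joins the two ranges. *)
Definition euler_bound k : R :=
  if (k <= 6)%N then nth 0 [:: 1; 1; 3/2; 7/4; 7/4; 147/80; 147/80] k else 147/80 * (6/5) * (1 - k%:R^-1).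

Lemma euler_bound_mono k : euler_bound k <= euler_bound k.+1.
Proof.
rewrite /euler_bound; case: k => [|[|[|[|[|[|[|k]]]]]]] //=; try lra.
have h : k.+4.+4%:R^-1 <= k.+4.+3%:R^-1 :> R by rewrite lef_pV2 ?posrE ?ltr0n // ler_nat.
move: h; set u := k.+4.+4%:R^-1; set v := k.+4.+3%:R^-1; lra.
Qed.

Lemma euler_bound_prime k : prime k.+1 -> (1 + (k.+1%:R * (k.+1%:R - 1))^-1) * euler_bound k <= euler_bound k.+1.
Proof.
rewrite /euler_bound; case: k => [|[|[|[|[|[|[|k]]]]]]] //= _.
- by have -> : (2 * (2 - 1))^-1 = 1/2 :> R; [field|lra].
- by have -> : (3 * (3 - 1))^-1 = 1/6 :> R; [field|lra].
- by have -> : (5 * (5 - 1))^-1 = 1/20 :> R; [field|lra].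
- by have -> : (7 * (7 - 1))^-1 = 1/42 :> R; [field|lra].
have kR : 7 <= k.+4.+3%:R :> R by rewrite ler_nat.
rewrite -[k.+4.+4%:R]natr1; move: k.+4.+3%:R kR => z zR; rewrite addrK.
rewrite [leLHS](mulrCA _ (147/80*(6/5))); apply: ler_wpM2l; first lra.
rewrite -subr_ge0 (_ : _ - _ = ((z + 1) * z ^+ 2)^-1); last first.
  by field; apply/andP; split; apply/eqP; lra.
by rewrite invr_ge0 mulr_ge0 ?exprn_ge0 //; lra.
Qed.

Lemma euler_bound_le k : euler_bound k <= euler_const.
Proof.
rewrite /euler_bound /euler_const; case: k => [|[|[|[|[|[|[|k]]]]]]] //=; try lra.
have N0 : (0 : R) <= k.+4.+3%:R^-1 by rewrite invr_ge0.
move: N0; set u := k.+4.+3%:R^-1; lra.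
Qed.

Lemma primorial_sum k B : (primorial k <= B)%N ->
  \sum_(1 <= d < B.+1 | (d %| primorial k)%N) wt d / d%:R <= euler_bound k.
Proof.
have step j : (primorial j.+1 <= B)%N -> prime j.+1 ->
    \sum_(1 <= d < B.+1 | (d %| primorial j.+1)%N) wt d / d%:R =
    (1 + (j.+1%:R * (j.+1%:R - 1))^-1) * \sum_(1 <= d < B.+1 | (d %| primorial j)%N) wt d / d%:R.
  rewrite primorialS => jB pj; rewrite pj in jB *.
  rewrite sum_divisors_prime_mul ?primorial_gt0 ?primorial_notdvd //.
  rewrite mulrDl mul1r; congr (_ + _); rewrite mulr_sumr; apply: eq_bigr => d dj.
  rewrite wt_prime_mul ?(dvdn_gt0 (primorial_gt0 j) dj) //; last first.
    by apply: contra (primorial_notdvd pj (ltnSn j)) => h; exact: dvdn_trans h dj.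
  by rewrite prime_predE // natrM !invfM; ring.
have mono j : (primorial j.+1 <= B)%N -> (primorial j <= B)%N.
  by apply: leq_trans; rewrite primorialS; case: ifP => // _; rewrite leq_pmull.
have p0 : primorial 0 = 1%N by rewrite /primorial big_geq.
elim: k => [|k IH] kB.
  rewrite p0 (eq_bigl (fun d => d == 1%N)); last by move=> d; rewrite dvdn1.
  rewrite p0 in kB; rewrite big_nat1_eq /= ltnS kB divr1; exact: wt_le1.
have {}IH := IH (mono _ kB).
have s0 : 0 <= \sum_(1 <= d < B.+1 | (d %| primorial k)%N) wt d / d%:R.
  by apply: sumr_ge0 => d _; rewrite divr_ge0 ?wt_ge0.
case pk : (prime k.+1); last first.
  by move: kB; rewrite primorialS pk => kB; exact: le_trans IH (euler_bound_mono k).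
rewrite step //; apply: le_trans (euler_bound_prime pk).
apply: ler_wpM2l => //; rewrite addr_ge0 // invr_ge0 mulr_ge0 // subr_ge0 ler1n //.
Qed.

Lemma wt_over_sum N : \sum_(1 <= d < N.+1) wt d / d%:R <= euler_const.
Proof.
pose B := maxn N (primorial N).
have h0 d : 0 <= wt d / d%:R by rewrite divr_ge0 ?wt_ge0.
apply: (@le_trans _ _ (\sum_(1 <= d < B.+1 | (d %| primorial N)%N) wt d / d%:R)).
  rewrite [leRHS]big_mkcond (big_cat_nat (n := N.+1)) //=; last by rewrite ltnS leq_maxl.
  rewrite -[leLHS]addr0; apply: lerD; last by apply: sumr_ge0 => d _; case: ifP.
  rewrite !big_nat; apply: ler_sum => d /andP[d1 dN].
  case: ifP => // /negbT; rewrite /wt; case: ifP => [sq|_]; last by rewrite mul0r.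
  rewrite primorial_dvd // => p pp pd; apply: leq_trans (dvdn_leq d1 pd) _; exact: dN.
exact: le_trans (primorial_sum (leq_maxr _ _)) (euler_bound_le N).
Qed.

Lemma inv_le_ln_diff (k : nat) : (0 < k)%N -> k.+1%:R^-1 <= lnn k.+1 - lnn k.
Proof.
move=> k0; have kR : 0 < k%:R :> R by rewrite ltr0n.
have k1R : 0 < k.+1%:R :> R by rewrite ltr0n.
rewrite -lerN2 opprB -ln_div ?posrE //.
have -> : k%:R / k.+1%:R = 1 + (- k.+1%:R^-1) :> R.
  by rewrite -[k.+1%:R]natr1; field; rewrite natr1 gt_eqF.
by apply: le_ln1Dx; rewrite ltrN2 invf_lt1 // ltr1n ltnS.
Qed.

Lemma harmonic_interval (A B p : nat) : (0 < p)%N -> (0 < A)%N -> (B <= p * A)%N ->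
  \sum_(A <= m < B.+1) m%:R^-1 <= 1 + lnn p.
Proof.
move=> p0 A0 BA; have lp : 0 <= lnn p by rewrite ln_ge0 // ler1n.
have [AB|BltA] := leqP A B; last by rewrite big_geq // addr_ge0.
have h : \sum_(A <= m < B.+1) m%:R^-1 <= 1 + lnn B - lnn A.
  elim: B AB {BA} => [|B IH] AB; first lia.
  have [AB'|] := leqP A B.
    rewrite big_nat_recr //=.
    rewrite (_ : _ - _ = (1 + lnn B - lnn A) + (lnn B.+1 - lnn B)); last ring.
    by apply: lerD; [exact: IH|apply: inv_le_ln_diff; exact: leq_trans AB'].
  move=> BA; have -> : A = B.+1 by lia.
  rewrite big_nat1 addrK invf_le1 ?ler1n ?ltr0n //.
apply: le_trans h _; rewrite -addrA lerD2l lerBlDr -lnM ?posrE ?ltr0n //.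
have B0 : (0 < B)%N := leq_trans A0 AB.
by rewrite ler_ln ?posrE -?natrM ?ltr0n ?muln_gt0 ?p0 // ler_nat.
Qed.

(** By [wt_le_sum], wt(r) is at most the sum of (wt(d)/d)(1/m) over dm = r. For fixed d the range
    N/(dp) < m <= N/d gives at most 1 + ln p, and the sum of wt(d)/d is bounded by the Euler
    product. Having ln p here in place of ln N is what makes small primes cheap in the sieve. *)
Lemma wt_tail (N p : nat) : (0 < p)%N ->
  \sum_(1 <= r < N.+1 | (N < r * p)%N) wt r <= euler_const * (1 + lnn p).
Proof.
move=> p0.
apply: (@le_trans _ _ (\sum_(1 <= r < N.+1 | (N < r * p)%N) \sum_(1 <= d < N.+1 | (d %| r)%N)
   wt d / d%:R * (r %/ d)%:R^-1)).
  rewrite big_nat_cond [leRHS]big_nat_cond; apply: ler_sum => r /andP[/andP[r1 rN] _].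
  have rR : 0 < r%:R :> R by rewrite ltr0n.
  rewrite -(ler_pM2l rR); apply: le_trans (wt_le_sum r1 rN) _.
  rewrite mulr_sumr; apply: ler_sum => d dr.
  have d0 : (0 < d)%N := dvdn_gt0 r1 dr.
  rewrite -{1}(divnK dr) natrM le_eqVlt; apply/orP; left; apply/eqP; field.
  by rewrite !pnatr_eq0 -!lt0n d0 divn_gt0 // dvdn_leq.
rewrite (@sum_divisor_switch _ N (fun r => (N < r * p)%N) (fun d m => wt d / d%:R * m%:R^-1)).
apply: (@le_trans _ _ (\sum_(1 <= d < N.+1) wt d / d%:R * (1 + lnn p))).
  rewrite !big_nat; apply: ler_sum => d /andP[d1 dN].
  rewrite -mulr_sumr; apply: ler_wpM2l; first by rewrite divr_ge0 ?wt_ge0.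
  rewrite (@sum_interval R _ _ N (N %/ (d * p)).+1 (N %/ d).+1) ?ltnS ?leq_div //.
    apply: harmonic_interval => //.
    by rewrite mulnC divnMA ltnW // ltn_ceil.
  by move=> l l1; rewrite ltnS leq_divRL // ltn_divLR ?muln_gt0 ?d1 // andbC !(mulnC l) mulnAC.
rewrite -mulr_suml; apply: ler_wpM2r; last exact: wt_over_sum.
by rewrite addr_ge0 // ln_ge0 // ler1n.
Qed.

Definition rad n := \prod_(p <- primes n) p.

Lemma rad_prime_mul p n : prime p -> (0 < n)%N ->
  rad (p * n) = if (p %| n)%N then rad n else (p * rad n)%N.
Proof.
move=> pp n0; have p0 := prime_gt0 pp; case: ifP => pn.
  congr (\prod_(p <- _) p); apply/eq_primes => q.
  rewrite primesM // primes_prime // inE; case: eqP => //= ->.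
  by rewrite mem_primes pp n0 pn.
rewrite /rad (perm_big _ (primes_prime_mul pp n0 (negbT pn))) big_cons //.
Qed.

Lemma rad_facts n : (0 < n)%N -> squarefree (rad n) /\ (rad n <= n)%N.
Proof.
elim/ltn_ind: n => n IH n0; case: (ltnP 1 n) => n1; last first.
  have -> : n = 1%N by lia.
  by rewrite /rad big_nil.
have [p [m [pp m0 mr nE]]] := prime_factor n1.
have [sm rm] := IH m mr m0.
have radd k : (0 < k)%N -> forall q, prime q -> (q %| rad k)%N -> (q %| k)%N.
  move=> k0 q qq; rewrite /rad big_seq; apply: (big_ind (fun r => (q %| r)%N -> (q %| k)%N)).
  - by rewrite dvdn1 => /eqP q1; rewrite q1 in qq.
  - by move=> a b ha hb; rewrite Euclid_dvdM // => /orP[].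
  - by move=> r; rewrite mem_primes => /and3P[rr _ rk]; rewrite dvdn_prime2 // => /eqP ->.
rewrite nE rad_prime_mul //; case: ifP => pm.
  by split=> //; rewrite (leq_trans rm) // leq_pmull // prime_gt0.
split; last by rewrite leq_mul2l rm orbT.
rewrite squarefree_prime_mul //; first by case/andP: sm.
by apply/negP => /(radd _ m0 _ pp); rewrite pm.
Qed.

(** A number of radical pm is pl with l of radical pm or m; hence p F(pm) <= F(pm) + F(m) for the
    class sums F, which is a division by p - 1. *)
Lemma radical_class_sum r X : squarefree r ->
  \sum_(1 <= n < X.+1 | rad n == r) n%:R^-1 <= wt r.
Proof.
elim/ltn_ind: r X => r IH X sr; have r0 : (0 < r)%N by case/andP: sr.
case: (ltnP 1 r) => r1; last first.
  have -> : r = 1%N by lia.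
  rewrite /wt /= [leRHS]invr1.
  apply: (@le_trans _ _ (\sum_(1 <= n < X.+1 | n == 1%N) n%:R^-1)).
    rewrite [leLHS]big_mkcond [leRHS]big_mkcond !big_nat; apply: ler_sum => n /andP[n1 _].
    case: eqP => rn; last by case: ifP; rewrite // invr_ge0.
    case: (ltnP 1 n) => h.
      have [p [m [pp m0 mr nE]]] := prime_factor h.
      have : (p %| rad n)%N.
        rewrite /rad; have : p \in primes n by rewrite mem_primes pp n1 nE dvdn_mulr.
        by move=> hp; rewrite (big_rem p) //= dvdn_mulr.
      by rewrite rn dvdn1 => /eqP p1; rewrite p1 in pp.
    by rewrite (_ : n == 1%N); last lia.
  by rewrite big_nat1_eq; case: ifP => _ //; rewrite invr1.
have [p [m [pp m0 mr rE]]] := prime_factor r1.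
rewrite rE in sr *; have [pm sm] := squarefree_split pp m0 sr.
have p0 := prime_gt0 pp.
pose Fs s Y : R := \sum_(1 <= n < Y.+1 | rad n == s) n%:R^-1.
have F0 s Y : 0 <= Fs s Y by apply: sumr_ge0 => n _; rewrite invr_ge0.
have pR : 0 < p%:R :> R by rewrite ltr0n.
have rec : p%:R * Fs (p * m)%N X <= Fs (p * m)%N X + Fs m X.
  rewrite /Fs [X in p%:R * X](eq_bigl (fun n => (rad n == p * m)%N && (p %| n)%N)); last first.
    move=> n; case: eqP => //= rn; apply/esym; case: (posnP n) => [->|n0]; first exact: dvdn0.
    have : (p %| rad n)%N by rewrite rn dvdn_mulr.
    rewrite /rad; case pn : (p %| n)%N => // h; exfalso; move: h; apply/negP.
    rewrite big_seq; apply: (big_ind (fun r => ~~ (p %| r)%N)).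
    - by rewrite dvdn1 neq_ltn prime_gt1 ?orbT.
    - by move=> a b pa pb; rewrite Euclid_dvdM // negb_or pa.
    - move=> q; rewrite mem_primes => /and3P[qq _ qn]; rewrite dvdn_prime2 //.
      by apply/eqP => e; rewrite e qn in pn.
  rewrite [X in p%:R * X]sum_multiples // mulr_sumr.
  rewrite [leLHS]big_mkcond [X in _ <= X + _]big_mkcond [X in _ <= _ + X]big_mkcond -big_split /= !big_nat.
  apply: ler_sum => l /andP[l1 lX]; have lR : 0 < l%:R :> R by rewrite ltr0n.
  have i0 : 0 <= l%:R^-1 :> R by rewrite invr_ge0.
  have i1 (b : bool) : 0 <= (if b then l%:R^-1 else 0) :> R by case: b.
  case: ifP => [/andP[_ h]|_]; last by rewrite addr_ge0.
  have -> : p%:R * (p * l)%N%:R^-1 = l%:R^-1 :> R by rewrite natrM invfM mulrA divff ?mul1r // gt_eqF.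
  move: h; rewrite rad_prime_mul //; case: (p %| l)%N.
    by move=> ->; rewrite lerDl.
  by rewrite eqn_pmul2l // => ->; rewrite lerDr.
have := IH m mr X sm; rewrite -/(Fs m X) wt_prime_mul // => h.
rewrite ler_pdivlMr ?prime_pred_gt0 // prime_predE // -/(Fs _ _) mulrBr mulr1 mulrC.
rewrite lerBlDl; apply: le_trans rec _; by rewrite lerD2l.
Qed.

(** The harmonic sum up to N is grouped by radicals, which are squarefree and at most N. *)
Lemma wt_sum_ge_ln N : (0 < N)%N -> lnn N <= \sum_(1 <= r < N.+1) wt r.
Proof.
move=> N0.
have h K : lnn K.+1 <= harm R K.
  elim: K => [|K IH]; first by rewrite ln1 harm_ge0.
  have -> : harm R K.+1 = harm R K + K.+1%:R^-1 by rewrite /harm big_nat_recr.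
  rewrite -lerBlDl; have := lerD IH (lexx (lnn K.+2 - lnn K.+1)).
  rewrite addrC subrK => h1; rewrite lerBlDl; apply: le_trans h1 _; rewrite lerD2l.
  have kR : 0 < K.+1%:R :> R by rewrite ltr0n.
  rewrite -ln_div ?posrE ?ltr0n //.
  have -> : K.+2%:R / K.+1%:R = 1 + K.+1%:R^-1 :> R.
    by rewrite -[K.+2%:R]natr1 mulrDl mul1r divff ?gt_eqF.
  by apply: le_ln1Dx; rewrite (lt_le_trans (ltrN10 R)) // invr_ge0.
have hN : lnn N <= harm R N.
  case: N N0 => // N _; apply: le_trans (h N) _.
  by rewrite [leRHS]/harm big_nat_recr //= lerDl invr_ge0.
apply: le_trans hN _.
apply: (@le_trans _ _ (\sum_(1 <= r < N.+1) \sum_(1 <= n < N.+1 | rad n == r) (if squarefree r then n%:R^-1 else 0))).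
  rewrite (exchange_big_dep xpredT) //= /harm !big_nat; apply: ler_sum => n /andP[n1 nN].
  have [sr rn] := rad_facts n1.
  rewrite (eq_bigl (fun r => r == rad n)) => [|r]; last by rewrite eq_sym.
  rewrite big_nat1_eq sr (leq_ltn_trans rn nN).
  by case/andP: sr => ->.
apply: ler_sum => r _; case sr : (squarefree r); last by rewrite big1 // wt_ge0.
exact: radical_class_sum.
Qed.

End ArithmeticWeights.

(** * The quadratic form of the sieve *)

Section SelbergForm.
Variables (R : realType) (N : nat).
Hypothesis N0 : (0 < N)%N.
Local Notation wt := (@wt R).
Local Notation lnn := (fun n : nat => ln (n%:R : R)).

Lemma lcm3_identity d1 d2 e : (0 < d1)%N -> (0 < d2)%N -> (0 < e)%N ->
  (lcmn (lcmn d1 d2) e * (gcdn d1 e * gcdn d2 e * gcdn (d1 %/ gcdn d1 e) (d2 %/ gcdn d2 e)) = e * (d1 * d2))%N.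
Proof.
move=> h1 h2 h0; set g1 := gcdn d1 e; set g2 := gcdn d2 e.
have g10 : (0 < g1)%N by rewrite gcdn_gt0 h1.
have g20 : (0 < g2)%N by rewrite gcdn_gt0 h2.
have E1 : lcmn d1 e = (e * (d1 %/ g1))%N.
  by rewrite /lcmn -/g1 muln_divA ?dvdn_gcdl // mulnC.
have E2 : lcmn d2 e = (e * (d2 %/ g2))%N.
  by rewrite /lcmn -/g2 muln_divA ?dvdn_gcdl // mulnC.
have -> : lcmn (lcmn d1 d2) e = (e * lcmn (d1 %/ g1) (d2 %/ g2))%N.
  by rewrite muln_lcmr -E1 -E2 lcmnACA [lcmn e e]/lcmn gcdnn mulnK.
rewrite -[in RHS](divnK (dvdn_gcdl d1 e : g1 %| d1)%N) -[in RHS](divnK (dvdn_gcdl d2 e : g2 %| d2)%N).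
have := muln_lcm_gcd (d1 %/ g1) (d2 %/ g2); set l := lcmn _ _; set g := gcdn _ _.
set a := (d1 %/ g1)%N; set b := (d2 %/ g2)%N => h.
rewrite (_ : (a * g1 * (b * g2) = a * b * (g1 * g2))%N); last ring.
rewrite -h; ring.
Qed.

Lemma sum_totient n B : (0 < n)%N -> (n <= B)%N ->
  \sum_(1 <= r < B.+1 | (r %| n)%N) totient r = n.
Proof.
move=> n0 nB; rewrite (@sum_divisors_widen _ n B totient) // -[RHS](sum_totient_dvd n).
rewrite -(big_mkord (fun d => d %| n)%N) [RHS]big_ltn_cond //= dvd0n.
by rewrite gtn_eqF.
Qed.

Definition shifted_sum (a : nat -> R) e r : R :=
  \sum_(1 <= d < N.+1 | (r %| d %/ gcdn d e)%N) a d * (gcdn d e)%:R / d%:R.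

(** By [lcm3_identity], 1/[d1, d2, e] is 1/e times a factor in d1, a factor in d2 and one gcd;
    writing this gcd as the sum of phi(r) over its divisors makes the form diagonal. *)
Lemma lcm_form_diag (a : nat -> R) e : (0 < e)%N ->
  \sum_(1 <= d1 < N.+1) \sum_(1 <= d2 < N.+1) a d1 * a d2 / (lcmn (lcmn d1 d2) e)%:R =
  e%:R^-1 * \sum_(1 <= r < N.+1) (totient r)%:R * shifted_sum a e r ^+ 2.
Proof.
move=> e0; have eR : e%:R != 0 :> R by rewrite pnatr_eq0 -lt0n.
have E d1 d2 : (1 <= d1 < N.+1)%N -> (1 <= d2 < N.+1)%N ->
    a d1 * a d2 / (lcmn (lcmn d1 d2) e)%:R = e%:R^-1 *
    \sum_(1 <= r < N.+1) (totient r)%:R * ((if (r %| d1 %/ gcdn d1 e)%N then a d1 * (gcdn d1 e)%:R / d1%:R else 0) *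
      (if (r %| d2 %/ gcdn d2 e)%N then a d2 * (gcdn d2 e)%:R / d2%:R else 0)).
  move=> /andP[h1 h1'] /andP[h2 h2'].
  have I := lcm3_identity h1 h2 e0.
  set g1 := gcdn d1 e in I *; set g2 := gcdn d2 e in I *.
  have g10 : (0 < g1)%N by rewrite gcdn_gt0 h1.
  have g20 : (0 < g2)%N by rewrite gcdn_gt0 h2.
  set g := gcdn _ _ in I; set l := lcmn _ _ in I *.
  have l0 : (0 < l)%N by rewrite !lcmn_gt0 h1 h2.
  have q1 : (0 < d1 %/ g1)%N by rewrite divn_gt0 // dvdn_leq // dvdn_gcdl.
  have gg : (0 < g)%N by rewrite gcdn_gt0 q1.
  have gN : (g <= N)%N.
    by rewrite (leq_trans (dvdn_leq q1 (dvdn_gcdl _ _))) // (leq_trans (leq_div _ _)).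
  have -> : \sum_(1 <= r < N.+1) (totient r)%:R * ((if (r %| d1 %/ g1)%N then a d1 * g1%:R / d1%:R else 0) *
      (if (r %| d2 %/ g2)%N then a d2 * g2%:R / d2%:R else 0)) = (a d1 * g1%:R / d1%:R) * (a d2 * g2%:R / d2%:R) * g%:R.
    rewrite -{1}(sum_totient gg gN) natr_sum mulr_sumr [RHS]big_mkcond; apply: eq_bigr => r _.
    rewrite /g dvdn_gcd; case: (r %| _)%N => /=; case: (r %| _)%N; rewrite ?mulr0 ?mul0r ?mulr0 //; ring.
  have dR : [/\ d1%:R != 0 :> R, d2%:R != 0 :> R & l%:R != 0 :> R].
    by rewrite !pnatr_eq0 -!lt0n.
  have [n1 n2 n3] := dR.
  have IR : l%:R * (g1%:R * g2%:R * g%:R) = e%:R * (d1%:R * d2%:R) :> R by rewrite -!natrM I.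
  have n4 : e%:R * (d1%:R * d2%:R) != 0 :> R by rewrite !mulf_neq0.
  apply: (mulIf n3); rewrite divfK //; apply: (mulIf n4).
  rewrite -[in LHS]IR; field; by rewrite ?n1 ?n2 ?eR.
transitivity (\sum_(1 <= d1 < N.+1) \sum_(1 <= d2 < N.+1) e%:R^-1 *
    \sum_(1 <= r < N.+1) (totient r)%:R * ((if (r %| d1 %/ gcdn d1 e)%N then a d1 * (gcdn d1 e)%:R / d1%:R else 0) *
      (if (r %| d2 %/ gcdn d2 e)%N then a d2 * (gcdn d2 e)%:R / d2%:R else 0))).
  by apply: eq_big_nat => d1 h1; apply: eq_big_nat => d2 h2; exact: E.
under eq_bigr do rewrite -mulr_sumr.
rewrite -mulr_sumr; congr (_ * _).
under eq_bigr do rewrite exchange_big /=.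
rewrite exchange_big /=; apply: eq_bigr => r _.
have -> : shifted_sum a e r = \sum_(1 <= d < N.+1) (if (r %| d %/ gcdn d e)%N then a d * (gcdn d e)%:R / d%:R else 0).
  by rewrite /shifted_sum big_mkcond.
rewrite expr2 big_distrlr /= mulr_sumr; apply: eq_bigr => d1 _.
by rewrite mulr_sumr.
Qed.

Definition sel r : R := (mu r)%:~R * wt r.
(* Prescribing the diagonal values [sel r = mu r wt r] of the quadratic form and inverting. *)
Definition selberg d : R := d%:R * \sum_(1 <= k < N.+1 | (d * k <= N)%N) (mu k)%:~R * sel (d * k).

Lemma mu_sq_wt r : (mu r)%:~R ^+ 2 * wt r = wt r.
Proof.
rewrite /wt /mu; case: ifP => _; last by rewrite mulr0.
by rewrite rmorphXn /= rmorphN1 sqrr_sign mul1r.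
Qed.

Lemma totient_wt r : (totient r)%:R * wt r ^+ 2 = wt r.
Proof.
rewrite /wt; case: ifP => [/andP[r0 _]|_]; last by rewrite expr0n mulr0.
by rewrite expr2 mulrA divff ?mul1r // pnatr_eq0 -lt0n totient_gt0.
Qed.

Lemma lam_squarefree d : (0 < d)%N -> selberg d != 0 -> squarefree d.
Proof.
move=> d0; apply: contraNT => sd; apply/eqP; rewrite /selberg big_nat_cond big1 ?mulr0 //.
move=> k /andP[/andP[k1 _] _]; rewrite /sel /wt; case: ifP => h; last by rewrite !mulr0.
have dk : (0 < d * k)%N by rewrite muln_gt0 d0.
by rewrite (squarefree_dvd dk (dvdn_mulr k (dvdnn d)) h) in sd.
Qed.

(** Moebius inversion along the multiples of r up to N. The weights are not normalised: [selberg 1]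
    is the full sum of [wt], and so is the value of the form at modulus 1. *)
Lemma lam_sum r : (0 < r)%N ->
  \sum_(1 <= d < N.+1 | (r %| d)%N) selberg d / d%:R = if (r <= N)%N then sel r else 0.
Proof.
move=> r0.
transitivity (\sum_(1 <= j < N.+1) \sum_(1 <= k < N.+1 | (j * k <= N)%N && (r * (j * k) <= N)%N) (mu k)%:~R * sel (r * (j * k))).
  have -> : \sum_(1 <= d < N.+1 | (r %| d)%N) selberg d / d%:R =
     \sum_(1 <= d < N.+1 | true && (r %| d)%N) selberg d / d%:R by [].
  rewrite sum_multiples //= big_mkcond [RHS]big_nat big_nat; apply: eq_bigr => j /andP[j1 _].
  have jR : (r * j)%N%:R != 0 :> R by rewrite pnatr_eq0 -lt0n muln_gt0 r0.
  rewrite andbT /selberg; case: ifP => rj.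
    rewrite mulrAC divff // mul1r; apply: eq_big => [k|k _]; rewrite -mulnA //.
    by rewrite andb_idl // => h; apply: leq_trans h; rewrite leq_pmull.
  rewrite big_nat_cond big1 // => k /andP[/andP[k1 _] /andP[_ h]]; exfalso.
  move/negbT: rj; rewrite -ltnNge; apply/negP; rewrite -leqNgt; apply: leq_trans h.
  by rewrite mulnA leq_pmulr.
rewrite (exchange_big_dep xpredT) //=.
rewrite (eq_bigr (fun k => \sum_(1 <= j < N.+1 | (k * j <= N)%N && (r * (k * j) <= N)%N) (mu k)%:~R * sel (r * (k * j)))); last first.
  by move=> k _; apply: eq_big => [j|j _]; rewrite (mulnC k).
rewrite -(@sum_divisor_switch _ N (fun n => (r * n <= N)%N) (fun k j => (mu k)%:~R * sel (r * (k * j)))).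
rewrite big_nat_cond (eq_bigr (fun n => if n == 1%N then sel r else 0)); last first.
  move=> n /andP[/andP[n1 nN] _].
  rewrite (eq_bigr (fun d => (mu d)%:~R * sel (r * n))); last first.
    by move=> d dn; rewrite (mulnC d) divnK.
  rewrite -mulr_suml -(rmorph_sum intr) /= (@sum_divisors_widen _ n N mu) // sum_mu //.
  by case: eqP => [->|_]; rewrite ?mul0r // mul1r muln1.
rewrite -big_nat_cond -big_mkcondr /= (eq_bigl (fun n => (r <= N)%N && (n == 1%N))); last first.
  by move=> n; case: (eqVneq n 1%N) => [->|]; rewrite ?andbF // muln1.
case: ifP => rN; last by rewrite big_pred0.
by rewrite /= big_nat1_eq /= ltnS N0.
Qed.

Lemma shifted_sum1 r : (0 < r)%N -> shifted_sum selberg 1 r = if (r <= N)%N then sel r else 0.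
Proof.
move=> r0; rewrite -lam_sum // /shifted_sum; apply: eq_big => [d|d _]; rewrite gcdn1 ?divn1 //.
by rewrite mulr1.
Qed.

Lemma form_one : \sum_(1 <= d1 < N.+1) \sum_(1 <= d2 < N.+1) selberg d1 * selberg d2 / (lcmn (lcmn d1 d2) 1)%:R =
  \sum_(1 <= r < N.+1) wt r.
Proof.
rewrite lcm_form_diag // invr1 mul1r; apply: eq_big_nat => r /andP[r1 rN].
by rewrite shifted_sum1 // -ltnS rN /sel exprMn mulrCA totient_wt mu_sq_wt.
Qed.

(** Let y(r) be the sum of lambda(d)/d over r | d. For p not dividing r the shifted sum is y(r) +
    (p-1) y(rp), and sel(rp) = -sel(r)/(p-1) makes it cancel as long as rp <= N. If p | r, only d
    divisible by p^2 could occur, and there lambda vanishes. The hypothesis on [e] admits both p and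
    p^2. *)
Lemma shifted_sum_prime p e r : prime p -> (0 < r)%N ->
  (forall d, (0 < d)%N -> squarefree d -> gcdn d e = gcdn d p) ->
  (totient r)%:R * shifted_sum selberg e r ^+ 2 <= (if (r <= N < r * p)%N then wt r else 0).
Proof.
move=> pp r0 He; have p0 := prime_gt0 pp.
have wr : 0 <= (if (r <= N < r * p)%N then wt r else 0) by case: ifP => // _; exact: wt_ge0.
have -> : shifted_sum selberg e r = shifted_sum selberg p r.
  rewrite /shifted_sum [LHS]big_mkcond [RHS]big_mkcond; apply: eq_big_nat => d /andP[d1 _].
  case: (eqVneq (selberg d) 0) => [->|ld]; first by rewrite !mul0r !if_same.
  by rewrite He // lam_squarefree.
case pr : (p %| r)%N.
  rewrite /shifted_sum big_nat_cond big1 ?expr0n ?mulr0 // => d /andP[/andP[d1 _] rd].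
  case: (eqVneq (selberg d) 0) => [->|ld]; first by rewrite !mul0r.
  have /(squarefreeP d1) sq := lam_squarefree d1 ld.
  have pg : (p %| d %/ gcdn d p)%N := dvdn_trans pr rd.
  have pd : (p %| d)%N by apply: dvdn_trans pg (dvdn_div _); exact: dvdn_gcdl.
  have gp : gcdn d p = p by apply/gcdn_idPr.
  rewrite gp in pg; exfalso; move: (sq p pp); apply/negP; rewrite negbK.
  by rewrite expnS expn1 -(divnK pd) dvdn_pmul2r.
have E : shifted_sum selberg p r = \sum_(1 <= d < N.+1 | (r %| d)%N) selberg d / d%:R
   + (p%:R - 1) * \sum_(1 <= d < N.+1 | (r * p %| d)%N) selberg d / d%:R.
  rewrite mulr_sumr /shifted_sum [LHS]big_mkcond [X in _ = X + _]big_mkcond [X in _ = _ + X]big_mkcond -big_split /=.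
  apply: eq_big_nat => d /andP[d1 _].
  have cop : coprime r p by rewrite coprime_sym prime_coprime // pr.
  rewrite Gauss_dvd //; case pd : (p %| d)%N.
    have -> : gcdn d p = p by apply/gcdn_idPr.
    rewrite andbT -(Gauss_dvdl (d %/ p) cop) divnK //; case: ifP => _; ring.
  have -> : gcdn d p = 1%N by apply/eqP; rewrite -/(coprime d p) coprime_sym prime_coprime // pd.
  by rewrite divn1 andbF addr0 mulr1.
have rp0 : (0 < r * p)%N by rewrite muln_gt0 r0.
rewrite E !lam_sum //.
have sp : sel (r * p) = - sel r / (p%:R - 1).
  rewrite /sel mulnC mu_prime_mul ?pr // wt_prime_mul ?pr // prime_predE // rmorphN /=; ring.
have pm1 : p%:R - 1 != 0 :> R by rewrite -prime_predE // gt_eqF // prime_pred_gt0.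
case: (leqP (r * p) N) => rpN.
  have rN : (r <= N)%N by rewrite (leq_trans _ rpN) // leq_pmulr.
  rewrite rN sp andbF (_ : sel r + _ = 0) ?expr0n ?mulr0 //.
  by field.
rewrite mulr0 addr0 andbT; case: ifP => rN; last by rewrite expr0n mulr0.
by rewrite /sel exprMn mulrCA totient_wt mu_sq_wt.
Qed.

Lemma form_prime p e : prime p -> (0 < e)%N ->
  (forall d, (0 < d)%N -> squarefree d -> gcdn d e = gcdn d p) ->
  \sum_(1 <= d1 < N.+1) \sum_(1 <= d2 < N.+1) selberg d1 * selberg d2 / (lcmn (lcmn d1 d2) e)%:R <=
  e%:R^-1 * \sum_(1 <= r < N.+1 | (N < r * p)%N) wt r.
Proof.
move=> pp e0 He; rewrite lcm_form_diag //; apply: ler_wpM2l; first by rewrite invr_ge0.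
rewrite [leRHS]big_mkcond !big_nat; apply: ler_sum => r /andP[r1 rN].
apply: le_trans (shifted_sum_prime pp r1 He) _.
by rewrite -ltnS rN.
Qed.

Lemma gcd_square_squarefree p d : prime p -> (0 < d)%N -> squarefree d -> gcdn d (p ^ 2) = gcdn d p.
Proof.
move=> pp d0 /(squarefreeP d0) sq; apply/eqP; rewrite eqn_dvd; apply/andP; split; last first.
  by rewrite dvdn_gcd dvdn_gcdl (dvdn_trans (dvdn_gcdr _ _)) // expnS dvdn_mulr.
rewrite dvdn_gcd dvdn_gcdl /=.
have /(dvdn_pfactor _ _ pp) [k k2 gE] := dvdn_gcdr d (p ^ 2).
rewrite gE; case: k k2 gE => [|[|[|k]]] // _ gE; exfalso.
by move: (sq p pp); rewrite -gE dvdn_gcdl.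
Qed.

End SelbergForm.

(** * Numerical positivity of the weighted form *)

Section SieveNumerics.
Variable R : realType.
Local Notation wt := (@wt R).
Local Notation Lam := (@Lam R).
Local Notation lnn := (fun n : nat => ln (n%:R : R)).

Lemma sum_blocks (V : nmodType) (b : nat -> nat) (F : nat -> V) m n : (m <= n)%N ->
  (forall i, (b i <= b i.+1)%N) ->
  \sum_(b m <= k < b n) F k = \sum_(m <= i < n) \sum_(b i <= k < b i.+1) F k.
Proof.
move=> mn bm; have mono i j : (i <= j)%N -> (b i <= b j)%N.
  by move=> /subnK <-; elim: (j - i)%N => // d IH; exact: leq_trans IH (bm _).
elim: n mn => [|n IH] mn.
  by have -> : m = 0%N; [lia|rewrite !big_geq].
have [mn'|nm] := leqP m n.
  by rewrite big_nat_recr //= -IH // (big_cat_nat (n := b n)) // mono.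
by have -> : m = n.+1; [lia|rewrite !big_geq].
Qed.

Lemma prime_log_sum a b : \sum_(a <= p < b | prime p) lnn p / p%:R <= \sum_(a <= d < b) Lam d / d%:R.
Proof.
rewrite big_mkcond; apply: ler_sum => p _; case: ifP => pp; last by rewrite divr_ge0 ?Lam_ge0.
by rewrite Lam_prime.
Qed.

Lemma prime_log_le w : (0 < w)%N -> \sum_(1 <= p < w.+1 | prime p) lnn p / p%:R <= lnn w + 4.
Proof. by move=> w0; apply: le_trans (prime_log_sum _ _) (sum_Lam_div_upper R w0). Qed.

Lemma capped_count (w K : nat) (c : R) : 0 <= c ->
  \sum_(1 <= p < w.+1) (if (p <= K)%N then c else 0) <= c * K%:R.
Proof.
move=> c0; have -> : c * K%:R = \sum_(1 <= p < (maxn w K).+1) (if (p <= K)%N then c else 0).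
  rewrite (big_cat_nat (n := K.+1)) //=; last by rewrite ltnS leq_maxr.
  rewrite [X in _ + X]big_nat [X in _ + X]big1 ?addr0; last first.
    by move=> p /andP[Kp _]; rewrite leqNgt Kp.
  rewrite (@eq_big_nat _ _ _ _ _ _ (fun=> c)) => [|p /andP[_ pK]]; last by rewrite -ltnS pK.
  by rewrite big_const_nat iter_addr_0 subn1 /= mulr_natr.
rewrite [leRHS](big_cat_nat (n := w.+1)) //=; last by rewrite ltnS leq_maxl.
by rewrite lerDl; apply: sumr_ge0 => p _; case: ifP.
Qed.

(** Primes up to K are counted one by one; above K, 1/p is at most (ln p)/(cp) and Mertens applies.
    A large K makes the coefficient of ln w small. *)
Lemma prime_recip_le (K w : nat) (c : R) : (0 < w)%N -> 0 < c -> c <= lnn K ->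
  \sum_(1 <= p < w.+1 | prime p) p%:R^-1 <= K%:R + c^-1 * (lnn w + 4).
Proof.
move=> w0 c0 cK; have K1 : (0 < K)%N by case: K cK => // h; rewrite ln0 // in h; lra.
have i0 p : 0 <= p%:R^-1 :> R by rewrite invr_ge0.
apply: (@le_trans _ _ (\sum_(1 <= p < w.+1) (if (p <= K)%N then 1 else 0) + 
    c^-1 * \sum_(1 <= p < w.+1 | prime p) lnn p / p%:R)).
  rewrite mulr_sumr [leLHS]big_mkcond [X in _ + X]big_mkcond -big_split /= !big_nat.
  apply: ler_sum => p /andP[p1 _]; have pR : 0 < p%:R :> R by rewrite ltr0n.
  have lp : 0 <= lnn p by rewrite ln_ge0 // ler1n.
  have t0 : 0 <= c^-1 * (lnn p / p%:R) by rewrite mulr_ge0 ?divr_ge0 ?invr_ge0 // ltW.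
  case: ifP => pp; last by rewrite addr0; case: ifP.
  case: (leqP p K) => pK; first by rewrite -[leLHS]addr0 lerD // invf_le1 // ler1n.
  rewrite add0r mulrA -[leLHS]mul1r ler_wpM2r // mulrC ler_pdivlMr // mul1r.
  by apply: le_trans cK _; rewrite ler_ln ?posrE ?ltr0n ?ler_nat // ltnW.
apply: lerD; last by rewrite ler_wpM2l ?invr_ge0 ?(ltW c0) // prime_log_le.
by have := @capped_count w K 1 ler01; rewrite mul1r.
Qed.

Lemma prime_square_sum (K w : nat) : (0 < w)%N -> (0 < K)%N ->
  \sum_(1 <= p < w.+1 | prime p) (1 + lnn p) / p%:R ^+ 2 <= 3 * K%:R + 3 / K%:R * (lnn w + 4).
Proof.
move=> w0 K0; have KR : 0 < K%:R :> R by rewrite ltr0n.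
apply: (@le_trans _ _ (\sum_(1 <= p < w.+1) (if (p <= K)%N then 3 else 0) + 
    3 / K%:R * \sum_(1 <= p < w.+1 | prime p) lnn p / p%:R)).
  rewrite mulr_sumr [leLHS]big_mkcond [X in _ + X]big_mkcond -big_split /= !big_nat.
  apply: ler_sum => p /andP[p1 _]; have pR : 0 < p%:R :> R by rewrite ltr0n.
  have lp : 0 <= lnn p by rewrite ln_ge0 // ler1n.
  have t0 : 0 <= 3 / K%:R * (lnn p / p%:R) by rewrite mulr_ge0 ?divr_ge0 // ltW.
  case: ifP => pp; last by rewrite addr0; case: ifP.
  have p2 : 2 <= p%:R :> R by rewrite ler_nat prime_gt1.
  have l3 : 1 + lnn p <= 3 * lnn p.
    have /andP[h _] := ln2_bounds R.
    have : ln 2 <= lnn p by rewrite ler_ln ?posrE //.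
    lra.
  have lpp : lnn p <= p%:R.
    exact: ltW (ln_sublinear pR).
  case: (leqP p K) => pK.
    rewrite -[leLHS]addr0 lerD // ler_pdivrMr ?exprn_gt0 //.
    apply: le_trans l3 _; rewrite ler_wpM2l // expr2.
    apply: le_trans lpp _; rewrite ler_peMr ?(ltW pR) //; lra.
  rewrite add0r ler_pdivrMr ?exprn_gt0 //; apply: le_trans l3 _.
  rewrite (_ : 3 / K%:R * _ * _ = 3 * lnn p * (p%:R / K%:R)); last by field; rewrite !gt_eqF.
  by rewrite ler_peMr ?mulr_ge0 // ler_pdivlMr // mul1r ler_nat ltnW.
apply: lerD; last by rewrite ler_wpM2l ?divr_ge0 ?(ltW KR) // prime_log_le.
exact: capped_count.
Qed.

(** A Riemann sum for the integral of 1/u - 1/400 from 10 to 400, about 2.714. Reciprocals are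
    rounded up to multiples of 1/10000, so that what is computed is an inequality between natural
    numbers. *)
Lemma grid_sum : \sum_(10 <= i < 400) (i%:R^-1 * (1 - i%:R / 400)) <= 2785 / 1000 :> R.
Proof.
have h : (\sum_(10 <= i < 400) ((100 * 100) %/ i).+1 <= 376 * 100)%N.
  by rewrite unlock; vm_compute.
move: h; rewrite -(ler_nat R) natrM natr_sum.
have : (100 * 100)%N%:R = 100 * 100 :> R by rewrite natrM.
move: (100 * 100)%N => u uE h.
have uR : 0 < u%:R :> R by rewrite uE mulr_gt0.
apply: (@le_trans _ _ (\sum_(10 <= i < 400) ((u %/ i).+1%:R / u%:R - 400^-1))).
  rewrite !big_nat; apply: ler_sum => i /andP[i1 _].
  have iR : 0 < i%:R :> R by rewrite ltr0n (leq_trans _ i1).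
  rewrite mulrBr mulr1 mulrA mulVf ?gt_eqF // mul1r lerD2r ler_pdivlMr // mulrC ler_pdivrMr //.
  by rewrite -natrM ler_nat ltnW // ltn_ceil // (leq_trans _ i1).
rewrite big_split /= -mulr_suml sumrN big_const_nat iter_addr_0.
rewrite (_ : (400 - 10)%N = 390%N) // -[_ *+ 390]mulr_natr.
set q := \sum_(_ <= _ < _) _ in h *.
have : q / u%:R <= 376 / 100 by rewrite ler_pdivrMr // uE; apply: le_trans h _; lra.
lra.
Qed.

Section SieveWeight.
Variables (E K : nat) (S : R).
Let N := (E ^ 20)%N.
Let y := (E ^ 400)%N.
Let z := (E ^ 40)%N.
Hypotheses (E1 : (1 < E)%N) (SE : S = lnn E) (K4 : 10 ^+ 4 <= K%:R :> R) (lnK : 100 <= lnn K).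
Hypothesis Slarge : 10 ^+ 3 * (K%:R + 1) <= S.

Let T p : R := \sum_(1 <= r < N.+1 | (N < r * p)%N) wt r.
Let G : R := \sum_(1 <= r < N.+1) wt r.

Lemma lnX k : lnn (E ^ k)%N = k%:R * S.
Proof. by rewrite /= natrX lnXn ?SE ?mulr_natl // ltr0n ltnW. Qed.

(** [G] is at least 20 S. Primes up to E^10 use T(p) <= 2.205 (1 + ln p) and cost about 22.3 S.
    Larger primes use T(p) <= G and, taken over the intervals from E^i to E^(i+1), cost at most
    2.799 G. The remaining 1.191 G is at least 23.8 S; the squares cost little because K is large
    and S much larger. *)
Lemma sieve_main_numeric :
  1 <= 399 / 100 * G - \sum_(1 <= p < y.+1 | prime p) (1 - lnn p / (400 * S)) * (T p / p%:R)
   - 14 * \sum_(1 <= p < z.+1 | prime p) T p / p%:R ^+ 2.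
Proof.
have S0 : 0 < S by rewrite SE ln_gt0 // ltr1n.
have E0 k : (0 < E ^ k)%N by rewrite expn_gt0 ltnW.
have T0 p : 0 <= T p by apply: sumr_ge0 => r _; exact: wt_ge0.
have TG p : T p <= G.
  rewrite /T /G big_mkcond; apply: ler_sum => r _; case: ifP => // _; exact: wt_ge0.
have TC p : (0 < p)%N -> T p <= euler_const R * (1 + lnn p) by exact: wt_tail.
have G20 : 20 * S <= G by have := wt_sum_ge_ln R (E0 20%N); rewrite lnX.
have KR : 0 < K%:R :> R by apply: lt_le_trans K4; rewrite exprn_gt0.
have K0 : (0 < K)%N by rewrite -(ltr0n R).
have c0 : 0 <= euler_const R by rewrite /euler_const; lra.
have low : \sum_(1 <= p < (E ^ 10).+1 | prime p) (1 - lnn p / (400 * S)) * (T p / p%:R) <=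
    euler_const R * (K%:R + 100^-1 * (10 * S + 4) + (10 * S + 4)).
  apply: (@le_trans _ _ (euler_const R * (\sum_(1 <= p < (E ^ 10).+1 | prime p) p%:R^-1 +
     \sum_(1 <= p < (E ^ 10).+1 | prime p) lnn p / p%:R))).
    rewrite -big_split /= mulr_sumr big_nat_cond [leRHS]big_nat_cond.
    apply: ler_sum => p /andP[/andP[p1 _] pp]; have pR : 0 < p%:R :> R by rewrite ltr0n.
    have lp : 0 <= lnn p by rewrite ln_ge0 // ler1n.
    apply: (@le_trans _ _ (T p / p%:R)).
      rewrite ler_piMl ?divr_ge0 // gerBl divr_ge0 // mulr_ge0 // ltW //.
    rewrite (_ : _ * (_ + _) = euler_const R * (1 + lnn p) / p%:R); last by field; rewrite gt_eqF.
    by rewrite ler_wpM2r ?invr_ge0 ?(ltW pR) // TC.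
  rewrite ler_wpM2l // lerD //.
    by rewrite -lnX; apply: prime_recip_le.
  by rewrite -lnX; exact: prime_log_le.
have sq : \sum_(1 <= p < z.+1 | prime p) T p / p%:R ^+ 2 <= euler_const R * (3 * K%:R + 3 / K%:R * (40 * S + 4)).
  rewrite -lnX; apply: le_trans (ler_wpM2l c0 (prime_square_sum (E0 40%N) K0)).
  rewrite mulr_sumr big_nat_cond [leRHS]big_nat_cond.
  apply: ler_sum => p /andP[/andP[p1 _] pp].
  by rewrite mulrA ler_wpM2r ?invr_ge0 ?exprn_ge0 // TC.
have mid : \sum_((E ^ 10).+1 <= p < y.+1 | prime p) (1 - lnn p / (400 * S)) * (T p / p%:R) <=
    G * (1 + 5 / S) * (2785 / 1000).
  apply: le_trans (ler_wpM2l _ grid_sum); last first.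
    by rewrite mulr_ge0 ?addr_ge0 ?divr_ge0 ?(ltW S0) // (le_trans _ G20) // mulr_ge0 // ltW.
  rewrite mulr_sumr big_mkcond.
  rewrite (@sum_blocks _ (fun i => (E ^ i).+1) _ 10 400) //; last first.
    by move=> i; rewrite ltnS leq_exp2l.
  rewrite !big_nat; apply: ler_sum => i /andP[i10 i400].
  have iR : 0 < i%:R :> R by rewrite ltr0n (leq_trans _ i10).
  have i4 : i%:R <= 400 :> R by rewrite ler_nat ltnW.
  have a0 : 0 <= 1 - i%:R / 400 :> R by rewrite subr_ge0 ler_pdivrMr // mul1r.
  apply: (@le_trans _ _ (G * (1 - i%:R / 400) / (i%:R * S) * \sum_((E ^ i).+1 <= d < (E ^ i.+1).+1) Lam d / d%:R)).
    rewrite mulr_sumr !big_nat; apply: ler_sum => p /andP[p1 p2].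
    have p0 : (0 < p)%N by exact: leq_trans p1.
    have pR : 0 < p%:R :> R by rewrite ltr0n.
    have cc0 : 0 <= G * (1 - i%:R / 400) / (i%:R * S).
      by rewrite !mulr_ge0 // ?invr_ge0 ?mulr_ge0 ?(ltW iR) ?(ltW S0) // (le_trans _ G20) // mulr_ge0 // ltW.
    case: ifP => pp; last by apply: mulr_ge0 => //; rewrite divr_ge0 ?Lam_ge0.
    rewrite Lam_prime //.
    have lp : i%:R * S <= lnn p by rewrite -lnX ler_ln ?posrE ?ltr0n // ler_nat ltnW.
    have lp0 : 0 < lnn p by apply: lt_le_trans lp; rewrite mulr_gt0.
    apply: (@le_trans _ _ ((1 - i%:R / 400) * (G / p%:R))).
      apply: ler_pM.
      - rewrite subr_ge0 ler_pdivrMr ?mulr_gt0 // mul1r -lnX ler_ln ?posrE ?ltr0n // ler_nat.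
        by rewrite -ltnS (leq_trans p2) // ltnS leq_exp2l.
      - by rewrite divr_ge0.
      - rewrite lerD2l lerN2 ler_pdivlMr ?mulr_gt0 //.
        by rewrite (_ : i%:R / 400 * (400 * S) = i%:R * S) //; field.
      - by rewrite ler_wpM2r // invr_ge0 ltW.
    rewrite (_ : _ * _ / _ * _ = (1 - i%:R / 400) * (G / p%:R) * (lnn p / (i%:R * S))); last by field; rewrite !gt_eqF.
    rewrite ler_peMr //; last by rewrite ler_pdivlMr ?mulr_gt0 // mul1r.
    by rewrite mulr_ge0 // divr_ge0 // (le_trans _ (TG p)).
  have M : \sum_((E ^ i).+1 <= d < (E ^ i.+1).+1) Lam d / d%:R <= S + 5.
    apply: le_trans (mertens_interval R (E0 i) _) _; first by rewrite leq_exp2l.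
    rewrite !lnX -natr1; lra.
  apply: le_trans (ler_wpM2l _ M) _.
    by rewrite !mulr_ge0 // ?invr_ge0 ?mulr_ge0 ?(ltW iR) ?(ltW S0) // (le_trans _ G20) // mulr_ge0 // ltW.
  by rewrite le_eqVlt; apply/orP; left; apply/eqP; field; rewrite !gt_eqF.
rewrite (big_cat_nat (n := (E ^ 10).+1)) //=; last by rewrite ltnS leq_exp2l.
have S3 : 1000 <= S.
  apply: le_trans Slarge; rewrite (_ : 10 ^+ 3 = 1000 :> R); last ring.
  by rewrite ler_peMr // lerDr ltW.
have KS : 1000 * (K%:R + 1) <= S by apply: le_trans Slarge; rewrite le_eqVlt; apply/orP; left; apply/eqP; ring.
have g5 : G * (1 + 5 / S) * (2785 / 1000) <= 2799 / 1000 * G.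
  have h5 : 5 / S <= 5 / 1000 by rewrite ler_wpM2l // lef_pV2 ?posrE.
  have G0 : 0 <= G by apply: le_trans G20; rewrite mulr_ge0 // ltW.
  have := ler_wpM2l G0 h5; lra.
have k5 : 3 / K%:R * (40 * S + 4) <= 3 / 10000 * (40 * S + 4).
  rewrite ler_wpM2r ?addr_ge0 ?mulr_ge0 ?(ltW S0) // ler_wpM2l // lef_pV2 ?posrE //.
  by apply: le_trans K4; rewrite le_eqVlt; apply/orP; left; apply/eqP; ring.
have := le_trans mid g5; move: low sq k5; rewrite /euler_const /z.
move: (\sum_(_ <= _ < _ | _) _) (\sum_(_ <= _ < _ | _) _) (\sum_(_ <= _ < _ | _) _) => a b c.
move: (3 / K%:R * _) => d; lra.
Qed.

End SieveWeight.
End SieveNumerics.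

(** * The weighted sieve *)

Section SieveList.
Variable R : realType.
Local Notation wt := (@wt R).
Local Notation Lam := (@Lam R).
Local Notation lnn := (fun n : nat => ln (n%:R : R)).
Variables (E K : nat) (S s : R).
Let N := (E ^ 20)%N.
Let y := (E ^ 400)%N.
Let z := (E ^ 40)%N.
Hypotheses (E1 : (1 < E)%N) (SE : S = lnn E) (K4 : 10 ^+ 4 <= K%:R :> R) (lnK : 100 <= lnn K).
Hypothesis Slarge : 10 ^+ 3 * (K%:R + 1) <= S.
Hypotheses (s19 : 19 <= s) (Hs : forall m, (0 < m <= N)%N -> (tau m)%:R <= s) (HL : harm R N <= s).

Local Notation lam := (@selberg R N).
Let sm p : R := 1 - lnn p / (400 * S).

(* For [P <= E^4004] the weights [1 - ln p/(400 ln E)], summed over all prime factors of [P] with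
   multiplicity, give at least [Omega P - 10.01]. So positivity of [3.99] minus this sum forces
   [Omega P < 14]. The terms of weight [-14] eliminate repeated factors up to [z]. *)
Definition sieve_terms : seq (R * nat) :=
  (399 / 100, 1%N) :: [seq (- sm p, p) | p <- index_iota 1 y.+1 & prime p]
    ++ [seq (- 14, (p ^ 2)%N) | p <- index_iota 1 z.+1 & prime p].

(* The weights multiply the square of [sum_(d | P) selberg d], expanded as a list of pairs
   (coefficient, modulus). *)
Definition sieve_list : seq (R * nat) :=
  [seq (c.1 * (lam d.1 * lam d.2), lcmn (lcmn d.1 d.2) c.2) | c <- sieve_terms,
     d <- [seq (d1, d2) | d1 <- index_iota 1 N.+1, d2 <- index_iota 1 N.+1]].

Lemma sum_sieve_terms (V : nmodType) (F : R -> nat -> V) :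
  \sum_(c <- sieve_terms) F c.1 c.2 = F (399 / 100) 1%N + (\sum_(1 <= p < y.+1 | prime p) F (- sm p) p
     + \sum_(1 <= p < z.+1 | prime p) F (- 14) (p ^ 2)%N).
Proof. by rewrite big_cons big_cat !big_map !big_filter. Qed.

Lemma sum_sieve_list (V : nmodType) (F : R -> nat -> V) :
  \sum_(t <- sieve_list) F t.1 t.2 = \sum_(c <- sieve_terms) \sum_(1 <= d1 < N.+1) \sum_(1 <= d2 < N.+1)
     F (c.1 * (lam d1 * lam d2)) (lcmn (lcmn d1 d2) c.2).
Proof.
rewrite big_allpairs_dep /=; apply: eq_bigr => c _; by rewrite big_allpairs_dep.
Qed.

Let N0 : (0 < N)%N. Proof. by rewrite expn_gt0 ltnW. Qed.
Let y0 : (0 < y)%N. Proof. by rewrite expn_gt0 ltnW. Qed.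
Let z0 : (0 < z)%N. Proof. by rewrite expn_gt0 ltnW. Qed.
Let S0 : 0 < S. Proof. by rewrite SE ln_gt0 // ltr1n. Qed.
Let lnE k : lnn (E ^ k)%N = k%:R * S. Proof. exact: lnX. Qed.

Lemma sm_bounds p : (1 <= p <= y)%N -> 0 <= sm p <= 1.
Proof.
move=> /andP[p1 py]; have l0 : 0 <= lnn p by rewrite ln_ge0 // ler1n.
have h4 : 0 < 400 * S by rewrite mulr_gt0.
apply/andP; split; last by rewrite gerBl divr_ge0 // ltW.
by rewrite subr_ge0 ler_pdivrMr // mul1r -lnE ler_ln ?posrE ?ltr0n // ler_nat.
Qed.

(** Each term d wt(dk) equals dk wt(dk) / k, at most tau(dk)/k: a divisor bound times a harmonic
    sum. *)
Lemma lam_le d : (1 <= d <= N)%N -> `|lam d| <= s ^+ 2.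
Proof.
move=> /andP[d1 dN]; have dR : 0 < d%:R :> R by rewrite ltr0n.
have s0 : 0 <= s by apply: le_trans s19.
rewrite /selberg normrM gtr0_norm //.
apply: (@le_trans _ _ (s * harm R N)); last by rewrite expr2 ler_wpM2l.
rewrite /harm mulr_sumr.
apply: le_trans (ler_wpM2l (ltW dR) (ler_norm_sum _ _ _)) _.
rewrite mulr_sumr big_mkcond !big_nat; apply: ler_sum => k /andP[k1 kN].
have kR : 0 < k%:R :> R by rewrite ltr0n.
case: ifP => dk; last by rewrite mulr_ge0 ?invr_ge0.
rewrite ler_pdivlMr //.
have dk0 : (0 < d * k)%N by rewrite muln_gt0 d1.
apply: (@le_trans _ _ ((d * k)%N%:R * wt (d * k))); last first.
  by apply: le_trans (wt_le_tau R dk0) (Hs _); rewrite dk0.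
rewrite natrM mulrAC ler_wpM2l ?mulr_ge0 // /sel !normrM (ger0_norm (wt_ge0 R _)).
rewrite mulrA ler_piMl ?wt_ge0 //.
by rewrite mulr_ile1 // -intr_norm lerz1 mu_norm.
Qed.

(** 440 = 20 + 20 + 400, from d1, d2 <= N and the third modulus <= y; the squares are at most z^2 =
    E^80. *)
Lemma sieve_list_range t : t \in sieve_list -> (0 < t.2 <= E ^ 440)%N.
Proof.
case/allpairsP => -[c d] [/= hc /allpairsP[[d1 d2] [/= h1 h2 ->]] ->] /=.
rewrite !mem_index_iota !ltnS in h1 h2; case/andP: h1 => a1 b1; case/andP: h2 => a2 b2.
have hy : (0 < c.2 <= y)%N.
  move: hc; rewrite inE mem_cat => /or3P[/eqP -> //=|/mapP[p]|/mapP[p]].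
  - by rewrite mem_filter mem_index_iota ltnS => /andP[_ ?] -> .
  - rewrite mem_filter mem_index_iota ltnS => /andP[_ /andP[p1 pz]] -> /=.
    rewrite expn_gt0 p1 /=; apply: (@leq_trans (z ^ 2)%N); first by rewrite leq_exp2r.
    by rewrite -expnM leq_exp2l.
case/andP: hy => c0 cy; rewrite !lcmn_gt0 a1 a2 c0 /=.
have -> : (E ^ 440 = N * N * y)%N by rewrite -!expnD.
have lm a b : (0 < a)%N -> (0 < b)%N -> (lcmn a b <= a * b)%N.
  by move=> ha hb; rewrite -muln_lcm_gcd leq_pmulr // gcdn_gt0 ha.
apply: leq_trans (lm _ _ _ c0) _; first by rewrite lcmn_gt0 a1.
by apply: leq_mul => //; apply: leq_trans (lm _ _ a1 a2) _; exact: leq_mul.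
Qed.

(** The form equals [G] at modulus 1, and is at most T(p)/p at a prime and T(p)/p^2 at its square,
    so the numerical inequality applies term by term. *)
Lemma sieve_list_main : 1 <= \sum_(t <- sieve_list) t.1 / t.2%:R.
Proof.
rewrite (sum_sieve_list (fun a b => a / b%:R)).
pose Q e : R := \sum_(1 <= d1 < N.+1) \sum_(1 <= d2 < N.+1) lam d1 * lam d2 / (lcmn (lcmn d1 d2) e)%:R.
rewrite (eq_bigr (fun c => c.1 * Q c.2)); last first.
  move=> c _; rewrite /Q mulr_sumr; apply: eq_bigr => d1 _; rewrite mulr_sumr; apply: eq_bigr => d2 _.
  by rewrite !mulrA.
rewrite (sum_sieve_terms (fun a b => a * Q b)).
have := sieve_main_numeric E1 SE K4 lnK Slarge; move=> /le_trans; apply.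
rewrite -!addrA; apply: lerD; first by rewrite /Q form_one.
apply: lerD.
  rewrite -sumrN big_nat_cond [leRHS]big_nat_cond; apply: ler_sum => p /andP[/andP[p1 py] pp].
  rewrite mulNr lerN2; apply: ler_wpM2l; first by have /andP[] := @sm_bounds p (introT andP (conj p1 py)).
  rewrite mulrC; apply: form_prime => //.
rewrite mulr_sumr -sumrN big_nat_cond [leRHS]big_nat_cond; apply: ler_sum => p /andP[/andP[p1 py] pp].
rewrite mulNr lerN2; apply: ler_wpM2l => //.
rewrite mulrC -natrX; apply: form_prime => //; first by rewrite expn_gt0 p1.
by move=> d; exact: gcd_square_squarefree.
Qed.

Let hit P : R := \sum_(1 <= d < N.+1 | (d %| P)%N) lam d.

Lemma sum_sieve_list_dvd P : \sum_(t <- sieve_list | (t.2 %| P)%N) t.1 =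
  (\sum_(c <- sieve_terms | (c.2 %| P)%N) c.1) * hit P ^+ 2.
Proof.
rewrite big_mkcond (sum_sieve_list (fun a b => if (b %| P)%N then a else 0)).
rewrite [X in _ = X * _]big_mkcond mulr_suml; apply: eq_bigr => c _.
have -> : hit P = \sum_(1 <= d < N.+1) (if (d %| P)%N then lam d else 0) by rewrite /hit big_mkcond.
rewrite expr2 big_distrlr /= mulr_sumr; apply: eq_bigr => d1 _; rewrite mulr_sumr; apply: eq_bigr => d2 _.
by rewrite !dvdn_lcm; case: (d1 %| P)%N; case: (d2 %| P)%N; case: (c.2 %| P)%N; rewrite /= ?(mulr0, mul0r) ?(mulr0, mul0r).
Qed.

Lemma sum_sieve_list_abs P : \sum_(t <- sieve_list | (t.2 %| P)%N) `|t.1| =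
  (\sum_(c <- sieve_terms | (c.2 %| P)%N) `|c.1|) * (\sum_(1 <= d < N.+1 | (d %| P)%N) `|lam d|) ^+ 2.
Proof.
rewrite big_mkcond (sum_sieve_list (fun a b => if (b %| P)%N then `|a| else 0)).
rewrite [X in _ = X * _]big_mkcond mulr_suml; apply: eq_bigr => c _.
have -> : \sum_(1 <= d < N.+1 | (d %| P)%N) `|lam d| = \sum_(1 <= d < N.+1) (if (d %| P)%N then `|lam d| else 0) by rewrite big_mkcond.
rewrite expr2 big_distrlr /= mulr_sumr; apply: eq_bigr => d1 _; rewrite mulr_sumr; apply: eq_bigr => d2 _.
by rewrite !dvdn_lcm; case: (d1 %| P)%N; case: (d2 %| P)%N; case: (c.2 %| P)%N; rewrite /= ?(mulr0, mul0r) ?(mulr0, mul0r) ?normrM.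
Qed.

Lemma sieve_list_total : \sum_(t <- sieve_list) `|t.1| <= E%:R ^+ 440 * s ^+ 5.
Proof.
have s0 : 0 <= s by apply: le_trans s19.
have -> : \sum_(t <- sieve_list) `|t.1| = \sum_(t <- sieve_list | (t.2 %| 0)%N) `|t.1| by apply: eq_bigl => t; rewrite dvdn0.
rewrite sum_sieve_list_abs.
have h1 : \sum_(1 <= d < N.+1 | (d %| 0)%N) `|lam d| <= N%:R * s ^+ 2.
  apply: (@le_trans _ _ (\sum_(1 <= d < N.+1) s ^+ 2)).
    by rewrite big_mkcond !big_nat; apply: ler_sum => d hd; rewrite dvdn0 lam_le.
  by rewrite big_const_nat iter_addr_0 subn1 /= [leRHS]mulr_natl.
have h2 : \sum_(c <- sieve_terms | (c.2 %| 0)%N) `|c.1| <= 19 * y%:R.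
  have zy : z%:R <= y%:R :> R by rewrite ler_nat leq_exp2l.
  have y1 : 1 <= y%:R :> R by rewrite ler1n.
  have cst n (c : R) : 0 <= c -> \sum_(1 <= p < n.+1 | prime p) c <= n%:R * c.
    move=> c0; apply: (@le_trans _ _ (\sum_(1 <= p < n.+1) c)).
      by rewrite big_mkcond; apply: ler_sum => p _; case: ifP.
    by rewrite big_const_nat iter_addr_0 subn1 /= [leRHS]mulr_natl.
  rewrite (eq_bigl xpredT) => [|c]; last exact: dvdn0.
  rewrite (sum_sieve_terms (fun a b => `|a|)).
  have n1 : `|399 / 100 : R| = 399 / 100 by rewrite ger0_norm // divr_ge0.
  have n2 : `|- 14 : R| = 14 by rewrite normrN ger0_norm.
  rewrite n1 n2; have := cst z 14 (ler0n _ _).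
  have : \sum_(1 <= p < y.+1 | prime p) `|- sm p| <= y%:R * 1.
    apply: le_trans (cst y 1 ler01); rewrite big_nat_cond [leRHS]big_nat_cond.
    apply: ler_sum => p /andP[/andP[p1 py] _]; have /andP[h hh] := @sm_bounds p (introT andP (conj p1 py)).
    by rewrite normrN ger0_norm.
  lra.
apply: (@le_trans _ _ ((19 * y%:R) * (N%:R * s ^+ 2) ^+ 2)).
  apply: ler_pM => //; first by apply: sumr_ge0.
    exact: sqr_ge0.
  by rewrite ler_pXn2r ?nnegrE ?mulr_ge0 ?exprn_ge0 // sumr_ge0.
have -> : E%:R ^+ 440 * s ^+ 5 = s * (y%:R * (N%:R * s ^+ 2) ^+ 2).
  rewrite /y /N !natrX; ring.
by rewrite -mulrA ler_wpM2r // mulr_ge0 // sqr_ge0.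
Qed.

(** Only divisors of P occur, so tau(P) replaces the lengths of the sums. This is the pointwise
    bound that later serves on the diagonal of the bilinear sums. *)
Lemma sieve_list_abs P : (0 < P)%N -> (tau P)%:R <= s -> 
  \sum_(t <- sieve_list | (t.2 %| P)%N) `|t.1| <= s ^+ 8.
Proof.
move=> P0 tP; have s0 : 0 <= s by apply: le_trans s19.
rewrite sum_sieve_list_abs.
have cnt n (Q : pred nat) (c : R) : 0 <= c -> (forall p, (0 < p)%N -> Q p -> (p %| P)%N) ->
    \sum_(1 <= p < n.+1 | Q p) c <= c * s.
  move=> c0 HQ; apply: le_trans (ler_wpM2l c0 tP).
  rewrite -(tau_sum R P0 (leq_maxl P n)) mulr_sumr.
  rewrite [leRHS](big_cat_nat (n := n.+1)) //=; last by rewrite ltnS leq_maxr.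
  rewrite -[leLHS]addr0; apply: lerD; last by apply: sumr_ge0 => p _; rewrite mulr1.
  rewrite big_mkcond [leRHS]big_mkcond !big_nat; apply: ler_sum => p /andP[p1 _].
  by case: ifP => [/(HQ p p1) ->|_]; rewrite ?mulr1 //; case: ifP.
apply: (@le_trans _ _ (s ^+ 2 * (s ^+ 2 * s) ^+ 2)); last by rewrite le_eqVlt; apply/orP; left; apply/eqP; ring.
apply: ler_pM => //; first by apply: sumr_ge0.
- exact: sqr_ge0.
- rewrite big_mkcond (sum_sieve_terms (fun a b => if (b %| P)%N then `|a| else 0)) dvd1n.
  have n1 : `|399 / 100 : R| = 399 / 100 by rewrite ger0_norm // divr_ge0.
  have n2 : `|- 14 : R| = 14 by rewrite normrN ger0_norm.
  rewrite n1 -!big_mkcondr /=.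
  have h2 : \sum_(1 <= p < z.+1 | prime p && (p ^ 2 %| P)%N) `|- 14 : R| <= 14 * s.
    rewrite n2; apply: cnt => // p p1 /andP[_ h]; apply: dvdn_trans h.
    by rewrite expnS dvdn_mulr.
  have h1 : \sum_(1 <= p < y.+1 | prime p && (p %| P)%N) `|- sm p| <= 1 * s.
    apply: le_trans (cnt y (fun p => prime p && (p %| P)%N) 1 ler01 _); last by move=> p _ /andP[].
    rewrite big_nat_cond [leRHS]big_nat_cond.
    apply: ler_sum => p /andP[/andP[p1 py] _]; have /andP[h hh] := @sm_bounds p (introT andP (conj p1 py)).
    by rewrite normrN ger0_norm.
  have h3 : 19 * s <= s ^+ 2 by rewrite expr2 ler_wpM2r.
  by move: h1 h2 h3 s19 s0; set a := \sum_(_ <= _ < _ | _) _; set b := \sum_(_ <= _ < _ | _) _; lra.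
- rewrite ler_pXn2r ?nnegrE ?mulr_ge0 ?exprn_ge0 ?sumr_ge0 //.
  apply: le_trans (cnt N (fun d => (d %| P)%N) (s ^+ 2) (sqr_ge0 s) _) => //.
  by rewrite big_nat_cond [leRHS]big_nat_cond; apply: ler_sum => d /andP[h _]; exact: lam_le.
Qed.

(** The sum is W times a square, hence W > 0. A square factor p^2 with p <= z would push W below
    3.99 - 14, so P is squarefree; a prime p > y counts for at most ln p / (400 S), and adding up
    logarithms gives fewer than 3.99 + 10.01 primes. *)
Lemma sieve_list_detect P : (0 < P)%N -> (P <= E ^ 4004)%N ->
  (forall q, prime q -> (z < q)%N -> ~~ (q ^ 2 %| P)%N) ->
  0 < \sum_(t <- sieve_list | (t.2 %| P)%N) t.1 ->
  (\sum_(p <- primes P) logn p P <= 13)%N.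
Proof.
move=> P0 PE big; rewrite sum_sieve_list_dvd.
set W := \sum_(_ <- _ | _) _ => pos.
have W0 : 0 < W.
  rewrite ltNge; apply/negP => Wn; move: pos; rewrite ltNge mulr_le0_ge0 ?sqr_ge0 //.
have WE : W = 399 / 100 - \sum_(1 <= p < y.+1 | prime p && (p %| P)%N) sm p
    - \sum_(1 <= p < z.+1 | prime p && (p ^ 2 %| P)%N) 14.
  rewrite /W big_mkcond (sum_sieve_terms (fun a b => if (b %| P)%N then a else 0)) dvd1n -addrA.
  by congr (_ + (_ + _)); rewrite -sumrN [RHS]big_mkcondr.
set A := \sum_(1 <= p < y.+1 | _) _ in WE; set B := \sum_(1 <= p < z.+1 | _) _ in WE.
have A0 : 0 <= A.
  rewrite /A big_nat_cond; apply: sumr_ge0 => p /andP[/andP[p1 py] _].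
  by case/andP: (@sm_bounds p (introT andP (conj p1 py))).
have sq q : prime q -> ~~ (q ^ 2 %| P)%N.
  move=> qq; case: (leqP q z) => qz; last exact: big.
  apply/negP => qP; have : 14 <= B.
    rewrite /B big_mkcond (bigD1_seq q) ?iota_uniq ?mem_index_iota ?prime_gt0 //= qq qP lerDl.
    by apply: sumr_ge0 => p _; case: ifP.
  move: W0; rewrite WE; lra.
have B0 : 0 <= B by apply: sumr_ge0.
pose M := maxn P y.
have pr : perm_eq (primes P) [seq p <- index_iota 1 M.+1 | prime p && (p %| P)%N].
  apply: uniq_perm; rewrite ?primes_uniq ?filter_uniq ?iota_uniq // => p.
  rewrite mem_filter mem_primes mem_index_iota P0 /=.
  case pp : (prime p) => //=; case pP : (p %| P)%N => //=.
  by rewrite prime_gt0 // ltnS /M leq_max dvdn_leq.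
rewrite (perm_big _ pr) big_filter /=.
have -> : (\sum_(1 <= p < M.+1 | prime p && (p %| P)) logn p P = \sum_(1 <= p < M.+1 | prime p && (p %| P)) 1)%N.
  apply: eq_bigr => p /andP[pp pP]; apply/eqP; rewrite eqn_leq logn_gt0 mem_primes pp P0 pP andbT.
  by rewrite leqNgt -pfactor_dvdn // sq.
rewrite -ltnS -(ltr_nat R) natr_sum.
have LP : \sum_(1 <= p < M.+1 | prime p && (p %| P)%N) lnn p <= 4004 * S.
  apply: (@le_trans _ _ (\sum_(1 <= p < M.+1 | (p %| P)%N) Lam p)).
    rewrite big_mkcond [leRHS]big_mkcond; apply: ler_sum => p _.
    case pP : (p %| P)%N; rewrite ?andbF ?andbT //; case: ifP => pp; last exact: Lam_ge0.
    by rewrite Lam_prime.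
  rewrite sum_divisors_widen ?leq_maxl // sum_Lam // -lnE.
  by rewrite ler_ln ?posrE ?ltr0n ?expn_gt0 ?(ltnW E1) // ler_nat.
apply: (@le_lt_trans _ _ (A + (400 * S)^-1 * (4004 * S))); last first.
  rewrite (_ : _^-1 * _ = 1001 / 100); last by field; rewrite gt_eqF.
  move: W0; rewrite WE; lra.
have h4 : 0 < 400 * S by rewrite mulr_gt0.
apply: le_trans (lerD (lexx A) (ler_wpM2l _ LP)); last by rewrite invr_ge0 ltW.
rewrite /A [X in _ <= X + _](big_nat_widen _ _ M.+1) ?ltnS ?leq_maxr // mulr_sumr.
rewrite [X in _ <= X + _]big_mkcondr -big_split /= big_nat_cond [leRHS]big_nat_cond.
apply: ler_sum => p /andP[/andP[p1 pM] /andP[pp pP]].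
case: ifP => py; first by rewrite /sm [_^-1 * _]mulrC subrK.
rewrite add0r [leRHS]mulrC ler_pdivlMr // mul1r -lnE ler_ln ?posrE ?ltr0n // ler_nat.
by rewrite ltnW // ltnNge -ltnS py.
Qed.

End SieveList.

(** * Diophantine approximation *)

Section Approximation.
Variable R : realType.

Lemma nint_uniq (w : R) (z : int) : `|w - z%:~R| < 1 / 2 -> nint w = z.
Proof.
rewrite ltr_norml => /andP[h1 h2]; have /andP[h3 h4] := nint_itv w.
have a1 : ((nint w)%:~R : R) < (z + 1)%:~R by rewrite intrD /=; lra.
have a2 : (z%:~R : R) < (nint w + 1)%:~R by rewrite intrD /=; lra.
by move: a1 a2; rewrite !ltr_int; lia.
Qed.

(** At w/d the triangle of width 1/(d sg) sees the w within 1/sg of a multiple of d. As sg >= 2,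
    this multiple is then the integer nearest to w: a divisibility condition and a closeness
    condition in one function. *)
Lemma tri_dvd (d sg : nat) (w : R) : (0 < d)%N -> (2 <= sg)%N ->
  tri (d * sg) (w / d%:R) = if (d%:Z %| nint w)%Z then tri sg w else 0.
Proof.
move=> d0 s2; have dR : 0 < d%:R :> R by rewrite ltr0n.
have sR : 2 <= sg%:R :> R by rewrite ler_nat.
case: ifP => [/dvdzP [q qE]|/negP nd'].
  have e : w / d%:R - q%:~R = (w - (nint w)%:~R) / d%:R.
    by rewrite qE intrM /=; field; rewrite gt_eqF.
  have e2 : `|w / d%:R - q%:~R| = nd w / d%:R by rewrite e normrM normfV (gtr0_norm dR).
  rewrite /tri; have -> : nd (w / d%:R) = nd w / d%:R.
    rewrite -e2; apply: nd_small; rewrite e2 ler_pdivrMr //.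
    apply: le_trans (nd_le_half w) _; rewrite ler_peMr // ?divr_ge0 // ler1n //.
  rewrite (_ : (d * sg)%:R * _ = sg%:R * nd w) //.
  by rewrite natrM; field; rewrite gt_eqF.
apply/eqP; rewrite eq_le tri_ge0 andbT leNgt; apply/negP => h.
apply: nd'; set m := nint (w / d%:R).
suff -> : nint w = (m * d%:Z)%R by exact: dvdz_mull.
apply: nint_uniq; rewrite intrM /=.
have e : w - m%:~R * d%:R = (w / d%:R - m%:~R) * d%:R by field; rewrite gt_eqF.
rewrite e normrM (gtr0_norm dR) -/(nd (w / d%:R)).
move: h; rewrite /tri lt_max ltxx /= subr_gt0 natrM => h.
have := ler_wpM2r (mulr_ge0 (nd_ge0 (w / d%:R)) (ltW dR)) sR.
set v := nd _ * _; move: h; rewrite (_ : d%:R * sg%:R * _ = sg%:R * v); last by rewrite /v; ring.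
lra.
Qed.

Lemma nd_div (d : nat) (w : R) : (0 < d)%N -> nd w / d%:R <= nd (w / d%:R).
Proof.
move=> d0; have dR : 0 < d%:R :> R by rewrite ltr0n.
rewrite ler_pdivrMr //; set m := nint (w / d%:R).
apply: le_trans (nd_min w (m * d%:Z)) _.
rewrite intrM /= {1}(_ : w = w / d%:R * d%:R); last by rewrite divfK ?gt_eqF.
by rewrite -mulrBl normrM (gtr0_norm dR).
Qed.

(** Pigeonhole: the fractional parts of 0, a, ..., Qa in Q boxes of length 1/Q. *)
Lemma dirichlet (a : R) (Q : nat) : (0 < Q)%N ->
  exists (q : nat) (A : int), (0 < q <= Q)%N /\ `|q%:R * a - A%:~R| <= Q%:R^-1.
Proof.
move=> Q0; have QR : 0 < Q%:R :> R by rewrite ltr0n.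
pose fr (k : nat) : R := k%:R * a - (Num.floor (k%:R * a))%:~R.
have fr01 k : 0 <= fr k < 1.
  by have := floor_itv (k%:R * a); rewrite intrD /fr /= => /andP[? ?]; apply/andP; split; lra.
pose bk k := Num.truncn (Q%:R * fr k).
have bk_itv k : (bk k)%:R <= Q%:R * fr k < (bk k).+1%:R.
  by apply: truncn_itv; rewrite mulr_ge0 //; case/andP: (fr01 k).
have bkQ k : (bk k < Q)%N.
  rewrite -(ltr_nat R); have /andP[h _] := bk_itv k; have /andP[_ h2] := fr01 k.
  by apply: le_lt_trans h _; rewrite gtr_pMr.
pose f (k : 'I_Q.+1) : 'I_Q := Ordinal (bkQ k).
have /injectivePn [i [j ij fij]] : ~~ injectiveb f.
  by apply/injectiveP => /leq_card; rewrite !card_ord ltnn.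
wlog lt : i j ij fij / (i < j)%N.
  move=> H; case: (ltngtP i j) => h; first exact: (H i j).
    by apply: (H j i); rewrite // eq_sym.
  by move: ij; rewrite -(inj_eq val_inj) /= h eqxx.
exists (j - i)%N, (Num.floor (j%:R * a) - Num.floor (i%:R * a)).
split; first by rewrite subn_gt0 lt /= (leq_trans (leq_subr _ _)) // -ltnS.
have /andP[h1 h2] := bk_itv i; have /andP[h3 h4] := bk_itv j.
have e : bk i = bk j by have := congr1 val fij.
rewrite e in h1 h2; rewrite natrB ?(ltnW lt) // intrB.
rewrite (_ : _ - _ = fr j - fr i); last by rewrite /fr; ring.
rewrite -[leRHS]mul1r ler_pdivlMr // -[X in _ * X](gtr0_norm QR) -normrM ler_norml.
rewrite -natr1 in h2 h4; rewrite mulrBl ![_ * Q%:R]mulrC; apply/andP; split; lra.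
Qed.

Definition nonrational (a : R) := forall (q : nat) (A : int), (0 < q)%N -> q%:R * a <> A%:~R.

(** Q is taken so large that qa is farther than 1/Q from the integers for every q <= M; the
    denominator found by [dirichlet], reduced to lowest terms, must then exceed M. *)
Lemma good_denominator (a : R) (M : nat) : nonrational a ->
  exists (q : nat) (A : int), [/\ (M < q)%N, coprime `|A|%N q & `|q%:R * a - A%:~R| <= q%:R^-1].
Proof.
move=> irr.
have pos q : (0 < q)%N -> 0 < nd (q%:R * a).
  move=> q0; rewrite lt_neqAle nd_ge0 andbT eq_sym normr_eq0 subr_eq0.
  by apply/eqP; exact: irr.
have [Q [Q0 HQ]] : exists Q : nat, (0 < Q)%N /\ forall q, (0 < q <= M)%N -> Q%:R^-1 < nd (q%:R * a).
  elim: M => [|M [Q [Q0 IH]]]; first by exists 1%N; split => // q; lia.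
  have p1 := pos M.+1 isT.
  pose Q' := (Num.truncn (nd (M.+1%:R * a))^-1).+1.
  have hQ' : Q'%:R^-1 < nd (M.+1%:R * a).
    rewrite invf_plt ?posrE ?ltr0n //.
    have i0 : 0 <= (nd (M.+1%:R * a))^-1 by rewrite invr_ge0 ltW.
    by have /andP[] := truncn_itv i0.
  exists (maxn Q Q'); split; first by rewrite leq_max Q0.
  have mx : (0 < maxn Q Q')%N by rewrite leq_max Q0.
  move=> q /andP[q0]; rewrite leq_eqVlt => /orP[/eqP ->|qM].
    by apply: le_lt_trans hQ'; rewrite lef_pV2 ?posrE ?ltr0n // ler_nat leq_maxr.
  have := IH q; rewrite q0 -ltnS qM => /(_ isT); apply: le_lt_trans.
  by rewrite lef_pV2 ?posrE ?ltr0n // ler_nat leq_maxl.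
have [q [A [/andP[q0 qQ] hq]]] := dirichlet a Q0.
pose g := gcdn `|A|%N q; have g0 : (0 < g)%N by rewrite gcdn_gt0 q0 orbT.
pose q' := (q %/ g)%N; pose A' := (A %/ g%:Z)%Z.
have qE : q = (q' * g)%N by rewrite divnK // dvdn_gcdr.
have gA : (g%:Z %| A)%Z by rewrite dvdzE /= dvdn_gcdl.
have AE : A = (A' * g%:Z)%R by rewrite divzK.
have q'0 : (0 < q')%N by rewrite divn_gt0 // dvdn_leq // dvdn_gcdr.
have gR : 1 <= g%:R :> R by rewrite ler1n.
have hq' : `|q'%:R * a - A'%:~R| <= Q%:R^-1.
  apply: le_trans _ hq.
  have -> : q%:R * a - A%:~R = (q'%:R * a - A'%:~R) * g%:R.
    rewrite {1}qE AE natrM intrM /=; ring.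
  by rewrite normrM [`|g%:R|]ger0_norm // ler_peMr.
exists q', A'; split.
- rewrite ltnNge; apply/negP => qM.
  have := HQ q'; rewrite q'0 qM => /(_ isT); rewrite ltNge => /negP; apply.
  exact: le_trans (nd_min _ A') hq'.
- have := AE; move/(congr1 absz); rewrite abszM /= => aE.
  rewrite /coprime; have : (gcdn `|A'| q' * g)%N = g.
    by rewrite muln_gcdl -aE -qE.
  by move/eqP; rewrite -{2}(mul1n g) eqn_pmul2r.
- apply: le_trans hq' _; rewrite lef_pV2 ?posrE ?ltr0n // ler_nat.
  by apply: leq_trans qQ; rewrite leq_div.
Qed.

(** mA - zq is a nonzero integer, because q is coprime to A and exceeds m. Replacing A by qa changes
    it by at most m/q <= 1/2, so at least 1/2 remains. *)
Lemma good_denominator_spacing (a : R) (q m : nat) (A : int) : coprime `|A|%N q ->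
  `|q%:R * a - A%:~R| <= q%:R^-1 -> (0 < m)%N -> (2 * m <= q)%N ->
  (2 * q%:R)^-1 <= nd (m%:R * a).
Proof.
move=> cop hq m0 mq; have q0 : (0 < q)%N by lia.
have qR : 0 < q%:R :> R by rewrite ltr0n.
set z := nint (m%:R * a).
have nz : (m%:Z * A - z * q%:Z)%R != 0.
  apply/eqP => /eqP; rewrite subr_eq0 => /eqP h.
  have : (q %| m * `|A|)%N.
    have := congr1 absz h; rewrite !abszM /= => ->; exact: dvdn_mull.
  rewrite Gauss_dvdl; last by rewrite coprime_sym.
  by move=> /(dvdn_leq m0); lia.
have h1 : 1 <= `|m%:R * A%:~R - z%:~R * q%:R : R|.
  have -> : m%:R * A%:~R - z%:~R * q%:R = (m%:Z * A - z * q%:Z)%:~R :> R by rewrite intrB !intrM.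
  by rewrite -intr_norm ler1z; move: nz; lia.
have h2 : `|m%:R * (q%:R * a - A%:~R)| <= 1 / 2.
  rewrite normrM ger0_norm //; apply: le_trans (ler_wpM2l _ hq) _ => //.
  have mqR : 2 * m%:R <= q%:R :> R by rewrite -natrM ler_nat.
  by rewrite ler_pdivrMr //; lra.
have h3 : 1 / 2 <= `|m%:R * a - z%:~R| * q%:R.
  rewrite -{1}(gtr0_norm qR) -normrM.
  rewrite (_ : _ * q%:R = m%:R * (q%:R * a - A%:~R) + (m%:R * A%:~R - z%:~R * q%:R)); last ring.
  move: h1 h2; set u := m%:R * (_ - _); set v := _ - z%:~R * _ => h1 h2.
  have := ler_normD (u + v) (- u); rewrite addrAC subrr add0r normrN; lra.
by rewrite invfM -[2^-1]div1r ler_pdivrMr.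
Qed.

End Approximation.

(** * Frequencies and the main term *)

Section FrequencyInequalities.
Variable R : realType.

Lemma le_5half (u v X : R) : X <= u -> 0 < v -> 0 <= u -> X <= 5 / 2 * (v + u).
Proof. lra. Qed.

Lemma le16_25 (u : R) : u <= 1 -> 16 + u <= 25.
Proof. lra. Qed.

Lemma le_s4 (s : R) : 1000 <= s -> 85 * s ^+ 2 + 20 * s ^+ 3 <= s ^+ 4 * (2 / 5).
Proof.
move=> h; have s0 : 0 <= s by lra.
have s2 : 0 <= s ^+ 2 by exact: sqr_ge0.
have g1 : 1000 * s ^+ 2 <= s ^+ 3 by rewrite [s ^+ 3]exprS ler_wpM2r.
have g2 : 1000 * s ^+ 3 <= s ^+ 4 by rewrite [s ^+ 4]exprS ler_wpM2r ?exprn_ge0.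
lra.
Qed.

End FrequencyInequalities.

(** * A single linear frequency *)

Section Frequencies.
Variables (R : realType) (E : nat) (p : nat -> nat) (s : R).
Notation Lam := (@Lam R).
Local Notation e := (E%:R : R).
Let x := p 4000.
Let B := (8 * x)%N.
Hypothesis pE : forall i, p i = (E ^ i)%N.
Hypotheses (s1000 : 1000 <= s) (sE : s ^+ 100 <= e) (Hln : 1 + 4500 * ln e <= s).
Hypothesis Htau : forall m, (0 < m <= p 4500)%N -> (tau m)%:R <= s.

(* Every size is a power [p i] of the base [E], with [x = E^4000], and [s = E^(1/100)] absorbs
   constants, logarithms and divisor counts. The function [p] is kept abstract so that literals such
   as [E ^ 4000] are never unfolded. *)
Lemma s_ge0 : 0 <= s. Proof. exact: le_trans s1000. Qed.

Lemma s_ge1 : 1 <= s. Proof. by apply: le_trans s1000; rewrite ler1n. Qed.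

Lemma small_pow (c : R) i : c <= s -> (i < 100)%N -> c * s ^+ i <= e.
Proof.
move=> cs i9; have h1 := s_ge1; have h0 := s_ge0.
apply: le_trans sE; apply: (@le_trans _ _ (s ^+ i.+1)).
  by rewrite exprS ler_wpM2r // exprn_ge0.
exact: ler_weXn2l.
Qed.

Lemma e_ge1000 : 1000 <= e.
Proof. by have := small_pow s1000 (isT : (0 < 100)%N); rewrite expr0 mulr1. Qed.

Lemma E_gt1 : (1 < E)%N.
Proof. by rewrite -(ltr_nat R); apply: lt_le_trans e_ge1000; rewrite ltr_nat. Qed.

Lemma E_ge8 : (8 <= E)%N.
Proof. by rewrite -(ler_nat R); apply: le_trans e_ge1000; rewrite ler_nat. Qed.

Lemma pD i j : p (i + j) = (p i * p j)%N. Proof. by rewrite !pE expnD. Qed.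

Lemma p_gt0 i : (0 < p i)%N.
Proof. by rewrite pE expn_gt0 ltnW // E_gt1. Qed.

Lemma p_le i j : (i <= j)%N -> (p i <= p j)%N.
Proof. by rewrite !pE leq_exp2l // E_gt1. Qed.

Lemma p_mul_le c i : (c <= 8)%N -> (c * p i <= p i.+1)%N.
Proof. by move=> c8; rewrite !pE expnS leq_mul2r (leq_trans c8 E_ge8) orbT. Qed.

Lemma p_leR i j : (i <= j)%N -> (p i)%:R <= (p j)%:R :> R.
Proof. by move=> ij; rewrite ler_nat p_le. Qed.

Lemma p_gt0R i : 0 < (p i)%:R :> R.
Proof. by rewrite ltr0n p_gt0. Qed.

Lemma pDR i j : (p (i + j))%:R = (p i)%:R * (p j)%:R :> R.
Proof. by rewrite pD natrM. Qed.

Lemma ln_small m : (0 < m)%N -> (m <= p 4500)%N -> ln m%:R <= s - 1.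
Proof.
move=> m0 mE; have h : ln m%:R <= ln (p 4500)%:R :> R.
  by rewrite ler_ln ?posrE ?ltr0n ?p_gt0 // ler_nat.
apply: le_trans h _; rewrite pE natrX lnXn ?ltr0n ?(ltnW E_gt1) // -[ln e *+ _]mulr_natl lerBrDl; exact: Hln.
Qed.

Lemma ln_le_s m : (0 < m)%N -> (m <= p 4500)%N -> ln m%:R <= s.
Proof. by move=> m0 mp; apply: le_trans (ln_small m0 mp) _; rewrite gerBl. Qed.

Lemma harm_small m : (0 < m)%N -> (m <= p 4500)%N -> harm R m <= s.
Proof. by move=> m0 mE; apply: le_trans (harm_le R m0) _; have := ln_small m0 mE; lra. Qed.

Variables (a : R) (q d m : nat) (ph : R).
Hypothesis spacing : forall j, (0 < j)%N -> (2 * j <= q)%N -> (2 * q%:R)^-1 <= nd (j%:R * a).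
Hypotheses (q1 : (p 1520 <= q)%N) (q2 : (q <= p 1521)%N).
Hypotheses (d0 : (0 < d)%N) (d2 : (d <= p 440)%N) (m0 : (0 < m)%N) (mq : (2 * m <= q)%N).

(** The multiples j m a/d with j < Q are at least 1/(2qd) from the integers: [nd_div] removes d, and
    2jm <= q brings in the approximation of a. [Q] is as long as this allows, up to U = E^1000. *)
Lemma frequency_bound :
  `|\sum_(1 <= n < B.+1 | (x < n)%N) Lam n * cos (2 * pi * (m%:R * (a / d%:R) * n%:R + ph))|
  <= s ^+ 4 * x%:R * (2 * (p 500)%:R^-1 + 4 * m%:R * (p 500)%:R / q%:R).
Proof.
have q0 : (0 < q)%N := leq_trans (p_gt0 _) q1.
have qR : 0 < q%:R :> R by rewrite ltr0n.
have dR : 0 < d%:R :> R by rewrite ltr0n.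
have mR : 0 < m%:R :> R by rewrite ltr0n.
have s0 := s_ge0; have s1 := s_ge1.
have sp : 0 < s by apply: lt_le_trans s1.
pose Q := minn (p 1000) (q %/ (2 * m)).
have m20 : (0 < 2 * m)%N by rewrite muln_gt0 m0.
have qm0 : (0 < q %/ (2 * m))%N by rewrite divn_gt0.
have Q0 : (0 < Q)%N by rewrite /Q leq_min p_gt0.
have QR : 0 < Q%:R :> R by rewrite ltr0n.
have QU : (Q <= p 1000)%N by exact: geq_minl.
pose X : R := (p 1000)%:R^-1 + 4 * m%:R / q%:R.
have i1000 : 0 < (p 1000)%:R^-1 :> R by rewrite invr_gt0 p_gt0R.
have i500 : 0 < (p 500)%:R^-1 :> R by rewrite invr_gt0 p_gt0R.
have mq0 : 0 < 4 * m%:R / q%:R :> R by rewrite divr_gt0 // mulr_gt0.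
have X0 : 0 < X by rewrite addr_gt0.
have QX : Q%:R^-1 <= X.
  rewrite /Q /minn; case: ifP => _.
    by rewrite /X lerDl ltW.
  apply: (@le_trans _ _ (4 * m%:R / q%:R)); last by rewrite lerDr ltW.
  have qmR : 0 < (q %/ (2 * m))%N%:R :> R by rewrite ltr0n.
  rewrite -[leLHS]div1r ler_pdivrMr // mulrAC ler_pdivlMr // mul1r -!natrM ler_nat.
  have := ltn_ceil q m20; have : (q %/ (2 * m) >= 1)%N by [].
  move: (q %/ (2 * m))%N => k k1 h; apply: leq_trans (ltnW h) _.
  have -> : (4 * m * k = 2 * k * (2 * m))%N by rewrite mulnACA -mulnA (mulnC m).
  by rewrite leq_mul2r; apply/orP; right; rewrite mul2n -addnn -addn1 leq_add2l.
(* A stand-in for 5 sqrt(X) without the root: it equals 5/2 (1/f + Xf) with f = E^500, and the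
   inequality of means makes its square at least 25 X. *)
pose kap : R := 5 / 2 * (2 * (p 500)%:R^-1 + 4 * m%:R * (p 500)%:R / q%:R).
have e5 : (p 1000)%:R^-1 = (p 500)%:R^-1 * (p 500)%:R^-1 :> R by rewrite -invfM -pDR.
have kapX : kap = 5 / 2 * ((p 500)%:R^-1 + X * (p 500)%:R).
  rewrite /kap /X e5; have : (p 500)%:R != 0 :> R by rewrite gt_eqF // p_gt0R.
  by move: ((p 500)%:R : R) => f f0; field; rewrite f0 gt_eqF.
have kap0 : 0 < kap by rewrite kapX mulr_gt0 // ?divr_gt0 // addr_gt0 // mulr_gt0 // p_gt0R.
have kap2 : 25 * X <= kap ^+ 2.
  rewrite kapX -subr_ge0; rewrite (_ : _ - _ = 25 / 4 * ((p 500)%:R^-1 - X * (p 500)%:R) ^+ 2).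
    by rewrite mulr_ge0 ?sqr_ge0 // divr_ge0.
  have : (p 500)%:R != 0 :> R by rewrite gt_eqF // p_gt0R.
  by move: ((p 500)%:R : R) => f f0; field.
have kapQ : Q%:R^-1 <= kap.
  apply: le_trans QX _; rewrite kapX.
  have h1 : X <= X * (p 500)%:R.
    by rewrite ler_peMr ?(ltW X0) // ler1n p_gt0.
  have h2 : 0 <= X * (p 500)%:R by rewrite mulr_ge0 ?(ltW X0) // ltW // p_gt0R.
  exact: le_5half h1 i500 h2.
pose K := (2 * q * d)%N.
have K0 : (0 < K)%N by rewrite !muln_gt0 q0.
pose ks : R := K%:R^-1.
have ks0 : 0 < ks by rewrite invr_gt0 ltr0n.
have KE : (K <= p 1962)%N.
  rewrite /K -mulnA; apply: leq_trans (p_mul_le 1961 (isT : 2 <= 8)%N).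
  by rewrite leq_mul2l (_ : 1961 = 1521 + 440)%N // pD leq_mul.
(* The factor 3 gives Y^2 = 9x, which covers B = 8x. *)
pose U := (p 1000)%N; pose Y := (3 * p 2000)%N.
have xR : x%:R = (p 4000)%:R :> R by [].
have x0 : (0 < x)%N by exact: p_gt0.
have xRp : 0 < x%:R :> R by rewrite ltr0n.
have UU : (U * U = p 2000)%N by rewrite -pD.
have Hsp j : (1 <= j < Q)%N -> ks <= nd (m%:R * (a / d%:R) * j%:R).
  move=> /andP[j1 jQ].
  rewrite (_ : _ * j%:R = (j * m)%N%:R * a / d%:R); last by rewrite natrM; field; rewrite gt_eqF.
  apply: le_trans (nd_div _ d0).
  rewrite /ks /K natrM invfM ler_wpM2r ?invr_ge0 // natrM.
  apply: spacing; first by rewrite muln_gt0 j1.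
  have jq : (j <= q %/ (2 * m))%N by rewrite (leq_trans (ltnW jQ)) // geq_minr.
  by rewrite mulnCA -leq_divRL.
pose J := (U * U %/ Q).+1.
have UJ : (U * U <= J * Q)%N by rewrite ltnW // ltn_ceil.
have big i : (i < 4500)%N -> (p i.+1 <= p 4500)%N by move=> h; exact: p_le.
have Qle : (Q <= p 2000)%N by rewrite (leq_trans QU) // p_le.
have JE : (J <= p 2001)%N.
  apply: leq_trans (p_mul_le 2000 (isT : 2 <= 8)%N).
  by rewrite mul2n -addnn /J UU -addn1 leq_add ?p_gt0 // leq_div.
have YQ : (Y + Q <= p 2001)%N.
  apply: leq_trans (p_mul_le 2000 (isT : 4 <= 8)%N).
  by rewrite /Y (_ : 4 = 3 + 1)%N // mulnDl mul1n leq_add2l.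
have BE : (B <= p 4001)%N by exact: p_mul_le.
have B0 : (0 < B)%N by rewrite muln_gt0.
have B45 : (B <= p 4500)%N := leq_trans BE (big 4000 isT).
have HLB : ln B%:R <= s := ln_le_s B0 B45.
have HYQ : harm R (Y + Q) <= s.
  by apply: harm_small; [rewrite addn_gt0 Q0 orbT|exact: leq_trans YQ (big 2000 isT)].
have HKs : harm R K <= s := (harm_small K0 (leq_trans KE (big 1961 isT))).
have HJs : harm R J <= s := (@harm_small J isT (leq_trans JE (big 2000 isT))).
have HTs n : (1 <= n <= B)%N -> (tau n)%:R <= s.
  move=> /andP[n1 nB]; by apply: Htau; rewrite n1 (leq_trans nB B45).
have Kx : 24 * s * K%:R * (p 2000)%:R <= x%:R.
  apply: (@le_trans _ _ (e * (p 1962)%:R * (p 2000)%:R)).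
    rewrite ler_wpM2r ?(ltW (p_gt0R _)) //; apply: ler_pM => //; first by rewrite mulr_ge0.
      have := @small_pow 24 1 _ isT; rewrite expr1; apply; apply: le_trans s1000.
      by rewrite ler_nat.
    by rewrite ler_nat.
  have -> : e = (p 1)%:R :> R by rewrite pE expn1.
  by rewrite -!pDR p_leR.
have ksi : ks^-1 = K%:R by rewrite /ks invrK.
have Hkap : 16 + 4 * s * Y%:R / (ks * x%:R) <= kap ^+ 2 * Q%:R.
  apply: (@le_trans _ _ 25).
    have : 4 * s * Y%:R / (ks * x%:R) <= 1.
      rewrite invfM ksi mulrA ler_pdivrMr // mul1r.
      apply: le_trans _ Kx; rewrite /Y natrM.
      rewrite (_ : 24 * s * K%:R * _ = 4 * s * (3 * (p 2000)%:R) * K%:R * 2); last ring.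
      by rewrite ler_peMr // ?mulr_ge0 ?exprn_ge0 // ler1n.
    exact: le16_25.
  have {1}-> : 25 = 25 * Q%:R^-1 * Q%:R :> R by rewrite -mulrA mulVf ?mulr1 // gt_eqF.
  rewrite ler_wpM2r //.
  by apply: le_trans kap2; rewrite ler_wpM2l.
have Ux : (U <= x)%N by exact: p_le.
have UB : (U * U <= B)%N by rewrite UU (leq_trans (p_le (isT : 2000 <= 4000)%N)) // leq_pmull.
have BY : (B <= Y * Y)%N.
  rewrite /Y mulnACA -pD /B leq_mul2r orbT //.
have YB : (Y <= B)%N.
  by rewrite /Y /B; apply: leq_mul; [|exact: p_le].
have kK : ks^-1 <= K%:R by rewrite ksi.
have main := @linear_prime_sum R x B U Q Y K (m%:R * (a / d%:R)) ph ks s s kap x0 erefl Q0 ks0 kK Hsp QU Ux UB BY YB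
  sp HLB HYQ HKs sp HTs kap0 Hkap J isT UJ HJs.
apply: le_trans main _.
have J3 : J.+1%:R <= 3 * ((p 2000)%:R / Q%:R) :> R.
  rewrite mulrA ler_pdivlMr // -!natrM ler_nat /J UU -addn2 mulnDl.
  have h1 := leq_trunc_div (p 2000) Q.
  rewrite (_ : 3 = 1 + 2)%N // mulnDl mul1n leq_add // leq_mul2l //.
have t2 : J.+1%:R * (4 / ks * (s + 1)) <= x%:R / Q%:R.
  rewrite ksi; apply: (@le_trans _ _ (3 * ((p 2000)%:R / Q%:R) * (4 * K%:R * (2 * s)))).
    apply: ler_pM => //; first by rewrite !mulr_ge0 // addr_ge0.
    have ss : s + 1 <= 2 * s by rewrite mulr_natl mulr2n lerD2l.
    by rewrite ler_wpM2l ?mulr_ge0.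
  rewrite [leLHS](_ : _ = 24 * s * K%:R * (p 2000)%:R / Q%:R); last by field; rewrite gt_eqF.
  by rewrite ler_wpM2r // invr_ge0 ltW.
have t3 : x%:R / Q%:R <= x%:R * kap by rewrite ler_wpM2l // ltW.
apply: (@le_trans _ _ (5 * s * (17 * s * (x%:R * kap)) + 20 * s ^+ 3 * (x%:R * kap))).
  apply: lerD; last by rewrite le_eqVlt; apply/orP; left; apply/eqP; ring.
  rewrite ler_wpM2l ?mulr_ge0 //.
  have p0 : 0 <= x%:R / Q%:R :> R by rewrite divr_ge0.
  have h16 : 16 * x%:R / Q%:R * s <= 16 * s * (x%:R * kap).
    by rewrite (_ : 16 * x%:R / Q%:R * s = 16 * s * (x%:R / Q%:R)) ?ler_wpM2l ?mulr_ge0 //; ring.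
  have h1 : x%:R / Q%:R <= s * (x%:R * kap).
    by apply: le_trans t3 _; rewrite ler_peMl // mulr_ge0 // ltW.
  have h2 := lerD h16 (le_trans t2 h1); apply: le_trans h2 _.
  by rewrite le_eqVlt; apply/orP; left; apply/eqP; ring.
rewrite (_ : s ^+ 4 * x%:R * _ = s ^+ 4 * (2 / 5) * (x%:R * kap)); last first.
  rewrite /kap; have : (p 500)%:R != 0 :> R by rewrite gt_eqF // p_gt0R.
  by move: ((p 500)%:R : R) => f f0; field; rewrite f0 gt_eqF.
rewrite mulrA -mulrDl; apply: ler_wpM2r; first by apply: mulr_ge0 => //; exact: ltW.
rewrite (_ : 5 * s * (17 * s) = 85 * s ^+ 2); last ring.
exact: le_s4.
Qed.

End Frequencies.

(** * The sieve weight as a trigonometric polynomial *)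

Section Expansion.
Variables (R : realType) (E : nat) (p : nat -> nat) (s : R).
Notation Lam := (@Lam R).
Local Notation e := (E%:R : R).
Let x := p 4000.
Let B := (8 * x)%N.
Hypothesis pE : forall i, p i = (E ^ i)%N.
Hypotheses (s1000 : 1000 <= s) (sE : s ^+ 100 <= e) (Hln : 1 + 4500 * ln e <= s).
Hypothesis Htau : forall m, (0 < m <= p 4500)%N -> (tau m)%:R <= s.
Variables (a b : R) (q sg : nat).
Hypothesis spacing : forall j, (0 < j)%N -> (2 * j <= q)%N -> (2 * q%:R)^-1 <= nd (j%:R * a).
Hypotheses (q1 : (p 1520 <= q)%N) (q2 : (q <= p 1521)%N) (sg2 : (2 <= sg)%N) (sgp : (sg <= p 27)%N).

Definition mangoldt_sum (f : nat -> R) := \sum_(1 <= n < B.+1 | (x < n)%N) Lam n * f n.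

Lemma mangoldt_sumD f g : mangoldt_sum (fun n => f n + g n) = mangoldt_sum f + mangoldt_sum g.
Proof. by rewrite /mangoldt_sum -big_split /=; apply: eq_bigr => n _; rewrite mulrDr. Qed.

Lemma mangoldt_sumZ c f : mangoldt_sum (fun n => c * f n) = c * mangoldt_sum f.
Proof. by rewrite /mangoldt_sum mulr_sumr; apply: eq_bigr => n _; rewrite mulrCA. Qed.

Lemma mangoldt_sum_ext f g : f =1 g -> mangoldt_sum f = mangoldt_sum g.
Proof. by move=> fg; apply: eq_bigr => n _; rewrite fg. Qed.

Lemma mangoldt_sum_sum (I : Type) (r : seq I) (P : pred I) (F : I -> nat -> R) :
  mangoldt_sum (fun n => \sum_(i <- r | P i) F i n) = \sum_(i <- r | P i) mangoldt_sum (F i).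
Proof.
rewrite /mangoldt_sum exchange_big /=; apply: eq_bigr => n _; by rewrite mulr_sumr.
Qed.

Lemma mangoldt_sum_le f g : (forall n, (x < n <= B)%N -> f n <= g n) -> mangoldt_sum f <= mangoldt_sum g.
Proof.
move=> fg; rewrite /mangoldt_sum big_nat_cond [leRHS]big_nat_cond.
by apply: ler_sum => n /andP[/andP[_ nB] xn]; rewrite ler_wpM2l ?Lam_ge0 // fg // xn.
Qed.

Lemma mangoldt_sum_norm f g : (forall n, (x < n <= B)%N -> `|f n| <= g n) -> `|mangoldt_sum f| <= mangoldt_sum g.
Proof.
move=> fg; rewrite ler_norml -(mulN1r (mangoldt_sum g)) -mangoldt_sumZ.
apply/andP; split; apply: mangoldt_sum_le => n /fg; rewrite ler_norml => /andP[]; rewrite ?mulN1r //.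
Qed.

Let Psi := mangoldt_sum (fun=> 1).

Lemma Psi_ge0 : 0 <= Psi.
Proof. by apply: sumr_ge0 => n _; rewrite mulr1 Lam_ge0. Qed.

Lemma p_ratio i j k c : c%:R * s <= e -> (i + k + 1 <= j)%N -> c%:R * s * (p i)%:R / (p j)%:R <= (p k)%:R^-1.
Proof.
move=> cs ijk; have p0 i' : 0 < (p i')%:R :> R by exact: p_gt0R pE s1000 sE i'.
rewrite ler_pdivrMr // [leRHS]mulrC ler_pdivlMr //.
apply: (@le_trans _ _ ((p (i + k + 1))%:R)); last exact: p_leR pE s1000 sE _ _ ijk.
rewrite !(pDR R pE) [X in _ <= _ * X%:R]pE expn1 [leRHS]mulrC -[leLHS]mulrA.
by rewrite ler_wpM2r // mulr_ge0.
Qed.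

(** The accuracy E^-480 survives the mass E^440 of the list, and needs at most E^1429 frequencies
    (1429 = 467 + 2 * 481). As q >= E^1520, all frequencies below this limit satisfy the condition
    2m <= q of [frequency_bound]. *)
Lemma expand_one (d : nat) : (0 < d)%N -> (d <= p 440)%N ->
  exists tp : seq (R * R * R), [/\ tmass tp <= 2,
    forall n, `|tpoly tp n - tri (d * sg) ((a * n%:R + b) / d%:R)| <= (p 480)%:R^-1 &
    `|mangoldt_sum (tpoly tp) - (d * sg)%N%:R^-1 * Psi| <= s ^+ 5 * x%:R / (p 500)%:R].
Proof.
move=> d0 dp; have p0 i : 0 < (p i)%:R :> R by exact: p_gt0R pE s1000 sE i.
have ple i j : (i <= j)%N -> (p i)%:R <= (p j)%:R :> R by move=> h; exact: p_leR pE s1000 sE _ _ h.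
have s0 := s_ge0 s1000; have s1 := s_ge1 s1000.
have dR : 0 < d%:R :> R by rewrite ltr0n.
have sg0 : (0 < sg)%N by exact: ltnW.
have e1000 := e_ge1000 s1000 sE.
have eE : (p 1)%:R = e by rewrite pE expn1.
pose r := (d * sg)%N.
have r2 : (2 <= r)%N by rewrite (leq_trans sg2) // leq_pmull.
have r0 : 0 < r%:R :> R by rewrite ltr0n (leq_trans _ r2).
have rp : r%:R <= (p 467)%:R :> R.
  by rewrite ler_nat (_ : 467 = 440 + 27)%N // (pD pE) leq_mul.
have eps0 : 0 < (p 480)%:R^-1 :> R by rewrite invr_gt0.
have [N [c [mu [Nb [c0 c1] cw mu0 F]]]] := tri_fourier r2 eps0.
have NE : (N <= p 1429)%N.
  rewrite -(ler_nat R); apply: le_trans Nb _; rewrite invrK.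
  have h25 : 24 * (p 480)%:R + 1 <= (p 481)%:R :> R.
    rewrite (_ : 481 = 1 + 480)%N // (pDR R pE) eE.
    apply: (@le_trans _ _ (25 * (p 480)%:R)).
      have h1 : 1 <= (p 480)%:R :> R by rewrite ler1n -(ltr0n R).
      by move: h1; move: ((p 480)%:R : R) => z; lra.
    rewrite ler_wpM2r ?(ltW (p0 _)) //; apply: le_trans e1000; by rewrite ler_nat.
  rewrite (_ : 1429 = 467 + (481 + 481))%N // !(pDR R pE) -expr2.
  apply: ler_pM => //; first exact: sqr_ge0.
  by rewrite ler_pXn2r ?nnegrE ?addr_ge0 ?mulr_ge0 // ltW.
have NE4 : (N <= p 4500)%N by apply: leq_trans NE _; exact: (p_le pE s1000 sE).
have Nq m : (m < N)%N -> (2 * m <= q)%N.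
  move=> mN; apply: (@leq_trans (2 * p 1429)).
    by rewrite leq_mul2l (leq_trans (ltnW mN)).
  apply: leq_trans (p_mul_le pE s1000 sE 1429 (isT : 2 <= 8)%N) _.
  by apply: leq_trans q1; exact: (p_le pE s1000 sE).
pose tp := (r%:R^-1, 0, 0) :: [seq (c h, (mu h)%:R * (a / d%:R), (mu h)%:R * (b / d%:R)) | h <- index_iota 1 N].
have tpE n : tpoly tp n = r%:R^-1 + \sum_(1 <= h < N) c h * cos (2 * pi * ((mu h)%:R * ((a * n%:R + b) / d%:R))).
  rewrite /tpoly big_cons big_map /= mul0r addr0 mulr0 cos0 mulr1; congr (_ + _).
  apply: eq_bigr => h _; congr (_ * cos (_ * _)); by field; rewrite gt_eqF.
exists tp; split.
- rewrite /tmass big_cons big_map /= gtr0_norm ?invr_gt0 //.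
  have : \sum_(1 <= h < N) `|c h| <= 1.
    by apply: le_trans c1; apply: ler_sum => h _; rewrite ger0_norm.
  have : r%:R^-1 <= 1 :> R by rewrite invf_le1 // ler1n (leq_trans _ r2).
  by move: (r%:R^-1) (\sum_(_ <= _ < _) _) => u v; lra.
- by move=> n; rewrite tpE distrC; exact: F.
have -> : mangoldt_sum (tpoly tp) = r%:R^-1 * Psi + \sum_(1 <= h < N) c h * mangoldt_sum (fun n => cos (2 * pi * ((mu h)%:R * (a / d%:R) * n%:R + (mu h)%:R * (b / d%:R)))).
  rewrite (mangoldt_sum_ext tpE) mangoldt_sumD; congr (_ + _).
    by rewrite /Psi -mangoldt_sumZ; apply: mangoldt_sum_ext => n; rewrite mulr1.
  rewrite mangoldt_sum_sum; apply: eq_bigr => h _; rewrite -mangoldt_sumZ; apply: mangoldt_sum_ext => n.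
  congr (_ * cos (_ * _)); by field; rewrite gt_eqF.
rewrite addrAC subrr add0r.
apply: le_trans (ler_norm_sum _ _ _) _.
have q0 : (0 < q)%N by rewrite (leq_trans _ q1) // -(ltr0n R).
have qR : 0 < q%:R :> R by rewrite ltr0n.
pose A : R := s ^+ 4 * x%:R * (2 * (p 500)%:R^-1).
pose Bq : R := s ^+ 4 * x%:R * (4 * (p 500)%:R / q%:R).
have xR0 : 0 <= x%:R :> R by [].
have s40 : 0 <= s ^+ 4 by rewrite exprn_ge0.
have A0 : 0 <= A by rewrite !mulr_ge0 // invr_ge0 ltW.
have Bq0 : 0 <= Bq by rewrite !mulr_ge0 // invr_ge0 ltW.
(* [tri_fourier] does not bound an individual frequency, so m >= N receives the trivial bound [Psi];
   the weighted series runs over m < N, where this term vanishes. *)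
pose w m := Bq * m%:R + (if (N <= m)%N then Psi else 0).
have w0 m : 0 <= w m.
  rewrite /w; apply: addr_ge0; first exact: mulr_ge0.
  by case: (N <= m)%N => //; exact: Psi_ge0.
apply: (@le_trans _ _ (\sum_(1 <= h < N) c h * (A + w (mu h)))).
  rewrite !big_nat; apply: ler_sum => h hN; rewrite normrM ger0_norm //; apply: ler_wpM2l => //.
  rewrite /w; case: leqP => hm.
    apply: (@le_trans _ _ Psi); last by rewrite addrA lerDr addr_ge0 // mulr_ge0.
    by apply: mangoldt_sum_norm => n _; exact: cos_max.
  rewrite addr0; have := frequency_bound pE s1000 sE Hln Htau ((mu h)%:R * (b / d%:R)) spacing q1 q2 d0 dp (mu0 _ hN) (Nq _ hm).
  move=> H; apply: le_trans H _; rewrite le_eqVlt /A /Bq; apply/orP; left; apply/eqP.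
  have n5 : (p 500)%:R != 0 :> R by rewrite gt_eqF.
  by field; rewrite n5 gt_eqF.
have -> : \sum_(1 <= h < N) c h * (A + w (mu h)) = (\sum_(1 <= h < N) c h) * A + \sum_(1 <= h < N) c h * w (mu h).
  rewrite mulr_suml -big_split /=; apply: eq_bigr => h _; ring.
have S2 : \sum_(1 <= h < N) c h * w (mu h) <= 16 * r%:R * Bq * s.
  apply: le_trans (cw w w0) _.
  apply: (@le_trans _ _ (16 * r%:R * Bq * \sum_(1 <= m < N) m%:R^-1)).
    rewrite mulr_sumr !big_nat; apply: ler_sum => m /andP[m1 mN].
    have mR : 0 < m%:R :> R by rewrite ltr0n.
    rewrite /w leqNgt mN /= addr0 le_eqVlt; apply/orP; left; apply/eqP; field; by rewrite gt_eqF.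
  apply: ler_wpM2l; first by apply: mulr_ge0 => //; rewrite mulr_ge0 // ltW.
  case: N NE4 {Nb c1 cw mu0 F NE Nq tp tpE w w0} => [|[|N]] NE4; [by rewrite big_geq|by rewrite big_geq|].
  exact: (@harm_small R E p s pE s1000 sE Hln N.+1 isT (leq_trans (leqnSn _) NE4)).
have h1 : (\sum_(1 <= h < N) c h) * A <= A by rewrite ler_piMl.
apply: le_trans (lerD h1 S2) _.
have h2 : 16 * r%:R * Bq * s <= s ^+ 4 * x%:R * (p 500)%:R^-1.
  rewrite (_ : _ * s = s ^+ 4 * x%:R * (64 * s * (r%:R * (p 500)%:R) / q%:R)); last by rewrite /Bq; ring.
  rewrite ler_wpM2l ?mulr_ge0 //.
  apply: (@le_trans _ _ (64 * s * (p 967)%:R / (p 1520)%:R)).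
    apply: ler_pM; rewrite ?invr_ge0 ?(ltW qR) ?mulr_ge0 ?(ltW r0) ?(ltW (p0 _)) //.
      rewrite ler_wpM2l ?mulr_ge0 // (_ : 967 = 467 + 500)%N // (pDR R pE) ler_wpM2r // ltW //.
    by rewrite lef_pV2 ?posrE // ler_nat.
  apply: (p_ratio (c := 64)) => //.
  by have := @small_pow R E s s1000 sE 64 1 _ isT; rewrite expr1; apply; apply: le_trans s1000; rewrite ler_nat.
apply: le_trans (lerD (lexx A) h2) _.
rewrite /A -mulrDr (_ : 2 * _ + _ = 3 * (p 500)%:R^-1); last ring.
rewrite mulrA ler_wpM2r ?invr_ge0 ?(ltW (p0 _)) // mulrAC ler_wpM2r // [s ^+ 5]exprSr ler_wpM2l //.
by apply: le_trans s1000; rewrite ler_nat.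
Qed.

(** For positive moduli, [tri_dvd] turns this into [tri sg (a n + b)] times the sum of the
    coefficients whose modulus divides the integer nearest to a n + b. *)
Definition weighted (Xi : seq (R * nat)) (n : nat) : R :=
  \sum_(t <- Xi) t.1 * tri (t.2 * sg) ((a * n%:R + b) / t.2%:R).

Lemma expand_list (Xi : seq (R * nat)) : (forall t, t \in Xi -> (0 < t.2 <= p 440)%N) ->
  exists tp : seq (R * R * R), [/\ tmass tp <= 2 * \sum_(t <- Xi) `|t.1|,
    forall n, `|tpoly tp n - weighted Xi n| <= (p 480)%:R^-1 * \sum_(t <- Xi) `|t.1| &
    `|mangoldt_sum (tpoly tp) - Psi / sg%:R * \sum_(t <- Xi) t.1 / t.2%:R| <= s ^+ 5 * x%:R / (p 500)%:R * \sum_(t <- Xi) `|t.1|].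
Proof.
elim: Xi => [|t Xi IH] H.
  exists [::]; split; rewrite ?big_nil ?mulr0 ?/tmass ?big_nil //.
    by move=> n; rewrite /tpoly /weighted !big_nil subrr normr0.
  rewrite subr0 (_ : mangoldt_sum _ = 0) ?normr0 // /mangoldt_sum big1 // => n _; by rewrite /tpoly big_nil mulr0.
have [tp [m1 m2 m3]] : exists tp : seq (R * R * R), [/\ tmass tp <= 2 * \sum_(t <- Xi) `|t.1|,
    forall n, `|tpoly tp n - weighted Xi n| <= (p 480)%:R^-1 * \sum_(t <- Xi) `|t.1| &
    `|mangoldt_sum (tpoly tp) - Psi / sg%:R * \sum_(t <- Xi) t.1 / t.2%:R| <= s ^+ 5 * x%:R / (p 500)%:R * \sum_(t <- Xi) `|t.1|].
  by apply: IH => u uX; apply: H; rewrite inE uX orbT.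
have /andP[t0 tp4] := H t (mem_head _ _).
have [tq [k1 k2 k3]] := expand_one t0 tp4.
pose tr := [seq (t.1 * u.1.1, u.1.2, u.2) | u <- tq].
have trE n : tpoly (tr ++ tp) n = t.1 * tpoly tq n + tpoly tp n.
  rewrite /tpoly big_cat big_map /= mulr_sumr; congr (_ + _); apply: eq_bigr => u _; by rewrite mulrA.
have two (A B' C u v : R) : `|A| <= u -> `|B'| <= v -> A + B' = C -> `|C| <= u + v.
  by move=> hA hB <-; apply: le_trans (ler_normD _ _) _; exact: lerD.
have sc (A u : R) : `|A| <= u -> `|t.1 * A| <= `|t.1| * u by move=> h; rewrite normrM ler_wpM2l.
exists (tr ++ tp); split.
- rewrite /tmass big_cat big_map /= big_cons mulrDr; apply: lerD => //.
  apply: (@le_trans _ _ (`|t.1| * tmass tq)).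
    by rewrite /tmass mulr_sumr; apply: ler_sum => u _; rewrite normrM.
  by rewrite mulrC ler_wpM2r.
- move=> n; rewrite big_cons mulrDr trE /weighted big_cons -/(weighted Xi n).
  rewrite [X in _ <= X + _]mulrC.
  by apply: two (sc _ _ (k2 n)) (m2 n) _; ring.
- rewrite !big_cons mulrDr [X in _ <= X]mulrDr (mangoldt_sum_ext trE) mangoldt_sumD mangoldt_sumZ.
  rewrite [X in _ <= X + _]mulrC; apply: two (sc _ _ k3) m3 _.
  have tR : t.2%:R != 0 :> R by rewrite pnatr_eq0 -lt0n.
  have sR : sg%:R != 0 :> R by rewrite pnatr_eq0 -lt0n ltnW.
  by rewrite natrM; field; rewrite tR sR.
Qed.

End Expansion.

Section ExponentInequalities.
Variable R : realType.

Lemma three_term_le (u w z : R) : u <= 2 * z -> 4 <= z -> w <= z -> 36 * (u + 4 + w) <= 144 * z.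
Proof. lra. Qed.

Lemma three_term_le1 (u w z : R) : u <= z -> 4 <= z -> w <= z -> 36 * (u + 4 + w) <= 108 * z.
Proof. lra. Qed.

Lemma half_sum_le (u v x y z w : R) : u <= x -> v <= y -> 2 * z <= w -> x <= z -> y <= z -> 0 <= y ->
  u + v / 2 <= w.
Proof. lra. Qed.

End ExponentInequalities.

(** * A single frequency of n^g *)

Section PowerFrequencies.
Variables (R : realType) (E : nat) (p : nat -> nat) (s : R).
Notation Lam := (@Lam R).
Local Notation e := (E%:R : R).
Local Notation "'P i" := ((p i)%:R : R) (at level 10, i at level 8).
Let x := p 4000.
Let B := (8 * x)%N.
Hypothesis pE : forall i, p i = (E ^ i)%N.
Hypotheses (s1000 : 1000 <= s) (sE : s ^+ 100 <= e) (Hln : 1 + 4500 * ln e <= s).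
Hypothesis Htau : forall m, (0 < m <= p 4500)%N -> (tau m)%:R <= s.

Lemma pSR (c : R) i : c <= e -> c * 'P i <= 'P i.+1.
Proof.
move=> ce; rewrite -[i.+1]add1n (pDR R pE) [X in _ <= X%:R * _]pE expn1.
by rewrite ler_wpM2r.
Qed.

Lemma pSn (c : nat) i : (c <= 1000)%N -> c%:R * 'P i <= 'P i.+1.
Proof.
by move=> c1; apply: pSR; apply: le_trans (e_ge1000 s1000 sE); rewrite ler_nat.
Qed.

Variables (g : R) (t kq : nat) (tp : seq (R * R * R)) (ph : R).
Let mu0 : R := g * (1 - g) / 1024.
Hypotheses (g12 : 1 / 2 <= g) (g1 : g < 1) (hmu : s^-1 <= mu0).
Let v : R := x%:R `^ (g - 1).
Hypotheses (v1 : ('P 27)^-1 <= v) (tv : t%:R * v <= 9).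
Hypotheses (kq0 : (0 < kq)%N) (kqt : (kq <= t * p 30)%N).
Hypotheses (htp : tmass tp <= 'P 441) (htW : forall n, (x < n <= B)%N -> `|tpoly tp n| <= s ^+ 9).

(** Balance of exponents. Off the diagonal the squared mass E^882 meets eta Q = E^-880 and leaves
    E^2; on the diagonal 8 s^18 <= E; both are well below kap^2 Q = E^4. In the type I sums, U^2
    times the mass is E^1921 against eta1 = E^-1980. *)
Lemma power_frequency :
  `|mangoldt_sum p (fun n => tpoly tp n * cos (2 * pi * (kq%:R * n%:R `^ g + ph)))| <= x%:R / 'P 31.
Proof.
have P0 i : 0 < 'P i by exact: p_gt0R pE s1000 sE i.
have Pi0 i : 0 <= ('P i)^-1 by rewrite invr_ge0 ltW.
have Pge0 i : 0 <= 'P i by exact: ltW.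
have Ple i j : (i <= j)%N -> 'P i <= 'P j by move=> h; exact: p_leR pE s1000 sE _ _ h.
have PD i j : 'P (i + j) = 'P i * 'P j by exact: pDR.
have s0 := s_ge0 s1000; have s1 := s_ge1 s1000.
have sp : 0 < s by exact: lt_le_trans s1.
have se i : (i < 100)%N -> s ^+ i <= e.
  by move=> h; have := @small_pow R E s s1000 sE 1 i s1 h; rewrite mul1r.
have kR : 0 < kq%:R :> R by rewrite ltr0n.
have v0 : 0 < v by apply: lt_le_trans v1; rewrite invr_gt0.
pose T := kq%:R * v.
have T0 : 0 < T by rewrite mulr_gt0.
have T1 : ('P 27)^-1 <= T.
  by apply: le_trans v1 _; rewrite /T ler_peMl ?(ltW v0) // ler1n.
have T2 : T <= 'P 31.
  apply: le_trans (pSn 30 (isT : 9 <= 1000)%N).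
  apply: (@le_trans _ _ (t%:R * 'P 30 * v)).
    by rewrite /T ler_wpM2r ?(ltW v0) // -natrM ler_nat.
  by rewrite mulrAC ler_wpM2r.
have Ti : T^-1 <= 'P 27 by rewrite -[leRHS]invrK lef_pV2 ?posrE ?invr_gt0.
have g0 : 0 < g by apply: lt_le_trans g12; rewrite divr_gt0.
have mu00 : 0 < mu0 by apply: lt_le_trans hmu; rewrite invr_gt0.
have mu08 : 8 * mu0 <= 1.
  have h : g * (1 - g) <= 1 by rewrite mulr_ile1 ?subr_ge0 ?(ltW g0) ?(ltW g1) // gerBl ltW.
  rewrite /mu0 mulrCA; apply: le_trans (ler_wpM2r _ h) _; first by rewrite divr_ge0.
  by rewrite mul1r ler_pdivrMr // mul1r ler_nat.
pose U := p 740; pose Q := p 68; pose Y := (3 * p 2000)%N.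
have x0 : (0 < x)%N by exact: p_gt0 pE s1000 sE _.
have ple i j : (i <= j)%N -> (p i <= p j)%N by exact: p_le pE s1000 sE i j.
have UU : (U * U = p 1480)%N by rewrite -(pD pE).
have Ux : (U * U <= x)%N by rewrite UU ple.
have Y6 : (2 * Y)%:R <= 'P 2001.
  rewrite /Y mulnA natrM; exact: pSn.
have Yx : (2 * Y <= x)%N.
  rewrite -(ler_nat R); apply: le_trans Y6 _; exact: Ple.
have BY : (B <= Y * Y)%N by rewrite /Y mulnACA -(pD pE) /B leq_mul2r orbT.
have YB : (Y <= B)%N by apply: leq_mul => //; exact: ple.
have Y0 : (0 < Y)%N by rewrite muln_gt0 (p_gt0 pE s1000 sE).
have xY : 'P 1999 <= x%:R / (2 * Y%:R).
  have Y20 : 0 < (2 * Y)%N%:R :> R by rewrite ltr0n muln_gt0.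
  rewrite -natrM ler_pdivlMr //.
  apply: le_trans (ler_wpM2l (Pge0 _) Y6) _; rewrite -PD; exact: Ple.
have B45 : (B <= p 4500)%N.
  apply: leq_trans (p_mul_le pE s1000 sE 4000 (isT : 8 <= 8)%N) _; exact: ple.
have B0 : (0 < B)%N by rewrite muln_gt0.
have HLB : ln B%:R <= s := ln_le_s pE s1000 sE Hln B0 B45.
have HYQ : harm R (Y + Q) <= s.
  apply: (harm_small pE s1000 sE Hln); first by rewrite addn_gt0 Y0.
  apply: (@leq_trans (4 * p 2000)).
    by rewrite (_ : 4 = 3 + 1)%N // mulnDl mul1n leq_add2l ple.
  apply: leq_trans (p_mul_le pE s1000 sE 2000 (isT : 4 <= 8)%N) _; exact: ple.
have HTs n : (1 <= n <= B)%N -> (tau n)%:R <= s.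
  by move=> /andP[n1 nB]; apply: Htau; rewrite n1 (leq_trans nB B45).
have QT : Q%:R * T <= 'P 99.
  by rewrite (_ : 99 = 68 + 31)%N // PD ler_wpM2l.
have smallT : 8 * mu0 * Q%:R * T <= x%:R / (2 * Y%:R).
  apply: le_trans xY; rewrite -mulrA; apply: (@le_trans _ _ (1 * 'P 99)); last by rewrite mul1r Ple.
  apply: ler_pM mu08 QT; apply: mulr_ge0 => //; exact: ltW.
have smallT1 : 4 * mu0 * T * (U * U)%:R ^+ 2 <= x%:R.
  rewrite UU expr2 -PD; apply: (@le_trans _ _ (1 * ('P 31 * 'P (1480 + 1480)))); last first.
    by rewrite mul1r -PD Ple.
  rewrite -[leLHS]mulrA; apply: ler_pM.
  - by apply: mulr_ge0 => //; exact: ltW.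
  - by rewrite mulr_ge0 // ltW.
  - by apply: le_trans mu08; rewrite ler_wpM2r ?(ltW mu00) // ler_nat.
  - by rewrite ler_wpM2r.
have P1 : 'P 1 = e by rewrite pE expn1.
have hmuP i j : (i + 2 <= j)%N -> 'P i * 'P 1 <= mu0 * 'P j.
  move=> ij; apply: (@le_trans _ _ (s^-1 * 'P j)); last by rewrite ler_wpM2r.
  rewrite [leRHS]mulrC ler_pdivlMr //.
  apply: (@le_trans _ _ ('P (i + 1 + 1)%N)); last by rewrite -addnA Ple.
  by rewrite !PD ler_wpM2l ?mulr_ge0 // P1 -[s]expr1 se.
(* Both are as small as the second derivative test comfortably permits: eta^2 x/(2Y) is at least
   E^103 against a left side of at most E^100, and eta1^2 x = E^40 against E^32, with [mu0] no
   smaller than 1/s. *)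
pose eta : R := ('P 948)^-1; pose eta1 : R := ('P 1980)^-1.
have Heta : 36 * (2 * Q%:R * T + 4 + 8 / T) <= eta ^+ 2 * mu0 * (x%:R / (2 * Y%:R)).
  apply: (@le_trans _ _ ('P 100)).
    apply: (@le_trans _ _ (144 * 'P 99)); last exact: pSn.
    have a1 : 2 * Q%:R * T <= 2 * 'P 99 by rewrite -mulrA ler_wpM2l.
    have a2 : 4 <= 'P 99 by apply: (@le_trans _ _ (4%:R * 'P 0)); [rewrite pE expn0 mulr1|apply: le_trans (pSn 0 _) (Ple _ _ _)].
    have a3 : 8 / T <= 'P 99.
      apply: (@le_trans _ _ (8%:R * 'P 27)); first by rewrite ler_wpM2l.
      exact: le_trans (pSn 27 _) (Ple _ _ _).
    exact: three_term_le a1 a2 a3.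
  apply: (@le_trans _ _ (eta ^+ 2 * mu0 * 'P 1999)); last first.
    by rewrite ler_wpM2l // mulr_ge0 ?sqr_ge0 // ltW.
  have -> : eta ^+ 2 = ('P 1896)^-1 by rewrite /eta exprVn expr2 -PD.
  rewrite -mulrA mulrC ler_pdivlMr // -PD.
  apply: le_trans (hmuP 1997 1999 isT); rewrite -PD; exact: Ple.
have Heta1 : 36 * (T + 4 + 4 / T) <= eta1 ^+ 2 * mu0 * x%:R.
  apply: (@le_trans _ _ ('P 32)).
    apply: (@le_trans _ _ (108 * 'P 31)); last exact: pSn.
    have a2 : 4 <= 'P 31 by apply: (@le_trans _ _ (4%:R * 'P 0)); [rewrite pE expn0 mulr1|apply: le_trans (pSn 0 _) (Ple _ _ _)].
    have a3 : 4 / T <= 'P 31.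
      apply: (@le_trans _ _ (4%:R * 'P 27)); first by rewrite ler_wpM2l.
      exact: le_trans (pSn 27 _) (Ple _ _ _).
    exact: three_term_le1 T2 a2 a3.
  have -> : eta1 ^+ 2 = ('P 3960)^-1 by rewrite /eta1 exprVn expr2 -PD.
  rewrite -mulrA mulrC ler_pdivlMr // -PD.
  apply: le_trans (hmuP 3998 4000 isT); rewrite -PD; exact: Ple.
pose kap : R := ('P 32)^-1.
have Hkap : 8 * (s ^+ 9) ^+ 2 + tmass tp ^+ 2 * eta * Q%:R / 2 <= kap ^+ 2 * Q%:R.
  have -> : kap ^+ 2 * Q%:R = 'P 4.
    have h68 : 'P 68 = 'P (32 + 32)%N * 'P 4 by rewrite -PD.
  by rewrite /kap exprVn expr2 -PD /Q h68 mulrA mulVf ?mul1r // gt_eqF.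
  have b1 : 8 * (s ^+ 9) ^+ 2 <= 'P 1.
    by rewrite -exprM P1; apply: small_pow => //; apply: le_trans s1000; rewrite ler_nat.
  have b2 : tmass tp ^+ 2 * eta * Q%:R <= 'P 2.
    apply: (@le_trans _ _ ('P 441 ^+ 2 * eta * Q%:R)).
      rewrite ler_wpM2r // ler_wpM2r ?Pi0 // ler_pXn2r ?nnegrE ?tmass_ge0 //.
    by rewrite expr2 -PD mulrAC -PD /eta ler_pdivrMr // -PD Ple.
  have b3 : 2 * 'P 3 <= 'P 4 by exact: pSn.
  have b4 : 'P 1 <= 'P 3 by exact: Ple.
  have b5 : 'P 2 <= 'P 3 by exact: Ple.
  have b6 := Pge0 2.
  exact: half_sum_le b1 b2 b3 b4 b5 b6.
have kap0 : 0 < kap by rewrite invr_gt0.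
have Q0 : (0 < Q)%N by exact: p_gt0 pE s1000 sE _.
have QU : (Q <= U)%N by exact: ple.
have main := @power_prime_sum R x B U Q Y g kq%:R ph s s kap eta eta1 (s ^+ 9) tp x0 erefl Q0 QU Ux Yx BY YB
  g12 g1 kR (Pi0 _) (Pi0 _) htW smallT smallT1 Heta Heta1 sp HLB HYQ sp HTs kap0 Hkap.
apply: le_trans main _.
have xR0 : 0 <= x%:R :> R by [].
have m1 : 5 * s * ((U * U)%N%:R * (tmass tp * (x%:R * eta1))) <= 2^-1 * (x%:R / 'P 31).
  apply: (@le_trans _ _ (5 * s * ('P 1480 * ('P 441 * (x%:R * eta1))))).
    rewrite UU ler_wpM2l ?mulr_ge0 // ler_wpM2l // ler_wpM2r // mulr_ge0 ?Pi0 //.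
  rewrite (_ : 5 * s * _ = 2^-1 * (x%:R * (10 * s * ('P (1480 + 441)%N * eta1)))); last by rewrite PD; field.
  rewrite ler_wpM2l ?invr_ge0 // ler_wpM2l // /eta1 mulrA ler_pdivrMr // [leRHS]mulrC ler_pdivlMr //.
  have h10 : 10 * s <= e.
    by have := @small_pow R E s s1000 sE 10 1 _ isT; rewrite expr1; apply; apply: le_trans s1000; rewrite ler_nat.
  apply: (@le_trans _ _ ('P (1480 + 441).+1 * 'P 31)); first by rewrite ler_wpM2r // pSR.
  by rewrite -PD Ple.
have m2 : 20 * s ^+ 2 * s * kap * x%:R <= 2^-1 * (x%:R / 'P 31).
  have h40 : 40 * s ^+ 3 <= e.
    by apply: small_pow => //; apply: le_trans s1000; rewrite ler_nat.
  rewrite (_ : 20 * s ^+ 2 * s * kap * x%:R = 2^-1 * (x%:R * (40 * s ^+ 3 * kap))); last by field.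
  rewrite ler_wpM2l ?invr_ge0 // ler_wpM2l // /kap ler_pdivrMr // [leRHS]mulrC ler_pdivlMr //.
  exact: pSR.
apply: le_trans (lerD m1 m2) _.
by rewrite -mulrDl (_ : 2^-1 + 2^-1 = 1) ?mul1r //; field.
Qed.

End PowerFrequencies.

Section MainTermInequality.
Variable R : realType.

(** Everything is measured in the unit z = x/E^29: errors of five units against a main term of e^2
    units. *)
Lemma main_sum_combine (Z Z1 Z2 A D z e : R) : 0 <= z -> 1000 <= e ->
  `|Z1 - Z| <= z -> `|Z1 - Z2| <= z -> Z2 = A + D -> `|D| <= z + z -> e * e * z - z <= A -> e * z <= Z.
Proof.
move=> z0 e1; rewrite !ler_norml => /andP[a1 a2] /andP[b1 b2] Z2E /andP[c1 c2] h.
rewrite Z2E in b1 b2.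
have h1 : 1000 * z <= e * z by rewrite ler_wpM2r.
have h2 : 1000 * (e * z) <= e * e * z by rewrite -mulrA ler_wpM2r // mulr_ge0 //; lra.
lra.
Qed.

End MainTermInequality.

(** * The lower bound for the detected sum *)

Section MainSum.
Variables (R : realType) (E : nat) (p : nat -> nat) (s : R).
Notation Lam := (@Lam R).
Local Notation e := (E%:R : R).
Local Notation "'P i" := ((p i)%:R : R) (at level 10, i at level 8).
Let x := p 4000.
Let B := (8 * x)%N.
Hypothesis pE : forall i, p i = (E ^ i)%N.
Hypotheses (s1000 : 1000 <= s) (sE : s ^+ 100 <= e) (Hln : 1 + 4500 * ln e <= s).
Hypothesis Htau : forall m, (0 < m <= p 4500)%N -> (tau m)%:R <= s.

Local Notation msum := (@mangoldt_sum R p).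

Lemma Psi_bounds : x%:R <= msum (fun=> 1) <= 32 * x%:R.
Proof.
have x0 : (0 < x)%N by exact: p_gt0 pE s1000 sE _.
have B45 : ((8 * x).+1 <= p 4500)%N.
  apply: (@leq_ltn_trans (p 4001)); first exact: (p_mul_le pE s1000 sE 4000 (isT : 8 <= 8)%N).
  by rewrite !pE ltn_exp2l // (E_gt1 s1000 sE).
have psiE : msum (fun=> 1) = psi R B - psi R x.
  rewrite /msum /psi [X in _ = X - _](big_cat_nat (n := x.+1)) //=; last by rewrite ltnS leq_pmull.
  rewrite addrAC subrr add0r.
  rewrite /mangoldt_sum [LHS](big_cat_nat (n := x.+1)) //=; last by rewrite ltnS leq_pmull.
  rewrite [X in X + _]big_nat_cond [X in X + _]big1 ?add0r => [|n /andP[/andP[_ h1] h2]]; last by rewrite ltnNge -ltnS h1 in h2.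
  rewrite big_nat_cond [RHS]big_nat_cond; apply: eq_big => [n|n _]; last by rewrite mulr1.
  by rewrite andbT -/x andbAC andbb.
rewrite psiE; apply/andP; split.
  apply: chebyshev_lower => //; rewrite addn1; apply: le_trans (ln_le_s pE s1000 sE Hln _ B45) _ => //.
  apply: (@le_trans _ _ ('P 1)); last exact: p_leR pE s1000 sE _ _ _.
  by rewrite pE expn1; have := small_pow s1000 sE (s_ge1 s1000) (isT : 1 < 100)%N; rewrite mul1r expr1.
apply: (@le_trans _ _ (psi R B)); first by rewrite gerBl psi_ge0.
apply: le_trans (psi_linear R B) _; rewrite /B natrM mulrA ler_wpM2r //.
have /andP[_ h2] := ln2_bounds R; move: h2; lra.
Qed.

Lemma inv_square_tail (K N : nat) : (0 < K)%N -> \sum_(K.+1 <= m < N) (m%:R ^+ 2)^-1 <= K%:R^-1 :> R.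
Proof.
move=> K0; have KR : 0 < K%:R :> R by rewrite ltr0n.
have [NK|KN] := leqP N K.+1; first by rewrite big_geq // invr_ge0.
suff h : \sum_(K.+1 <= m < N) (m%:R ^+ 2)^-1 <= K%:R^-1 - N.-1%:R^-1 :> R.
  by apply: le_trans h _; rewrite gerBl invr_ge0.
move/ltnW: KN; elim: N => // N IH; rewrite leq_eqVlt => /orP[/eqP <-|KN].
  by rewrite big_geq //= subrr.
rewrite ltnS in KN.
rewrite big_nat_recr //=.
have N0 : 0 < N%:R :> R by rewrite ltr0n (leq_trans _ KN).
have N1 : N.-1%:R = N%:R - 1 :> R by rewrite -subn1 natrB // (leq_trans _ KN).
have N10 : 0 < N%:R - 1 :> R by rewrite -N1 ltr0n -subn1 subn_gt0 (leq_trans _ KN) // ltnS.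
apply: le_trans (lerD (IH KN) (lexx _)) _; rewrite N1 -subr_ge0.
rewrite (_ : _ - _ = ((N%:R - 1) * N%:R ^+ 2)^-1); last by field; rewrite !gt_eqF.
by rewrite invr_ge0 mulr_ge0 ?exprn_ge0 ?(ltW N10).
Qed.

Variables (a b : R) (q sg : nat).
Hypothesis spacing : forall j, (0 < j)%N -> (2 * j <= q)%N -> (2 * q%:R)^-1 <= nd (j%:R * a).
Hypotheses (q1 : (p 1520 <= q)%N) (q2 : (q <= p 1521)%N) (sg2 : (2 <= sg)%N).
Variables (g : R) (t : nat) (Xi : seq (R * nat)).
Let mu0 : R := g * (1 - g) / 1024.
Hypotheses (g12 : 1 / 2 <= g) (g1 : g < 1) (hmu : s^-1 <= mu0).
Let v : R := x%:R `^ (g - 1).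
Hypotheses (v1 : ('P 27)^-1 <= v) (tv : t%:R * v <= 9) (t2 : (2 <= t)%N) (tsg : (t * sg <= p 27)%N).
Hypotheses (X1 : forall u, u \in Xi -> (0 < u.2 <= p 440)%N) (X2 : 1 <= \sum_(u <- Xi) u.1 / u.2%:R).
Hypotheses (X3 : \sum_(u <- Xi) `|u.1| <= 'P 440 * s ^+ 5).
Hypothesis X4 : forall n, (x < n <= B)%N -> `|weighted a b sg Xi n| <= s ^+ 8.

(* Shifted by [1/t]: positivity puts an integer in the open interval from [n^g] to [n^g + 2/t]. *)
Definition ps_weight (n : nat) : R := tri t (n%:R `^ g + t%:R^-1).

(** Frequencies of n^g up to t E^30 fall under [power_frequency]; beyond, the coefficients 16t/m^2
    add up to at most 16/E^30 and the trivial bound s^9 Psi suffices. The zero frequency yields x/(t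
    sg) >= x/E^27 up to one error unit, by [X2]. *)
Lemma main_sum_lower : x%:R / 'P 28 <= msum (fun n => ps_weight n * weighted a b sg Xi n).
Proof.
have P0 i : 0 < 'P i by exact: p_gt0R pE s1000 sE i.
have Pi0 i : 0 <= ('P i)^-1 by rewrite invr_ge0 ltW.
have Pge0 i : 0 <= 'P i by exact: ltW.
have Ple i j : (i <= j)%N -> 'P i <= 'P j by move=> h; exact: p_leR pE s1000 sE _ _ h.
have PD i j : 'P (i + j) = 'P i * 'P j by exact: pDR.
have s0 := s_ge0 s1000; have s1 := s_ge1 s1000.
have sge c i : c <= s -> (i < 100)%N -> c * s ^+ i <= e.
  by move=> h1 h2; exact: (@small_pow R E s s1000 sE c i h1 h2).
have x0 : (0 < x)%N by exact: p_gt0 pE s1000 sE _.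
have xR : 0 < x%:R :> R by rewrite ltr0n.
have /andP[Psi1 Psi2] := Psi_bounds.
set Psi := msum (fun=> 1) in Psi1 Psi2.
have t0 : (0 < t)%N by exact: ltnW.
have tR : 0 < t%:R :> R by rewrite ltr0n.
have sg0 : (0 < sg)%N by exact: ltnW.
have sgR : 0 < sg%:R :> R by rewrite ltr0n.
have sg27 : (sg <= p 27)%N by apply: leq_trans tsg; rewrite leq_pmull.
have [tp [m1 m2 m3]] := expand_list pE s1000 sE Hln Htau b spacing q1 q2 sg2 sg27 X1.
pose XA := \sum_(u <- Xi) `|u.1|.
have XA0 : 0 <= XA by apply: sumr_ge0.
have P1 : 'P 1 = e by rewrite pE expn1.
(* Every error term has the form [c s^i x / E^j] with [j >= 30]. *)
have err c i j : c <= s -> (i < 100)%N -> (30 <= j)%N -> c * s ^+ i * (x%:R / 'P j) <= x%:R / 'P 29.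
  move=> cs i9 j3; rewrite mulrCA ler_wpM2l // ler_pdivrMr // [leRHS]mulrC ler_pdivlMr //.
  apply: le_trans (ler_wpM2r (Pge0 29) (sge c i cs i9)) _.
  by apply: le_trans (Ple 30 j j3); rewrite -P1 -(PD 1 29)%N.
have n2s (c : nat) : (c <= 1000)%N -> c%:R <= s by move=> h; apply: le_trans s1000; rewrite ler_nat.
have htp : tmass tp <= 'P 441.
  apply: le_trans m1 _; apply: le_trans (ler_wpM2l _ X3) _ => //.
  by rewrite mulrA mulrAC; apply: pSR => //; apply: sge => //; exact: (n2s 2).
have eW : (p 480)%:R^-1 * XA <= s ^+ 5 * ('P 40)^-1.
  apply: le_trans (ler_wpM2l (Pi0 _) X3) _.
  rewrite le_eqVlt; apply/orP; left; apply/eqP.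
  have -> : 'P 480 = 'P 440 * 'P 40 by exact: (PD 440 40)%N.
  by field; rewrite !gt_eqF.
have eW1 : s ^+ 5 * ('P 40)^-1 <= 1.
  rewrite ler_pdivrMr // mul1r; apply: (@le_trans _ _ e); first by have := sge 1 5%N s1 isT; rewrite mul1r.
  by rewrite -(expn1 E) -pE Ple.
have htW n : (x < n <= B)%N -> `|tpoly tp n| <= s ^+ 9.
  move=> hn; rewrite -(subrK (weighted a b sg Xi n) (tpoly tp n)).
  apply: le_trans (ler_normD _ _) _; apply: le_trans (lerD (le_trans (m2 n) (le_trans eW eW1)) (X4 hn)) _.
  have s8 : 1 <= s ^+ 8 by exact: exprn_ege1.
  rewrite [s ^+ 9]exprS; apply: (@le_trans _ _ (2 * s ^+ 8)).
    by rewrite mulr_natl mulr2n lerD2r.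
  by rewrite ler_wpM2r ?exprn_ge0 // (n2s 2).
have u01 n : 0 <= ps_weight n <= 1 by rewrite tri_ge0 tri_le1.
have msumZ c f : msum (fun n => c * f n) = c * msum f by exact: mangoldt_sumZ.
have cstm c : msum (fun=> c) = c * Psi.
  by rewrite -msumZ; apply: mangoldt_sum_ext => n; rewrite mulr1.
pose Z := msum (fun n => ps_weight n * weighted a b sg Xi n).
pose Z1 := msum (fun n => ps_weight n * tpoly tp n).
have d1 : `|Z1 - Z| <= x%:R / 'P 29.
  have -> : Z1 - Z = msum (fun n => ps_weight n * (tpoly tp n - weighted a b sg Xi n)).
    rewrite -mulN1r -msumZ -mangoldt_sumD; apply: mangoldt_sum_ext => n; ring.
  apply: (@le_trans _ _ (msum (fun=> s ^+ 5 * ('P 40)^-1))).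
    apply: mangoldt_sum_norm => n _; rewrite normrM -[leRHS]mul1r.
    have /andP[w1 w2] := u01 n; apply: ler_pM => //; first by rewrite ger0_norm.
    exact: le_trans (m2 n) eW.
  rewrite cstm; apply: le_trans (ler_wpM2l _ Psi2) _; first by rewrite mulr_ge0 ?exprn_ge0.
  apply: le_trans (err 32 5%N 40%N _ isT isT); last exact: (n2s 32).
  rewrite le_eqVlt; apply/orP; left; apply/eqP; ring.
have eps0 : 0 < ('P 31)^-1 by rewrite invr_gt0.
have [N [c [mu [_ [c0 c1] cw mup F]]]] := tri_fourier t2 eps0.
pose Kc := (t * p 30)%N.
have Kc0 : (0 < Kc)%N by rewrite muln_gt0 t0 (p_gt0 pE s1000 sE).
pose Ck k := msum (fun n => tpoly tp n * cos (2 * pi * ((mu k)%:R * n%:R `^ g + (mu k)%:R / t%:R))).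
pose Z2 := t%:R^-1 * msum (tpoly tp) + \sum_(1 <= k < N) c k * Ck k.
have d2 : `|Z1 - Z2| <= x%:R / 'P 29.
  have -> : Z1 - Z2 = msum (fun n => (ps_weight n - (t%:R^-1 + \sum_(1 <= k < N) c k * cos (2 * pi * ((mu k)%:R * (n%:R `^ g + t%:R^-1))))) * tpoly tp n).
    have -> : Z2 = msum (fun n => (t%:R^-1 + \sum_(1 <= k < N) c k * cos (2 * pi * ((mu k)%:R * (n%:R `^ g + t%:R^-1)))) * tpoly tp n).
      transitivity (msum (fun n => t%:R^-1 * tpoly tp n + \sum_(1 <= k < N) c k * (tpoly tp n * cos (2 * pi * ((mu k)%:R * n%:R `^ g + (mu k)%:R / t%:R))))).
        rewrite mangoldt_sumD (msumZ _ (tpoly tp)); congr (_ + _).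
        rewrite [RHS]mangoldt_sum_sum; apply: eq_bigr => k _; by rewrite msumZ.
      apply: mangoldt_sum_ext => n; rewrite [RHS]mulrDl; congr (_ + _); rewrite mulr_suml.
      by apply: eq_bigr => k _; rewrite [RHS]mulrAC [LHS]mulrA (mulrDr (mu k)%:R).
    rewrite -mulN1r -msumZ -mangoldt_sumD; apply: mangoldt_sum_ext => n; ring.
  apply: (@le_trans _ _ (msum (fun=> ('P 31)^-1 * s ^+ 9))).
    apply: mangoldt_sum_norm => n hn; rewrite normrM; apply: ler_pM => //; [exact: F|exact: htW].
  rewrite cstm; apply: le_trans (ler_wpM2l _ Psi2) _; first by rewrite mulr_ge0 ?exprn_ge0.
  apply: le_trans (err 32 9%N 31%N _ isT isT); last exact: (n2s 32).
  rewrite le_eqVlt; apply/orP; left; apply/eqP; ring.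
pose w m : R := if (m <= Kc)%N then 0 else s ^+ 9 * Psi.
have sP0 : 0 <= s ^+ 9 * Psi by rewrite mulr_ge0 ?exprn_ge0 // (le_trans _ Psi1).
have w0 m : 0 <= w m by rewrite /w; case: ifP.
have CkB k : (1 <= k < N)%N -> `|Ck k| <= x%:R / 'P 31 + w (mu k).
  move=> hk; rewrite /w; case: ifP => hm.
    rewrite addr0.
    exact: (power_frequency pE s1000 sE Hln Htau _ g12 g1 hmu v1 tv (mup k hk) hm htp htW).
  apply: (@le_trans _ _ (s ^+ 9 * Psi)); last by rewrite lerDr divr_ge0.
  rewrite -cstm; apply: mangoldt_sum_norm => n hn; rewrite normrM -[leRHS]mulr1.
  by apply: ler_pM => //; [exact: htW|exact: cos_max].
have d3 : `|\sum_(1 <= k < N) c k * Ck k| <= x%:R / 'P 29 + x%:R / 'P 29.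
  apply: le_trans (ler_norm_sum _ _ _) _.
  apply: (@le_trans _ _ (\sum_(1 <= k < N) c k * (x%:R / 'P 31 + w (mu k)))).
    rewrite !big_nat; apply: ler_sum => k hk; rewrite normrM ger0_norm // ler_wpM2l //; exact: CkB.
  have -> : \sum_(1 <= k < N) c k * (x%:R / 'P 31 + w (mu k)) = (\sum_(1 <= k < N) c k) * (x%:R / 'P 31) + \sum_(1 <= k < N) c k * w (mu k).
    rewrite mulr_suml -big_split /=; apply: eq_bigr => k _; ring.
  apply: lerD.
    apply: (@le_trans _ _ (1 * (x%:R / 'P 31))); first by rewrite ler_wpM2r // divr_ge0.
    by rewrite mul1r ler_wpM2l // lef_pV2 ?posrE // Ple.
  apply: le_trans (cw w w0) _.
  apply: (@le_trans _ _ (16 * t%:R * (s ^+ 9 * Psi) * \sum_(Kc.+1 <= m < N) (m%:R ^+ 2)^-1)).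
    rewrite mulr_sumr; have [NK|KN] := leqP N Kc.+1.
      rewrite [leRHS]big_geq // big_nat big1 // => m /andP[_ mN].
      by rewrite /w -ltnS (leq_trans mN NK) mulr0.
    rewrite (big_cat_nat (n := Kc.+1)) //=; last exact: ltnW.
    rewrite big_nat big1 ?add0r => [|m /andP[_ mK]]; last by rewrite /w -ltnS mK mulr0.
    rewrite !big_nat; apply: ler_sum => m /andP[mK _]; rewrite /w leqNgt mK /=.
    rewrite le_eqVlt; apply/orP; left; apply/eqP; ring.
  have ww : 0 <= 16 * t%:R * (s ^+ 9 * Psi) by rewrite mulr_ge0 // mulr_ge0.
  apply: le_trans (ler_wpM2l ww (inv_square_tail N Kc0)) _.
  rewrite /Kc natrM.
  rewrite [leLHS](_ : _ = 16 * s ^+ 9 * Psi / 'P 30); last by field; rewrite !gt_eqF.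
  apply: le_trans (err 512 9%N 30%N _ isT isT); last exact: (n2s 512).
  rewrite (_ : 512 * s ^+ 9 * _ = 16 * s ^+ 9 * (32 * x%:R) / 'P 30); last ring.
  by rewrite ler_wpM2r // ler_wpM2l // mulr_ge0 // exprn_ge0.
have d4 : x%:R / 'P 27 - x%:R / 'P 29 <= t%:R^-1 * msum (tpoly tp).
  have h1 : x%:R / 'P 27 <= t%:R^-1 * (Psi / sg%:R * \sum_(u <- Xi) u.1 / u.2%:R).
    apply: (@le_trans _ _ (t%:R^-1 * (x%:R / sg%:R))).
      rewrite mulrCA ler_wpM2l // -invfM lef_pV2 ?posrE ?mulr_gt0 // -natrM ler_nat //.
    rewrite ler_wpM2l ?invr_ge0 ?(ltW tR) // -[leLHS]mulr1; apply: ler_pM => //.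
      by rewrite divr_ge0.
    by rewrite ler_wpM2r // invr_ge0.
  have h2 : t%:R^-1 * (s ^+ 5 * x%:R / 'P 500 * XA) <= x%:R / 'P 29.
    apply: (@le_trans _ _ (1 * (s ^+ 5 * x%:R / 'P 500 * ('P 440 * s ^+ 5)))).
      apply: ler_pM.
      - by rewrite invr_ge0.
      - by rewrite mulr_ge0 // mulr_ge0 // mulr_ge0 // exprn_ge0.
      - by rewrite invf_le1 // ler1n.
      - by rewrite ler_wpM2l // mulr_ge0 // mulr_ge0 // exprn_ge0.
    apply: le_trans (err 1 10%N 60%N s1 isT isT).
    have -> : 'P 500 = 'P 440 * 'P 60 by exact: (PD 440 60)%N.
    by rewrite le_eqVlt; apply/orP; left; apply/eqP; field; rewrite !gt_eqF.
  have h3 : Psi / sg%:R * (\sum_(u <- Xi) u.1 / u.2%:R) - s ^+ 5 * x%:R / 'P 500 * XA <= msum (tpoly tp).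
    by move: m3; rewrite ler_distl => /andP[].
  have h4 := ler_wpM2l (_ : 0 <= t%:R^-1) h3; rewrite mulrBr in h4.
  apply: le_trans (h4 _); last by rewrite invr_ge0.
  exact: lerB.
have z0 : 0 <= x%:R / 'P 29 by rewrite divr_ge0.
have P28 : x%:R / 'P 28 = e * (x%:R / 'P 29).
  have -> : 'P 29 = e * 'P 28 by rewrite -P1; exact: (PD 1 28)%N.
  field; by rewrite -P1 !gt_eqF.
have P27 : x%:R / 'P 27 = e * e * (x%:R / 'P 29).
  have -> : 'P 29 = e * (e * 'P 27) by rewrite -P1 -(PD 1 27)%N; exact: (PD 1 28)%N.
  field; by rewrite -P1 !gt_eqF.
rewrite P28; rewrite P27 in d4.
exact: main_sum_combine z0 (e_ge1000 s1000 sE) d1 d2 erefl d3 d4.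
Qed.

End MainSum.

(** * Exceptional terms *)

Section BadTerms.
Variables (R : realType) (E : nat) (p : nat -> nat) (s : R).
Notation Lam := (@Lam R).
Local Notation e := (E%:R : R).
Local Notation "'P i" := ((p i)%:R : R) (at level 10, i at level 8).
Let x := p 4000.
Let B := (8 * x)%N.
Hypothesis pE : forall i, p i = (E ^ i)%N.
Hypotheses (s1000 : 1000 <= s) (sE : s ^+ 100 <= e) (Hln : 1 + 4500 * ln e <= s).
Hypothesis Htau : forall m, (0 < m <= p 4500)%N -> (tau m)%:R <= s.

(** This lets the divisor bound limit the exponent of a prime power. *)
Lemma tau_pow_ge (r j : nat) : (1 < r)%N -> (j < tau (r ^ j))%N.
Proof.
move=> r1; have r0 : (0 < r)%N by exact: ltnW.
have rj0 : (0 < r ^ j)%N by rewrite expn_gt0 r0.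
pose l := [seq (r ^ i)%N | i <- iota 0 j.+1].
have lu : uniq l.
  rewrite map_inj_in_uniq ?iota_uniq // => a b _ _ /eqP; rewrite eqn_exp2l // => /eqP //.
have ls : {subset l <= divisors (r ^ j)}.
  move=> d /mapP[i]; rewrite mem_iota add0n ltnS => /andP[_ ij] ->.
  by rewrite -dvdn_divisors // dvdn_exp2l.
by have := uniq_leq_size lu ls; rewrite size_map size_iota.
Qed.

(** A proper prime power r^j <= B <= Y^2 has r <= Y and j < tau(r^j) <= s, so there are at most sY
    of them, each of weight at most s. *)
Lemma nonprime_Lam_sum :
  \sum_(1 <= n < B.+1 | ~~ prime n) Lam n <= s ^+ 2 * (3 * p 2000)%N%:R.
Proof.
have s0 := s_ge0 s1000; have s1 := s_ge1 s1000.
pose Y := (3 * p 2000)%N; pose J := Num.truncn s.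
have /andP[J1 J2] : J%:R <= s < J.+1%:R by apply: truncn_itv.
have x0 : (0 < x)%N by exact: p_gt0 pE s1000 sE _.
have B45 : (B <= p 4500)%N.
  apply: leq_trans (p_mul_le pE s1000 sE 4000 (isT : 8 <= 8)%N) _; exact: p_le pE s1000 sE _ _ _.
have BY : (B <= Y * Y)%N by rewrite /Y mulnACA -(pD pE) /B leq_mul2r orbT.
have LamB n : (1 <= n <= B)%N -> Lam n <= s.
  move=> /andP[n1 nB]; apply: le_trans (Lam_le_ln R n1) _.
  apply: (ln_le_s pE s1000 sE Hln) => //; exact: leq_trans nB B45.
apply: (@le_trans _ _ (\sum_(1 <= n < B.+1) \sum_(1 <= r < Y.+1) \sum_(1 <= j < J.+1) (if n == (r ^ j)%N then s else 0))).
  rewrite big_mkcond !big_nat; apply: ler_sum => n /andP[n1 nB].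
  have pos : 0 <= \sum_(1 <= r < Y.+1) \sum_(1 <= j < J.+1) (if n == (r ^ j)%N then s else 0).
    by apply: sumr_ge0 => r _; apply: sumr_ge0 => j _; case: ifP.
  case: ifP => // np; have [L0|Ln0] := eqVneq (Lam n) 0; first by rewrite L0.
  have [r [j [rr j0 nE]]] := Lam_neq0 Ln0.
  have j2 : (2 <= j)%N.
    by case: j j0 nE => [//|[|j]] // _ nE; move: np; rewrite nE expn1 rr.
  have rY : (r <= Y)%N.
    rewrite leqNgt; apply/negP => Yr; have : (Y.+1 * Y.+1 <= n)%N.
      rewrite nE; apply: (@leq_trans (r ^ 2)%N); last by rewrite leq_exp2l // prime_gt1.
      by rewrite expnS expn1 leq_mul.
    rewrite leqNgt => /negP; apply; rewrite ltnS in nB; apply: leq_ltn_trans (leq_trans nB BY) _.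
    by rewrite ltn_mul.
  have jJ : (j <= J)%N.
    rewrite -ltnS -(ltr_nat R); apply: le_lt_trans J2.
    apply: (@le_trans _ _ (tau n)%:R).
      by rewrite ler_nat nE ltnW // tau_pow_ge // prime_gt1.
    by apply: Htau; rewrite n1 (leq_trans _ B45).
  have rin : r \in index_iota 1 Y.+1 by rewrite mem_index_iota prime_gt0 // ltnS.
  have jin : j \in index_iota 1 J.+1 by rewrite mem_index_iota j0 ltnS.
  rewrite (bigD1_seq r) ?iota_uniq //= (bigD1_seq j) ?iota_uniq //= nE eqxx -addrA -nE.
  apply: le_trans (LamB n _) _; first by rewrite n1.
  rewrite lerDl addr_ge0 //; apply: sumr_ge0 => k _; first by case: ifP.
  by apply: sumr_ge0 => k' _; case: ifP.
rewrite exchange_big /=.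
apply: (@le_trans _ _ (\sum_(1 <= r < Y.+1) \sum_(1 <= j < J.+1) s)).
  apply: ler_sum => r _; rewrite exchange_big /=; apply: ler_sum => j _.
  rewrite -big_mkcond /= big_nat1_eq; by case: ifP.
rewrite !big_const_nat !iter_addr_0 !subn1 /= -[leLHS]mulr_natr ler_wpM2r //.
by rewrite -mulr_natr expr2 ler_wpM2l.
Qed.

Variables (a b : R).
Hypotheses (a0 : 0 < a) (ba : a^-1 + 1 <= s) (abs : 8 * a + `|b| + 1 <= s).

Definition target n := `|nint (a * n%:R + b)|%N.

Hypothesis big_x : `|b| + 1 <= a * x%:R.

Lemma target_bounds n : (x < n <= B)%N -> (0 < target n <= p 4001)%N /\ nint (a * n%:R + b) = (target n)%:Z.
Proof.
move=> /andP[xn nB]; set w := a * n%:R + b.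
have s0 := s_ge0 s1000.
have w1 : 1 <= w.
  have h : a * x%:R <= a * n%:R by rewrite ler_wpM2l ?(ltW a0) // ler_nat ltnW.
  have := ler_norm (- b); rewrite normrN /w; move: big_x; lra.
have /andP[h1 h2] := nint_itv w.
have nz : (0 < nint w)%R.
  by rewrite -(ltr_int R) /=; lra.
have e1 : nint w = (target n)%:Z by rewrite /target -/w gtz0_abs.
split=> //; apply/andP; split; first by rewrite -ltz_nat -e1.
rewrite -(ler_nat R) /target -/w.
have -> : (`|nint w|%N)%:R = (nint w)%:~R :> R by rewrite [in RHS]e1.
apply: (@le_trans _ _ (w + 1)); first lra.
apply: (@le_trans _ _ (s * x%:R)).
  have x1 : 1 <= x%:R :> R by rewrite ler1n; exact: p_gt0 pE s1000 sE _.
  apply: le_trans (ler_wpM2r _ abs) => //.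
  have n8 : a * n%:R <= a * (8 * x%:R) by rewrite ler_wpM2l ?(ltW a0) // -natrM ler_nat.
  have hb : b <= `|b| * x%:R by apply: le_trans (ler_norm b) _; rewrite ler_peMr.
  rewrite /w !mulrDl mul1r; move: n8 hb x1; lra.
apply: (pSR pE); have := small_pow s1000 sE (s_ge1 s1000) (isT : 1 < 100)%N; by rewrite mul1r expr1.
Qed.

(** Equal targets force a|i - j| < 1, hence |i - j| < C with C > 1/a. Recording n mod C next to
    target(n)/m therefore makes the counting map injective. *)
Lemma target_multiples m : (0 < m)%N ->
  \sum_(1 <= n < B.+1 | (x < n)%N && (m %| target n)%N) 1 <= s * (p 4001)%:R / m%:R + 1 :> R.
Proof.
move=> m0; have s0 := s_ge0 s1000.
pose C := (Num.truncn a^-1).+1.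
have ai0 : 0 <= a^-1 by rewrite invr_ge0 ltW.
have /andP[C1 C2] := truncn_itv ai0.
have CR : a^-1 < C%:R by [].
have C0 : (0 < C)%N by [].
have Cs : C%:R <= s by rewrite -natr1; apply: le_trans ba; rewrite lerD2r.
pose bb n := ((target n %/ m) * C + n %% C)%N.
pose K := ((p 4001 %/ m) * C)%N.
have inj i j : (x < i <= B)%N -> (x < j <= B)%N -> (m %| target i)%N -> (m %| target j)%N ->
    bb i = bb j -> i = j.
  move=> hi hj mi mj h.
  have hm : (i %% C = j %% C)%N.
    by have := congr1 (fun k => k %% C)%N h; rewrite !modnMDl !modn_mod.
  have hd : (target i %/ m = target j %/ m)%N.
    by have := congr1 (fun k => k %/ C)%N h; rewrite !divnMDl // !(divn_small (ltn_pmod _ C0)) !addn0.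
  have ht : target i = target j by rewrite -(divnK mi) -(divnK mj) hd.
  have [_ ei] := target_bounds hi; have [_ ej] := target_bounds hj.
  have := nint_itv (a * i%:R + b); have := nint_itv (a * j%:R + b).
  rewrite ei ej ht => /andP[j1 j2] /andP[i1 i2].
  wlog lt : i j hi hj mi mj h hm hd ht ei ej j1 j2 i1 i2 / (i <= j)%N.
    move=> W; have [ij|ji] := leqP i j; first exact: W.
    by apply/esym/(W j i hj hi mj mi (esym h) (esym hm) (esym hd) (esym ht) ej ei); rewrite ?ht ?(ltnW ji).
  have d : a * (j - i)%N%:R < a * C%:R.
    have : 1 < a * C%:R by rewrite -ltr_pdivrMl // mulr1.
    rewrite natrB // mulrBr; lra.
  rewrite ltr_pM2l // ltr_nat in d.
  have : (C %| j - i)%N by rewrite -eqn_mod_dvd // hm.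
  by rewrite /dvdn modn_small // subn_eq0 => ji; apply/eqP; rewrite eqn_leq lt.
have tm n : (x < n <= B)%N -> (m %| target n)%N -> (0 < target n %/ m <= p 4001 %/ m)%N.
  move=> hn mn; have [/andP[t1 t2] _] := target_bounds hn.
  by rewrite divn_gt0 // dvdn_leq //= leq_div2r.
have H := @sum_injective_le R B.+1 K (fun n => (x < n)%N && (m %| target n)%N) (fun n => (bb n - C)%N) (fun=> 1).
rewrite (eq_bigl (fun n => (x < n)%N && (m %| target n)%N)) //.
apply: (@le_trans _ _ (\sum_(0 <= i < K.+1) 1)).
  have -> : \sum_(1 <= n < B.+1 | (x < n)%N && (m %| target n)%N) (1 : R) = \sum_(0 <= n < B.+1 | (x < n)%N && (m %| target n)%N) 1.
    by rewrite [RHS]big_ltn_cond.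
  apply: H => //.
    move=> j jB /andP[xj mj]; have hj : (x < j <= B)%N by rewrite xj -ltnS.
    have /andP[t1 t2] := tm j hj mj.
    rewrite leq_subLR /bb /K; apply: (@leq_trans ((p 4001 %/ m) * C + C)%N); last by rewrite addnC.
    by rewrite leq_add ?leq_mul2r ?t2 ?orbT // ltnW // ltn_pmod.
  move=> i j iB jB /andP[xi mi] /andP[xj mj] h.
  have hi : (x < i <= B)%N by rewrite xi -ltnS.
  have hj : (x < j <= B)%N by rewrite xj -ltnS.
  apply: inj => //; have /andP[ti _] := tm i hi mi; have /andP[tj _] := tm j hj mj.
  have bC k : (0 < target k %/ m)%N -> (C <= bb k)%N.
    by move=> hk; rewrite /bb (leq_trans _ (leq_addr _ _)) // leq_pmull.
  by rewrite -(subnK (bC i ti)) h subnK // bC.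
rewrite big_const_nat iter_addr_0 subn0 -natr1 lerD2r /K natrM mulrC -mulrA.
apply: ler_pM => //; rewrite ler_pdivlMr ?ltr0n // -natrM ler_nat; exact: leq_trunc_div.
Qed.

(** The count for each q carries an additive 1, so the range of q has to be limited; as a positive
    target is at most E^4001, q <= E^2001 loses nothing. *)
Lemma large_square_count :
  \sum_(1 <= n < B.+1 | (x < n)%N && has (fun q => prime q && (q ^ 2 %| target n)%N) (index_iota (p 40).+1 (p 2001).+1)) 1
   <= s * (p 4001)%:R / 'P 40 + 'P 2001 :> R.
Proof.
have s0 := s_ge0 s1000.
apply: (@le_trans _ _ (\sum_((p 40).+1 <= q < (p 2001).+1) \sum_(1 <= n < B.+1 | (x < n)%N && (q ^ 2 %| target n)%N) 1)).
  rewrite (exchange_big_dep xpredT) //= big_mkcond !big_nat; apply: ler_sum => n _.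
  case xn : (x < n)%N; last by apply: sumr_ge0.
  case: ifP => [/hasP[q qi /andP[_ qn]]|_]; last by apply: sumr_ge0.
  rewrite big_mkcond (bigD1_seq q) ?iota_uniq //= qn lerDl.
  by apply: sumr_ge0 => k _; case: ifP.
apply: (@le_trans _ _ (\sum_((p 40).+1 <= q < (p 2001).+1) (s * (p 4001)%:R * (q%:R ^+ 2)^-1 + 1))).
  rewrite !big_nat; apply: ler_sum => q /andP[q1 _]; rewrite -natrX.
  by apply: target_multiples; rewrite expn_gt0 (leq_trans _ q1).
rewrite big_split /= -mulr_sumr; apply: lerD.
  rewrite ler_wpM2l ?mulr_ge0 // inv_square_tail //; exact: p_gt0 pE s1000 sE _.
by rewrite big_const_nat iter_addr_0 ler_nat subSS leq_subr.
Qed.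

End BadTerms.

Lemma lt_triple (R : realType) (u v : R) : 0 < v -> u <= v -> u + (u + u) < 1000 * v.
Proof. lra. Qed.

(** * A surviving term *)

Section GoodTerm.
Variables (R : realType) (E : nat) (p : nat -> nat) (s : R).
Notation Lam := (@Lam R).
Local Notation e := (E%:R : R).
Local Notation "'P i" := ((p i)%:R : R) (at level 10, i at level 8).
Let x := p 4000.
Let B := (8 * x)%N.
Hypothesis pE : forall i, p i = (E ^ i)%N.
Hypotheses (s1000 : 1000 <= s) (sE : s ^+ 100 <= e) (Hln : 1 + 4500 * ln e <= s).
Hypothesis Htau : forall m, (0 < m <= p 4500)%N -> (tau m)%:R <= s.
Variables (a b : R) (q sg : nat).
Hypotheses (a0 : 0 < a) (ba : a^-1 + 1 <= s) (abs : 8 * a + `|b| + 1 <= s) (big_x : `|b| + 1 <= a * x%:R).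
Hypothesis spacing : forall j, (0 < j)%N -> (2 * j <= q)%N -> (2 * q%:R)^-1 <= nd (j%:R * a).
Hypotheses (q1 : (p 1520 <= q)%N) (q2 : (q <= p 1521)%N) (sg2 : (2 <= sg)%N).
Variables (g : R) (t : nat) (Xi : seq (R * nat)).
Hypotheses (g12 : 1 / 2 <= g) (g1 : g < 1) (hmu : s^-1 <= g * (1 - g) / 1024).
Hypotheses (v1 : ('P 27)^-1 <= x%:R `^ (g - 1)) (tv : t%:R * x%:R `^ (g - 1) <= 9).
Hypotheses (t2 : (2 <= t)%N) (tsg : (t * sg <= p 27)%N).
Hypotheses (X1 : forall u, u \in Xi -> (0 < u.2 <= p 440)%N) (X2 : 1 <= \sum_(u <- Xi) u.1 / u.2%:R).
Hypotheses (X3 : \sum_(u <- Xi) `|u.1| <= 'P 440 * s ^+ 5).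
Hypothesis X4 : forall m, (0 < m <= p 4001)%N -> \sum_(u <- Xi | (u.2 %| m)%N) `|u.1| <= s ^+ 8.

Local Notation msum := (@mangoldt_sum R p).
Local Notation target := (target a b).

Lemma weighted_target n : (x < n <= B)%N ->
  weighted a b sg Xi n = tri sg (a * n%:R + b) * \sum_(u <- Xi | (u.2 %| target n)%N) u.1.
Proof.
move=> hn; have [_ ei] := target_bounds pE s1000 sE a0 abs big_x hn.
rewrite /weighted mulr_sumr [RHS]big_mkcond big_seq [RHS]big_seq; apply: eq_bigr => u uX.
have /andP[u0 _] := X1 uX; rewrite tri_dvd // ei dvdzE /=.
by case: ifP => _; rewrite ?mulr0 // mulrC.
Qed.

Lemma weighted_le n : (x < n <= B)%N -> `|weighted a b sg Xi n| <= s ^+ 8.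
Proof.
move=> hn; have [ht _] := target_bounds pE s1000 sE a0 abs big_x hn.
rewrite weighted_target // normrM -[leRHS]mul1r; apply: ler_pM => //.
  by rewrite ger0_norm ?tri_ge0 // tri_le1.
exact: le_trans (ler_norm_sum _ _ _) (X4 ht).
Qed.

Let large_square n := has (fun r => prime r && (r ^ 2 %| target n)%N) (index_iota (p 40).+1 (p 2001).+1).

Lemma no_large_square n r : (x < n <= B)%N -> ~~ large_square n -> prime r -> (p 40 < r)%N -> ~~ (r ^ 2 %| target n)%N.
Proof.
move=> hn /hasPn nl rr r40; apply/negP => rn.
have [/andP[t0 tp] _] := target_bounds pE s1000 sE a0 abs big_x hn.
have r2 : (r ^ 2 <= p 2001 ^ 2)%N.
  apply: leq_trans (dvdn_leq t0 rn) (leq_trans tp _).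
  by rewrite expnS expn1 -(pD pE); exact: p_le pE s1000 sE _ _ _.
rewrite leq_exp2r // in r2.
have := nl r; rewrite mem_index_iota r40 ltnS r2 rr rn => /(_ isT) //.
Qed.

(** If no n qualified, every prime n free of large squares would contribute at most 0. Prime powers
    and large squares contribute at most 3 E^3970, which is less than the lower bound x/E^28 =
    E^3972. *)
Lemma good_term : exists n, [/\ prime n, (x < n <= B)%N, 0 < ps_weight g t n, 0 < tri sg (a * n%:R + b) &
  (forall r, prime r -> (p 40 < r)%N -> ~~ (r ^ 2 %| target n)%N) /\ 0 < \sum_(u <- Xi | (u.2 %| target n)%N) u.1].
Proof.
have s0 := s_ge0 s1000; have s1 := s_ge1 s1000.
have x0 : (0 < x)%N by exact: p_gt0 pE s1000 sE _.
have B45 : (B <= p 4500)%N.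
  apply: leq_trans (p_mul_le pE s1000 sE 4000 (isT : 8 <= 8)%N) _; exact: p_le pE s1000 sE _ _ _.
apply: contrapT => nogood.
have lower := main_sum_lower pE s1000 sE Hln Htau spacing q1 q2 sg2 g12 g1 hmu v1 tv t2 tsg X1 X2 X3 weighted_le.
have step n : (x < n <= B)%N -> prime n -> ~~ large_square n -> ps_weight g t n * weighted a b sg Xi n <= 0.
  move=> hn pn nl; rewrite leNgt; apply/negP => pos; apply: nogood; exists n.
  have w0 : 0 <= ps_weight g t n by exact: tri_ge0.
  have y0 : 0 <= tri sg (a * n%:R + b) by exact: tri_ge0.
  have wp : 0 < ps_weight g t n by rewrite lt_neqAle w0 andbT; apply/eqP => z; rewrite -z mul0r ltxx in pos.
  rewrite pmulr_rgt0 // weighted_target // in pos.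
  have yp : 0 < tri sg (a * n%:R + b) by rewrite lt_neqAle y0 andbT; apply/eqP => z; rewrite -z mul0r ltxx in pos.
  rewrite pmulr_rgt0 // in pos.
  by split => //; split => // r; exact: no_large_square.
have s8 : 0 <= s ^+ 8 by exact: exprn_ge0.
have upper : msum (fun n => ps_weight g t n * weighted a b sg Xi n) <=
    s ^+ 8 * (\sum_(1 <= n < B.+1 | ~~ prime n) Lam n) + s ^+ 9 * (\sum_(1 <= n < B.+1 | (x < n)%N && large_square n) 1).
  rewrite !mulr_sumr /mangoldt_sum big_mkcond [X in _ <= _ + X]big_mkcond [X in _ <= X + _]big_mkcond -big_split /= !big_nat.
  apply: ler_sum => n /andP[n1 nB].
  have p0 : 0 <= (if ~~ prime n then s ^+ 8 * Lam n else 0) by case: ifP => // _; rewrite mulr_ge0 ?Lam_ge0.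
  have p1 : 0 <= (if (x < n)%N && large_square n then s ^+ 9 * 1 else 0) by case: ifP => // _; rewrite mulr1 exprn_ge0.
  case: ifP => [xn|_]; last by rewrite addr_ge0.
  have hn : (x < n <= B)%N by rewrite xn -ltnS.
  have wle : ps_weight g t n * weighted a b sg Xi n <= s ^+ 8.
    apply: le_trans (ler_norm _) _; rewrite normrM -[leRHS]mul1r.
    by apply: ler_pM => //; [rewrite ger0_norm ?tri_ge0 // tri_le1|exact: weighted_le].
  have [pn|np] := boolP (prime n); last first.
    rewrite /=; apply: (@le_trans _ _ (s ^+ 8 * Lam n)); first by rewrite [leRHS]mulrC ler_wpM2l ?Lam_ge0.
    by rewrite xn /= in p1; rewrite lerDl.
  rewrite /=.
  case: ifP => [_|/negbT nl]; last first.
    by rewrite addr0 mulr_ge0_le0 ?Lam_ge0 // step.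
  rewrite add0r mulr1 [s ^+ 9]exprS; apply: le_trans (ler_wpM2l (Lam_ge0 R n) wle) _.
  rewrite ler_wpM2r //; apply: le_trans (Lam_le_ln R n1) _; apply: (ln_le_s pE s1000 sE Hln) => //.
  by apply: leq_trans B45; exact: nB.
have PD i j : 'P (i + j) = 'P i * 'P j by exact: pDR.
have P0 i : 0 < 'P i by exact: p_gt0R pE s1000 sE i.
have Ple i j : (i <= j)%N -> 'P i <= 'P j by move=> h; exact: p_leR pE s1000 sE _ _ h.
have P1 : 'P 1 = e by rewrite pE expn1.
have sge c i : c <= s -> (i < 100)%N -> c * s ^+ i <= e.
  by move=> h1 h2; exact: (@small_pow R E s s1000 sE c i h1 h2).
have n1 : s ^+ 8 * (\sum_(1 <= n < B.+1 | ~~ prime n) Lam n) <= 'P 3970.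
  apply: le_trans (ler_wpM2l s8 (nonprime_Lam_sum pE s1000 sE Hln Htau)) _.
  rewrite natrM [leLHS](_ : _ = 3 * s ^+ 10 * 'P 2000); last ring.
  apply: (@le_trans _ _ (e * 'P 2000)); first by rewrite ler_wpM2r ?(ltW (P0 _)) // sge // (le_trans _ s1000) // ler_nat.
  by rewrite -P1 -PD; exact: Ple.
have n2 : s ^+ 9 * (\sum_(1 <= n < B.+1 | (x < n)%N && large_square n) 1) <= 'P 3970 + 'P 3970.
  have s9 : 0 <= s ^+ 9 by exact: exprn_ge0.
  apply: le_trans (ler_wpM2l s9 (large_square_count pE s1000 sE a0 ba abs big_x)) _.
  have -> : 'P 4001 = 'P 3961 * 'P 40 by exact: (PD 3961 40)%N.
  rewrite mulrDr; apply: lerD.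
    rewrite [leLHS](_ : _ = 1 * s ^+ 10 * 'P 3961); last by field; rewrite gt_eqF.
    apply: (@le_trans _ _ (e * 'P 3961)); first by rewrite ler_wpM2r ?(ltW (P0 _)) // sge.
    by rewrite -P1 -PD; exact: Ple.
  apply: (@le_trans _ _ (e * 'P 2001)); first by rewrite ler_wpM2r ?(ltW (P0 _)) // -[leLHS]mul1r sge.
  by rewrite -P1 -PD; exact: Ple.
have : x%:R / 'P 28 <= 'P 3970 + ('P 3970 + 'P 3970).
  exact: le_trans lower (le_trans upper (lerD n1 n2)).
have -> : x%:R = 'P 1 * 'P 3971 * 'P 28.
  by rewrite -PD; exact: (PD 3972 28)%N.
rewrite mulfK ?gt_eqF // P1.
have h2 : 'P 3970 <= 'P 3971 by exact: Ple.
apply/negP; rewrite -ltNge; apply: (@lt_le_trans _ _ (1000 * 'P 3971)); last first.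
  by rewrite ler_wpM2r ?(ltW (P0 _)) // (e_ge1000 s1000 sE).
exact: lt_triple.
Qed.

End GoodTerm.

(** * Choice of parameters *)

Section SmallRoot.
Variable R : realType.

Lemma nat_above (r : R) : exists E0 : nat, forall E, (E0 <= E)%N -> r <= E%:R.
Proof.
exists (Num.truncn r).+1 => E hE; apply: le_trans (ltW (truncnS_gt r)) _; by rewrite ler_nat.
Qed.

Lemma expr_root (c : R) n : 0 <= c -> (0 < n)%N -> (c ^+ n) `^ n%:R^-1 = c.
Proof. by move=> c0 n0; rewrite -powR_mulrn // -powRrM mulfV ?powRr1 // pnatr_eq0 -lt0n. Qed.

Definition small_root (E : nat) : R := E%:R `^ (100%:R)^-1.

Lemma small_rootX E : small_root E ^+ 100 = E%:R.
Proof. by rewrite /small_root -powR_mulrn ?powR_ge0 // -powRrM mulVf ?powRr1 ?pnatr_eq0. Qed.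

Lemma small_root_ge (C : R) : exists E0 : nat, forall E, (E0 <= E)%N -> C <= small_root E.
Proof.
have [E0 H] := nat_above (`|C| ^+ 100); exists E0 => E /H hE.
apply: le_trans (ler_norm C) _.
rewrite -[leLHS](@expr_root _ 100) //.
by apply: ge0_ler_powR => //; rewrite ?invr_ge0 ?nnegrE // exprn_ge0.
Qed.

(** The logarithm is compared with w = E^(1/200), whose square is the small root: ln E = 200 ln w <
    200 w. *)
Lemma ln_small_root : exists E0 : nat, forall E, (E0 <= E)%N -> 1 + 4500 * ln E%:R <= small_root E.
Proof.
have [E0 H] := nat_above ((1000 * 1000) ^+ 200); exists E0.+1 => E hE.
have E1 : 0 < E%:R :> R by rewrite ltr0n (leq_ltn_trans _ hE).
have {}hE := H E (ltnW hE).
pose w : R := E%:R `^ (200%:R)^-1.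
have w0 : 0 < w by exact: powR_gt0.
have lw : ln E%:R = 200 * ln w by rewrite /w ln_powR mulrA divff ?mul1r ?pnatr_eq0.
have sw : small_root E = w * w.
  rewrite -expr2 -[RHS]powR_mulrn ?(ltW w0) // /w -powRrM /small_root; congr (_ `^ _).
  by field.
have wC : 1000 * 1000 <= w.
  rewrite -[leLHS](@expr_root _ 200) //.
    by apply: ge0_ler_powR => //; rewrite ?invr_ge0 ?nnegrE // exprn_ge0 // mulr_ge0.
  by rewrite mulr_ge0.
rewrite sw lw; have lnw := ln_sublinear w0.
have : 1000 * 1000 * w <= w * w by apply: ler_wpM2r wC; exact: ltW.
by move: w0 wC lnw; clear; lra.
Qed.

(** The divisor bound with exponent 100(j+1) gives at most C E^j <= E^(j+1) once E >= C, and the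
    root of that order is E^(1/100). *)
Lemma tau_small_root j : exists E0 : nat, forall E m, (E0 <= E)%N -> (0 < m <= E ^ j)%N ->
  (tau m)%:R <= small_root E.
Proof.
have [C [C0 H]] := divisor_bound (100 * j.+1).
exists C => E m CE /andP[m0 mE].
have h : (tau m ^ (100 * j.+1) <= E ^ j.+1)%N.
  by apply: leq_trans (H m m0) _; rewrite expnS leq_mul.
have k0 : (0 < 100 * j.+1)%N by rewrite muln_gt0.
rewrite -(ler_pXn2r k0) ?nnegrE ?powR_ge0 // -natrX [leRHS]exprM small_rootX -natrX ler_nat //.
Qed.

Lemma power_window k E0 q : (0 < k)%N -> (E0 ^ k <= q)%N ->
  exists E, (E0 <= E)%N /\ (E ^ k <= q < E.+1 ^ k)%N.
Proof.
move=> k0 h; pose P E := (E ^ k <= q)%N.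
have ub E : P E -> (E <= q)%N.
  by case: E => // E; apply: leq_trans; rewrite -[X in (X <= _)%N]expn1 leq_pexp2l.
have [E PE max] := @ex_maxnP P q (ex_intro P E0 h) ub.
exists E; split; first exact: max.
rewrite [(E ^ k <= q)%N]PE /= ltnNge; apply/negP => PE1.
by have := max E.+1 PE1; rewrite ltnn.
Qed.

(** The denominator q comes first; E is then the integer part of its k-th root. E >= 2^k gives
    (E+1)^k <= (2E)^k <= E^(k+1). *)
Lemma good_modulus k (a : R) E0 : (0 < k)%N -> nonrational a ->
  exists (E q : nat) (p : nat -> nat), [/\ forall i, p i = (E ^ i)%N, (E0 <= E)%N, (p k <= q <= p k.+1)%N &
    forall j, (0 < j)%N -> (2 * j <= q)%N -> (2 * q%:R)^-1 <= nd (j%:R * a)].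
Proof.
move=> k0 irr; pose E1 := maxn E0 (2 ^ k).
have [q [A [Mq cop hq]]] := good_denominator (E1 ^ k) irr.
have [E [hE /andP[q1 q2]]] := power_window k0 (ltnW Mq).
exists E, q, (expn E); split => //.
- by apply: leq_trans hE; rewrite leq_maxl.
- rewrite q1; apply: leq_trans (ltnW q2) _.
  have E2 : (2 ^ k <= E)%N by apply: leq_trans hE; rewrite leq_maxr.
  have E0' : (0 < E)%N by apply: leq_trans E2; rewrite expn_gt0.
  apply: (@leq_trans ((2 * E) ^ k)%N).
    by rewrite leq_exp2r // mul2n -addnn -addn1 leq_add2l.
  by rewrite expnMn expnS leq_mul2r E2 orbT.
- by move=> j j0 jq; exact: good_denominator_spacing cop hq j0 jq.
Qed.

Lemma sieve_exists (E K : nat) (p : nat -> nat) (s : R) : (forall i, p i = (E ^ i)%N) -> 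
  1000 <= s -> s ^+ 100 <= E%:R -> 1 + 4500 * ln E%:R <= s ->
  (forall m, (0 < m <= p 4500)%N -> (tau m)%:R <= s) ->
  10 ^+ 4 <= K%:R :> R -> 100 <= ln (K%:R : R) -> 10 ^+ 3 * (K%:R + 1) <= ln (E%:R : R) ->
  exists Xi : seq (R * nat), 
  [/\ forall u, u \in Xi -> (0 < u.2 <= p 440)%N,
      1 <= \sum_(u <- Xi) u.1 / u.2%:R,
      \sum_(u <- Xi) `|u.1| <= (p 440)%:R * s ^+ 5,
      forall m, (0 < m <= p 4001)%N -> \sum_(u <- Xi | (u.2 %| m)%N) `|u.1| <= s ^+ 8 &
      forall m, (0 < m <= p 4001)%N -> (forall r, prime r -> (p 40 < r)%N -> ~~ (r ^ 2 %| m)%N) ->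
        0 < \sum_(u <- Xi | (u.2 %| m)%N) u.1 -> (\sum_(r <- primes m) logn r m <= 13)%N].
Proof.
move=> pE s1000 sE Hln Htau K4 lnK Sl.
have E1 := E_gt1 s1000 sE.
have s19 : 19 <= s by apply: le_trans s1000; rewrite ler_nat.
have Hs m : (0 < m <= E ^ 20)%N -> (tau m)%:R <= s.
  by rewrite -pE => /andP[m0 m1]; apply: Htau; rewrite m0 (leq_trans m1) // (p_le pE s1000 sE).
have HL : harm R (E ^ 20) <= s.
  by rewrite -pE; apply: (harm_small pE s1000 sE Hln); rewrite ?(p_gt0 pE s1000 sE) ?(p_le pE s1000 sE).
have t4 m : (0 < m <= p 4001)%N -> (tau m)%:R <= s.
  by move=> /andP[m0 m1]; apply: Htau; rewrite m0 (leq_trans m1) // (p_le pE s1000 sE).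
exists (sieve_list E (ln (E%:R : R))); split.
- by move=> u hu; rewrite pE; exact: sieve_list_range hu.
- exact: (sieve_list_main E1 erefl K4 lnK Sl).
- rewrite pE natrX; exact: (sieve_list_total E1 erefl s19 Hs HL).
- by move=> m /[dup] /andP[m0 _] /t4; exact: (sieve_list_abs E1 erefl s19 Hs HL m0).
- move=> m /andP[m0 m1] ns; apply: (sieve_list_detect E1 erefl m0).
    by rewrite -pE (leq_trans m1) // (p_le pE s1000 sE).
  by move=> r rr; rewrite -pE; exact: ns.
Qed.

End SmallRoot.

Section QuotientInequality.
Variable R : realType.

Lemma quotient_large (G F s t sg Q : R) : 1 <= G -> 1 <= F -> 1000 <= s -> 0 <= sg -> t <= 9 * F -> Q < t * (sg + 1) ->
  G * F * s ^+ 10 <= Q -> 8 * s * G <= sg.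
Proof.
move=> G1 F1 s1 sg0 tF h1 h2.
have G0 : 0 < G by lra.
have F0 : 0 < F by lra.
have s0 : 0 <= s by lra.
have h3 : F * (G * s ^+ 10) <= F * (9 * (sg + 1)).
  rewrite mulrA (mulrC F G); apply: le_trans h2 (le_trans (ltW h1) _).
  by rewrite [leRHS]mulrA (mulrC F 9) ler_wpM2r // addr_ge0.
rewrite ler_pM2l // in h3.
have s11 : 1 <= s by lra.
have s9 : 1000 <= s ^+ 9 by apply: (le_trans s1); rewrite [s ^+ 9]exprS ler_peMr // exprn_ege1.
have h4 : G * (s * 1000) <= G * s ^+ 10.
  by rewrite [s ^+ 10]exprS ler_wpM2l ?(ltW G0) // ler_wpM2l.
have h5 : 1 <= s * G by rewrite -[leLHS]mulr1; apply: ler_pM => //; lra.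
lra.
Qed.

End QuotientInequality.

(** * The widths of the two triangles *)

Section Choice.
Variables (R : realType) (E : nat) (p : nat -> nat).
Local Notation s := (small_root R E).
Local Notation e := (E%:R : R).
Local Notation "'P i" := ((p i)%:R : R) (at level 10, i at level 8).
Let x := p 4000.
Hypothesis pE : forall i, p i = (E ^ i)%N.
Hypothesis s1000 : 1000 <= s.
Variable g : R.
Hypotheses (g149 : 149 / 150 <= g) (g1 : g < 1).

Let sE : s ^+ 100 <= e. Proof. by rewrite small_rootX. Qed.
Let F : R := x%:R `^ (1 - g).

Let x1 : 1 <= x%:R :> R.
Proof. by rewrite ler1n; exact: p_gt0 pE s1000 sE _. Qed.

Let F1 : 1 <= F.
Proof. by rewrite -[leLHS](powRr0 x%:R); apply: ler_powR => //; rewrite subr_ge0 ltW. Qed.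

Let vF : x%:R `^ (g - 1) = F^-1.
Proof. by rewrite /F -powRN opprB. Qed.

Lemma p_powR i r : 'P i `^ r = e `^ (i%:R * r).
Proof. by rewrite pE natrX -powR_mulrn // powRrM. Qed.

(** [t] is about 8 x^(1-g) and [sg] the quotient of E^27 by t. The exponents of x add up to at most
    269/40000, that is E^26.9, and the spare E^(1/10) = s^10 absorbs the roundings and the constant
    A. The maximum with 0 keeps [sg] large when [rh] is negative. *)
Lemma choice_of_parameters (rh A : R) : Num.max rh 0 + (1 - g) <= 269 / (4000 * 10) -> 0 <= A <= s ->
  exists t sg : nat, [/\ (2 <= t)%N, (2 <= sg)%N, (t * sg <= p 27)%N, 8 * F <= t%:R & t%:R * x%:R `^ (g - 1) <= 9] /\
    (('P 27)^-1 <= x%:R `^ (g - 1) /\ forall n, (0 < n <= 8 * x)%N -> A * n%:R `^ rh <= sg%:R).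
Proof.
set r0 := Num.max rh 0 => hr /andP[A0 As].
have r00 : 0 <= r0 by rewrite /r0 le_max lexx orbT.
have rr0 : rh <= r0 by rewrite /r0 le_max lexx.
pose G : R := x%:R `^ r0.
have G1 : 1 <= G by rewrite -[leLHS](powRr0 x%:R); apply: ler_powR.
have e1 : 1 <= e by apply: le_trans (e_ge1000 s1000 sE); rewrite ler1n.
have FG : G * F <= e `^ (269 / 10).
  rewrite /G /F -powRD; last by apply/implyP => _; rewrite gt_eqF // (lt_le_trans _ x1).
  rewrite p_powR; apply: ler_powR => //; move: hr; lra.
have P27 : 'P 27 = e `^ (269 / 10) * s ^+ 10.
  have -> : s ^+ 10 = e `^ (10%:R^-1).
    rewrite -powR_mulrn ?powR_ge0 // /small_root -powRrM; congr (_ `^ _); by field.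
  rewrite -powRD; last by apply/implyP => _; rewrite gt_eqF // (lt_le_trans _ e1).
  rewrite pE natrX -powR_mulrn //; congr (_ `^ _); by field.
have s1 := s_ge1 s1000; have s0 := s_ge0 s1000.
have big : G * F * s ^+ 10 <= 'P 27 by rewrite P27 ler_wpM2r // exprn_ge0.
have F0 : 0 < F by exact: lt_le_trans F1.
have F8 : 0 <= 8 * F by rewrite mulr_ge0 // ltW.
have /andP[t1 t2] := truncn_itv F8.
pose t := (Num.truncn (8 * F)).+1.
have tE : t%:R = (Num.truncn (8 * F))%:R + 1 :> R by rewrite natr1.
have tF : t%:R <= 9 * F by rewrite tE; move: t1 F1; lra.
have t8 : 8 * F <= t%:R by exact: ltW.
have t0 : (0 < t)%N by [].
pose sg := (p 27 %/ t)%N.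
have Qlt : 'P 27 < t%:R * (sg%:R + 1).
  by rewrite natr1 -natrM ltr_nat mulnC ltn_ceil.
have lower := quotient_large G1 F1 s1000 (ler0n R sg) tF Qlt big.
have sG : 1 <= s * G by rewrite -[leLHS]mulr1; apply: ler_pM.
exists t, sg; split; first split => //.
- rewrite -(ler_nat R); apply: le_trans t8; apply: (@le_trans _ _ (8 * 1)); last by rewrite ler_wpM2l.
  by rewrite mulr1 ler_nat.
- rewrite -(ler_nat R); apply: le_trans lower; rewrite -mulrA.
  by apply: (@le_trans _ _ (8 * 1)); [rewrite mulr1 ler_nat|rewrite ler_wpM2l].
- by rewrite mulnC leq_trunc_div.
- by rewrite vF ler_pdivrMr.
split.
  rewrite vF lef_pV2 ?posrE ?(p_gt0R pE s1000 sE) //.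
  apply: le_trans big; rewrite mulrAC ler_peMl ?(ltW F0) //.
  by rewrite -[leLHS]mulr1; apply: ler_pM => //; exact: exprn_ege1.
move=> n /andP[n0 nx]; apply: le_trans lower.
rewrite -[leRHS]mulrA [leRHS]mulrCA; apply: ler_pM => //; first by rewrite powR_ge0.
have n1 : 1 <= n%:R :> R by rewrite ler1n.
apply: le_trans (ler_powR n1 rr0) _.
apply: (@le_trans _ _ ((8 * x%:R) `^ r0)).
  by apply: ge0_ler_powR; rewrite ?nnegrE // ?mulr_ge0 // -natrM ler_nat.
rewrite powRM //; apply: ler_wpM2r; first exact: powR_ge0.
apply: ler1_powR; first by rewrite ler1n.
by move: hr g1; lra.
Qed.

(** The gap is at least g (9x)^(g-1), hence at least g/(3F) as 9^(1-g) <= 3, and g/3 exceeds 2/8: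
    this is the origin of the 8 in the choice of t. *)
Lemma power_gap (t n : nat) : 8 * F <= t%:R -> (0 < n <= 8 * x)%N ->
  2 / t%:R <= (n%:R + 1) `^ g - n%:R `^ g.
Proof.
move=> t8 /andP[n0 nx]; have nR : 0 < n%:R :> R by rewrite ltr0n.
have F0 : 0 < F by exact: lt_le_trans F1.
have g01 : 0 < g < 1 by rewrite g1 andbT; move: g149; lra.
apply: le_trans (pdiff_ge g01 nR).
have h9 : 9 `^ (1 - g) <= 3.
  rewrite -[leRHS](@expr_root R 3 2) //.
  have -> : 3 ^+ 2 = 9 :> R by rewrite expr2 -natrM.
  apply: ler_powR; first by rewrite ler1n.
  by move: g149; lra.
have h1 : (9 * x%:R) `^ (g - 1) <= (n%:R + 1) `^ (g - 1).
  apply: ler_powR_neg; [by rewrite addr_gt0| |by rewrite subr_le0 ltW].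
  have : n%:R <= 8 * x%:R :> R by rewrite -natrM ler_nat.
  by move: x1; lra.
have h2 : 3^-1 * F^-1 <= (9 * x%:R) `^ (g - 1).
  rewrite powRM // vF ler_wpM2r ?invr_ge0 ?(ltW F0) //.
  by rewrite -opprB powRN lef_pV2 ?posrE ?powR_gt0.
have g0 : 0 <= g by case/andP: g01 => /ltW.
apply: le_trans (ler_wpM2l g0 (le_trans h2 h1)).
apply: (@le_trans _ _ (2 / (8 * F))).
  by rewrite ler_wpM2l // lef_pV2 ?posrE ?mulr_gt0 // (lt_le_trans _ t8) // mulr_gt0.
rewrite invfM !mulrA ler_wpM2r ?invr_ge0 ?(ltW F0) //.
by move: g149; lra.
Qed.

End Choice.

(** * Assembly of the parameters *)

Section Core.
Variable R : realType.

Lemma ps_integer (g : R) (t n : nat) : (0 < t)%N -> 0 < ps_weight g t n ->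
  2 / t%:R <= (n%:R + 1) `^ g - n%:R `^ g ->
  exists j : nat, n%:R `^ g < j%:R < (n%:R + 1) `^ g.
Proof.
move=> t0; have tR : 0 < t%:R :> R by rewrite ltr0n.
rewrite /ps_weight /tri lt_max ltxx /= subr_gt0 -ltr_pdivlMl // mulr1 /nd.
set w := n%:R `^ g + t%:R^-1; set z := nint w => hz gap.
have pg : 0 <= n%:R `^ g by exact: powR_ge0.
move: hz; rewrite ltr_norml => /andP[h1 h2].
have ti : 0 < t%:R^-1 :> R by rewrite invr_gt0.
have z1 : n%:R `^ g < z%:~R by rewrite /w in h2; move: h2; clear; lra.
have z2 : z%:~R < (n%:R + 1) `^ g by rewrite /w in h1; move: h1 gap; clear; lra.
have z0 : 0 < z by rewrite -(ltr_int R) (le_lt_trans pg).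
have zE : z = (`|z|%N)%:Z by rewrite gtz0_abs.
by exists `|z|%N; rewrite zE in z1 z2; rewrite z1.
Qed.

(** All requirements on the size of E are thresholds that do not involve q. They are gathered in
    [E0] before the denominator q, and E with it, is chosen. *)
Theorem approximation_core (a b g rh A : R) (M : nat) :
  0 < a -> nonrational a -> 149 / 150 <= g -> g < 1 -> 0 <= A -> Num.max rh 0 + (1 - g) <= 269 / (4000 * 10) ->
  exists n m : nat, [/\ (M < n)%N, prime n, exists j : nat, n%:R `^ g < j%:R < (n%:R + 1) `^ g,
    (0 < m)%N /\ (\sum_(r <- primes m) logn r m <= 13)%N & A * `|a * n%:R + b - m%:R| < n%:R `^ (- rh)].
Proof.
move=> a0 irr g149 g1 A0 hr.
have g12 : 1 / 2 <= g by move: g149; clear; lra.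
have gg0 : 0 < g * (1 - g) / 1024 by rewrite divr_gt0 // mulr_gt0 ?subr_gt0 //; move: g149; clear; lra.
pose mu0i := (g * (1 - g) / 1024)^-1.
have [EA HA] := small_root_ge (A + 1).
have [E1 H1] := small_root_ge (1000 : R).
have [E2 H2] := small_root_ge mu0i.
have [E3 H3] := small_root_ge (a^-1 + 1).
have [E4 H4] := small_root_ge (8 * a + `|b| + 1).
have [E5 H5] := ln_small_root R.
have [E6 H6] := tau_small_root R 4500.
have [K1 HK1] := nat_above (10 ^+ 4 : R).
have [K2 HK2] := nat_above (expR 100 : R).
pose K := maxn K1 K2.
have K4 : 10 ^+ 4 <= K%:R :> R by apply: HK1; rewrite leq_maxl.
have lnK : 100 <= ln (K%:R : R).
  have h : expR 100 <= K%:R :> R by apply: HK2; rewrite leq_maxr.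
  by rewrite -[leLHS](@expRK R) ler_ln ?posrE ?expR_gt0 // (lt_le_trans _ h) // expR_gt0.
have [E7 H7] := nat_above (expR (10 ^+ 3 * (K%:R + 1)) : R).
pose E0 := \max_(i <- [:: EA; E1; E2; E3; E4; E5; E6; E7; M.+1]) i.
have [E [q [p [pE E0E /andP[q1 q2] spacing]]]] := @good_modulus R 1520 a E0 isT irr.
have ge i : i \in [:: EA; E1; E2; E3; E4; E5; E6; E7; M.+1] -> (i <= E)%N.
  by move=> hi; apply: leq_trans E0E; rewrite /E0 (big_rem _ hi) leq_maxl.
have {}HA := HA E (ge EA _). have {}H1 := H1 E (ge E1 _). have {}H2 := H2 E (ge E2 _).
have {}H3 := H3 E (ge E3 _). have {}H4 := H4 E (ge E4 _). have {}H5 := H5 E (ge E5 _).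
have {}H7 := H7 E (ge E7 _). 
pose s := small_root R E.
have s1000 : 1000 <= s by apply: H1; rewrite !inE eqxx ?orbT.
have sE : s ^+ 100 <= E%:R by rewrite small_rootX.
have Hln : 1 + 4500 * ln E%:R <= s by apply: H5; rewrite !inE eqxx ?orbT.
have Htau m : (0 < m <= p 4500)%N -> (tau m)%:R <= s.
  by rewrite pE; apply: H6; apply: ge; rewrite !inE eqxx ?orbT.
have Sl : 10 ^+ 3 * (K%:R + 1) <= ln (E%:R : R).
  have h : expR (10 ^+ 3 * (K%:R + 1)) <= E%:R :> R by apply: H7; rewrite !inE eqxx ?orbT.
  by rewrite -[leLHS](@expRK R) ler_ln ?posrE ?expR_gt0 // (lt_le_trans _ h) // expR_gt0.
have ba : a^-1 + 1 <= s by apply: H3; rewrite !inE eqxx ?orbT.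
have abs : 8 * a + `|b| + 1 <= s by apply: H4; rewrite !inE eqxx ?orbT.
have As : A + 1 <= s by apply: HA; rewrite !inE eqxx ?orbT.
have s0 : 0 < s by apply: lt_le_trans s1000; rewrite ltr0n.
have hmu : s^-1 <= g * (1 - g) / 1024.
  by rewrite -[leRHS]invrK lef_pV2 ?posrE ?invr_gt0 //; apply: H2; rewrite !inE eqxx ?orbT.
have big_x : `|b| + 1 <= a * (p 4000)%:R.
  apply: (@le_trans _ _ s); first by move: abs a0; clear; lra.
  have ai : a^-1 <= s by move: ba; clear; lra.
  rewrite -ler_pdivrMl //; apply: (@le_trans _ _ (s * s)); first by rewrite ler_wpM2r // ltW.
  apply: (@le_trans _ _ E%:R).
    by have := small_pow s1000 sE (s_ge1 s1000) (isT : (2 < 100)%N); rewrite mul1r expr2.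
  by rewrite ler_nat -[X in (X <= _)%N]expn1 -pE (p_le pE s1000 sE).
have [Xi [X1 X2 X3 X4 X5]] := sieve_exists pE s1000 sE Hln Htau K4 lnK Sl.
have As' : 0 <= A <= s by rewrite A0; move: As; clear; lra.
have [t [sg [[t2 sg2 tsg t8 tv] [v1 rhA]]]] := choice_of_parameters pE s1000 g1 hr As'.
have [n [pn hn w1 w2 [nsq spos]]] := good_term pE s1000 sE Hln Htau a0 ba abs big_x spacing q1 q2 sg2 g12 g1 hmu v1 tv t2 tsg X1 X2 X3 X4.
have [/andP[m0 mp] ei] := target_bounds pE s1000 sE a0 abs big_x hn.
have n0 : (0 < n)%N by exact: prime_gt0.
have hn8 : (0 < n <= 8 * p 4000)%N by rewrite n0; case/andP: hn.
exists n, (target a b n); split => //.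
- case/andP: hn => xn _; apply: leq_ltn_trans xn; apply: (@leq_trans E).
    by apply: ltnW; apply: ge; rewrite !inE eqxx ?orbT.
  by rewrite -[X in (X <= _)%N]expn1 -pE (p_le pE s1000 sE).
- exact: ps_integer (ltnW t2) w1 (power_gap pE s1000 g149 g1 t8 hn8).
- by split => //; apply: X5; rewrite ?m0.
have sgR : 0 < sg%:R :> R by rewrite ltr0n ltnW.
have ndE : nd (a * n%:R + b) = `|a * n%:R + b - (target a b n)%:R| by rewrite /nd ei.
move: w2; rewrite /tri lt_max ltxx /= subr_gt0 ndE => h.
have nr : 0 < n%:R `^ rh :> R by rewrite powR_gt0 // ltr0n.
rewrite powRN -[ltRHS]mul1r ltr_pdivlMr //.
apply: le_lt_trans h; rewrite mulrAC; apply: ler_wpM2r => //.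
exact: rhA.
Qed.

End Core.

(** * Return from g = 1/c to c *)

Section PiatetskiShapiroPrimes.
Variable R : realType.

Lemma approximation_general (c l0 l1 l2 : R) (M : nat) :
  1 < c -> c <= 1 + 1 / 149 -> l2 != 0 -> l1 / l2 < 0 -> nonrational (- (l1 / l2)) ->
  exists n m j : nat, [/\ (M < n)%N, prime n, (0 < j)%N /\ n%:R < j%:R `^ c < n%:R + 1,
    (0 < m)%N /\ (\sum_(r <- primes m) logn r m <= 13)%N &
    `|l0 + l1 * n%:R + l2 * m%:R| < n%:R `^ (- ((1 + 9 * (c^-1 - 1)) / 12 - c / (13 - 144 / 1000)))].
Proof.
move=> c1 c2 l20 neg irr; set rh := _ / 12 - _.
have c0 : 0 < c by lra.
pose g := c^-1.
have g0 : 0 < g by rewrite invr_gt0.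
have gc : g * c = 1 by rewrite mulVf // gt_eqF.
have g149 : 149 / 150 <= g.
  rewrite -(ler_pM2r c0) gc; lra.
have g1 : g < 1 by rewrite invf_lt1.
(* With this inequality rho(c) is bounded by a linear function of g. *)
have c2g : 2 - g <= c.
  rewrite -(ler_pM2l g0) gc -subr_ge0 (_ : _ - _ = (1 - g) ^+ 2); [exact: sqr_ge0|ring].
(* The end point g = 149/150 decides both cases: 1 - g is 1/150 there when rho <= 0, and otherwise
   the linear bound for rho + 1 - g is about 0.0067; both are below 0.006725. *)
have hr : Num.max rh 0 + (1 - g) <= 269 / (4000 * 10).
  have [r0|r0] := leP rh 0; first lra.
  have : rh <= (1 + 9 * (g - 1)) / 12 - (2 - g) / (13 - 144 / 1000).
    by rewrite /rh -/g lerB // ler_wpM2r // invr_ge0; lra.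
  have -> : 13 - 144 / 1000 = 1607 / 125 :> R by field.
  rewrite invf_div; lra.
pose a := - (l1 / l2).
have a0 : 0 < a by rewrite oppr_gt0.
have [n [m [Mn pn [j /andP[j1 j2]] hm close]]] := approximation_core (- (l0 / l2)) M a0 irr g149 g1 (normr_ge0 l2) hr.
have powK (y : R) : 0 <= y -> (y `^ g) `^ c = y by move=> y0; rewrite -powRrM gc powRr1.
have j0 : (0 < j)%N by rewrite -(ltr_nat R) (le_lt_trans _ j1) // powR_ge0.
exists n, m, j; split => //.
- have h1 : (n%:R `^ g) `^ c < j%:R `^ c by rewrite gt0_ltr_powR ?nnegrE ?powR_ge0.
  have h2 : j%:R `^ c < ((n%:R + 1) `^ g) `^ c by rewrite gt0_ltr_powR ?nnegrE ?powR_ge0.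
  by rewrite powK // in h1; rewrite powK ?addr_ge0 // in h2; rewrite h1.
- apply: le_lt_trans close; rewrite -normrM /a -[leLHS]normrN le_eqVlt; apply/orP; left; apply/eqP.
  by congr (`| _ |); field.
Qed.

End PiatetskiShapiroPrimes.

(** * The statement over Stdlib's reals *)

From mathcomp Require Import Rstruct Rstruct_topology.

Section RealNumbers.
Local Notation R := Rdefinitions.R.

Lemma RpowerE (x y : R) : 0 < x -> Rpower x y = x `^ y.
Proof. by move=> x0; rewrite /Rpower /powR gt_eqF // RexpE RlnE. Qed.

Lemma Int_part_nat (n : nat) (y : R) : n%:R < y < n%:R + 1 -> Z.of_nat n = Int_part y.
Proof.
move=> /andP[h1 h2]; apply: Int_part_spec; rewrite -INR_IZR_INZ INRE; split.
  by apply/RltP; rewrite RminusE ltrBlDr.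
by apply/RleP; exact: ltW.
Qed.

Lemma nonrational_Q2R (y : R) : (forall q : Q, Q2R q <> y) -> nonrational (- y).
Proof.
move=> irr q A q0 h.
have qR : q%:R != 0 :> R by rewrite pnatr_eq0 -lt0n.
pose z := match A with Posz k => Z.opp (Z.of_nat k) | Negz k => Z.of_nat k.+1 end.
have zE : IZR z = - A%:~R.
  rewrite /z; case: A {h z} => k.
    by rewrite opp_IZR -INR_IZR_INZ INRE.
  by rewrite -INR_IZR_INZ INRE NegzE mulrNz opprK.
apply: (irr (Qmake z (Pos.of_nat q))); rewrite /Q2R [Qnum _]/= [Qden _]/= zE.
have -> : IZR (Z.pos (Pos.of_nat q)) = q%:R.
  by rewrite IZRposE -Pos_to_natE Nat2Pos.id ?INRE //; apply/eqP; rewrite -lt0n.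
by rewrite RmultE RinvE -h; field.
Qed.

End RealNumbers.

Local Open Scope R_scope.

Theorem theorem2 (c l0 l1 l2 : R) :
  1 < c -> c <= 1 + 1 / 149 ->
  l2 <> 0 ->
  l1 / l2 < 0 ->
  (forall q : Q, Q2R q <> l1 / l2) ->
  (* infinitely many pairs (p, P): beyond any bound there is a good pair *)
  forall N : nat, exists p P : nat,
    good_pair c l0 l1 l2 p P /\ (N < p \/ N < P)%N.
Proof.
move=> c1 c2 l20 neg irr N.
(* Real numerals on the two sides are compared through natural numbers. *)
have lit k : IZR (Z.pos k) = (nat_of_pos k)%:R%R by rewrite IZRposE INRE.
have c1' : (1 < c)%R by apply/RltP.
have c2' : (c <= 1 + 1 / 149)%R.
  by apply/RleP; move: c2; rewrite RplusE RdivE (lit 149%positive).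
have l20' : (l2 != 0)%R by apply/eqP.
have neg' : (l1 / l2 < 0)%R by apply/RltP; rewrite -RdivE.
have irr' : nonrational (- (l1 / l2))%R by apply: nonrational_Q2R => q; rewrite -RdivE.
have [n [m [j [Nn pn [j0 jn] [m0 m13] close]]]] := approximation_general l0 N c1' c2' l20' neg' irr'.
have jR : (0 < j%:R :> R)%R by rewrite ltr0n.
have nR : (0 < n%:R :> R)%R by rewrite ltr0n prime_gt0.
exists n, m; split; last by left.
split; [split => //; exists j; split => //|split => //].
  by rewrite INRE RpowerE //; exact: Int_part_nat.
apply/RltP; rewrite !INRE RpowerE // RabsE /Defs.rho.
rewrite !(RplusE, RminusE, RmultE, RoppE, RdivE, RinvE).
rewrite (lit 12%positive) (lit 9%positive) (lit 13%positive) (lit 144%positive) (lit 1000%positive).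
exact: close.
Qed.
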